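(* Let $M$ be a smooth $(d+1)$-dimensional manifold, $d\ge 1$, and let $g$ be a continuous Lorentzian metric on $M$ such that $(M,g)$ is a causally simple spacetime. Then the metric measure spacetime $(M,\ell_g,\mathrm{vol}_g)$ (with the manifold topology) is infinitesimally Minkowskian, i.e. for any two causal functions $f_1,f_2\colon M\to[-\infty,+\infty]$ it holds $$2|\mathrm{d}(f_1+f_2)|^2+2|\mathrm{d}f_1|^2=|\mathrm{d}f_2|^2+|\mathrm{d}(2f_1+f_2)|^2\qquad \mathrm{vol}_g\text{-a.e.},$$ where $|\mathrm{d}f|$ denotes the maximal weak subslope of a causal function $f$.
   Context: Lorentzian setting. A continuous Lorentzian metric $g$ is a continuous symmetric $(0,2)$-tensor of signature $(-,+,\dots,+)$. A vector $v\in TM$ is timelike if $g(v,v)<0$, null if $g(v,v)=0$ and $v\neq0$, and causal if it is timelike or null. $(M,g)$ is a spacetime if it is time orientable, i.e. there is a continuous timelike vector field $X$ (fixed); a causal vector $v$ is future directed if $g(v,X)<0$ and past directed otherwise. An absolutely continuous curve $\gamma\colon[0,1]\to M$ is classically causal (and future directed) if for a.e. $t$, $g(\dot\gamma_t,\dot\gamma_t)\le0$ and $\dot\gamma_t$ is future directed or zero. For such Lipschitz curves $L_g(\gamma)=\int_0^1\sqrt{-g(\dot\gamma_t,\dot\gamma_t)}\,dt$, and $\ell_g(x,y)=\sup\{L_g(\gamma):\gamma\in C^{0,1}([0,1],M)$ classically causal and future directed, $\gamma_0=x,\gamma_1=y\}$, with $\sup\emptyset=-\infty$. Write $x\le y$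 iff $\ell_g(x,y)\ge0$. $(M,g)$ is causally simple if there are no non-constant closed classically causal future directed curves and $\le$ is closed in the manifold topology. $\mathrm{vol}_g$ is locally $\sqrt{-\det g}\,d\mathcal L^{d+1}$. Conventions in $[-\infty,+\infty]$: $+\infty-(+\infty)=+\infty$, $-\infty-(-\infty)=+\infty$ (for differences), $\pm\infty+z=\pm\infty$ for $z\in[-\infty,+\infty]$ (for sums, the first summand dominates), $(\pm\infty)\cdot0=0$. Synthetic notions, with $\ell=\ell_g$, $\mathfrak m=\mathrm{vol}_g$. A causal function is $f\colon M\to[-\infty,+\infty]$ with $f(x)\le f(y)$ whenever $x\le y$. A causal path is a map $\gamma\colon[0,1]\to M$ with $\gamma_s\le\gamma_t$ for $s\le t$; $\mathrm{LCC}([0,1],M)$ is the set of causal paths that are left continuous at every $t\in(0,1]$, with the $\sigma$-algebra generated by the evaluation maps $e_t(\gamma)=\gamma_t$. For a causal path $\gamma$ there is a maximal Borel measure $|\dot{\boldsymbol\gamma}|$ on $[0,1]$ with $|\dot{\boldsymbol\gamma}|([s,t])\le\ell(\gamma_s,\gamma_t)$ for all $s\le t$; the density of its absolutely continuous part with respect to $\mathcal L^1$ is the causal speed $|\dot\gamma_t|$, and for a.e. $t$ it equals $\lim_{s\searrow t}\ell(\gamma_t,\gamma_s)/(s-t)=\lim_{s\nearrow t}\ell(\gamma_s,\gamma_t)/(t-s)$. A test plan is a probability measure $\boldsymbol\pi$ on $\mathrm{LCC}([0,1],M)$ for which there is $C>0$ with $(e_t)_\#\boldsymbol\pi\le C\mathfrak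 m$ for all $t\in[0,1]$. A Borel function $G\colon M\to[0,\infty]$ is a weak subslope of a causal function $f$ if for every test plan $\boldsymbol\pi$, $$\int[f(\gamma_1)-f(\gamma_0)]\,d\boldsymbol\pi(\gamma)\ge\int\int_0^1G(\gamma_t)|\dot\gamma_t|\,dt\,d\boldsymbol\pi(\gamma).$$ It is known that there is a weak subslope that is ($\mathfrak m$-a.e.) no smaller than any other one, unique up to $\mathfrak m$-a.e. equality; this is the maximal weak subslope $|\mathrm df|$. *)

(* Defs.v *)
From HB Require Import structures.
From mathcomp Require Import all_boot all_order all_algebra.
From mathcomp Require Import all_classical all_reals all_analysis.
From mathcomp Require Import measurable_realfun.

Set Implicit Arguments.
Unset Strict Implicit.
Unset Printing Implicit Defensive.
Import Order.TTheory GRing.Theory Num.Theory.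
Import numFieldNormedType.Exports.
Local Open Scope classical_set_scope.
Local Open Scope ring_scope.

(** * Lebesgue measure on R^n, n >= 1 *)

(* Caratheodory measure of the outer measure obtained from countable covers by
   half-open boxes. *)
Section lebesgue_rV.
Context {R : realType} {n : nat}.
Implicit Types (A : set 'rV[R]_n.+1) (p : 'rV[R]_n.+1 * 'rV[R]_n.+1).

Definition box p : set 'rV[R]_n.+1 :=
  [set x | forall i, p.1 0 i < x 0 i <= p.2 0 i].

Definition box_volume p : \bar R :=
  (\prod_i Num.max 0 (p.2 0 i - p.1 0 i))%:E.

Definition box_cover A : set (nat -> 'rV[R]_n.+1 * 'rV[R]_n.+1) :=
  [set p | A `<=` \bigcup_k box (p k)].

Definition lebesgue_outer A : \bar R :=
  ereal_inf [set (\sum_(k <oo) box_volume (p k))%E | p in box_cover A].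

Local Open Scope ereal_scope.

Lemma box_volume_ge0 p : 0 <= box_volume p.
Proof. by rewrite lee_fin prodr_ge0// => i _; rewrite le_max lexx. Qed.

Lemma le_lebesgue_outer : {homo lebesgue_outer : A B / A `<=` B >-> A <= B}.
Proof.
move=> A B AB; apply/ereal_inf_le_tmp => x [p Bp <-{x}].
by exists p => //; exact: subset_trans AB Bp.
Qed.

Lemma lebesgue_outer_ge0 A : 0 <= lebesgue_outer A.
Proof.
apply: le_ereal_inf_tmp => x [p _ <-{x}].
by apply: nneseries_ge0 => k _ _; exact: box_volume_ge0.
Qed.

Lemma lebesgue_outer0 : lebesgue_outer set0 = 0.
Proof.
apply/eqP; rewrite eq_le lebesgue_outer_ge0 andbT.
apply: ereal_inf_lbound; exists (fun=> (0%R, 0%R)); first by move=> x [].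
apply: eseries0 => k _ _; rewrite /box_volume (bigD1 ord0)//=.
by rewrite !mxE subrr maxxx mul0r.
Qed.

Lemma lebesgue_outer_sigma_subadditive : sigma_subadditive lebesgue_outer.
Proof.
move=> A; have [[i ioo]|] := pselect (exists i, lebesgue_outer (A i) = +oo).
  rewrite (eseries_pinfty _ _ ioo) ?leey// => k _.
  by rewrite -ltNye (lt_le_trans _ (lebesgue_outer_ge0 _)).
rewrite -forallNE => Aoo.
suff add2e (e : {posnum R}) : lebesgue_outer (\bigcup_n A n) <=
    \sum_(i <oo) lebesgue_outer (A i) + e%:num%:E.
  by apply/lee_addgt0Pr => _/posnumP[].
rewrite (le_trans _ (epsilon_trick _ _ _))//; last first.
  by move=> k; exact: lebesgue_outer_ge0.
pose P k (p : nat -> _) := box_cover (A k) p /\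
  \sum_(j <oo) box_volume (p j) <=
    lebesgue_outer (A k) + (e%:num / (2 ^ k.+1)%:R)%:E.
have [G PG] : {G & forall k, P k (G k)}.
  apply: (@choice _ _ P) => k.
  have fA : lebesgue_outer (A k) \is a fin_num.
    by rewrite ge0_fin_numE ?lebesgue_outer_ge0// ltey; apply/eqP/Aoo.
  have en1 : (0 < e%:num / (2 ^ k.+1)%:R :> R)%R by [].
  have [x [p Ap <-] /ltW] := lb_ereal_inf_adherent en1 fA.
  by exists p.
have G0 i : 0 <= (box_volume \o uncurry G) i by exact: box_volume_ge0.
apply: (@le_trans _ _ (\esum_(i in setT) (box_volume \o uncurry G) i)).
  apply: ereal_inf_lbound => /=.
  have /card_esym/ppcard_eqP[f] := card_nat2.
  exists (uncurry G \o f).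
    move=> x [i _ /(PG i).1[j _ xij]].
    by exists (f^-1%FUN (i, j)) => //=; rewrite invK ?inE.
  rewrite -(esum_pred_image (box_volume \o uncurry G) _ xpredT) ?[fun=> _]set_true//.
  by rewrite image_eq.
rewrite (_ : esum _ _ = \sum_(i <oo) \sum_(j <oo) box_volume (G i j)).
  apply: lee_nneseries => k *.
    by apply: nneseries_ge0 => j _ _; exact: box_volume_ge0.
  exact: (PG k).2.
rewrite nneseries_esumT; last first.
  by move=> k; apply: nneseries_ge0 => j _ _; exact: box_volume_ge0.
under [RHS]eq_esum.
  move=> k _; rewrite nneseries_esumT; last by move=> j; exact: box_volume_ge0.
  over.
rewrite esum_esum; last by move=> *; exact: box_volume_ge0.
rewrite (_ : setT `*`` _ = setT); last by apply/seteqP; split.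
by apply: eq_esum => -[].
Qed.

HB.instance Definition _ := isOuterMeasure.Build R _ lebesgue_outer
  lebesgue_outer0 lebesgue_outer_ge0 le_lebesgue_outer
  lebesgue_outer_sigma_subadditive.

Definition lebesgue_rV : set (caratheodory_type lebesgue_outer) -> \bar R :=
  lebesgue_outer.

HB.instance Definition _ := isMeasure.Build _ _ _ lebesgue_rV
  (@caratheodory_measure0 R _ lebesgue_outer)
  (@caratheodory_measure_ge0 R _ lebesgue_outer)
  (@caratheodory_measure_sigma_additive R _ lebesgue_outer).

End lebesgue_rV.

(** * Smooth manifolds *)

(* [class_C k U f]: [f] is of class C^k on the open set [U]. *)
Fixpoint class_C {R : realType} {n m : nat} (k : nat) (U : set 'rV[R]_n)
    (f : 'rV[R]_n -> 'rV[R]_m) : Prop :=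
  match k with
  | 0 => forall x, U x -> {for x, continuous f}
  | k'.+1 => (forall x, U x -> {for x, continuous f}) /\
      forall v, (forall x, U x -> derivable f x v) /\ class_C k' U ('D_v f)
  end.

Definition smooth_on {R : realType} {n m : nat} (U : set 'rV[R]_n)
    (f : 'rV[R]_n -> 'rV[R]_m) := forall k, class_C k U f.

(* [cmap] and [cinv] are total functions; only their values on [cdom] and on
   its image matter. *)
Record chart (R : realType) (n : nat) (M : topologicalType) := Chart {
  cdom : set M;
  cmap : M -> 'rV[R]_n;
  cinv : 'rV[R]_n -> M;
  cdom_open : open cdom;
  cimg_open : open (cmap @` cdom);
  cmapK : forall x, cdom x -> cinv (cmap x) = x;
  cmap_continuous : forall x, cdom x -> {for x, continuous cmap};
  cinv_continuous : forall y, (cmap @` cdom) y -> {for y, continuous cinv} }.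

Definition transition {R : realType} {n : nat} {M : topologicalType}
    (c c' : chart R n M) : 'rV[R]_n -> 'rV[R]_n := cmap c' \o cinv c.

(* [chart_at] is an auxiliary choice of a chart around each point; geometric
   quantities computed with it do not depend on the chart. *)
Record smooth_structure (R : realType) (n : nat) (M : topologicalType) :=
  SmoothStructure {
  M_hausdorff : hausdorff_space M;
  M_second_countable : @second_countable M;
  atlas : set (chart R n M);
  chart_at : M -> chart R n M;
  chart_at_atlas : forall x, atlas (chart_at x);
  chart_at_dom : forall x, cdom (chart_at x) x;
  atlas_smooth : forall c c', atlas c -> atlas c' ->
    smooth_on (cmap c @` (cdom c `&` cdom c')) (transition c c') }.

(* Vectors are rows, so the differential of the change of coordinates from
   [c] to [c'] at [x] is [v |-> v *m jac c c' x]. *)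
Definition jac {R : realType} {n : nat} {M : topologicalType}
    (c c' : chart R n M) (x : M) : 'M[R]_n :=
  jacobian (transition c c') (cmap c x).

(** * Continuous Lorentzian metrics *)

Definition minkowski_mx (R : realType) (d : nat) : 'M[R]_d.+1 :=
  diag_mx (\row_j (if j == ord0 then -1 else 1)).

(* Tensor fields are given by their components in the charts of the atlas,
   related by the usual transformation laws. *)
Record lorentz_metric (R : realType) (d : nat) (M : topologicalType)
    (A : smooth_structure R d.+1 M) := LorentzMetric {
  gmx : chart R d.+1 M -> M -> 'M[R]_d.+1;
  gmx_continuous : forall c x, atlas A c -> cdom c x ->
    {for x, continuous (gmx c)};
  gmx_sym : forall c x, atlas A c -> cdom c x -> (gmx c x)^T = gmx c x;
  gmx_signature : forall c x, atlas A c -> cdom c x ->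
    exists2 P, P \in unitmx & P *m gmx c x *m P^T = minkowski_mx R d;
  gmx_change : forall c c' x, atlas A c -> atlas A c' -> cdom c x -> cdom c' x ->
    gmx c x = jac c c' x *m gmx c' x *m (jac c c' x)^T }.

Record vector_field (R : realType) (n : nat) (M : topologicalType)
    (A : smooth_structure R n M) := VectorField {
  vcomp : chart R n M -> M -> 'rV[R]_n;
  vcomp_continuous : forall c x, atlas A c -> cdom c x ->
    {for x, continuous (vcomp c)};
  vcomp_change : forall c c' x, atlas A c -> atlas A c' -> cdom c x -> cdom c' x ->
    vcomp c' x = vcomp c x *m jac c c' x }.

Section lorentz.
Context {R : realType} {d : nat} {M : topologicalType}.
Context {A : smooth_structure R d.+1 M} (g : lorentz_metric A).
Implicit Types (c : chart R d.+1 M) (x y : M) (v w : 'rV[R]_d.+1)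
  (gamma : R -> M).

(* In the following [v], [w] are components, with respect to the chart [c], of
   tangent vectors at [x]. *)
Definition gform c x v w : R := (v *m gmx g c x *m w^T) 0 0.

Definition timelike c x v := gform c x v v < 0.
Definition null c x v := gform c x v v = 0 /\ v <> 0.
Definition causal c x v := timelike c x v \/ null c x v.

Definition timelike_field (X : vector_field A) :=
  forall c x, atlas A c -> cdom c x -> timelike c x (vcomp X c x).

Definition future_directed (X : vector_field A) c x v :=
  causal c x v /\ gform c x v (vcomp X c x) < 0.

(* Curves [0,1] -> M are represented by functions on R of which only the
   values on [0,1] are used. *)
Definition velocity c gamma (t : R) : 'rV[R]_d.+1 := derive1 (cmap c \o gamma) t.

Definition abs_continuous_on (a b : R) (f : R -> 'rV[R]_d.+1) :=
  forall e : R, 0 < e -> exists2 del : R, 0 < del &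
    forall (n : nat) (s t : 'I_n -> R),
      (forall i, [/\ a <= s i, s i <= t i & t i <= b]) ->
      (forall i j, i != j -> t i <= s j \/ t j <= s i) ->
      \sum_i (t i - s i) < del -> \sum_i `|f (t i) - f (s i)| < e.

Definition abs_continuous_curve gamma :=
  {within `[0, 1], continuous gamma} /\
  forall c a b, atlas A c -> 0 <= a -> a <= b -> b <= 1 ->
    gamma @` `[a, b] `<=` cdom c -> abs_continuous_on a b (cmap c \o gamma).

Definition lipschitz_curve gamma :=
  {within `[0, 1], continuous gamma} /\
  forall c a b, atlas A c -> 0 <= a -> a <= b -> b <= 1 ->
    gamma @` `[a, b] `<=` cdom c ->
    [lipschitz (cmap c \o gamma) t | t in `[a, b]].

(* Derivability a.e. is automatic for absolutely continuous curves; it is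
   required since [derive1] is total. *)
Definition fd_causal_curve (X : vector_field A) gamma :=
  abs_continuous_curve gamma /\
  {ae lebesgue_measure, forall t, t \in `[0, 1] ->
    forall c, atlas A c -> cdom c (gamma t) ->
    let v := velocity c gamma t in
    [/\ derivable (cmap c \o gamma) t 1, gform c (gamma t) v v <= 0
      & future_directed X c (gamma t) v \/ v = 0]}.

Definition length gamma : \bar R :=
  \int[lebesgue_measure]_(t in `[0, 1])
    (let c := chart_at A (gamma t) in let v := velocity c gamma t in
     Num.sqrt (- gform c (gamma t) v v))%:E.

Definition time_sep (X : vector_field A) x y : \bar R :=
  ereal_sup [set length gamma | gamma in
    [set gamma | [/\ lipschitz_curve gamma, fd_causal_curve X gamma,
                     gamma 0 = x & gamma 1 = y]]].

Definition causally_simple (X : vector_field A) :=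
  (forall gamma, fd_causal_curve X gamma -> gamma 0 = gamma 1 ->
     forall t, t \in `[0, 1] -> gamma t = gamma 0) /\
  closed [set p : M * M | (0 <= time_sep X p.1 p.2)%E].

End lorentz.

Lemma time_sep_refl {R : realType} {d : nat} {M : topologicalType}
    {A : smooth_structure R d.+1 M} (g : lorentz_metric A) (X : vector_field A)
    (x : M) : (0 <= time_sep g X x x)%E.
Proof.
have comp_cst c : cmap c \o cst x = cst (cmap c x) :> (R -> 'rV[R]_d.+1) by [].
have length_ge0 (gamma : R -> M) : (0 <= length g gamma)%E.
  by apply: integral_ge0 => t _; rewrite lee_fin sqrtr_ge0.
apply: le_trans (length_ge0 (cst x)) _; apply: ereal_sup_ubound.
exists (cst x) => //; split=> //.
- split; first by move=> ?; exact: cvg_cst.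
  move=> c a b _ _ _ _ _; rewrite comp_cst.
  rewrite /lipschitz_on; near=> k; move=> [s t] _ /=.
  by rewrite subrr normr0 mulr_ge0.
- split.
    split; first by move=> ?; exact: cvg_cst.
    move=> c a b _ _ _ _ _ e e0; exists 1 => // n s t _ _ _.
    by rewrite big1// => i _; rewrite subrr normr0.
  apply: aeW => t _ c _ _ /=; rewrite /velocity comp_cst derive1_cst.
  split; [exact: derivable_cst| |by right].
  by rewrite /gform !mul0mx mxE.
Unshelve. all: by end_near. Qed.

(** * Metric measure spacetimes *)

Record time_separation (R : realType) (M : Type) := TimeSeparation {
  tsep :> M -> M -> \bar R;
  tsep_refl : forall x, (0 <= tsep x x)%E }.

Definition lorentz_tsep {R : realType} {d : nat} {M : topologicalType}
    {A : smooth_structure R d.+1 M} (g : lorentz_metric A) (X : vector_field A)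
  : time_separation R M := TimeSeparation (time_sep_refl g X).

Definition borel (M : topologicalType) := g_sigma_algebraType (@open M).

(* [vol] is the Borel measure whose density in every chart is sqrt(-det g); it
   is unique since M is second countable. *)
Definition is_volume {R : realType} {d : nat} {M : ptopologicalType}
    {A : smooth_structure R d.+1 M} (g : lorentz_metric A)
    (vol : {measure set (borel M) -> \bar R}) :=
  forall c (B : set (borel M)), atlas A c -> measurable B -> B `<=` cdom c ->
    vol B = (\int[lebesgue_rV]_(y in cmap c @` B)
               (Num.sqrt (- \det (gmx g c (cinv c y))))%:E)%E.

Section paths.
Context {R : realType} {M : ptopologicalType} (l : time_separation R M).
Local Open Scope ereal_scope.

Definition cle (x y : M) := 0 <= l x y.

Definition causal_path (gamma : R -> M) :=
  forall s t : R, (0 <= s)%R -> (s <= t)%R -> (t <= 1)%R ->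
    cle (gamma s) (gamma t).

(* A map on [0,1] is represented by its unique extension to R which is constant
   on ]-oo, 0] and on [1, +oo[. *)
Record lcc := Lcc {
  lcc_path :> R -> M;
  lcc_causal : causal_path lcc_path;
  lcc_left_continuous : forall t : R, (0 < t)%R -> (t <= 1)%R ->
    lcc_path s @[s --> t^'-] --> lcc_path t;
  lcc_clamp : forall t, lcc_path t = lcc_path (Num.max 0%R (Num.min t 1%R)) }.

HB.instance Definition _ := gen_eqMixin lcc.
HB.instance Definition _ := gen_choiceMixin lcc.
HB.instance Definition _ := isPointed.Build lcc
  (@Lcc (cst point) (fun _ _ _ _ _ => tsep_refl l point)
    (fun _ _ _ => cvg_cst _) (fun=> erefl)).

Definition evaluations : set (set lcc) :=
  [set E | exists t : R, (0 <= t <= 1)%R /\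
     exists2 B : set (borel M), measurable B & E = [set gamma : lcc | B (gamma t)]].

(* Borel measures on [0,1] are Borel measures on R with no mass outside. *)
Definition speed_admissible (gamma : R -> M)
    (nu : {measure set (measurableTypeR R) -> \bar R}) :=
  nu (~` `[0%R, 1%R]%classic) = 0 /\
  forall s t : R, (0 <= s)%R -> (s <= t)%R -> (t <= 1)%R ->
    nu `[s, t]%classic <= l (gamma s) (gamma t).

Definition maximal_speed_measure (gamma : R -> M)
    (nu : {measure set (measurableTypeR R) -> \bar R}) :=
  speed_admissible gamma nu /\
  forall nu' : {measure set (measurableTypeR R) -> \bar R},
    speed_admissible gamma nu' ->
    forall B : set (measurableTypeR R), measurable B -> nu' B <= nu B.

(* Lebesgue decomposition: [nu] is [rho] times the Lebesgue measure plus a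
   measure [nus] singular to it. *)
Definition ac_density (nu : {measure set (measurableTypeR R) -> \bar R})
    (rho : R -> \bar R) :=
  [/\ measurable_fun [set: R] rho, (forall t, 0 <= rho t) &
  exists nus : {measure set (measurableTypeR R) -> \bar R},
    (exists2 N : set (measurableTypeR R), measurable N &
       lebesgue_measure N = 0 /\ nus (~` N) = 0) /\
    forall B : set (measurableTypeR R), measurable B ->
      nu B = \int[lebesgue_measure]_(t in B) rho t + nus B].

(* Defined up to a.e. equality; [0] is the default value of the choice
   operator, irrelevant when the decomposition exists. *)
Definition causal_speed (gamma : R -> M) : R -> \bar R :=
  xget (cst 0) [set rho |
    exists2 nu, maximal_speed_measure gamma nu & ac_density nu rho].

End paths.

Arguments evaluations {R M} l.

Section subslopes.
Context {R : realType} {M : ptopologicalType} (l : time_separation R M).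
Context (m : {measure set (borel M) -> \bar R}).
Implicit Types (f : M -> \bar R) (G : borel M -> \bar R).
Local Open Scope ereal_scope.

Definition causal_function f := forall x y, cle l x y -> f x <= f y.

Definition test_plan
    (pi : probability (g_sigma_algebraType (evaluations l)) R) :=
  exists2 C : R, (0 < C)%R & forall t : R, (0 <= t <= 1)%R ->
    forall B : set (borel M), measurable B ->
      pi [set gamma : lcc l | B (gamma t)] <= C%:E * m B.

(* [(f y - f x)%dE] is the subtraction of \bar R for which
   +oo - +oo = -oo - -oo = +oo. *)
(* The integral of a nonnegative function is the supremum of the integrals of the
   simple functions below it, so for integrands only measurable with respect to
   the completion of [pi] it is the integral for the completion. *)
Definition weak_subslope f G :=
  [/\ measurable_fun [set: borel M] G, (forall x, 0 <= G x) &
  forall pi : probability (g_sigma_algebraType (evaluations l)) R,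
    test_plan pi ->
    \int[pi]_gamma
       \int[lebesgue_measure]_(t in `[0%R, 1%R])
          (G (gamma t) * causal_speed l gamma t) <=
    \int[pi]_gamma (f (gamma 1%R) - f (gamma 0%R))%dE].

Definition maximal_weak_subslope f G :=
  weak_subslope f G /\
  forall G', weak_subslope f G' -> {ae m, forall x, G' x <= G x}.

(* Sum in which the first summand dominates if it is infinite. *)
Definition ladde (a b : \bar R) : \bar R :=
  if a is r%:E then r%:E + b else a.

Definition infinitesimally_Minkowskian :=
  forall f1 f2, causal_function f1 -> causal_function f2 ->
  forall G1 G2 G12 G112 : borel M -> \bar R,
    maximal_weak_subslope f1 G1 ->
    maximal_weak_subslope f2 G2 ->
    maximal_weak_subslope (fun x => ladde (f1 x) (f2 x)) G12 ->
    maximal_weak_subslope (fun x => ladde (2%:E * f1 x) (f2 x)) G112 ->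
  {ae m, forall x, 2%:E * G12 x ^+ 2 + 2%:E * G1 x ^+ 2 =
                   G2 x ^+ 2 + G112 x ^+ 2}.

End subslopes.

(* Main.v *)
(* Work in a chart around an almost every point and truncate a causal function f.
   Being monotone along the future cone, f has at almost every point backward
   derivatives along all future integral vectors v; these are additive in v, again
   by Fatou's lemma, hence given by a covector a. The maximal weak subslope equals
   N(a) = inf a(v) / |v|_g over the future integral vectors v:
   - it is at least N(a), since the constants q below N(a) on a set B define weak
     subslopes q 1_B: at points of B the increments of f along a causal path are at
     least q times the time separation, up to lower order, and Fatou's lemma
     integrates this infinitesimal estimate along the path;
   - it is at most N(a): test plans uniformly distributed on short coordinate
     segments in direction v, for which the speed is |v|_g, bound its averages over
     lines by increments of f, and Lebesgue differentiation on lines concludes.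
   By the reversed Cauchy-Schwarz inequality N(a)^2 = - a g^-1 a^T, a quadratic form
   in a, and the parallelogram-type identity follows where f1 and f2 are finite.
   Where f is infinite, the function +oo on the interiors of {f = +oo} and
   {f = -oo}, whose complement in {|f| = +oo} is null, is a weak subslope by the
   conventions on differences, so that both sides of the identity are infinite. *)

Require Import Defs.
From HB Require Import structures.
From mathcomp Require Import all_boot all_order all_algebra.
From mathcomp Require Import all_classical all_reals all_analysis.
From mathcomp Require Import measurable_realfun.
From mathcomp Require Import ring lra.

Set Implicit Arguments.
Unset Strict Implicit.
Unset Printing Implicit Defensive.
Import Order.TTheory GRing.Theory Num.Theory.
Import numFieldNormedType.Exports.
Local Open Scope classical_set_scope.
Local Open Scope ring_scope.
Import HBNNSimple.

(** * Monotone functions on the line *)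

(** Three obstacles shape the proof. Causal functions are not assumed Borel, and the integrand
    [G (gamma t) * causal_speed l gamma t] is not known to be measurable: such integrals are suprema
    over simple functions and can only be compared, so measurable substitutes (monotone
    regularizations in charts, cut-offs on sets of paths) take over wherever Fubini, Fatou or
    uniqueness of measures is used. Paths are merely left continuous, so only increments from the
    past of a point are under control; hence backward derivatives and Lebesgue differentiation on
    left intervals. Finally, the exceptional null set must not depend on the direction: integral
    vectors are countable, those in the cone are closed under addition, and they are dense in it up
    to scaling, so that additivity on them already produces a covector. Causal simplicity is used
    through strong causality: curves between nearby points stay nearby, which reduces [time_sep] to
    the metric at a single point up to a small relative error. *)

Section integral_lemmas.
Context d (T : measurableType d) (R : realType)
  (mu : {measure set T -> \bar R}).
Local Open Scope ereal_scope.

(** No measurability is available. A simple function below [f] is multiplied by the indicator of the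
    complement of the null set [N]: its integral does not change, and it now lies below [g]
    everywhere. *)
Lemma ae_le_lower_integral (D : set T) (f g : T -> \bar R) : measurable D ->
  (forall x, D x -> 0 <= f x) -> (forall x, D x -> 0 <= g x) ->
  {ae mu, forall x, D x -> f x <= g x} ->
  \int[mu]_(x in D) f x <= \int[mu]_(x in D) g x.
Proof.
move=> mD f0 g0 [N [mN N0 fgN]].
rewrite integral_mkcond [leRHS]integral_mkcond.
have fD0 x : 0 <= (f \_ D) x by rewrite patchE; case: ifPn => // /set_mem/f0.
have gD0 x : 0 <= (g \_ D) x by rewrite patchE; case: ifPn => // /set_mem/g0.
rewrite (ge0_integralTE _ fD0) (ge0_integralTE _ gD0).
apply: ge_ereal_sup => _ [h /= hf <-].
have mNC : measurable (~` N) by exact: measurableC.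
pose h' := proj_nnsfun h mNC.
rewrite (_ : sintegral mu h = sintegral mu h').
  apply: ereal_sup_ubound; exists h' => //= x.
  rewrite /h' /= /mindic indicE; have [xN|xN] := boolP (x \in ~` N); last first.
    by rewrite mulr0.
  rewrite mulr1; move: (hf x); rewrite !patchE; case: ifPn => // xD hx.
  apply: (le_trans hx); apply: contrapT => fg.
  by move: xN; rewrite inE; apply; apply: fgN => /= /(_ (set_mem xD)).
rewrite -!integralT_nnsfun.
apply: ge0_ae_eq_integral => //.
- exact/measurable_EFinP.
- exact/measurable_EFinP.
- by move=> x _; rewrite lee_fin.
- by move=> x _; rewrite lee_fin.
exists N; split => // x /= hh'; apply: contrapT => xN; apply: hh' => _.
by rewrite /h' /= /mindic indicE mem_set ?mulr1.
Qed.

Lemma le_lower_integral (D : set T) (f g : T -> \bar R) : measurable D ->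
  (forall x, D x -> 0 <= f x) -> (forall x, D x -> f x <= g x) ->
  \int[mu]_(x in D) f x <= \int[mu]_(x in D) g x.
Proof.
move=> mD f0 fg; apply: ae_le_lower_integral => //.
  by move=> x Dx; rewrite (le_trans (f0 _ Dx)) ?fg.
exact: aeW.
Qed.

Lemma ae_imp (P Q : T -> Prop) : (forall x, P x -> Q x) ->
  {ae mu, forall x, P x} -> {ae mu, forall x, Q x}.
Proof.
by move=> PQ; apply: (@filterS _ _ (ae_filter_ringOfSetsType mu)).
Qed.

Lemma ae_and (P Q : T -> Prop) : {ae mu, forall x, P x} ->
  {ae mu, forall x, Q x} -> {ae mu, forall x, P x /\ Q x}.
Proof. exact: (@filterI _ _ (ae_filter_ringOfSetsType mu)). Qed.

End integral_lemmas.

Section stieltjes.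
Context {R : realType}.
Local Open Scope ereal_scope.
Local Notation mu := (@lebesgue_measure R).

(* [m] need not be a measure: the lemma also serves for images of an outer measure. *)
Lemma le_lebesgue_stieltjes (f : cumulative R R) (C : R) (A : set R)
    (m : set R -> \bar R) : (0 < C)%R ->
  (forall a b : R, (a <= b)%R -> m `]a, b]%classic <= (C * (f b - f a))%:E) ->
  (forall B, 0 <= m B) ->
  (forall F : nat -> set R, (forall k, ocitv (F k)) -> A `<=` \bigcup_k F k ->
    m A <= \sum_(k <oo) m (F k)) ->
  m A <= C%:E * lebesgue_stieltjes_measure f A.
Proof.
move=> C0 mf m0 msub.
have [|Aoo] := leP +oo (lebesgue_stieltjes_measure f A).
  by rewrite leye_eq => /eqP ->; rewrite gt0_muley ?leey.
apply/lee_addgt0Pr => e e0.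
have Ce : (0 < e / C)%R by rewrite divr_gt0.
have fA : lebesgue_stieltjes_measure f A \is a fin_num.
  by rewrite ge0_fin_numE// outer_measure_ge0.
have [_ [F [oF AF] <-] /ltW Fe] := lb_ereal_inf_adherent Ce fA.
rewrite -/(wlength f) in Fe.
apply: (le_trans (msub F oF AF)).
apply: (@le_trans _ _ (C%:E * \sum_(k <oo) wlength f (F k))).
  rewrite -nneseriesZl//.
  apply: lee_nneseries => k *; first exact: m0.
  have [/= [a b] _ <-] := oF k.
  rewrite /=; have [ab|ba] := ltP a b.
    by rewrite wlength_itv/= lte_fin ab -EFinB -EFinM mf// ltW.
  rewrite set_itv_ge ?wlength0 ?mule0; last by rewrite -leNgt bnd_simp.
  by move: (mf a a (lexx _)); rewrite subrr mulr0 set_itv_ge// bnd_simp ltxx.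
apply: le_trans (lee_wpmul2l _ Fe) _; first by rewrite lee_fin ltW.
have -> : e%:E = C%:E * (e / C)%:E by rewrite -EFinM mulrC divfK ?gt_eqF.
by rewrite -muleDr ?fin_num_adde_defl.
Qed.

Lemma dominated_lebesgue (C : R)
    (nu : {measure set (measurableTypeR R) -> \bar R}) : (0 < C)%R ->
  (forall a b : R, (a <= b)%R -> nu `]a, b]%classic <= (C * (b - a))%:E) ->
  forall A : set (measurableTypeR R), measurable A -> nu A <= C%:E * mu A.
Proof.
move=> C0 nuC A mA.
have moc F : ocitv F -> measurable (F : set (measurableTypeR R)).
  by move=> [[a b] _ <-]; exact: measurable_itv.
apply: (@le_lebesgue_stieltjes idfun) => //=.
  by move=> F oF AF; apply: measure_sigma_subadditive => // k; exact: moc.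
Qed.

(** The bound on intervals makes [nu] absolutely continuous. Radon-Nikodym gives the density, and
    the fundamental theorem of calculus identifies it a.e. with the derivative of the distribution
    function. *)
Lemma lipschitz_measure_density (C : R)
    (nu : {measure set (measurableTypeR R) -> \bar R}) : (0 < C)%R ->
  (forall a b : R, (a <= b)%R -> nu `]a, b]%classic <= (C * (b - a))%:E) ->
  nu setT < +oo ->
  exists k : R -> R, [/\ measurable_fun setT k, (forall x, 0 <= k x)%R,
    mu.-integrable setT (EFin \o k),
    (forall A : set (measurableTypeR R), measurable A -> nu A = \int[mu]_(x in A) (k x)%:E) &
    {ae mu, forall x : R,
       is_derive x 1%R (fun y => fine (nu `]-oo, y]%classic)) (k x)}].
Proof.
move=> C0 nuC nuT.
pose nu' := mfrestr measurableT nuT.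
have nuE0 A : nu' A = nu A by rewrite /nu' /mfrestr/= /mrestr setIT.
have dom : nu' `<< mu.
  apply/null_content_dominatesP => A mA A0; rewrite nuE0.
  apply/eqP; rewrite eq_le measure_ge0 andbT.
  by apply: (le_trans (dominated_lebesgue C0 nuC mA)); rewrite A0 mule0.
have [f [f0 ffin fint nuE]] := radon_nikodym_sigma_finite dom.
have mk : measurable_fun setT (fine \o f).
  by apply: measurableT_comp => //; case/integrableP: fint.
have fE : f = EFin \o (fine \o f).
  by apply/funext => x /=; rewrite fineK.
have kint : mu.-integrable setT (EFin \o (fine \o f)) by rewrite -fE.
exists (fine \o f); split => //.
- by move=> x; rewrite fine_ge0.
- by move=> A mA; rewrite (etrans (esym (nuE0 A)) (nuE A mA)) fE.
have kinty (y : R) : mu.-integrable [set` `]-oo, y]] (EFin \o (fine \o f)).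
  by apply: integrableS kint.
have lk : locally_integrable [set: R] (fine \o f).
  exact: (open_integrable_locally openT).
apply: ae_imp (FTC1Ny kinty lk) => x [df dE].
have FE : (fun y => fine (nu `]-oo, y]%classic)) =
   (fun y : R => \int[mu]_(t in [set` `]-oo, y]]) (fine \o f) t)%R.
  apply/funext => y; rewrite -(nuE0 `]-oo, y]%classic).
  by rewrite [X in fine X](nuE `]-oo, y]%classic (measurable_itv _)) fE.
by rewrite FE; split => //; rewrite -dE derive1E.
Qed.

End stieltjes.

Section real_derivative.
Context {R : realType}.

Lemma is_derive1P (f : R -> R) (t l : R) : is_derive t (1 : R) f l <->
  h^-1 * (f (t + h) - f t) @[h --> 0^'] --> l.
Proof.
have E : (fun h : R => h^-1 *: ((f \o shift t) (h *: (1 : R)) - f t)) =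
         (fun h => h^-1 * (f (t + h) - f t)).
  by apply/funext => h /=; rewrite [h *: _]mulr1 [h + t]addrC.
split=> [[fd <-]|fl].
  by move: fd => /cvg_ex[l']; rewrite /derive E => fl; rewrite (cvg_lim _ fl).
split; first by apply/cvg_ex; exists l; rewrite E.
by rewrite /derive E; apply: cvg_lim.
Qed.

(** [r] is only a right inverse and may jump elsewhere; the positive derivative of [u] at [r t]
    forces [r] to be continuous at [t], after which the difference quotients are inverse to each
    other. *)
Lemma is_derive_inverse (u r : R -> R) (t k : R) :
  {homo u : x y / x <= y} -> (forall s, u (r s) = s) ->
  0 < k -> is_derive (r t) (1 : R) u k -> is_derive t (1 : R) r k^-1.
Proof.
move=> ndu ur k0 /is_derive1P uk.
have k20 : 0 < k / 2 by rewrite divr_gt0.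
have ulow : \forall h \near 0^', k / 2 < h^-1 * (u (r t + h) - u (r t)).
  have : nbhs k [set x | k / 2 < x].
    by apply: lt_nbhsr; rewrite ltr_pdivrMr// ltr_pMr// ltrDl.
  exact: uk.
have rinj : injective r by move=> a b ab; rewrite -(ur a) -(ur b) ab.
(* Over a distance [e1] from [r t] the function [u] changes by more than [k / 2 * e1]. By
   monotonicity, [r (t + h)] beyond that distance would force [h] to be at least as large. *)
have rc : r (t + h) - r t @[h --> 0^'] --> 0.
  apply/cvgr0Pnorm_lt => e e0.
  have [d /= d0 dlow] := ulow.
  pose e1 := Num.min (e / 2) (d / 2).
  have e10 : 0 < e1 by rewrite lt_min !divr_gt0.
  have e1e : e1 < e.
    by rewrite gt_min; apply/orP; left; rewrite ltr_pdivrMr// ltr_pMr// ltrDl.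
  have e1d : e1 < d.
    by rewrite gt_min; apply/orP; right; rewrite ltr_pdivrMr// ltr_pMr// ltrDl.
  have lowp : u (r t + e1) - t > k / 2 * e1.
    have := dlow e1; rewrite /= sub0r normrN gtr0_norm// => /(_ e1d).
    move=> /(_ (lt0r_neq0 e10)); rewrite ur ltr_pdivlMl// => ?.
    by rewrite mulrC.
  have lown : t - u (r t - e1) > k / 2 * e1.
    have := dlow (- e1); rewrite /= sub0r opprK gtr0_norm// => /(_ e1d).
    rewrite oppr_eq0 => /(_ (lt0r_neq0 e10)); rewrite ur invrN mulNr -mulrN opprB.
    by rewrite ltr_pdivlMl// => ?; rewrite mulrC.
  near=> h.
  have hs : `|h| < k / 2 * e1.
    near: h; apply: dnbhs0_lt; exact: mulr_gt0.
  rewrite (le_lt_trans _ e1e)// ler_norml; apply/andP; split.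
    rewrite lerBrDr addrC leNgt; apply/negP => /ltW/ndu; rewrite ur => hh.
    by move: hs; rewrite ltr_norml => /andP[hs _]; lra.
  rewrite leNgt; apply/negP; rewrite ltrBrDl => /ltW/ndu; rewrite ur => hh.
  by move: hs; rewrite ltr_norml => /andP[_ hs]; lra.
have rc' : r (t + h) - r t @[h --> 0^'] --> 0^'.
  move=> P P0; have rP : \forall h \near 0^', r (t + h) - r t != 0 ->
    P (r (t + h) - r t) := rc _ P0.
  suff : \forall h \near 0^', P (r (t + h) - r t) by [].
  apply: filterS2 rP (nbhs_dnbhs_neq (0 : R)) => h hP h0; apply: hP.
  rewrite subr_eq0; apply/eqP => /rinj /eqP.
  by rewrite -subr_eq0 addrAC subrr add0r; apply/negP.
have := cvg_comp _ _ rc' uk; rewrite /comp /= => {}uk.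
have ukV : ((r (t + h) - r t)^-1 * (u (r t + (r (t + h) - r t)) - u (r t)))^-1
    @[h --> 0^'] --> k^-1 by apply: cvgV uk; exact: lt0r_neq0.
apply/is_derive1P; apply: cvg_trans ukV; apply: near_eq_cvg; near=> h.
by rewrite /= [r t + _]addrC subrK !ur invfM invrK [t + h]addrC addrK mulrC.
Unshelve. all: by end_near. Qed.


End real_derivative.

Section stieltjes_derivative.
Context {R : realType}.
Local Open Scope ereal_scope.
Local Notation mu := (@lebesgue_measure R).

Lemma lebesgue_stieltjes_itv (u : cumulative R R) (a b : R) : (a <= b)%R ->
  lebesgue_stieltjes_measure u `]a, b]%classic = (u b - u a)%:E.
Proof.
move=> ab; rewrite /lebesgue_stieltjes_measure/= /measure_extension.
by rewrite measurable_mu_extE/=; [rewrite wlength_itv_bnd|exact: is_ocitv].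
Qed.

(** The Stieltjes measure is restricted to []a, b]] to make it finite; inside the interval the
    distribution function of the restriction differs from [u] by a constant. *)
Lemma lipschitz_nondecreasing_density (u : cumulative R R) (C a b : R) :
  (0 < C)%R -> (forall s t : R, s <= t -> u t - u s <= C * (t - s))%R -> (a < b)%R ->
  exists k : R -> R, [/\ measurable_fun setT k, (forall x, 0 <= k x)%R,
    mu.-integrable setT (EFin \o k),
    (forall A : set (measurableTypeR R), measurable A -> A `<=` `]a, b]%classic ->
      lebesgue_stieltjes_measure u A = \int[mu]_(x in A) (k x)%:E) &
    {ae mu, forall x : R, (a < x < b)%R -> is_derive x 1%R (u : R -> R) (k x)}].
Proof.
move=> C0 uC ab.
pose D : set (measurableTypeR R) := `]a, b]%classic.
have mD : measurable D by exact: measurable_itv.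
pose nu := mrestr (lebesgue_stieltjes_measure u) mD.
have nuC (s t : R) : (s <= t)%R -> nu `]s, t]%classic <= (C * (t - s))%:E.
  move=> st; rewrite /nu /mrestr/=.
  apply: (@le_trans _ _ (lebesgue_stieltjes_measure u `]s, t]%classic)).
    exact: measureIl.
  by rewrite lebesgue_stieltjes_itv// lee_fin uC.
have nuT : nu setT < +oo.
  by rewrite /nu /mrestr/= setTI lebesgue_stieltjes_itv ?ltry// ltW.
have [k [mk k0 ik nuE dk]] := lipschitz_measure_density C0 nuC nuT.
exists k; split => //.
  move=> A mA AD; rewrite -nuE//.
  by rewrite -[RHS]/(lebesgue_stieltjes_measure u (A `&` D)) setIidl.
apply: ae_imp dk => x /is_derive1P dk /andP[ax xb]; apply/is_derive1P.
apply: cvg_trans dk; apply: near_eq_cvg; near=> h.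
have nuI y : (a < y < b)%R -> fine (nu `]-oo, y]%classic) = (u y - u a)%R.
  move=> /andP[ay yb]; rewrite /nu /mrestr/= [X in fine (_ X)](_ : _ = `]a, y]%classic).
    by rewrite lebesgue_stieltjes_itv// ltW.
  rewrite /D; apply/seteqP; split=> z /=; rewrite !in_itv/=.
    by move=> [zy /andP[az _]]; rewrite az zy.
  by move=> /andP[-> zy]; split=> //; rewrite (le_trans zy)// ltW.
rewrite !nuI ?ax//; first by congr (_ * _)%R; lra.
apply/andP; split.
  rewrite -ltrBlDl; suff : (`|h| < x - a)%R by rewrite ltr_norml opprB => /andP[].
  by near: h; apply: dnbhs0_lt; rewrite subr_gt0.
rewrite -ltrBrDl; suff : (`|h| < b - x)%R by rewrite ltr_norml => /andP[].
by near: h; apply: dnbhs0_lt; rewrite subr_gt0.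
Unshelve. all: by end_near. Qed.

End stieltjes_derivative.

Section monotone_derivative.
Context {R : realType}.
Local Open Scope ereal_scope.
Local Notation mu := (@lebesgue_measure R).

Lemma nondecreasing_lipschitz_right_continuous (u : R -> R) (C : R) :
  (0 < C)%R ->
  {homo u : x y / (x <= y)%R} -> (forall s t, s <= t -> u t - u s <= C * (t - s))%R ->
  right_continuous u.
Proof.
move=> C0 ndu uC x; apply/cvgrPdist_lt => e e0; near=> y.
have xy : (x <= y)%R by near: y; exact: nbhs_right_ge.
rewrite distrC ger0_norm ?subr_ge0 ?ndu//.
rewrite (le_lt_trans (uC _ _ xy))// -ltr_pdivlMl// ltrBlDl.
near: y; apply: nbhs_right_lt; rewrite ltrDl mulr_gt0 ?invr_gt0//.
Unshelve. all: by end_near. Qed.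

(* The inverse [u] of the expansive map [t + phi t] is nondecreasing and
   1-Lipschitz, hence absolutely continuous: it maps the set where its
   derivative vanishes or does not exist to a null set. *)
Theorem nondecreasing_ae_derivable (phi : R -> R) :
  {homo phi : x y / (x <= y)%R} ->
  {ae mu, forall t : R, derivable phi t 1%R}.
Proof.
move=> ndphi.
pose r (t : R) : R := (t + phi t)%R.
have ltr' : {homo r : x y / (x < y)%R} by move=> x y xy; rewrite ltr_leD// ndphi// ltW.
have ler' : {homo r : x y / (x <= y)%R} by move=> x y xy; rewrite lerD// ndphi.
have rle : {mono r : x y / (x <= y)%R} by apply: le_mono.
pose S (rho : R) := [set t | r t <= rho]%R.
have S0 rho : S rho !=set0.
  exists (Num.min 0 (rho - phi 0))%R => /=.
  have [h|h] := leP 0%R (rho - phi 0)%R; first by rewrite /S/= /r add0r; move: h; rewrite subr_ge0.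
  by rewrite /S/= /r -lerBrDr lerB// ndphi// ltW.
have Sub rho : has_ubound (S rho).
  exists (Num.max 0 (rho - phi 0))%R => t /= tr.
  rewrite le_max; have [t0|t0] := leP t 0%R; first by [].
  by rewrite orFb lerBrDr (le_trans _ tr)// lerD2l ndphi// ltW.
(* Generalized inverse of [r]: it fills the jumps of [r] with constant pieces, so that it is defined
   on the whole line. *)
pose u rho := sup (S rho).
have hS rho : has_sup (S rho) by split.
have ur t : u (r t) = t.
  apply/eqP; rewrite eq_le; apply/andP; split.
    by apply: sup_le_ub => // s; rewrite /S/= rle.
  by apply: sup_upper_bound => //; rewrite /S/=.
have ndu : {homo u : x y / (x <= y)%R}.
  move=> x y xy; apply: sup_le_ub => // s; rewrite /S/= => sx.
  by apply: sup_upper_bound => //; rewrite /S/=; exact: le_trans xy.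
have uC s t : (s <= t -> u t - u s <= 1 * (t - s))%R.
  move=> st; rewrite mul1r lerBlDr; apply: sup_le_ub => // x /= xt.
  rewrite -lerBlDl; apply: sup_upper_bound => //.
  rewrite /S/= /r opprB addrA.
  have : (phi (x + (s - t)) <= phi x)%R by apply: ndphi; rewrite gerDl subr_le0.
  by rewrite addrA => h; move: xt; rewrite /S/= /r; move: h; lra.
have rcu := nondecreasing_lipschitz_right_continuous ltr01 ndu uC.
pose U : cumulative R R := HB.pack u (isCumulative.Build _ _ _ u ndu rcu).
have key (N : nat) : {ae mu, forall t : R, (- N.+1%:R < r t < N.+1%:R)%R -> derivable phi t 1%R}.
  have [|k [mk k0 ik kE dk]] := @lipschitz_nondecreasing_density R U 1%R (- N.+1%:R)%R N.+1%:R%R ltr01 uC.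
    by rewrite gtrN.
  have [Z [mZ Z0 ZE]] := dk.
  pose E : set R := ((Z : set R) `|` [set x : R | k x = 0%R]) `&` `](- N.+1%:R)%R, N.+1%:R%R]%classic.
  have mk0 : measurable (k @^-1` [set 0%R]) by rewrite -[X in measurable X]setTI; exact: mk.
  have mE : measurable (E : set (measurableTypeR R)).
    by apply: measurableI => //; apply: measurableU.
  have E0 : lebesgue_stieltjes_measure U E = 0.
    rewrite kE//; last exact: subIsetr.
    rewrite (@ge0_ae_eq_integral _ _ _ _ _ _ (cst 0)) ?integral0//.
    - by apply/measurable_EFinP; exact: measurable_funTS.
    - by move=> x _; rewrite lee_fin.
    exists Z; split => // x /= nx; apply: contrapT => nZ; apply: nx.
    by case=> -[//|/= ->].
  (* The Stieltjes bound is applied to the outer measure of images under [u], which is subadditive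
     but not a measure: an interval is mapped into one of length [u b - u a]. *)
  have uE0 : (wlength idfun)^*%mu (u @` E) = 0.
    apply/eqP; rewrite eq_le outer_measure_ge0 andbT.
    have := @le_lebesgue_stieltjes R U 1%R E (fun A => (wlength idfun)^*%mu (u @` A)) ltr01.
    rewrite E0 mule0; apply.
    - move=> a b ab; rewrite mul1r.
      apply: (@le_trans _ _ (mu `[u a, u b]%classic)).
        apply: le_outer_measure => _ [x /= + <-]; rewrite !in_itv/= => /andP[ax xb].
        by rewrite !ndu// ltW.
      by rewrite lebesgue_measure_itv/=; case: ifP => _; rewrite ?lee_fin ?subr_ge0 ?ndu.
    - by move=> B; exact: outer_measure_ge0.
    - move=> F _ EF; apply: (@le_trans _ _ ((wlength idfun)^*%mu (\bigcup_k (u @` F k)))).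
        apply: le_outer_measure => _ [x /EF[j _ Fkx] <-].
        by exists j => //; exists x.
      exact: outer_measure_sigma_subadditive.
  have [B [mB B0 uEB]] := (negligible_outer_measure (u @` E)).2 uE0.
  exists B; split => //; apply: subset_trans uEB => t /= /not_implyP[/andP[Nr rN] nd].
  exists (r t) => //; split; last by rewrite /= in_itv/= Nr ltW.
  apply: contrapT => /not_orP[nZ nk]; apply: nd.
  have du : is_derive (r t) 1%R u (k (r t)).
    by apply: contrapT => /= nu; apply: nZ; apply: ZE => /= /(_ _); rewrite Nr rN => /(_ isT).
  have kr0 : (0 < k (r t))%R by rewrite lt_neqAle k0 eq_sym andbT; apply/eqP.
  have := is_derive_inverse ndu ur kr0 du => -[dr _].
  have -> : phi = (r - id)%R by apply/funext => x; rewrite /r !fctE addrC addKr.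
  by apply: derivableB.
have := ae_foralln key.
apply: ae_imp => t tP; apply: (tP (Num.bound `|r t|)).
have := archi_boundP (normr_ge0 (r t)).
by move=> /lt_trans /(_ (_ : _ < (Num.bound `|r t|).+1%:R)%R); rewrite ltr_nat ltr_norml; exact.
Qed.

Lemma ae_neq (r : R) : {ae mu, forall t : R, t != r}.
Proof.
exists [set r]; split => //; first by rewrite lebesgue_measure_set1.
by move=> t /= /negP; rewrite negbK => /eqP.
Qed.

(** Clamping the argument to [[0, 1]] and adding [(L + 1) * t] turns [phi] into a nondecreasing
    Lipschitz function on the line, which is the integral of its derivative; the linear term is
    subtracted at the end. *)
Lemma lipschitz_integral_le (phi : R -> R) (L : R) (h : R -> \bar R) :
  (forall s t, 0 <= s <= 1 -> 0 <= t <= 1 -> `|phi s - phi t| <= L * `|s - t|)%R ->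
  (forall t, 0 <= h t) ->
  {ae mu, forall t : R, (0 < t < 1)%R ->
     derivable phi t 1%R /\ h t <= (derive1 phi t)%:E} ->
  \int[mu]_(t in `[0%R, 1%R]) h t <= (phi 1 - phi 0)%:E.
Proof.
move=> lip h0 hphi.
pose cl (t : R) : R := Num.max 0%R (Num.min t 1%R).
have cl01 t : (0 <= cl t <= 1)%R.
  rewrite /cl le_max lexx/= ge_max ler01/=.
  by rewrite ge_min lexx orbT.
have cli t : (0 <= t <= 1)%R -> cl t = t.
  by move=> /andP[t0 t1]; rewrite /cl min_l// max_r.
have clL s t : (s <= t -> 0 <= cl t - cl s <= t - s)%R.
  move=> st; rewrite /cl; case: (leP s 1%R) => s1; case: (leP t 1%R) => t1.
  - by case: (leP 0%R s) => s0; case: (leP 0%R t) => t0; apply/andP; split; lra.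
  - by case: (leP 0%R s) => s0; rewrite max_r//; apply/andP; split; lra.
  - by lra.
  - by rewrite subrr subr_ge0 st lexx.
have L0 : (0 <= L)%R.
  have := lip 0%R 1%R; rewrite !lexx ler01 => /(_ isT isT).
  by rewrite sub0r normrN normr1 mulr1; apply: le_trans.
pose C : R := (L + L + 1)%R.
have C0 : (0 < C)%R by rewrite /C; lra.
pose u (t : R) : R := (phi (cl t) + (L + 1) * t)%R.
have uphi s t : (s <= t -> `|phi (cl t) - phi (cl s)| <= L * (t - s))%R.
  move=> st; apply: le_trans (lip _ _ (cl01 _) (cl01 _)) _.
  have /andP[c0 c1] := clL _ _ st.
  by rewrite ger0_norm// ler_wpM2l.
have ndu : {homo u : x y / (x <= y)%R}.
  move=> s t st; have := uphi _ _ st; rewrite ler_norml => /andP[h1 h2].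
  rewrite /u -subr_ge0; move: h1 h2; set a := phi _; set b := phi _; nra.
have uC s t : (s <= t -> u t - u s <= C * (t - s))%R.
  move=> st; have := uphi _ _ st; rewrite ler_norml => /andP[h1 h2].
  rewrite /u /C; move: h1 h2; set a := phi _; set b := phi _; nra.
have rcu := nondecreasing_lipschitz_right_continuous C0 ndu uC.
pose U : cumulative R R := HB.pack u (isCumulative.Build _ _ _ u ndu rcu).
have [k [mk k0 ik kE dk]] := @lipschitz_nondecreasing_density R U C 0%R 1%R C0 uC ltr01.
have kh : {ae mu, forall t : R, `[0%R, 1%R]%classic t -> h t <= (k t - (L + 1))%:E}.
  apply: ae_imp (ae_and (ae_and (ae_neq 0%R) (ae_neq 1%R)) (ae_and dk hphi)).
  move=> t [[t0 t1] [dku hp]]; rewrite /= in_itv/= => t01'.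
  have t01 : (0 < t < 1)%R by rewrite !lt_neqAle eq_sym t0 t1.
  have [dphi hle] := hp t01; apply: (le_trans hle); rewrite lee_fin.
  have /is_derive1P du := dku t01.
  have /is_derive1P dp : is_derive t 1%R phi (derive1 phi t).
    by split => //; rewrite derive1E.
  suff : is_derive t 1%R phi (k t - (L + 1))%R.
    by move=> [_ <-]; rewrite derive1E.
  apply/is_derive1P.
  have dd : (x^-1 * (U (t + x) - U t) - (L + 1))%R @[x --> (0%R : R)^'] --> (k t - (L + 1))%R.
    by apply: cvgB => //; exact: cvg_cst.
  have mpos : (0 < Num.min t (1 - t))%R.
    by rewrite lt_min subr_gt0.
  apply: cvg_trans dd; apply: near_eq_cvg; near=> x.
  have x0 : (x != 0)%R by near: x; exact: nbhs_dnbhs_neq.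
  rewrite /= /u !cli; last 2 first.
  - by move/andP: t01 => [/ltW-> /ltW->].
  - have /andP[t0' t1'] := t01.
    have : (`|x| < Num.min t (1 - t))%R by near: x; exact: dnbhs0_lt.
    by rewrite lt_min !ltr_norml => /andP[/andP[h1 h2] /andP[h3 h4]]; apply/andP; split; lra.
  by field.
have kae : {ae mu, forall t : R, `[0%R, 1%R]%classic t -> (0 <= k t - (L + 1))%R}.
  apply: ae_imp kh => t kt /kt; move: (h0 t) => /le_trans ht /ht.
  by rewrite lee_fin.
(* The positive part is nonnegative everywhere and not only a.e., as the comparison of lower
   integrals requires. *)
pose k1 t := Num.max 0%R (k t - (L + 1))%R.
have mk1 : measurable_fun setT k1.
  by apply: measurable_maxr => //; apply: measurable_funB.
apply: (@le_trans _ _ (\int[mu]_(t in `[0%R, 1%R]) (k1 t)%:E)).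
  apply: ae_le_lower_integral => //.
  - by move=> t _; rewrite lee_fin le_max lexx.
  - apply: ae_imp kh => t kt /kt /le_trans; apply.
    by rewrite lee_fin le_max lexx orbT.
rewrite -integral_itv_obnd_cbnd; last by apply/measurable_EFinP; exact: measurable_funTS.
have -> : \int[mu]_(t in `]0%R, 1%R]) (k1 t)%:E = \int[mu]_(t in `]0%R, 1%R]) ((k t)%:E - (L + 1)%:E).
  apply: ae_eq_integral => //.
  - by apply/measurable_EFinP; exact: measurable_funTS.
  - by apply/measurable_EFinP; apply: measurable_funB => //; exact: measurable_funTS.
  - apply: ae_imp kae => t kt; rewrite /= in_itv/= => /andP[t0 t1].
    have kt0 : (0 <= k t - (L + 1))%R by apply: kt; rewrite /= in_itv/= (ltW t0).
    by rewrite /k1 max_r// EFinB.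
rewrite integralB//=; last 2 first.
- by apply: integrableS ik.
- apply/integrableP; split; first exact: measurable_cst.
  rewrite /= integral_cst//= lebesgue_measure_itv/= lte_fin ltr01 -EFinB -EFinM.
  exact: ltry.
have <- : lebesgue_stieltjes_measure U `]0%R, 1%R]%classic = \int[mu]_(x in `]0%R, 1%R]) (k x)%:E.
  by apply: kE.
have m1 : mu `]0%R, 1%R]%classic = 1%:E.
  by rewrite lebesgue_measure_itv/= lte_fin ltr01 oppr0 adde0.
rewrite lebesgue_stieltjes_itv ?ler01// (integral_cst mu)//= m1 mule1 -EFinB lee_fin.
by rewrite /= /u !cli ?lexx ?ler01//; lra.
Unshelve. all: by end_near. Qed.

End monotone_derivative.

Section shift.
Context {R : realType}.
Local Notation mu := (@lebesgue_measure R).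

Lemma lebesgue_measure_shift (a : R) (A : set R) : measurable A ->
  pushforward mu ((fun t => t + a) : _ -> measurableTypeR R) A = mu A.
Proof.
have mf : measurable_fun setT ((fun t : R => t + a) : _ -> measurableTypeR R).
  exact: measurable_funD.
move=> mA; apply/esym/lebesgue_measure_unique => //=.
move=> X /ocitvP[->|[[x y] /= xy ->]]; first by rewrite /pushforward preimage_set0 !measure0.
rewrite /pushforward (_ : _ @^-1` _ = `]x - a, y - a]%classic).
  rewrite !lebesgue_measure_itv/= !lte_fin ltrD2r xy -!EFinB.
  by congr (_%:E); rewrite opprB addrA subrK.
by apply/seteqP; split=> z /=; rewrite !in_itv/= ltrBlDr lerBrDr.
Qed.

Lemma ge0_integral_shift (a : R) (D : set R) (f : R -> \bar R) :
  measurable D -> measurable_fun D f -> (forall t, D t -> (0 <= f t)%E) ->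
  (\int[mu]_(t in (fun t : R => (t + a)%R) @^-1` D) f (t + a)%R = \int[mu]_(t in D) f t)%E.
Proof.
move=> mD mf f0.
pose sh : measurableTypeR R -> measurableTypeR R := fun t : R => t + a.
have mp : measurable_fun setT sh by exact: measurable_funD.
have E := ge0_integral_pushforward mp (@lebesgue_measure R) mD mf.
apply: etrans (esym (E _)) _; first by move=> y /set_mem; exact: f0.
by apply: eq_measure_integral => A mA _; exact: lebesgue_measure_shift.
Qed.

(* Fatou's lemma for the difference quotients, whose integrals telescope. *)
Lemma nondecreasing_integral_le (phi : R -> R) (h : R -> \bar R) :
  {homo phi : x y / x <= y} -> (forall t, 1 <= t -> phi t = phi 1) ->
  (forall t, (0 <= h t)%E) ->
  {ae mu, forall t : R, (0 < t < 1) -> derivable phi t 1 ->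
     (h t <= (derive1 phi t)%:E)%E} ->
  (\int[mu]_(t in `[0%R, 1%R]) h t <= (phi 1 - phi 0)%:E)%E.
Proof.
move=> ndphi phi1 h0 hphi.
pose I01 : set R := `[0%R, 1%R]%classic.
have mI : measurable I01 by exact: measurable_itv.
have mphi : measurable_fun setT phi.
  exact: nondecreasing_measurable.
(* Nonnegative on [[0, +oo[], so that the shifted integrals can be handled as integrals of
   nonnegative functions. *)
pose psi t := phi t - phi 0.
have psi0 t : 0 <= t -> 0 <= psi t by move=> t0; rewrite subr_ge0 ndphi.
have mpsi : measurable_fun setT psi by apply: measurable_funB.
pose q (n : nat) (t : R) : \bar R := (n.+1%:R * (phi (t + n.+1%:R^-1) - phi t))%:E.
have q0 n t : I01 t -> (0 <= q n t)%E.
  by move=> _; rewrite lee_fin mulr_ge0// subr_ge0 ndphi// lerDl.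
have mq n : measurable_fun I01 (q n).
  apply/measurable_EFinP; apply: measurable_funTS.
  apply: measurable_funM => //; apply: measurable_funB => //.
  by apply: (measurableT_comp mphi); exact: measurable_funD.
have qint n : (\int[mu]_(t in I01) q n t <= (phi 1 - phi 0)%:E)%E.
  set e : R := n.+1%:R^-1.
  have e0 : 0 < e by rewrite invr_gt0.
  have -> : (\int[mu]_(t in I01) q n t = n.+1%:R%:E * \int[mu]_(t in I01) ((phi (t + e) - phi t)%:E))%E.
    rewrite -ge0_integralZl_EFin//.
    - by move=> t _; rewrite lee_fin subr_ge0 ndphi// lerDl ltW.
    - apply/measurable_EFinP; apply: measurable_funTS; apply: measurable_funB => //.
      by apply: (measurableT_comp mphi); exact: measurable_funD.
  rewrite muleC -lee_pdivlMr// -EFinM -/e.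
  have mpE (D : set R) : measurable D -> measurable_fun D (fun t => (psi t)%:E).
    by move=> mD; apply/measurable_EFinP; exact: measurable_funTS.
  have intpsi : (\int[mu]_(t in I01) (psi t)%:E)%E \is a fin_num.
    rewrite ge0_fin_numE; last first.
      apply: integral_ge0 => t; rewrite /I01/= in_itv/= => /andP[t0 _].
      by rewrite lee_fin psi0.
    apply: (@le_lt_trans _ _ (\int[mu]_(t in I01) (psi 1)%:E)%E); last first.
      by rewrite integral_cst//= lebesgue_measure_itv/= lte_fin ltr01 -EFinB -EFinM ltry.
    apply: le_lower_integral => // t; rewrite /I01/= in_itv/= => /andP[t0 t1].
      by rewrite lee_fin psi0.
    by rewrite lee_fin lerD2r ndphi.
  (* After the shift the domain is [[e, 1 + e]], contained in [[0, 1]] and []1, 1 + e]]; on the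
     latter [psi] is constant. *)
  have step : (\int[mu]_(t in I01) (psi (t + e)%R)%:E <= \int[mu]_(t in I01) (psi t)%:E + (e * psi 1)%:E)%E.
    have {1}-> : I01 = (fun t : R => t + e) @^-1` (`[e, 1 + e]%classic).
      by apply/seteqP; split=> z /=; rewrite !in_itv/= lerDr lerD2r.
    rewrite (@ge0_integral_shift e _ (fun t => (psi t)%:E))//; last 2 first.
    - exact: mpE.
    - move=> t /=; rewrite in_itv/= => /andP[et _]; rewrite lee_fin psi0//.
      by apply: le_trans et; exact: ltW.
    have mJ : measurable (`]1%R, (1 + e)%R]%classic : set R) by exact: measurable_itv.
    apply: (@le_trans _ _ (\int[mu]_(t in I01 `|` `]1%R, (1 + e)%R]%classic) (psi t)%:E)%E).
      apply: ge0_subset_integral => //.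
      - exact: measurableU.
      - by apply: mpE; exact: measurableU.
      - move=> t [|]; rewrite /I01 /= in_itv/= => /andP[t0 _]; rewrite lee_fin psi0//.
        by rewrite (le_trans ler01)// ltW.
      - move=> t; rewrite /I01 /= !in_itv/= => /andP[et te].
        have [t1|t1] := leP t 1; [left|right]; rewrite ?te ?t1 ?andbT//.
        by apply: le_trans et; exact: ltW.
    rewrite ge0_integral_setU//; last 3 first.
    - by apply: mpE; exact: measurableU.
    - move=> t [|]; rewrite /I01 /= in_itv/= => /andP[t0 _]; rewrite lee_fin psi0//.
      by rewrite (le_trans ler01)// ltW.
    - apply/disj_setPS => t []; rewrite /I01 /= !in_itv/= => /andP[_ t1] /andP[t1' _].
      by move: t1; rewrite leNgt t1'.
    rewrite leeD2l//.
    rewrite (_ : (\int[mu]_(x in `]1%R, (1 + e)%R]) (psi x)%:E = \int[mu]_(x in `]1%R, (1 + e)%R]) (psi 1)%:E)%E).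
      rewrite integral_cst//= lebesgue_measure_itv/= lte_fin ltrDl e0 -EFinB -EFinM.
      by rewrite lee_fin addrAC subrr add0r mulrC.
    apply: eq_integral => t; rewrite inE/= in_itv/= => /andP[t1 _].
    by rewrite /psi phi1// ltW.
  rewrite -(leeD2rE _ _ intpsi).
  have : (\int[mu]_(t in I01) (phi (t + e) - phi t)%:E + \int[mu]_(t in I01) (psi t)%:E
     <= (e * psi 1)%:E + \int[mu]_(t in I01) (psi t)%:E)%E.
    rewrite -ge0_integralD//.
    - rewrite [leRHS]addeC; apply: le_trans step; rewrite le_eqVlt; apply/orP; left; apply/eqP.
      by apply: eq_integral => t _; rewrite -EFinD; congr (_%:E); rewrite /psi; lra.
    - by move=> t _; rewrite lee_fin subr_ge0 ndphi// lerDl ltW.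
    - apply/measurable_EFinP; apply: measurable_funTS; apply: measurable_funB => //.
      by apply: (measurableT_comp mphi); exact: measurable_funD.
    - by move=> t; rewrite /I01/= in_itv/= => /andP[t0 _]; rewrite lee_fin psi0.
    - exact: mpE.
  by rewrite [(phi 1 - _) * e]mulrC.
have := fatou mu mI mq q0; rewrite -/I01 => fat.
apply: (@le_trans _ _ (\int[mu]_(t in I01) limn_einf (q ^~ t))%E).
  apply: ae_le_lower_integral => //.
    move=> t It; rewrite limn_einf_lim; apply: lime_ge; first exact: is_cvg_einfs.
    by apply: nearW => n; apply: le_ereal_inf_tmp => _ [m _ <-]; exact: q0.
  have nd := nondecreasing_ae_derivable ndphi.
  apply: ae_imp (ae_and (ae_and (ae_neq 0%R) (ae_neq 1%R)) (ae_and nd hphi)).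
  move=> t [[t0 t1] [dp hp]]; rewrite /I01/= in_itv/= => t01'.
  have t01 : 0 < t < 1 by rewrite !lt_neqAle eq_sym t0 t1.
  apply: (le_trans (hp t01 dp)).
  have qcvg : (q ^~ t) x @[x --> \oo] --> (derive1 phi t)%:E.
    apply/fine_cvgP; split; first exact: nearW.
    have /is_derive1P/cvgr_dnbhsP dp' : is_derive t 1 phi (derive1 phi t).
      by split => //; rewrite derive1E.
    rewrite (_ : _ \o _ = (fun n : nat => (n.+1%:R^-1)^-1 *
        (phi (t + n.+1%:R^-1) - phi t))); last by apply/funext => m /=; rewrite invrK.
    apply: (dp' (fun n => n.+1%:R^-1)); split; last exact: cvg_harmonic.
    by move=> m; rewrite invr_neq0.
  by rewrite (cvg_limn_einf_sup qcvg).
apply: (le_trans fat).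
rewrite limn_einf_lim; apply: lime_le; first exact: is_cvg_einfs.
apply: nearW => n; apply: le_trans (qint n).
by apply: ereal_inf_lbound; exists n => //=.
Qed.
End shift.

(** * Directional derivatives of cone-monotone functions *)

Section rational_vectors.
Context {R : realType} {n : nat}.
Local Notation E := 'rV[R]_n.+1.

Definition ratv (z : 'rV[rat]_n.+1) : E := map_mx ratr z.

Lemma ltr_rV_norm (x : E) (e : R) : 0 < e -> (`|x| < e) <-> (forall i, `|x 0 i| < e).
Proof.
move=> e0; rewrite [`|x|]/Num.norm/= /mx_norm -[e]/((NngNum (ltW e0))%:num)%R num_lt.
split=> [|h]; last by apply/bigmax_ltP; split=> // -[i j] _; rewrite /= ord1; exact: h.
by move=> /bigmax_ltP[_ h] i; have := h (ord0, i) isT.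
Qed.

Lemma dense_ratv (O : set E) : open O -> O !=set0 -> exists z, O (ratv z).
Proof.
move=> oO [x Ox]; have /nbhs_ballP[e /= e0 xe] : nbhs x O by exact: open_nbhs_nbhs.
have h i : exists q : rat, `|x 0 i - ratr q| < e.
  have [|q] := @rat_in_itvoo R (x 0 i - e) (x 0 i + e); first lra.
  by rewrite in_itv/= => qe; exists q; rewrite ltr_distlC.
have [q hq] := choice h.
exists (\row_i q i); apply: xe; rewrite -ball_normE/=.
apply/ltr_rV_norm => // i; rewrite !mxE; exact: hq.
Qed.

(** An open set is a countable union of balls with rational centres and radii [1 / (k + 1)], and a
    ball of the sup norm is a finite intersection of conditions on coordinates. *)
Lemma measurable_fun_rV d (T : measurableType d) (f : T -> borel E) :
  (forall i, measurable_fun setT (fun t => (f t : E) 0 i)) -> measurable_fun setT f.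
Proof.
move=> mf.
suff : preimage_set_system setT f (@open E) `<=` measurable.
  move=> h; refine (@measurability _ _ T (borel E) setT f (@open E : set (set (borel E))) _ h).
  by [].
move=> _ [U oU <-]; rewrite setTI.
pose D := [set p : 'rV[rat]_n.+1 * nat | ball (ratv p.1) (p.2.+1%:R^-1 : R) `<=` U].
have -> : f @^-1` U = \bigcup_(p in D) \bigcap_(i in [set: 'I_n.+1])
    [set t | `|(f t : E) 0 i - ratv p.1 0 i| < p.2.+1%:R^-1].
  apply/seteqP; split=> t; last first.
    move=> [p Dp /= pt]; apply: Dp; rewrite -ball_normE/= -normrN opprB.
    by apply/ltr_rV_norm => // i; rewrite mxE [X in _ + X]mxE; exact: (pt i Logic.I).
  move=> /= Ut; have /nbhs_ballP[e /= e0 xe] : nbhs (f t : E) U by exact: open_nbhs_nbhs.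
  have e20 : 0 < e / 2 by rewrite divr_gt0.
  have [k ke] : exists k : nat, k.+1%:R^-1 < e / 2.
    exists (Num.truncn (e / 2)^-1); rewrite invf_plt ?posrE//.
    exact: truncnS_gt.
  have [z fz] : exists z, ball (f t : E) (k.+1%:R^-1) (ratv z).
    by apply: dense_ratv; [exact: ball_open|exists (f t); exact: ballxx].
  exists (z, k) => /=.
    move=> y /= zy; apply: xe; rewrite (splitr e).
    apply: ball_triangle (le_ball (ltW ke) fz) (le_ball (ltW ke) zy).
  move=> i _ /=; move: fz; rewrite -ball_normE/=.
  by move=> /ltr_rV_norm -/(_ (ltac:(by [])) i); rewrite !mxE.
rewrite bigcup_mkcond; apply: countable_bigcupT_measurable => [|p].
  exact: countableP.
case: ifPn => // _; apply: fin_bigcap_measurable => // i _.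
have := mf i => mfi.
rewrite (_ : [set t | _] = (fun t => `|(f t : E) 0 i - ratv p.1 0 i|) @^-1`
    `]-oo, p.2.+1%:R^-1[); last by apply/seteqP; split=> t /=; rewrite in_itv.
rewrite -[X in measurable X]setTI; apply: (_ : measurable_fun setT _) => //.
apply: measurableT_comp => //; apply: measurable_funB => //.
Qed.

Lemma measurable_coord (i : 'I_n.+1) : measurable_fun setT (fun x : borel E => (x : E) 0 i).
Proof.
apply: (measurability (@RGenOInfty.G R)); first exact: RGenOInfty.measurableE.
move=> _ [_ [a ->] <-]; rewrite setTI; apply: sub_sigma_algebra => /=.
apply: (@open_comp _ _ (fun x : E => x 0 i)); last exact: interval_open.
by move=> x _; exact: coord_continuous.
Qed.

End rational_vectors.

(** * Lebesgue measure on Borel sets and null sets along lines *)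

Section lebesgue_borel.
Context {R : realType} {n : nat}.
Local Notation E := 'rV[R]_n.+1.
Local Open Scope ereal_scope.

(** A hyperplane orthogonal to an axis cuts every covering box into two boxes whose volumes add up
    to at most the original volume. *)
Lemma halfspace_caratheodory (i : 'I_n.+1) (a : R) :
  caratheodory_measurable (@lebesgue_outer R n) [set x : E | (x 0 i <= a)%R].
Proof.
apply: le_caratheodory_measurable => X; set A := [set x | _].
apply: le_ereal_inf_tmp => _ [p Xp <-].
(* [p1 k] and [p2 k] are the two pieces of the box [p k]; a piece that is empty has reversed bounds
   and volume 0. *)
pose upd (x : E) (b : R) : E := (\row_j if j == i then b else x 0 j)%R.
pose p1 k := ((p k).1, upd (p k).2 (Num.min ((p k).2 0 i) a))%R.
pose p2 k := (upd (p k).1 (Num.max ((p k).1 0 i) a), (p k).2)%R.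
apply: (@le_trans _ _ (\sum_(k <oo) box_volume (p1 k) + \sum_(k <oo) box_volume (p2 k))).
  apply: leeD; apply: ereal_inf_lbound.
    exists p1 => // x [/Xp[k _ xk] Ax]; exists k => // j /=; rewrite mxE.
    by have := xk j; case: eqP => [->|//] /andP[-> xi]; rewrite le_min xi.
  exists p2 => // x [/Xp[k _ xk] Ax]; exists k => // j /=; rewrite mxE.
  have := xk j; case: eqP => [->|//] /andP[xi ->]; rewrite gt_max xi/= andbT.
  by rewrite ltNge; apply/negP.
rewrite -nneseriesD; try by move=> *; exact: box_volume_ge0.
apply: lee_nneseries => [k *|k *]; first by rewrite adde_ge0// box_volume_ge0.
rewrite /box_volume -EFinD lee_fin (bigD1 i)//= [X in (_ + X)%R](bigD1 i)//= [leRHS](bigD1 i)//=.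
rewrite !mxE eqxx.
set q1 := (\prod_(_ | _) _)%R; set q2 := (\prod_(_ | _) _)%R; set q3 := (\prod_(_ | _) _)%R.
have -> : q1 = q3.
  by apply: eq_bigr => j ji; rewrite !mxE (negbTE ji).
have -> : q2 = q3.
  by apply: eq_bigr => j ji; rewrite !mxE (negbTE ji).
rewrite -mulrDl ler_wpM2r//.
  by apply: prodr_ge0 => j _; rewrite le_max lexx.
move: ((p k).1 0 i)%R ((p k).2 0 i)%R => l u.
rewrite /Num.max /Num.min; do ![case: ltP => ?]; lra.
Qed.

Lemma borel_caratheodory (A : set (borel E)) : measurable A ->
  caratheodory_measurable (@lebesgue_outer R n) A.
Proof.
move=> mA.
pose T := caratheodory_type (@lebesgue_outer R n).
have : measurable_fun setT ((id : E -> E) : T -> borel E).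
  apply: measurable_fun_rV => i.
  apply: (measurability (@RGenOInfty.G R)); first exact: RGenOInfty.measurableE.
  move=> _ [_ [a ->] <-]; rewrite setTI.
  rewrite (_ : _ @^-1` _ = ~` [set x : E | (x 0 i <= a)%R]).
    by apply: (@measurableC _ T); exact: halfspace_caratheodory.
  by apply/seteqP; split=> x /=; rewrite in_itv/= andbT ltNge => /negP.
move=> /(_ measurableT A mA); rewrite setTI preimage_id; exact.
Qed.

(** The same set function as [lebesgue_rV], but on the Borel sigma-algebra, for which continuous
    maps between charts and the manifold are measurable. *)
Definition leb : set (borel E) -> \bar R := lebesgue_outer.

Let leb0 : leb set0 = 0. Proof. exact: outer_measure0. Qed.
Let leb_ge0 A : 0 <= leb A. Proof. exact: outer_measure_ge0. Qed.
Let leb_sigma_additive : semi_sigma_additive leb.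
Proof.
move=> F mF tF mU.
apply: (@caratheodory_measure_sigma_additive R _ (@lebesgue_outer R n)) => //.
- by move=> k; exact: borel_caratheodory.
- exact: borel_caratheodory.
Qed.

HB.instance Definition _ := isMeasure.Build _ _ _ leb leb0 leb_ge0 leb_sigma_additive.

Lemma leb_ball_lty (r : R) : (0 < r)%R -> leb (ball (0%R : E) r) < +oo.
Proof.
move=> r0; pose p (k : nat) := ((const_mx (- r)), (if k is 0 then const_mx r else const_mx (- r)))%R : E * E.
apply: (@le_lt_trans _ _ (\sum_(k <oo) box_volume (p k))).
  apply: ereal_inf_lbound; exists p => // x; rewrite -ball_normE/= sub0r normrN.
  move=> /ltr_rV_norm -/(_ r0) h; exists 0%N => // i; rewrite !mxE.
  by have := h i; rewrite ltr_norml => /andP[-> /ltW ->].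
rewrite (@nneseries_split _ _ 0 1)//; last by move=> *; exact: box_volume_ge0.
rewrite big_nat1 eseries0 ?adde0 ?ltry//.
move=> [//|k] _ _; rewrite /box_volume (bigD1 ord0)//=.
by rewrite !mxE subrr maxxx mul0r.
Qed.

Let lebT_sigma_finite : sigma_finite setT leb.
Proof.
exists (fun k => ball (0%R : E) k.+1%:R).
  apply/esym; rewrite -subTset => x _; exists (Num.truncn `|x|) => //.
  by rewrite -ball_normE/= sub0r normrN truncnS_gt.
move=> k; split; last exact: leb_ball_lty.
by apply: sub_sigma_algebra; exact: ball_open.
Qed.

HB.instance Definition _ := Measure_isSigmaFinite.Build _ _ _ leb lebT_sigma_finite.

Lemma leb_translate (v : E) (A : set (borel E)) : leb ((fun x : E => x + v)%R @^-1` A) = leb A.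
Proof.
suff H (w : E) (B : set E) : lebesgue_outer ((fun x : E => x + w)%R @^-1` B) <= lebesgue_outer B.
  apply/eqP; rewrite eq_le H/=.
  have := H (- v)%R ((fun x : E => x + v)%R @^-1` A).
  rewrite -comp_preimage (_ : _ \o _ = id) ?preimage_id//.
  by apply/funext => x /=; rewrite subrK.
apply: le_ereal_inf_tmp => _ [p Bp <-].
apply: ereal_inf_lbound; exists (fun k => ((p k).1 - w, (p k).2 - w)%R).
  move=> x /= /Bp[k _ xk]; exists k => // i /=; have := xk i.
  by rewrite !mxE ltrBlDr lerBrDr.
congr (limn _); apply/funext => N; apply: eq_bigr => k _.
congr (_%:E); apply: eq_bigr => i _; rewrite !mxE /=.
by congr (Num.max _ _); rewrite opprB addrA subrK.
Qed.


Lemma measurable_line (v : E) : measurable_fun setT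
  (fun p : borel E * R => ((p.1 : E) + p.2 *: v)%R : borel E).
Proof.
apply: measurable_fun_rV => i.
under eq_fun do rewrite !mxE.
apply: measurable_funD.
  apply: (measurableT_comp (measurable_coord i)); exact: measurable_fst.
by apply: measurable_funM => //; exact: measurable_snd.
Qed.

(** Fubini for the pairs [(x, s)] with [x + s *: v] in [N]: the sections in [s] are null, while each
    section in [x] is a translate of [N]. Hence [leb N] times the infinite length of the line is
    0. *)
Lemma null_on_lines (v : E) (N : set (borel E)) : measurable N ->
  (forall x : E, {ae (@lebesgue_measure R), forall s : R, ~ N (x + s *: v)%R}) ->
  leb N = 0.
Proof.
move=> mN Nl.
pose A := (fun p : borel E * R => ((p.1 : E) + p.2 *: v)%R : borel E) @^-1` N.
have mA : measurable A by rewrite -[A]setTI; exact: measurable_line.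
have := @indic_fubini_tonelli _ _ _ _ R leb (@lebesgue_measure R) A mA.
rewrite indic_fubini_tonelli_FE// indic_fubini_tonelli_GE//.
under eq_integral => x _.
  rewrite /=; have -> : lebesgue_measure (xsection A x) = 0.
    have [Z [mZ Z0 ZN]] := Nl x.
    apply/eqP; rewrite eq_le measure_ge0 andbT -Z0.
    apply: le_measure; rewrite ?inE//; first exact: measurable_xsection.
    move=> s; rewrite /xsection/= inE => xs; apply: ZN => /=; exact.
  over.
rewrite integral0.
under eq_integral => s _.
  rewrite /= (_ : ysection A s = (fun x : E => x + s *: v)%R @^-1` N); last first.
    by apply/seteqP; split=> x; rewrite /ysection/= inE.
  rewrite leb_translate.
  over.
rewrite integral_cst// => /esym/eqP; rewrite mule_eq0 => /orP[/eqP//|/eqP mu0].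
have : lebesgue_measure (`[0%R, 1%R]%classic : set R) <= lebesgue_measure [set: R].
  by apply: le_measure; rewrite ?inE.
by rewrite [X in _ <= X -> _]mu0 lebesgue_measure_itv/= lte_fin ltr01 oppr0 adde0 lee_fin ler10.
Qed.

End lebesgue_borel.

Lemma measurable_cvgn (R : realType) d (T : measurableType d) (f : nat -> T -> R) :
  (forall k, measurable_fun setT (f k)) -> measurable [set x | cvgn (f ^~ x)].
Proof.
move=> mf.
have -> : [set x | cvgn (f ^~ x)] = \bigcap_(i in [set: nat]) \bigcup_(K in [set: nat])
    \bigcap_(k in [set: nat]) \bigcap_(l in [set: nat])
      [set x : T | `|f (K + k)%N x - f (K + l)%N x| < i.+1%:R^-1].
  apply/seteqP; split=> x /=.
    move=> /cauchy_cvgP/cauchy_ballP h i _.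
    have i0 : (0 : R) < i.+1%:R^-1 by rewrite invr_gt0.
    have [[A B] /= [[M1 _ MA] [M2 _ MB]] AB] := h _ i0.
    exists (M1 + M2)%N => // k _ l _ /=.
    have := AB (f (M1 + M2 + k)%N x, f (M1 + M2 + l)%N x).
    rewrite -ball_normE; apply; split; [apply: MA|apply: MB] => /=.
      by rewrite -addnA leq_addr.
    by rewrite (leq_trans (leq_addl M1 M2))// leq_addr.
  move=> h; apply/cauchy_cvgP/cauchy_ballP => e e0.
  have [i ie] : exists i : nat, i.+1%:R^-1 < e.
    exists (Num.truncn e^-1); rewrite invf_plt ?posrE//; exact: truncnS_gt.
  have [K _ hK] := h i Logic.I.
  exists ((f ^~ x) @` [set k | (K <= k)%N], (f ^~ x) @` [set k | (K <= k)%N]) => /=.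
    by split; exists K => // k Kk; exists k.
  move=> [_ _] /= [[k Kk <-] [l Kl <-]]; rewrite -ball_normE/=.
  have := hK (k - K)%N Logic.I (l - K)%N Logic.I; rewrite /= !subnKC// => /lt_trans; exact.
apply: bigcapT_measurable => i; apply: bigcupT_measurable => K.
apply: bigcapT_measurable => k; apply: bigcapT_measurable => l.
rewrite (_ : [set x : T | _] = (fun x => `|f (K + k)%N x - f (K + l)%N x|) @^-1`
    `]-oo, i.+1%:R^-1[); last by apply/seteqP; split=> t /=; rewrite in_itv.
rewrite -[X in measurable X]setTI; apply: (_ : measurable_fun setT _) => //.
by apply: measurableT_comp => //; apply: measurable_funB.
Qed.

Section density.
Context d (T : measurableType d) (R : realType) (mu : {measure set T -> \bar R}).
Variables (f : T -> \bar R) (mf : measurable_fun setT f) (f0 : forall x, (0 <= f x)%E).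

(** The proofs are arguments so that the measure structure declared below can be attached to the
    function. *)
Definition density_measure (_ : measurable_fun setT f) (_ : forall x, (0 <= f x)%E)
  (A : set T) : \bar R := (\int[mu]_(x in A) f x)%E.

Local Notation nu := (density_measure mf f0).

Let nu0 : nu set0 = 0%E.
Proof. exact: integral_set0. Qed.

Let nu_ge0 A : (0 <= nu A)%E.
Proof. by apply: integral_ge0. Qed.

Let nu_sigma_additive : semi_sigma_additive nu.
Proof.
move=> F mF tF mUF; rewrite /density_measure ge0_integral_bigcup//.
  by apply: is_cvg_ereal_nneg_natsum_cond => n _ _; exact: integral_ge0.
exact: measurable_funTS.
Qed.

HB.instance Definition _ := isMeasure.Build _ _ _ nu nu0 nu_ge0 nu_sigma_additive.

End density.

Section bounded_integral.
Context d (T : measurableType d) (R : realType) (mu : {measure set T -> \bar R}).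
Variables (U : set T) (mU : measurable U) (Ufin : (mu U < +oo)%E).
Variables (C : R) (C0 : 0 <= C).

Lemma bounded_integrable (z : T -> R) : measurable_fun setT z -> (forall y, 0 <= z y <= C) ->
  mu.-integrable U (fun y => (z y)%:E).
Proof.
move=> mz z0; apply: (@le_integrable _ _ _ _ _ _ _ (fun=> C%:E)) => //.
- by apply/measurable_EFinP; exact: measurable_funTS.
- by move=> y _; rewrite /= lee_fin; have /andP[g1 g2] := z0 y; rewrite !ger0_norm.
- apply/integrableP; split; first exact: measurable_cst.
  by rewrite /= integral_cst//= lte_mul_pinfty.
Qed.

(** Reverses a one-sided estimate: an inequality of Fatou type for both [a] and [C - a] yields an
    equality. *)
Lemma le_integral_cstB (z z' : T -> R) :
  measurable_fun setT z -> (forall y, 0 <= z y <= C) ->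
  measurable_fun setT z' -> (forall y, 0 <= z' y <= C) ->
  (\int[mu]_(y in U) (C - z y)%:E <= \int[mu]_(y in U) (C - z' y)%:E)%E ->
  (\int[mu]_(y in U) (z' y)%:E <= \int[mu]_(y in U) (z y)%:E)%E.
Proof.
move=> mz z0 mz' z'0.
have iz := bounded_integrable mz z0; have iz' := bounded_integrable mz' z'0.
have iC : mu.-integrable U (fun=> C%:E).
  by apply: (@bounded_integrable (fun=> C)) => // y; rewrite C0 lexx.
have IB (u : T -> R) : mu.-integrable U (fun y => (u y)%:E) ->
    (\int[mu]_(y in U) (C - u y)%:E = \int[mu]_(y in U) C%:E - \int[mu]_(y in U) (u y)%:E)%E.
  by move=> iu; rewrite -integralB.
by rewrite !IB// leeD2lE ?leeN2//; exact: integrable_fin_num.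
Qed.

End bounded_integral.

(** * Backward difference quotients: existence, independence of translation, additivity *)

Section directional.
Context {R : realType} {n : nat}.
Local Notation E := 'rV[R]_n.+1.
Implicit Types (phi F : E -> R) (v w x y u : E).

Definition pq phi v (k : nat) x : R :=
  k.+1%:R * (phi x - phi (x - k.+1%:R^-1 *: v)).

(** The open convex cone spanned by the ball of radius [rho] around [v]. *)
Definition dircone v (rho : R) : set E :=
  [set u | exists2 s : R, 0 < s & `|u - s *: v| < s * rho].

Lemma continuous_subr y : continuous (fun q : E => q - y).
Proof.
by move=> q; apply: (@cvgB _ E E (nbhs q) _ id (cst y) q y); [exact: cvg_id|exact: cvg_cst].
Qed.

Lemma continuous_rsubr y : continuous (fun q : E => y - q).
Proof.
by move=> q; apply: (@cvgB _ E E (nbhs q) _ (cst y) id y q); [exact: cvg_cst|exact: cvg_id].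
Qed.

Lemma dircone_add v rho u w : dircone v rho u -> dircone v rho w ->
  dircone v rho (u + w).
Proof.
move=> [s s0 us] [t t0 wt]; exists (s + t); first exact: addr_gt0.
rewrite scalerDl opprD addrACA mulrDl (le_lt_trans (ler_normD _ _))//.
exact: ltrD.
Qed.

Lemma dircone_dir v rho (s : R) : 0 < rho -> 0 < s -> dircone v rho (s *: v).
Proof. by move=> r0 s0; exists s => //; rewrite subrr normr0 mulr_gt0. Qed.

Lemma open_dircone v rho : open (dircone v rho).
Proof.
have -> : dircone v rho = \bigcup_(s in [set s : R | 0 < s]) ball (s *: v) (s * rho).
  by apply/seteqP; split=> u [s s0 us]; exists s => //; move: us;
    rewrite -ball_normE/= distrC.
by apply: bigcup_open => s _; exact: ball_open.
Qed.

Lemma measurable_pq F v k : measurable_fun setT (F : borel E -> R) ->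
  measurable_fun setT (pq F v k : borel E -> R).
Proof.
move=> mF; apply: measurable_funM => //; apply: measurable_funB => //.
apply: (measurableT_comp mF); apply: measurable_fun_rV => i.
under eq_fun do rewrite !mxE.
by apply: measurable_funB => //; exact: measurable_coord.
Qed.

Lemma measurable_translate w : measurable_fun setT ((fun x : E => x + w) : borel E -> borel E).
Proof.
apply: measurable_fun_rV => i; under eq_fun do rewrite mxE.
by apply: measurable_funD => //; exact: measurable_coord.
Qed.

Lemma measurable_fun_translate (G : E -> R) w : measurable_fun setT (G : borel E -> R) ->
  measurable_fun setT ((fun y : E => G (y + w)) : borel E -> R).
Proof. by move=> mG; exact: (measurableT_comp mG (measurable_translate w)). Qed.

Lemma leb_integral_translate w (g : borel E -> \bar R) : measurable_fun setT g ->
  (forall y, (0 <= g y)%E) ->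
  (\int[@leb R n]_y g ((y : E) + w)%R = \int[@leb R n]_y g y)%E.
Proof.
move=> mg g0.
have E1 := ge0_integral_pushforward (measurable_translate w) (@leb R n) measurableT mg.
apply: etrans (esym (E1 _)) _; first by move=> y _; exact: g0.
have T A : measurable A -> pushforward leb ((fun x : E => x + w) : borel E -> borel E) A = leb A.
  by move=> mA; exact: (leb_translate w A).
apply: eq_measure_integral => [|mf A mA _]; first exact: measurable_translate.
exact (T A mA).
Qed.

Lemma ae_translate (P : E -> Prop) w : {ae (@leb R n), forall y, P y} ->
  {ae (@leb R n), forall y : borel E, P ((y : E) + w)}.
Proof.
move=> [N [mN N0 PN]]; exists ((fun x : E => x + w) @^-1` N); split.
- by rewrite -[X in measurable X]setTI; exact: measurable_translate.
- exact: (etrans (leb_translate w N) N0).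
- by move=> y /= ny; apply: PN.
Qed.

Section regularization.
Variables (phi : E -> R) (m rho : R) (Q : set E) (v : E).
Hypothesis (rho0 : 0 < rho) (oQ : open Q) (phim : forall x, `|phi x| <= m).
Hypothesis phimono : forall x y, Q x -> Q y -> dircone v rho (y - x) -> phi x <= phi y.

(** The supremum [F] of [phi] over the rational points of [Q] in the past cone of [x] is lower
    semicontinuous, hence Borel, even when [phi] is not. The value [- m] keeps the set nonempty and
    does not affect the bounds. *)
Let S x : set R := [set - m] `|` [set phi (ratv z) | z in
  [set z | Q (ratv z) /\ dircone v rho (x - ratv z)]].

Let F x := sup (S x).

Let hsS x : has_sup (S x).
Proof.
split; first by exists (- m); left.
exists m => _ [->|[z _ <-]]; last by rewrite (le_trans (ler_norm _)).
by rewrite (@le_trans _ _ 0)// ?oppr_le0; exact: le_trans (phim 0).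
Qed.

Let Fub x r : S x r -> r <= F x.
Proof. exact: sup_upper_bound. Qed.

Let Fle x a : (forall r, S x r -> r <= a) -> F x <= a.
Proof. by move=> h; apply: sup_le_ub => //; case: (hsS x). Qed.

Let F_le_phi y : Q y -> F y <= phi y.
Proof.
move=> Qy; apply: Fle => _ [->|[z [Qz Kz] <-]]; last exact: phimono.
by have := phim y; rewrite ler_norml => /andP[].
Qed.

Let phi_le_F y (s : R) : Q y -> 0 < s -> phi y <= F (y + s *: v).
Proof.
move=> Qy s0.
(* A rational point strictly between [y] and [y + s *: v] for the cone order is enough; the points
   [y + t *: v] with small positive [t] show that the open set of such points is nonempty. *)
pose O := Q `&` ((fun q => q - y) @^-1` dircone v rho) `&`
  ((fun q => y + s *: v - q) @^-1` dircone v rho).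
have oO : open O.
  apply: openI; first apply: openI => //.
    apply: open_comp; last exact: open_dircone.
    by move=> q _; exact: continuous_subr.
  apply: open_comp; last exact: open_dircone.
  by move=> q _; exact: continuous_rsubr.
have [z [[Qz z1] z2]] : exists z, O (ratv z).
  apply: dense_ratv => //.
  have h : \forall t \near 0^'+, Q (y + t *: v).
    have : (fun t : R => y + t *: v) @ 0^'+ --> y + 0 *: v.
      apply: cvgD; first exact: cvg_cst.
      by apply: cvgZr_tmp; apply: cvg_at_right_filter; exact: cvg_id.
    rewrite scale0r addr0; apply; exact: open_nbhs_nbhs.
  near (0 : R)^'+ => t.
  exists (y + t *: v); split; first split.
  - by near: t.
  - by rewrite /= addrC addKr; apply: dircone_dir.
  - rewrite /= opprD addrACA subrr add0r -scalerBl; apply: dircone_dir => //.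
    by rewrite subr_gt0; near: t; exact: nbhs_right_lt.
apply: (@le_trans _ _ (phi (ratv z))); first exact: phimono.
by apply: Fub; right; exists z.
Unshelve. all: by end_near. Qed.

Let F_mono x u : dircone v rho u -> F x <= F (x + u).
Proof.
move=> Ku; apply: Fle => _ [->|[z [Qz Kz] <-]]; apply: Fub; first by left.
right; exists z => //; split => //.
by rewrite addrAC; exact: dircone_add.
Qed.

Let Fm x : `|F x| <= m.
Proof.
rewrite ler_norml; apply/andP; split; first by apply: Fub; left.
apply: Fle => _ [->|[z _ <-]]; last by rewrite (le_trans (ler_norm _)).
by rewrite (@le_trans _ _ 0)// ?oppr_le0; exact: le_trans (phim 0).
Qed.

Let mF : measurable_fun setT (F : borel E -> R).
Proof.
apply: (measurability (@RGenOInfty.G R)); first exact: RGenOInfty.measurableE.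
move=> _ [_ [a ->] <-]; rewrite setTI.
have [am|am] := ltP a (- m).
  rewrite (_ : _ @^-1` _ = setT)//; apply/seteqP; split=> // x _ /=.
  by rewrite in_itv/= andbT (lt_le_trans am)//; apply: Fub; left.
apply: sub_sigma_algebra.
rewrite (_ : _ @^-1` _ = \bigcup_(z in [set z | Q (ratv z) /\ a < phi (ratv z)])
    ((fun x : E => x - ratv z) @^-1` dircone v rho)).
  apply: bigcup_open => z _; apply: open_comp; last exact: open_dircone.
  by move=> q _; exact: continuous_subr.
apply/seteqP; split=> x /=; rewrite in_itv/= andbT.
  move=> /(sup_gt (hsS x).1)[_ [->|[z [Qz Kz] <-]] az].
    by move: am; rewrite leNgt az.
  by exists z.
move=> [z [Qz az] Kz]; apply: (lt_le_trans az).
by apply: Fub; right; exists z.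
Qed.

Let Fline x : {homo (fun s : R => F (x + s *: v)) : s t / s <= t}.
Proof.
move=> s t st; have [->//|ne] := eqVneq s t.
have {}st : s < t by rewrite lt_neqAle ne.
have -> : x + t *: v = x + s *: v + (t - s) *: v by rewrite -addrA -scalerDl [s + _]addrC subrK.
by apply: F_mono; apply: dircone_dir => //; rewrite subr_gt0.
Qed.

(** On [Q] one has [F y <= phi y <= F (y + s *: v)] for all positive [s], so [phi] and [F] agree
    where [F] is right continuous along [v]. On every line parallel to [v], [F] is monotone, hence
    derivable a.e., and [null_on_lines] concludes. *)
Lemma monotone_regularization : exists F' : E -> R,
  [/\ measurable_fun setT (F' : borel E -> R), (forall x, `|F' x| <= m),
   {ae (@leb R n), forall y, Q y -> phi y = F' y},
   {ae (@leb R n), forall y, F' (y + k.+1%:R^-1 *: v) @[k --> \oo] --> F' y} &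
   {ae (@leb R n), forall y, cvgn (pq F' v ^~ y)}].
Proof.
(* The points where [F] jumps in the direction [v], written with countable operations so as to be
   Borel. *)
pose N : set (borel E) := \bigcup_(i in [set: nat]) \bigcap_(k in [set: nat])
    [set y : borel E | i.+1%:R^-1 <= F ((y : E) + k.+1%:R^-1 *: v) - F y].
have mN : measurable N.
  apply: bigcupT_measurable => i; apply: bigcapT_measurable => k.
    rewrite (_ : [set y | _] = (fun y : borel E => F ((y : E) + k.+1%:R^-1 *: v) - F y) @^-1`
      `[i.+1%:R^-1, +oo[); last by apply/seteqP; split=> y /=; rewrite in_itv/= andbT.
    rewrite -[X in measurable X]setTI; apply: (_ : measurable_fun setT _) => //.
    apply: measurable_funB => //.
    exact: (measurableT_comp mF (measurable_translate _)).
have N0 : leb N = 0%E.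
  apply: (@null_on_lines _ _ v) => // x.
    apply: ae_imp (nondecreasing_ae_derivable (Fline x)) => s ds /= [i _ h].
    pose psi (r : R) := F (x + r *: v).
    have cpsi : {for (s : R), continuous psi} by apply: differentiable_continuous; exact/derivable1_diffP.
    have : psi (s + k.+1%:R^-1) @[k --> \oo] --> psi s.
      have st : s + k.+1%:R^-1 @[k --> \oo] --> s + 0.
        by apply: cvgD; [exact: cvg_cst|exact: cvg_harmonic].
      by apply: (cvg_comp _ _ st); rewrite addr0.
    move=> /cvgrPdist_lt /(_ i.+1%:R^-1 (ltac:(by rewrite invr_gt0)))[k _ /(_ k (leqnn k))].
    rewrite distrC /psi => /(le_lt_trans (ler_norm _)); rewrite ltNge => /negP; apply.
    by have := h k Logic.I; rewrite /= scalerDl addrA.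
have fwd : {ae (@leb R n), forall y, F (y + k.+1%:R^-1 *: v) @[k --> \oo] --> F y}.
  exists N; split => // y /= ncv; apply: contrapT => nN; apply: ncv.
  apply/cvgrPdist_lt => e e0.
  have [i ie] : exists i : nat, i.+1%:R^-1 < e.
    exists (Num.truncn e^-1); rewrite invf_plt ?posrE//; exact: truncnS_gt.
  have [k0 hk] : exists k, F (y + k.+1%:R^-1 *: v) - F y < i.+1%:R^-1.
    apply: contrapT => nk; apply: nN; exists i => // k _ /=; rewrite leNgt.
    by apply/negP => hk; apply: nk; exists k.
  exists k0 => // k /= k0k; rewrite distrC ger0_norm; last first.
    by rewrite subr_ge0; apply: F_mono; apply: dircone_dir; rewrite ?invr_gt0.
  apply: le_lt_trans (lt_trans hk ie); rewrite lerD2r; apply: Fline.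
  by rewrite lef_pV2 ?posrE// ler_nat.
exists F; split => //.
- apply: ae_imp fwd => y cy Qy; apply/eqP; rewrite eq_le F_le_phi// andbT.
  have hl : limn (fun k => F (y + k.+1%:R^-1 *: v)) = F y by exact: cvg_lim cy.
  rewrite -hl; apply: limr_ge; first by apply/cvg_ex; exists (F y).
  by apply: nearW => k; apply: phi_le_F; rewrite ?invr_gt0.
- clear N mN N0.
  pose N : set (borel E) := ~` [set y | cvgn (pq F v ^~ y)].
  have mN : measurable N.
    apply: measurableC.
    exact: (@measurable_cvgn R _ (borel E) (fun k => pq F v k) (fun k => measurable_pq v k mF)).
  exists N; split => //.
  apply: (@null_on_lines _ _ v) => // x.
  apply: ae_imp (nondecreasing_ae_derivable (Fline x)) => s ds /=.
  apply; apply/cvg_ex.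
  pose psi (r : R) := F (x + r *: v).
  have /is_derive1P/cvgr_dnbhsP dp : is_derive (s : R) (1 : R) psi ('D_(1 : R) psi s) by split.
  exists ('D_(1 : R) psi s).
  have -> : (fun k => pq F v k (x + s *: v)) =
      (fun k => (- k.+1%:R^-1)^-1 * (psi (s + - k.+1%:R^-1) - psi s)).
    apply/funext => k; rewrite /pq /psi invrN invrK.
    by rewrite mulNr -mulrN opprB scalerDl scaleNr addrA.
  apply: dp; split=> [k|]; first by rewrite oppr_eq0 invr_neq0.
  by rewrite -[X in _ --> X]oppr0; apply: cvgN; exact: cvg_harmonic.
Qed.

End regularization.

(* Fatou's lemma on [B], whose translates contain every given point of [B]
   eventually since [B] is open. *)
Lemma open_translate_fatou (a : nat -> E -> R) (al be : E -> R) (C : R) w (B : set E) :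
  open B -> (leb B < +oo)%E -> 0 <= C ->
  (forall k, measurable_fun setT (a k : borel E -> R)) ->
  measurable_fun setT (al : borel E -> R) -> measurable_fun setT (be : borel E -> R) ->
  (forall k y, 0 <= a k y <= C) -> (forall y, 0 <= al y <= C) -> (forall y, 0 <= be y <= C) ->
  {ae (@leb R n), forall y, B y -> a k y @[k --> \oo] --> al y} ->
  {ae (@leb R n), forall y, B y -> a k (y - k.+1%:R^-1 *: w) @[k --> \oo] --> be y} ->
  (\int[@leb R n]_(y in B) (al y)%:E <= \int[@leb R n]_(y in B) (be y)%:E)%E.
Proof.
move=> oB Bfin C0 ma mal mbe a0 al0 be0 acv bcv.
have mB : measurable (B : set (borel E)) by exact: sub_sigma_algebra.
pose b k (y : E) := a k (y - k.+1%:R^-1 *: w).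
have mb k : measurable_fun setT (b k : borel E -> R) by exact: measurable_fun_translate.
(* [f k] is the translate of [b k] restricted to [B]: it has the integral of [b k] over [B], and it
   converges to [al] on [B]. Fatou treats the left side and dominated convergence the right one. *)
pose f k (y : borel E) : \bar R := (\1_B ((y : E) + k.+1%:R^-1 *: w) * a k y)%:E.
have mI (u : E) : measurable_fun setT ((fun y : E => \1_B (y + u) : R) : borel E -> R).
  by apply: (@measurable_fun_translate \1_B); exact: measurable_indic.
have mf k : measurable_fun setT (f k).
  by apply/measurable_EFinP; apply: measurable_funM.
have f0 k y : (0 <= f k y)%E.
  by rewrite lee_fin mulr_ge0//; have /andP[] := a0 k y.
have fint k : (\int[@leb R n]_y f k y = \int[@leb R n]_(y in B) (b k y)%:E)%E.
  rewrite [RHS]integral_mkcond -[RHS](@leb_integral_translate (k.+1%:R^-1 *: w)) => [||y].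
  - apply: eq_integral => y _; rewrite /f patchE indicE.
    by case: ifP => _; rewrite ?mul1r ?mul0r// /b addrK.
  - apply/(measurable_restrictT _ _).1 => //.
    by apply/measurable_EFinP; exact: measurable_funTS.
  - rewrite patchE; case: ifP => // _; rewrite lee_fin.
    by have /andP[] := a0 k (y - k.+1%:R^-1 *: w).
have := fatou (@leb R n) measurableT mf (fun k y _ => f0 k y) => fat.
apply: (@le_trans _ _ (\int[@leb R n]_y limn_einf (f ^~ y))%E).
  rewrite integral_mkcond; apply: ae_le_lower_integral => //.
  - by move=> y _; rewrite patchE; case: ifP => // _; rewrite lee_fin; have /andP[] := al0 y.
  - move=> y _; rewrite limn_einf_lim; apply: lime_ge; first exact: is_cvg_einfs.
    by apply: nearW => k; apply: le_ereal_inf_tmp => _ [l _ <-]; exact: f0.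
  apply: ae_imp acv => y ay _; rewrite patchE; case: ifPn => [/set_mem By|_]; last first.
    rewrite limn_einf_lim; apply: lime_ge; first exact: is_cvg_einfs.
    by apply: nearW => k; apply: le_ereal_inf_tmp => _ [l _ <-]; exact: f0.
  have fy : (f ^~ y) k @[k --> \oo] --> (al y)%:E.
    apply/fine_cvgP; split; first exact: nearW.
    apply: cvg_trans (ay By); apply: near_eq_cvg; near=> k.
    rewrite /f /= indicE mem_set ?mul1r//.
    near: k.
    have cy : y + k.+1%:R^-1 *: w @[k --> \oo] --> (y : E) + 0 *: w.
      apply: cvgD; first exact: cvg_cst.
      by apply: cvgZr_tmp; exact: cvg_harmonic.
    by apply: cy; rewrite scale0r addr0; exact: open_nbhs_nbhs.
  by rewrite (cvg_limn_einf_sup fy).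
apply: (le_trans fat).
have bint : (\int[@leb R n]_(y in B) (b k y)%:E)%E @[k --> \oo] --> (\int[@leb R n]_(y in B) (be y)%:E)%E.
  have [] := @dominated_convergence _ _ R (@leb R n) B mB (fun k y => (b k y)%:E)
    (fun y => (be y)%:E) (fun=> C%:E) => //.
  - by move=> k; apply/measurable_EFinP; exact: measurable_funTS.
  - by apply/measurable_EFinP; exact: measurable_funTS.
  - apply: ae_imp bcv => y by_ By.
    by apply/fine_cvgP; split; [exact: nearW|exact: by_].
  - apply/integrableP; split; first exact: measurable_cst.
    by rewrite /= integral_cst//= lte_mul_pinfty.
  - apply: aeW => y k _; rewrite lee_fin.
    by have /andP[b0 bC] := a0 k (y - k.+1%:R^-1 *: w); rewrite ger0_norm.
under [X in limn_einf X]eq_fun do rewrite fint.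
by rewrite (cvg_limn_einf_sup bint).
Unshelve. all: by end_near. Qed.

(** Open sets form a family stable under intersection that generates the Borel sets, so the two
    finite measures with densities [al] and [be] on [B] coincide. *)
Lemma leb_ae_eq_open (al be : E -> R) (C : R) (B : set E) :
  open B -> (leb B < +oo)%E -> 0 <= C ->
  measurable_fun setT (al : borel E -> R) -> measurable_fun setT (be : borel E -> R) ->
  (forall y, 0 <= al y <= C) -> (forall y, 0 <= be y <= C) ->
  (forall U, open U -> U `<=` B ->
    (\int[@leb R n]_(y in U) (al y)%:E = \int[@leb R n]_(y in U) (be y)%:E)%E) ->
  {ae (@leb R n), forall y, B y -> al y = be y}.
Proof.
move=> oB Bfin C0 mal mbe al0 be0 H.
have mB : measurable (B : set (borel E)) by exact: sub_sigma_algebra.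
have aeB : ae_eq (@leb R n) B (fun y => (al y)%:E) (fun y => (be y)%:E).
  apply: integral_ae_eq => //; [exact: (bounded_integrable mB Bfin C0 mal al0)|by apply/measurable_EFinP; exact: measurable_funTS|].
  move=> A AB mA.
  pose f (g : E -> R) (y : borel E) : \bar R := ((EFin \o g) \_ B) y.
  have mf (g : E -> R) : measurable_fun setT (g : borel E -> R) -> measurable_fun setT (f g).
    move=> mg; apply/(measurable_restrictT _ _).1 => //.
    by apply/measurable_EFinP; exact: measurable_funTS.
  have f0 (g : E -> R) : (forall y, 0 <= g y <= C) -> forall y, (0 <= f g y)%E.
    by move=> g0 y; rewrite /f patchE; case: ifP => // _; rewrite lee_fin; have /andP[] := g0 y.
  have dE (g : E -> R) mg g0 D : density_measure (@leb R n) (mf g mg) (f0 g g0) D =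
      (\int[@leb R n]_(y in D `&` B) (g y)%:E)%E.
    by rewrite integral_mkcondr.
  have cover : \bigcup_(k in [set: nat]) [set: borel E] = setT.
    by rewrite bigcup_const//; exists 0%N.
  have := @measure_unique _ R (borel E) (@open E) (fun=> setT) erefl (@openI E)
    (fun=> openT) cover
    (density_measure (@leb R n) (mf _ mal) (f0 _ al0))
    (density_measure (@leb R n) (mf _ mbe) (f0 _ be0)).
  have := dE be mbe be0 A; have := dE al mal al0 A.
  rewrite !setIidl// => <- <- uniq; apply: uniq => //.
    by move=> U oU; rewrite /= !dE; apply: H; [exact: openI|exact: subIsetr].
  move=> _; rewrite /= dE setTI.
  rewrite ltey_eq; apply/orP; left; apply: integrable_fin_num => //.
  exact: (bounded_integrable mB Bfin C0 mal al0).
by apply: ae_imp aeB => y hy By; have /= := hy By; case.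
Qed.

(** A vanishing translation does not change an a.e. limit: after a cut-off, the Fatou inequality
    applied to the sequence and to its complement gives equal integrals on every open subset of
    [B]. *)
Lemma limn_translate_eq (q : nat -> E -> R) w (B : set E) : open B -> (leb B < +oo)%E ->
  (forall k, measurable_fun setT (q k : borel E -> R)) ->
  {ae (@leb R n), forall y, B y -> cvgn (q ^~ y)} ->
  {ae (@leb R n), forall y, B y -> cvgn (fun k => q k (y - k.+1%:R^-1 *: w))} ->
  {ae (@leb R n), forall y, B y ->
     limn (fun k => q k (y - k.+1%:R^-1 *: w)) = limn (q ^~ y)}.
Proof.
move=> oB Bfin mq hq hr.
(* Cut-off to [[- N, N]], then a shift by [N] that makes the values lie in [[0, 2 N]]. *)
pose c (N : nat) (t : R) := Num.max (- N%:R) (Num.min t N%:R) + N%:R.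
have c0 N t : 0 <= c N t <= N%:R + N%:R.
  rewrite /c; apply/andP; split; first by rewrite -lerBlDr sub0r le_max lexx.
  by rewrite lerD2r ge_max ge_min lexx orbT andbT lerNl (@le_trans _ _ 0) ?oppr_le0.
have cE N : c N = (fun=> - N%:R) \max (id \min (fun=> N%:R)) \+ (fun=> N%:R) by [].
have ccont N : continuous (c N).
  move=> t; rewrite cE; apply: (@continuousD _ R^o R); last exact: cvg_cst.
  by apply: continuous_max; [exact: cvg_cst|apply: continuous_min; [exact: cvg_id|exact: cvg_cst]].
have mc N : measurable_fun setT (c N).
  by apply: continuous_measurable_fun.
(* An upper limit is measurable on the whole space and, after the cut-off, bounded even where the
   sequence diverges. *)
pose L (u : nat -> E -> R) (y : E) : R := fine (limn_esup (fun k => (u k y)%:E)).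
pose lim N (u : nat -> E -> R) : E -> R := L (fun k y => c N (u k y)).
have mlim N (u : nat -> E -> R) : (forall k, measurable_fun setT (u k : borel E -> R)) ->
    measurable_fun setT (lim N u : borel E -> R).
  move=> mu; apply: (measurableT_comp (@fine_measurable R _ measurableT)) => //.
  apply: measurable_fun_limn_esup => k; apply/measurable_EFinP.
  exact: (measurableT_comp (mc N)).
have lim0 N (u : nat -> E -> R) y : 0 <= lim N u y <= N%:R + N%:R.
  rewrite /lim /L limn_esup_lim; set e := esups _.
  have e0 k : (0 <= e k)%E.
    apply: (@le_trans _ _ (c N (u k y))%:E); first by rewrite lee_fin; have /andP[] := c0 N (u k y).
    by apply: ereal_sup_ubound; exists k => /=.
  have eC k : (e k <= (N%:R + N%:R)%:E)%E.
    by apply: ge_ereal_sup => _ [j _ <-]; rewrite lee_fin; have /andP[] := c0 N (u j y).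
  have cve : cvgn e by exact: is_cvg_esups.
  have l0 : (0 <= limn e)%E by apply: lime_ge => //; exact: nearW.
  have lC : (limn e <= (N%:R + N%:R)%:E)%E by apply: lime_le => //; exact: nearW.
  rewrite fine_ge0//= -lee_fin fineK// ge0_fin_numE//.
  exact: le_lt_trans lC (ltry _).
have limE N (u : nat -> E -> R) y l : u ^~ y @ \oo --> l -> lim N u y = c N l.
  move=> ul; rewrite /lim /L.
  have cl : (c N (u k y))%:E @[k --> \oo] --> (c N l)%:E.
    apply/fine_cvgP; split; first exact: nearW.
    exact: (cvg_comp _ _ ul (ccont N l)).
  by rewrite (cvg_limn_einf_sup cl).
pose r k y := q k (y - k.+1%:R^-1 *: w).
have mr k : measurable_fun setT (r k : borel E -> R) by exact: measurable_fun_translate.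
have key N : {ae (@leb R n), forall y, B y -> lim N q y = lim N r y}.
  set C : R := N%:R + N%:R.
  have C0 : 0 <= C by rewrite addr_ge0.
  apply: (@leb_ae_eq_open _ _ C) => [|||||||U oU UB]; [exact: oB|exact: Bfin|exact: C0|exact: mlim|exact: mlim|exact: lim0|exact: lim0|].
  have mU : measurable (U : set (borel E)) by exact: sub_sigma_algebra.
  have Ufin : (leb U < +oo)%E.
    by apply: le_lt_trans Bfin; apply: le_measure => //; rewrite inE//; exact: sub_sigma_algebra.
  have qcv : {ae (@leb R n), forall y, U y -> c N (q k y) @[k --> \oo] --> lim N q y}.
    apply: ae_imp hq => y hy Uy; have /cvg_ex[/= lq cq] := hy (UB _ Uy).
    by rewrite (limE _ _ _ _ cq); exact: (cvg_comp _ _ cq (ccont N _)).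
  have rcv : {ae (@leb R n), forall y, U y -> c N (q k (y - k.+1%:R^-1 *: w)) @[k --> \oo] --> lim N r y}.
    apply: ae_imp hr => y hy Uy; have /cvg_ex[/= lq cq] := hy (UB _ Uy).
    by rewrite (limE _ _ _ _ cq); exact: (cvg_comp _ _ cq (ccont N _)).
  have mcq k : measurable_fun setT ((fun y => c N (q k y)) : borel E -> R).
    exact: (measurableT_comp (mc N)).
  have opp (z : E -> R) : (forall y, 0 <= z y <= C) -> forall y, 0 <= C - z y <= C.
    by move=> z0 y; have /andP[z1 z2] := z0 y; rewrite subr_ge0 z2 gerBl.
  apply/eqP; rewrite eq_le; apply/andP; split.
    apply: (@open_translate_fatou (fun k y => c N (q k y)) _ _ C w); [exact: oU|exact: Ufin|
      exact: C0|exact: mcq|exact: mlim|exact: mlim|by move=> *; exact: c0|by move=> *; exact: lim0|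
      by move=> *; exact: lim0|exact: qcv|exact: rcv].
  apply: (le_integral_cstB mU Ufin C0); [exact: mlim|exact: lim0|exact: mlim|exact: lim0|].
  apply: (@open_translate_fatou (fun k y => C - c N (q k y)) _ _ C w);
    [exact: oU|exact: Ufin|exact: C0|move=> k|idtac|idtac|idtac|idtac|idtac|idtac|idtac].
  - by apply: measurable_funB; [exact: measurable_cst|exact: mcq].
  - by apply: measurable_funB; [exact: measurable_cst|exact: mlim].
  - by apply: measurable_funB; [exact: measurable_cst|exact: mlim].
  - by move=> k; apply: opp => y; exact: c0.
  - by apply: opp => y; exact: lim0.
  - by apply: opp => y; exact: lim0.
  - by apply: ae_imp qcv => y hy Uy; apply: (@cvgB _ R); [exact: cvg_cst|exact: hy].
  - by apply: ae_imp rcv => y hy Uy; apply: (@cvgB _ R); [exact: cvg_cst|exact: hy].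
have := ae_and (ae_and hq hr) (ae_foralln key).
apply: ae_imp => y [[Hq Hr] hN] By.
have /cvg_ex[/= a cva] := Hq By; have /cvg_ex[/= b cvb] := Hr By.
rewrite (cvg_lim _ cva)// (cvg_lim _ cvb)//.
(* A height above both limits, at which the cut-off no longer acts on them. *)
have [N hNb] : exists N : nat, `|a| + `|b| < N%:R.
  by exists (Num.bound (`|a| + `|b|)); apply: archi_boundP; rewrite addr_ge0.
have := hN N By; rewrite (limE _ _ _ _ cva) (limE _ r _ _ cvb) /c.
have hc (t : R) : `|t| < N%:R -> Num.max (- N%:R) (Num.min t N%:R) = t.
  by rewrite ltr_norml => /andP[t1 t2]; rewrite min_l ?max_r// ltW.
rewrite !hc ?(le_lt_trans _ hNb) ?lerDl ?lerDr//.
by move=> /addIr ->.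
Qed.

(** The quotient along [v + w] at [y] minus the one along [w] is exactly the quotient along [v] at
    the point translated by [- k.+1%:R^-1 *: w], and the translation disappears in the limit. No
    differentiability of [F] is involved. *)
Lemma pq_additive F v w (B : set E) : open B -> (leb B < +oo)%E ->
  measurable_fun setT (F : borel E -> R) ->
  {ae (@leb R n), forall y, B y -> cvgn (pq F v ^~ y)} ->
  {ae (@leb R n), forall y, B y -> cvgn (pq F w ^~ y)} ->
  {ae (@leb R n), forall y, B y -> cvgn (pq F (v + w) ^~ y)} ->
  {ae (@leb R n), forall y, B y ->
     limn (pq F (v + w) ^~ y) = limn (pq F v ^~ y) + limn (pq F w ^~ y)}.
Proof.
move=> oB Bfin mF cv cw cvw.
have step y : (fun k => pq F v k (y - k.+1%:R^-1 *: w)) = pq F (v + w) ^~ y \- pq F w ^~ y.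
  apply/funext => k; rewrite /= /pq -mulrBr scalerDr opprD [- _ - _]addrC addrA.
  by congr (_ * _); ring.
have hr : {ae (@leb R n), forall y, B y -> cvgn (fun k => pq F v k (y - k.+1%:R^-1 *: w))}.
  apply: ae_imp (ae_and cw cvw) => y [hw hvw] By.
  by rewrite step; apply: is_cvgB; [exact: hvw|exact: hw].
have := limn_translate_eq oB Bfin (fun k => measurable_pq v k mF) cv hr.
move=> /(ae_and (ae_and cw cvw)); apply: ae_imp => y [[hw hvw] hy] By.
rewrite -(hy By) step limB; [|exact: hvw|exact: hw].
by rewrite subrK.
Qed.

End directional.

Section transfer.
Context {R : realType} {n : nat}.
Local Notation E := 'rV[R]_n.+1.
Implicit Types (phi F : E -> R) (v w x y u : E) (Q : set E).

Lemma near_step (x v : E) Q : open Q -> Q x -> \forall k \near \oo, Q (x - k.+1%:R^-1 *: v).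
Proof.
move=> oQ Qx.
have cx : x - k.+1%:R^-1 *: v @[k --> \oo] --> (x : E) - (0 : R) *: v.
  by apply: cvgB; [exact: cvg_cst|apply: cvgZr_tmp; exact: cvg_harmonic].
by apply: cx; rewrite scale0r subr0; exact: open_nbhs_nbhs.
Qed.

(** Only countably many translates of the null set where [phi] and [F] differ are involved, so the
    quotients themselves can be exchanged. *)
Lemma ae_eq_pq phi F Q v : open Q -> {ae (@leb R n), forall y, Q y -> phi y = F y} ->
  {ae (@leb R n), forall y, Q y -> \forall k \near \oo, pq phi v k y = pq F v k y}.
Proof.
move=> oQ h.
have hk k := ae_translate (- (k.+1%:R^-1 *: v)) h.
apply: ae_imp (ae_and h (ae_foralln hk)) => y [hy hky] Qy.
by apply: filterS (near_step v oQ Qy) => k Qk; rewrite /pq hy// (hky k Qk).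
Qed.

Lemma near_eq_limn (u v : nat -> R) : (\forall k \near \oo, u k = v k) ->
  (cvgn u <-> cvgn v) /\ limn u = limn v.
Proof.
move=> uv.
have E2 : v @ \oo `=>` u @ \oo by exact: near_eq_cvg.
have E1 : u @ \oo `=>` v @ \oo by apply: near_eq_cvg; apply: filterS uv => k ->.
split; first by split=> /cvg_ex[l h]; apply/cvg_ex; exists l;
  [exact: cvg_trans E2 h|exact: cvg_trans E1 h].
by rewrite /lim /lim_in; congr (get _); apply/funext => l; apply/propext; split=> h;
  [exact: cvg_trans E2 h|exact: cvg_trans E1 h].
Qed.

Lemma monotone_cvg_pq phi (m rho : R) Q v : 0 < rho -> open Q -> (forall x, `|phi x| <= m) ->
  (forall x y, Q x -> Q y -> dircone v rho (y - x) -> phi x <= phi y) ->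
  {ae (@leb R n), forall y, Q y -> cvgn (pq phi v ^~ y)}.
Proof.
move=> rho0 oQ phim mono; have [F [_ _ h _ cF]] := monotone_regularization rho0 oQ phim mono.
apply: ae_imp (ae_and (ae_eq_pq v oQ h) cF) => y [hy cy] Qy.
by apply/(near_eq_limn (hy Qy)).1.
Qed.

Lemma limn_pq_additive phi F Q v w : open Q -> (leb Q < +oo)%E ->
  measurable_fun setT (F : borel E -> R) ->
  {ae (@leb R n), forall y, Q y -> phi y = F y} ->
  {ae (@leb R n), forall y, Q y -> cvgn (pq phi v ^~ y)} ->
  {ae (@leb R n), forall y, Q y -> cvgn (pq phi w ^~ y)} ->
  {ae (@leb R n), forall y, Q y -> cvgn (pq phi (v + w) ^~ y)} ->
  {ae (@leb R n), forall y, Q y ->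
     limn (pq phi (v + w) ^~ y) = limn (pq phi v ^~ y) + limn (pq phi w ^~ y)}.
Proof.
move=> oQ Qfin mF h cv cw cvw.
have tr u := ae_eq_pq u oQ h.
have cF u : {ae (@leb R n), forall y, Q y -> cvgn (pq phi u ^~ y)} ->
    {ae (@leb R n), forall y, Q y -> cvgn (pq F u ^~ y)}.
  by move=> cu; apply: ae_imp (ae_and (tr u) cu) => y [t c] Qy; apply/(near_eq_limn (t Qy)).1/c.
have := pq_additive oQ Qfin mF (cF _ cv) (cF _ cw) (cF _ cvw).
move=> /(ae_and (ae_and (tr v) (ae_and (tr w) (tr (v + w)))));
  apply: ae_imp => y [[tv [tw tvw]] hy] Qy.
rewrite (near_eq_limn (tv Qy)).2 (near_eq_limn (tw Qy)).2 (near_eq_limn (tvw Qy)).2.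
exact: hy.
Qed.

End transfer.

(** * Integral vectors and additive functions on them *)

Section integral_vectors.
Context {R : realType} {n : nat}.
Implicit Types (z : 'rV[int]_n.+1).

Definition intv z : 'rV[R]_n.+1 := map_mx intr z.

Lemma intvD z1 z2 : intv (z1 + z2) = intv z1 + intv z2.
Proof. by apply/rowP => i; rewrite !mxE intrD. Qed.

Lemma intvMn z (k : nat) : intv (z *+ k) = k%:R *: intv z.
Proof. by apply/rowP => i; rewrite !mxE mulmxnE rmorphMn/= mulr_natl. Qed.

(** Every integral vector is a difference of two elements of the semigroup [S], the second being a
    multiple of [e]. Hence [D] extends to a homomorphism on the lattice, which is given by its
    values on the standard basis. *)
Lemma additive_linear (S : set 'rV[int]_n.+1) (D : 'rV[int]_n.+1 -> R) e :
  S e -> (forall z1 z2, S z1 -> S z2 -> S (z1 + z2)) ->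
  (forall z, exists K : nat, S (z + e *+ K.+1)) ->
  (forall z1 z2, S z1 -> S z2 -> D (z1 + z2) = D z1 + D z2) ->
  exists a : 'rV[R]_n.+1, forall z, S z -> D z = (intv z *m a^T) 0 0.
Proof.
move=> Se SD Sabs Dadd.
have Sek k : S (e *+ k.+1).
  elim: k => // k IH; rewrite mulrS; exact: SD.
have [K SK] := choice Sabs.
have De k k' : D (e *+ k.+1 + e *+ k'.+1) = D (e *+ k.+1) + D (e *+ k'.+1) by exact: Dadd.
pose L z := D (z + e *+ (K z).+1) - D (e *+ (K z).+1).
have LE z k : S (z + e *+ k.+1) -> L z = D (z + e *+ k.+1) - D (e *+ k.+1).
  move=> Sk; apply/eqP; rewrite /L subr_eq addrAC eq_sym subr_eq.
  by rewrite -!Dadd// addrAC.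
have LD : zmod_morphism L.
  have LD2 z1 z2 : L (z1 + z2) = L z1 + L z2.
    rewrite (LE (z1 + z2) (K z1 + (K z2).+1)%N).
      rewrite -addSn mulrnDr addrACA Dadd// (Dadd (e *+ _))//.
      by rewrite /L opprD addrACA.
    by rewrite -addSn mulrnDr addrACA; exact: SD.
  have L0 : L 0 = 0 by apply: (@addIr _ (L 0)); rewrite -LD2 !add0r.
  move=> z1 z2; rewrite LD2; congr (_ + _).
  by apply: (@addrI _ (L z2)); rewrite -LD2 !subrr.
pose LL : {additive 'rV[int]_n.+1 -> R} := HB.pack L (GRing.isZmodMorphism.Build _ _ L LD).
exists (\row_j L (delta_mx 0 j)) => z Sz.
have -> : D z = LL z.
  by rewrite /= (LE _ 0%N) mulr1n; [rewrite Dadd// addrK|exact: SD].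
rewrite [X in LL X]row_sum_delta raddf_sum/= mxE; apply: eq_bigr => j _.
rewrite [in RHS]mxE [in X in _ * X]mxE [in X in _ * X]mxE.
change (LL (z 0 j *: delta_mx 0 j) = (z 0 j)%:~R * LL (delta_mx 0 j)).
by rewrite -[in LHS](intz (z 0 j)) scaler_int raddfMz -mulrzl.
Qed.

End integral_vectors.

Lemma cvg_bigsum (R : realType) (T I : Type) (F : set_system T) (FF : Filter F)
    (r : seq I) (f : I -> T -> R) (l : I -> R) :
  (forall i, f i t @[t --> F] --> l i) ->
  \sum_(i <- r) f i t @[t --> F] --> \sum_(i <- r) l i.
Proof.
move=> fl; elim: r => [|i r IH].
  by rewrite big_nil; under eq_fun do rewrite big_nil; exact: cvg_cst.
rewrite big_cons; under eq_fun do rewrite big_cons.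
exact: cvgD.
Qed.

(** * Lorentzian quadratic forms and their cones *)

Section quadratic_forms.
Context {R : realType} {n : nat}.
Implicit Types (G : 'M[R]_n) (v w e : 'rV[R]_n).

Definition qf G v w : R := (v *m G *m w^T) 0 0.

Lemma qfDl G v1 v2 w : qf G (v1 + v2) w = qf G v1 w + qf G v2 w.
Proof. by rewrite /qf !mulmxDl mxE. Qed.

Lemma qfDr G v w1 w2 : qf G v (w1 + w2) = qf G v w1 + qf G v w2.
Proof. by rewrite /qf linearD/= mulmxDr mxE. Qed.

Lemma qfZl G a v w : qf G (a *: v) w = a * qf G v w.
Proof. by rewrite /qf -!scalemxAl mxE. Qed.

Lemma qfZr G a v w : qf G v (a *: w) = a * qf G v w.
Proof. by rewrite /qf linearZ/= -scalemxAr mxE. Qed.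

Lemma qfNl G v w : qf G (- v) w = - qf G v w.
Proof. by rewrite -scaleN1r qfZl mulN1r. Qed.

Lemma qfNr G v w : qf G v (- w) = - qf G v w.
Proof. by rewrite -scaleN1r qfZr mulN1r. Qed.

Lemma qf0l G w : qf G 0 w = 0.
Proof. by rewrite -(scale0r 0) qfZl mul0r. Qed.

Lemma qf0r G w : qf G w 0 = 0.
Proof. by rewrite -(scale0r 0) qfZr mul0r. Qed.

Lemma qfC G v w : G^T = G -> qf G v w = qf G w v.
Proof.
move=> Gs; rewrite /qf -(trmxK (v *m G *m w^T)) [LHS]mxE.
by rewrite !trmx_mul Gs trmxK mulmxA.
Qed.

Lemma qfE G v w : qf G v w = \sum_j (\sum_i v 0 i * G i j) * w 0 j.
Proof.
rewrite /qf mxE; apply: eq_bigr => j _; rewrite !mxE; congr (_ * _).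
Qed.

Lemma cvg_qf (T : Type) (F : set_system T) (FF : Filter F) (Gf : T -> 'M[R]_n)
    (vf wf : T -> 'rV[R]_n) G v w :
  Gf @ F --> G -> vf @ F --> v -> wf @ F --> w ->
  (fun t => qf (Gf t) (vf t) (wf t)) @ F --> qf G v w.
Proof.
move=> hG hv hw; rewrite qfE.
under [X in X @ _]eq_fun do rewrite qfE.
apply: cvg_bigsum => j; apply: cvgM; last first.
  exact: (cvg_comp _ _ hw (@coord_continuous _ _ _ 0 j w)).
apply: cvg_bigsum => i; apply: cvgM.
  exact: (cvg_comp _ _ hv (@coord_continuous _ _ _ 0 i v)).
exact: (cvg_comp _ _ hG (@coord_continuous _ _ _ i j G)).
Qed.

End quadratic_forms.

Lemma sum_CauchySchwarz (R : realFieldType) (I : finType) (a b : I -> R) :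
  (\sum_i a i * b i) ^+ 2 <= (\sum_i a i ^+ 2) * (\sum_i b i ^+ 2).
Proof.
set A := \sum_i a i ^+ 2; set B := \sum_i b i ^+ 2; set C := \sum_i a i * b i.
have A0 : 0 <= A by apply: sumr_ge0 => i _; exact: sqr_ge0.
have : 0 <= \sum_i (A * b i - C * a i) ^+ 2 by apply: sumr_ge0 => i _; exact: sqr_ge0.
have -> : \sum_i (A * b i - C * a i) ^+ 2 = A * (A * B - C ^+ 2).
  transitivity (\sum_i (A ^+ 2 * b i ^+ 2 + (- (2 * A * C)) * (a i * b i) + C ^+ 2 * a i ^+ 2)).
    by apply: eq_bigr => i _; ring.
  by rewrite !big_split/= -!mulr_sumr -/A -/B -/C; ring.
move: A0; rewrite le_eqVlt => /orP[/eqP A0 _|A0]; last by rewrite pmulr_rge0// subr_ge0.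
have a0 i : a i = 0.
  have /eqP := esym A0; rewrite psumr_eq0; last by move=> j _; exact: sqr_ge0.
  by move=> /allP /(_ i (mem_index_enum _)); rewrite /= sqrf_eq0 => /eqP.
rewrite /C big1 ?expr0n -?A0 ?mul0r// => i _.
by rewrite a0 mul0r.
Qed.

Lemma qf_minkowski (R : realType) (d : nat) (v w : 'rV[R]_d.+1) :
  qf (minkowski_mx R d) v w =
  - (v 0 0 * w 0 0) + \sum_(i < d) v 0 (lift ord0 i) * w 0 (lift ord0 i).
Proof.
rewrite /qf /minkowski_mx mul_mx_diag mxE big_ord_recl; congr (_ + _).
  by rewrite !mxE/= mulrN1 mulNr.
by apply: eq_bigr => i _; rewrite !mxE/= mulr1.
Qed.

Section lorentz_forms.
Context {R : realType} {d : nat} (G : 'M[R]_d.+1).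
Hypothesis Gsym : G^T = G.
Hypothesis Gsig : exists2 P, P \in unitmx & P *m G *m P^T = minkowski_mx R d.
Implicit Types (v w b e x : 'rV[R]_d.+1).
Local Notation g := (qf G).

(** In a basis where the form is Minkowskian, orthogonality equates the product of time components
    with the spatial product, and the Cauchy-Schwarz inequality bounds the latter. *)
Lemma perp_timelike_gt0 e w : g e e < 0 -> g e w = 0 -> w != 0 -> 0 < g w w.
Proof.
have [P Pu PG] := Gsig.
pose S v w := \sum_(i < d) v 0 (lift ord0 i) * w 0 (lift ord0 i) : R.
have gE v u : g v u = - ((v *m invmx P) 0 0 * (u *m invmx P) 0 0) + S (v *m invmx P) (u *m invmx P).
  have -> : g v u = qf (minkowski_mx R d) (v *m invmx P) (u *m invmx P).
    rewrite /qf -PG trmx_mul !mulmxA mulmxKV// -!mulmxA.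
    by congr ((_ *m (_ *m _)) 0 0); rewrite mulmxA -trmx_mul mulVmx// trmx1 mul1mx.
  by rewrite qf_minkowski.
rewrite !gE => ee ew w0.
set v := e *m invmx P in ee ew *; set u := w *m invmx P in ew *.
have CS : S v u ^+ 2 <= S v v * S u u.
  have := sum_CauchySchwarz (fun i => v 0 (lift ord0 i)) (fun i => u 0 (lift ord0 i)).
  by rewrite /S; under [X in X * _ ]eq_bigr do rewrite expr2; under [X in _ * X]eq_bigr do rewrite expr2.
have Suu0 : 0 <= S u u by apply: sumr_ge0 => i _; rewrite -expr2 sqr_ge0.
have Svv0 : 0 <= S v v by apply: sumr_ge0 => i _; rewrite -expr2 sqr_ge0.
have [Su|Su] := eqVneq (S u u) 0.
  have uv : S v u = 0.
    by apply/eqP; rewrite -sqrf_eq0 eq_le sqr_ge0 andbT (le_trans CS)// Su mulr0.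
  have v00 : v 0 0 != 0 by apply: contraTneq ee => ->; rewrite mul0r oppr0 add0r -leNgt.
  have u00 : u 0 0 = 0.
    by move/eqP: ew; rewrite uv addr0 oppr_eq0 mulf_eq0 (negbTE v00) => /eqP.
  have : u = 0.
    apply/rowP => j; rewrite [RHS]mxE; case: (unliftP ord0 j) => [i|] ->//.
    have /eqP := Su; rewrite /S psumr_eq0; last by move=> k _; rewrite -expr2 sqr_ge0.
    by move=> /allP /(_ i (mem_index_enum _)); rewrite /= mulf_eq0 orbb => /eqP.
  by move=> u0; case/negP: w0; rewrite -[w](mulmxKV Pu) -/u u0 mul0mx.
have {}Su : 0 < S u u by rewrite lt_neqAle eq_sym Su.
move: ee ew CS; move: (S v v) (S u u) (S v u) (v 0 0) (u 0 0) Su Svv0 => A B C s t B0 A0.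
move=> h1 h2 h3; have hC : C = s * t by lra.
rewrite ltNge; apply/negP => h4.
have hA : A * B < s * s * B by rewrite ltr_pM2r//; lra.
have hB : s * s * B <= s * s * (t * t).
  by rewrite ler_wpM2l// -?expr2 ?sqr_ge0//; lra.
move: h3; rewrite hC leNgt => /negP; apply; apply: (lt_le_trans hA).
by apply: (le_trans hB); rewrite le_eqVlt; apply/orP; left; apply/eqP; ring.
Qed.

(** The component [u] of [w] orthogonal to [e] has nonnegative square. *)
Lemma reverse_CauchySchwarz e w : g e e < 0 -> g e e * g w w <= g e w ^+ 2.
Proof.
move=> ee; have ee0 : g e e != 0 by rewrite lt_eqF.
pose u := w - (g e w / g e e) *: e.
have eu : g e u = 0 by rewrite qfDr qfNr qfZr divfK// subrr.
have uu : 0 <= g u u.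
  have [->|u0] := eqVneq u 0; first by rewrite qf0l.
  by apply/ltW/(perp_timelike_gt0 ee).
move: uu; rewrite {1}/u qfDl qfNl qfZl eu mulr0 oppr0 addr0 qfC// {1}/u.
rewrite qfDl qfNl qfZl => h.
have : g e e * (g w w - g e w / g e e * g e w) <= 0 by rewrite nmulr_rle0.
rewrite mulrBr subr_le0 => /le_trans; apply.
by rewrite mulrAC mulrCA divff// mulr1 expr2.
Qed.

Section future.
Variable X : 'rV[R]_d.+1.
Hypothesis XX : g X X < 0.

Definition fut v := g v v < 0 /\ g v X < 0.

Lemma causal_dot_lt0 w : w != 0 -> g w w <= 0 -> g w X <= 0 -> g w X < 0.
Proof.
move=> w0 ww wX; rewrite lt_neqAle wX andbT; apply/negP => /eqP wX0.
by have := perp_timelike_gt0 XX (etrans (qfC _ _ Gsym) wX0) w0; rewrite ltNge ww.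
Qed.

(** Otherwise the combination [z] of [v] and [w] orthogonal to [X] would have negative square, since
    all three terms of its expansion have the same sign. *)
Lemma fut_dot v w : fut v -> w != 0 -> g w w <= 0 -> g w X <= 0 -> g v w < 0.
Proof.
move=> [vv vX] w0 ww wX0; have wX := causal_dot_lt0 w0 ww wX0.
rewrite ltNge; apply/negP => vw.
pose z := (- g w X) *: v + (g v X) *: w.
have zX : g X z = 0.
  by rewrite qfDr !qfZr ![g X _]qfC// mulNr mulrC addNr.
have zz : 0 <= g z z.
  have [->|z0] := eqVneq z 0; first by rewrite qf0l.
  by apply/ltW/(perp_timelike_gt0 XX).
move: zz; rewrite /z qfDl !qfDr !qfZl !qfZr (qfC w v Gsym).
move: (g v v) (g w w) (g v w) (g w X) (g v X) vv ww vw wX vX => a b c s t a0 b0 c0 s0 t0.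
have h1 : 0 < (- s) * (- s) by rewrite mulr_gt0// oppr_gt0.
have h2 : 0 < s * t by rewrite nmulr_rgt0.
have h3 : 0 < t * t by rewrite nmulr_rgt0.
nra.
Qed.

Lemma futD v w : fut v -> fut w -> fut (v + w).
Proof.
move=> fv [ww wX]; split; last by rewrite qfDl; have [_ ?] := fv; lra.
have w0 : w != 0 by apply: contraTneq ww => ->; rewrite qf0l ltxx.
have := fut_dot fv w0 (ltW ww) (ltW wX); have [vv _] := fv.
by rewrite !(qfDl, qfDr) (qfC w v Gsym); lra.
Qed.

Lemma futZ (a : R) v : 0 < a -> fut v -> fut (a *: v).
Proof.
move=> a0 [vv vX]; split; last by rewrite qfZl pmulr_rlt0.
by rewrite qfZl qfZr !pmulr_rlt0.
Qed.

Lemma futX : fut X. Proof. by split. Qed.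

Lemma fut_le v w : fut v -> fut w -> Num.sqrt (- g v v) * Num.sqrt (- g w w) <= - g v w.
Proof.
move=> fv [ww wX]; have [vv _] := fv.
have w0 : w != 0 by apply: contraTneq ww => ->; rewrite qf0l ltxx.
have vw := fut_dot fv w0 (ltW ww) (ltW wX).
rewrite -sqrtrM ?oppr_ge0 ?(ltW vv)// -(ler_sqr (sqrtr_ge0 _)); last first.
  by rewrite nnegrE oppr_ge0 ltW.
rewrite sqr_sqrtr ?mulrNN ?sqrrN; first exact: reverse_CauchySchwarz.
by rewrite nmulr_rge0 ?ltW.
Qed.

(* The test vector is [w + t X] with [t] slightly beyond the value making
   it orthogonal to [w]. *)
Lemma dual_fut (k : R) w : 0 < k ->
  (forall b, fut b -> k * Num.sqrt (- g b b) <= - g b w) ->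
  fut w /\ k <= Num.sqrt (- g w w).
Proof.
move=> k0 kb.
have s0 : 0 < - g w X.
  by rewrite qfC//; apply: lt_le_trans (kb X futX); rewrite mulr_gt0// sqrtr_gt0 oppr_gt0.
have ww : g w w < 0.
  rewrite ltNge; apply/negP => q0.
  pose t := (g w w + k ^+ 2) / - g w X.
  have t0 : 0 < t by rewrite divr_gt0// ltr_wpDl// exprn_gt0.
  pose b := w + t *: X.
  have tX : t * g w X = - (g w w + k ^+ 2).
    by rewrite /t invrN mulrN mulNr divfK// lt_eqF// -oppr_gt0.
  have bw : - g b w = k ^+ 2.
    by rewrite /b qfDl qfZl (qfC X w Gsym) tX; lra.
  have k20 : 0 < k ^+ 2 by rewrite exprn_gt0.
  have bb : 2 * k ^+ 2 <= - g b b.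
    have x0 : 0 < - g X X by rewrite oppr_gt0.
    have h : 0 <= t * (t * - g X X) by apply: mulr_ge0; [exact: ltW|apply: mulr_ge0; exact: ltW].
    rewrite /b !(qfDl, qfDr) !qfZl !qfZr (qfC X w Gsym) tX; lra.
  have fb : fut b.
    split; first lra.
    rewrite /b qfDl qfZl; have : t * g X X < 0 by rewrite pmulr_rlt0.
    by lra.
  have := kb b fb; rewrite bw leNgt => /negP; apply.
  rewrite expr2 ltr_pM2l// -[ltLHS]ger0_norm ?ltW// -sqrtr_sqr ltr_sqrt; lra.
have fw : fut w by split => //; rewrite -oppr_gt0.
split => //; have := kb w fw.
rewrite -[X in _ <= X -> _]sqr_sqrtr; last by rewrite oppr_ge0 ltW.
by rewrite expr2 ler_pM2r// sqrtr_gt0 oppr_gt0.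
Qed.

(** If [w] were spacelike, so would be [w + e *: X] for a small [e]; but adding [e *: X] gives a
    strictly positive dual bound, and [dual_fut] makes that vector timelike. *)
Lemma dual_causal w : (forall b, fut b -> 0 <= - g b w) -> g w w <= 0.
Proof.
move=> wb; rewrite leNgt; apply/negP => ww.
have [e e0 fe] : exists2 e : R, 0 < e & 0 < g (w + e *: X) (w + e *: X).
  pose s := - g w X; have s0 : 0 <= s by rewrite /s qfC//; exact/wb/futX.
  (* With this value [e <= 1], and both negative terms of the expansion, [2 * e * s] and
     [e ^+ 2 * - g X X], are absorbed by [g w w]. *)
  pose e := g w w / (2 * (s + - g X X + g w w + 1)).
  have x0 : 0 < - g X X by rewrite oppr_gt0.
  have D0 : 0 < 2 * (s + - g X X + g w w + 1) by lra.
  have e0 : 0 < e by rewrite divr_gt0.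
  exists e => //; rewrite !(qfDl, qfDr) !qfZl !qfZr (qfC X w Gsym).
  have eD : e * (2 * (s + - g X X + g w w + 1)) = g w w by rewrite divfK// gt_eqF.
  have e1 : e <= 1.
    by rewrite ler_pdivrMr//; lra.
  have : e * (e * - g X X) <= e * - g X X by rewrite ler_pM2l// ler_piMl// ltW.
  move: eD; rewrite -/s (_ : g w X = - s); last by rewrite /s opprK.
  nra.
have k0 : 0 < e * Num.sqrt (- g X X) by rewrite mulr_gt0// sqrtr_gt0 oppr_gt0.
have [] := @dual_fut _ (w + e *: X) k0; last by move=> [] /lt_trans /(_ fe); rewrite ltxx.
move=> b fb; rewrite qfDr qfZr opprD -mulrN ler_wpDl ?wb//.
by rewrite -mulrA ler_pM2l// mulrC fut_le//; exact: futX.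
Qed.

End future.

End lorentz_forms.

Lemma sphere_compact (R : realType) (n : nat) : compact [set w : 'rV[R]_n.+1 | `|w| = 1].
Proof.
apply: bounded_closed_compact.
  exists 1; split; first by rewrite realE ler01.
  by move=> M M1 w /= ->; exact: ltW.
rewrite (_ : [set w | _] = (fun w : 'rV[R]_n.+1 => `|w|) @^-1` [set 1])//.
apply: closed_comp; first by move=> w _; exact: norm_continuous.
exact: closed_eq.
Qed.

Lemma continuous_qfl (R : realType) (n : nat) (G : 'M[R]_n) (w : 'rV[R]_n) :
  continuous (fun v : 'rV[R]_n => qf G v w).
Proof.
move=> v; apply: (@cvg_qf _ _ _ _ (nbhs_filter v)).
- exact: cvg_cst.
- exact: cvg_id.
- exact: cvg_cst.
Qed.

Lemma continuous_qfd (R : realType) (n : nat) (G : 'M[R]_n) :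
  continuous (fun v : 'rV[R]_n => qf G v v).
Proof.
move=> v; apply: (@cvg_qf _ _ _ _ (nbhs_filter v)).
- exact: cvg_cst.
- exact: cvg_id.
- exact: cvg_id.
Qed.

(** * Uniform control of the cones near a point *)

Section cone_perturbation.
Context {R : realType} {d : nat} {T : topologicalType} (p : T).
Variables (Gf : T -> 'M[R]_d.+1) (Xf : T -> 'rV[R]_d.+1).
Hypotheses (cG : {for p, continuous Gf}) (cX : {for p, continuous Xf}).
Hypothesis Gsym : (Gf p)^T = Gf p.
Hypothesis Gsig : exists2 P, P \in unitmx & P *m Gf p *m P^T = minkowski_mx R d.
Hypothesis XX : qf (Gf p) (Xf p) (Xf p) < 0.
Local Notation E := 'rV[R]_d.+1.
Local Notation g := (qf (Gf p)).
Local Notation X := (Xf p).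

Let cfst (w0 : E) : (fun q : E * T => q.1) @ filter_prod (nbhs w0) (nbhs p) --> w0.
Proof. exact: cvg_fst. Qed.

Let cGs (w0 : E) : (fun q : E * T => Gf q.2) @ filter_prod (nbhs w0) (nbhs p) --> Gf p.
Proof. exact: (cvg_comp _ _ (@cvg_snd _ _ (nbhs w0) (nbhs p) _) cG). Qed.

Let cXs (w0 : E) : (fun q : E * T => Xf q.2) @ filter_prod (nbhs w0) (nbhs p) --> Xf p.
Proof. exact: (cvg_comp _ _ (@cvg_snd _ _ (nbhs w0) (nbhs p) _) cX). Qed.

Let FFw (w0 : E) : Filter (filter_prod (nbhs w0) (nbhs p)).
Proof. exact: filter_prod_filter. Qed.

Let not_causal_near (w0 : E) : ~ (g w0 w0 <= 0 /\ g w0 X <= 0) ->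
  \forall w \near w0 & z \near p,
    ~ (qf (Gf z) w w <= 0 /\ qf (Gf z) w (Xf z) <= 0).
Proof.
move=> h.
have c1 := cvg_qf (FFw w0) (@cGs w0) (@cfst w0) (@cfst w0).
have c2 := cvg_qf (FFw w0) (@cGs w0) (@cfst w0) (@cXs w0).
have K : filter_prod (nbhs w0) (nbhs p)
    (fun q => ~ (qf (Gf q.2) q.1 q.1 <= 0 /\ qf (Gf q.2) q.1 (Xf q.2) <= 0)).
  have [w00|w00] := ltP 0 (g w0 w0).
    apply: (@filterS _ _ (FFw w0) _ _ _ (cvgr_gt _ c1 _ w00)) => -[w z] /= w2 [+ _].
    by rewrite leNgt w2.
  have wX : 0 < g w0 X by rewrite ltNge; apply/negP => ?; apply: h.
  apply: (@filterS _ _ (FFw w0) _ _ _ (cvgr_gt _ c2 _ wX)) => -[w z] /= w2 [_].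
  by rewrite leNgt w2.
exact: K.
Qed.

(** On the compact unit sphere a vector is either causal at [p], where the pairing with [X] is
    bounded away from 0 nearby, or not causal at any nearby point. Homogeneity extends the bound to
    all vectors. *)
Lemma causal_norm_near : exists2 C : R, 0 < C & \forall z \near p, forall w,
  qf (Gf z) w w <= 0 -> qf (Gf z) w (Xf z) <= 0 -> `|w| <= C * - g w X.
Proof.
(* The constant is the second component of the parameter, tending to infinity, so that a single
   compactness argument finds both it and the neighbourhood. *)
pose P (i : T * R) (w : E) := qf (Gf i.1) w w <= 0 -> qf (Gf i.1) w (Xf i.1) <= 0 ->
  1 <= i.2 * - g w X.
have [|[B1 B2] /= [nB1 nB2] BP] :=
    (compact_near_coveringP _).1 (@sphere_compact R d) _ (filter_prod (nbhs p) (pinfty_nbhs R)) P _.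
  move=> w0 w01.
  have [[h1 h2]|h] := pselect (g w0 w0 <= 0 /\ g w0 X <= 0); last first.
    have [[A B] /= [nA nB] AB] := not_causal_near h.
    exists (A, B `*` setT) => /=.
      split => //; exists (B, setT) => //=; split => //; exact: filterT.
    by move=> [w [z C]] /= [Aw [Bz _]] c1 c2; case: (AB (w, z)).
  have w0N : w0 != 0 by rewrite -normr_eq0 w01 oner_eq0.
  have t0 : 0 < - g w0 X by rewrite oppr_gt0 (causal_dot_lt0 Gsym Gsig XX).
  have ct : (fun w : E => - g w X) @ (w0 : E) --> - g w0 X.
    under eq_fun do rewrite -qfNr.
    rewrite -qfNr.
    exact: continuous_qfl.
  set t := - g w0 X in t0 ct.
  exists ([set w | t / 2 < - g w X], setT `*` [set C | 2 / t < C]) => /=.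
    split; first by apply: (cvgr_gt _ ct); rewrite ltr_pdivrMr// ltr_pMr// ltr1n.
    exists (setT, [set C | 2 / t < C]) => //=; split; first exact: filterT.
    by apply: nbhs_pinfty_gt; rewrite num_real.
  move=> [w [z C]] /= [Aw [_ BC]] _ _ /=.
  have C0 : 0 < C by apply: lt_trans BC; rewrite divr_gt0.
  rewrite (_ : 1 = (2 / t) * (t / 2)); last by field; rewrite gt_eqF.
  by apply: ler_pM => //; rewrite ?divr_ge0// ltW.
have [C [BC C0]] : exists C, B2 C /\ 0 < C.
  have [M [_ hM]] := nB2.
  by exists (Num.max M 0 + 1); split; [apply: hM|]; rewrite /= ltr_pwDr// le_max lexx ?orbT.
exists C => //; apply: filterS nB1 => z Bz w c1 c2.
have [->|w0] := eqVneq w 0; first by rewrite normr0 qf0l oppr0 mulr0.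
have nw : 0 < `|w| by rewrite normr_gt0.
have := BP (z, C) (conj Bz BC) (`|w|^-1 *: w).
rewrite /P /= normrZ normfV normr_id mulVf ?gt_eqF// => /(_ erefl).
rewrite !qfZl qfZr !pmulr_rle0 ?invr_gt0// => /(_ c1 c2).
by rewrite -mulrN mulrCA -ler_pdivrMl ?invr_gt0// invrK mulr1.
Qed.

(** Tilting a vector [w] that is causal at [z] by [th * |w|] towards [X] makes it timelike at [p]
    and longer there than [w] is at [z]. The reversed Cauchy-Schwarz inequality at [p] then applies
    to the tilted vector. *)
Lemma causal_perturbation_near (th : R) : 0 < th -> \forall z \near p, forall w b,
  qf (Gf z) w w <= 0 -> qf (Gf z) w (Xf z) <= 0 -> fut (Gf p) X b ->
  Num.sqrt (- g b b) * Num.sqrt (- qf (Gf z) w w) <= - g b w + th * `|w| * - g b X.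
Proof.
move=> th0.
pose P (z : T) (w : E) := qf (Gf z) w w <= 0 -> qf (Gf z) w (Xf z) <= 0 ->
  [/\ g (w + th *: X) (w + th *: X) < 0, g (w + th *: X) X < 0 &
    - qf (Gf z) w w < - g (w + th *: X) (w + th *: X)].
have : \near p, [set w : E | `|w| = 1] `<=` P p.
  apply: ((compact_near_coveringP _).1 (@sphere_compact R d)) => w0 w01.
  have [[h1 h2]|h] := pselect (g w0 w0 <= 0 /\ g w0 X <= 0); last first.
    by apply: filterS (not_causal_near h) => -[w z] /= nc c1 c2; case: nc.
  have wX2 : g (w0 + th *: X) X < 0 by rewrite qfDl qfZl; have : th * g X X < 0 by [rewrite pmulr_rlt0]; lra.
  have w2 : - g w0 w0 < - g (w0 + th *: X) (w0 + th *: X).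
    rewrite !(qfDl, qfDr) !qfZl !qfZr (qfC X w0 Gsym).
    have : th * (th * g X X) < 0 by rewrite !pmulr_rlt0.
    have : th * g w0 X <= 0 by rewrite pmulr_rle0.
    by lra.
  have ww2 : g (w0 + th *: X) (w0 + th *: X) < 0 by lra.
  have cw : (fun q : E * T => q.1 + th *: X) @ filter_prod (nbhs w0) (nbhs p) --> w0 + th *: X.
    by apply: cvgD; [exact: (@cfst w0)|exact: cvg_cst].
  have cG0 : (fun q : E * T => Gf p) @ filter_prod (nbhs w0) (nbhs p) --> Gf p by exact: cvg_cst.
  have cX0 : (fun q : E * T => X) @ filter_prod (nbhs w0) (nbhs p) --> X by exact: cvg_cst.
  have k1 := cvgr_lt _ (cvg_qf (FFw w0) cG0 cw cX0) _ wX2.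
  have k2 := cvgr_lt _ (cvg_qf (FFw w0) cG0 cw cw) _ ww2.
  have k3 : \forall q \near filter_prod (nbhs w0) (nbhs p),
      - qf (Gf q.2) q.1 q.1 + g (q.1 + th *: X) (q.1 + th *: X) < 0.
    apply: (cvgr_lt (- g w0 w0 + g (w0 + th *: X) (w0 + th *: X))); last by lra.
    apply: cvgD; last exact: cvg_qf.
    by apply: cvgN; exact: cvg_qf (@cGs w0) (@cfst w0) (@cfst w0).
  have K : filter_prod (nbhs w0) (nbhs p) (fun q => P q.2 q.1).
    apply: (@filterS _ _ (FFw w0) _ _ _ (@filterI _ _ (FFw w0) _ _ (k1 (FFw w0)) (@filterI _ _ (FFw w0) _ _ (k2 (FFw w0)) k3))).
    by move=> -[w z] /= [q1 [q2 q3]] _ _; split => //; lra.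
  exact: K.
apply: filterS => z Pz w b c1 c2 fb.
have [->|w0] := eqVneq w 0.
  by rewrite qf0l qf0r normr0 !oppr0 sqrtr0 mulr0 mulr0 mul0r addr0.
have nw : 0 < `|w| by rewrite normr_gt0.
have := Pz (`|w|^-1 *: w).
rewrite /= normrZ normfV normr_id mulVf ?gt_eqF// => /(_ erefl).
rewrite /P !qfZl !qfZr !pmulr_rle0 ?invr_gt0// => /(_ c1 c2)[w1 w2 w3].
have -> : - g b w + th * `|w| * - g b X = - g b (w + (th * `|w|) *: X).
  by rewrite qfDr qfZr opprD mulrN.
have eE : w + (th * `|w|) *: X = `|w| *: (`|w|^-1 *: w + th *: X).
  by rewrite scalerDr scalerA divff ?gt_eqF// scale1r scalerA mulrC.
have fe : fut (Gf p) X (`|w|^-1 *: w + th *: X) by split.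
have := fut_le Gsym Gsig XX fb fe; rewrite eE qfZr.
set e := _ + _ in w1 w2 w3 fe *; move=> H.
have : Num.sqrt (- qf (Gf z) w w) <= `|w| * Num.sqrt (- g e e).
  rewrite -[X in _ <= X * _]gtr0_norm// -sqrtr_sqr -sqrtrM ?sqr_ge0// ler_sqrt; last first.
    by rewrite mulr_ge0 ?sqr_ge0// oppr_ge0 ltW.
  rewrite -ler_pdivrMl ?exprn_gt0// mulrN; apply: le_trans (ltW w3).
  by rewrite lerN2 expr2 invfM mulrA.
move=> /(ler_wpM2l (sqrtr_ge0 (- g b b))) /le_trans; apply.
by rewrite mulrCA -mulrN ler_pM2l.
Qed.

End cone_perturbation.

Lemma ler_rV_norm (R : realType) (n : nat) (x : 'rV[R]_n.+1) (e : R) : 0 <= e ->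
  (`|x| <= e) <-> (forall i, `|x 0 i| <= e).
Proof.
move=> e0; rewrite [`|x|]/Num.norm/= /mx_norm -[e]/((NngNum e0)%:num)%R num_le.
split=> [|hx].
  by move=> /bigmax_leP[_ hx] i; have := hx (0, i) erefl; rewrite -num_le.
apply/bigmax_leP; split=> [|[j i] _]; rewrite -num_le//= ord1; exact: hx.
Qed.

(** * Covectors nonnegative on the future cone and their dual length *)

Section cone_linear_forms.
Context {R : realType} {d : nat} (G : 'M[R]_d.+1).
Hypothesis Gsym : G^T = G.
Hypothesis Gsig : exists2 P, P \in unitmx & P *m G *m P^T = minkowski_mx R d.
Variable X : 'rV[R]_d.+1.
Local Notation E := 'rV[R]_d.+1.
Local Notation g := (qf G).
Hypothesis XX : g X X < 0.
Local Notation fut := (fut G X).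

Definition pairing (A v : E) : R := (v *m A^T) 0 0.

Lemma pairingD A v w : pairing A (v + w) = pairing A v + pairing A w.
Proof. by rewrite /pairing mulmxDl mxE. Qed.

Lemma pairingZ A (s : R) v : pairing A (s *: v) = s * pairing A v.
Proof. by rewrite /pairing -scalemxAl mxE. Qed.

Lemma pairing_qf A v : pairing A v = qf 1%:M v A.
Proof. by rewrite /pairing /qf mulmx1. Qed.

Lemma continuous_pairing A : continuous (pairing A).
Proof.
have -> : pairing A = (fun v => qf 1%:M v A) by apply/funext => v; exact: pairing_qf.
exact: continuous_qfl.
Qed.

Lemma open_fut : open (fut : set E).
Proof.
apply: openI; [apply: (@open_comp _ _ (fun v : E => g v v) [set x : R | x < 0])
              |apply: (@open_comp _ _ (fun v : E => g v X) [set x : R | x < 0])].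
- by move=> v _; exact: continuous_qfd.
- exact: open_lt.
- by move=> v _; exact: continuous_qfl.
- exact: open_lt.
Qed.

(** Rounding a large multiple of a point changes the direction arbitrarily little, and an open cone
    tolerates the change. *)
Lemma dense_intv (O : set E) : open O -> O !=set0 ->
  (forall (s : R) x, 0 < s -> O x -> O (s *: x)) -> exists z, O (intv z).
Proof.
move=> oO [x Ox] Os; have /nbhs_ballP[e /= e0 xe] : nbhs x O by exact: open_nbhs_nbhs.
have [N eN] : exists N : nat, N.+1%:R^-1 < e.
  exists (Num.truncn e^-1); rewrite invf_plt ?posrE//; exact: truncnS_gt.
set z := \row_j Num.floor (N.+1%:R * x 0 j); exists z.
have -> : intv z = N.+1%:R *: (N.+1%:R^-1 *: intv z) :> E by rewrite scalerA divff// scale1r.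
apply: Os => //.
apply: xe; rewrite -ball_normE /=; apply: (le_lt_trans _ eN).
have N0 : (0 : R) < N.+1%:R^-1 by rewrite invr_gt0.
apply/ler_rV_norm => [|i]; first exact: ltW.
rewrite !mxE.
set t := N.+1%:R * x 0 i.
have -> : x 0 i = N.+1%:R^-1 * t by rewrite mulrA mulVf ?mul1r.
rewrite -mulrBr normrM gtr0_norm// ger_pMr// ger0_norm ?subr_ge0 ?ge_floor//.
by rewrite lerBlDr addrC -intrD1 ltW// lt_succ_floor.
Qed.

Lemma futZV (s : R) v : 0 < s -> fut (s *: v) -> fut v.
Proof.
have s'0 : 0 < s -> 0 < s^-1 by rewrite invr_gt0.
move=> s0 /(futZ (s'0 s0)); rewrite scalerA mulVf ?gt_eqF// scale1r; apply.
Qed.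

Lemma fut_intv_exists : exists e : 'rV[int]_d.+1, fut (intv e).
Proof.
by apply: dense_intv; [exact: open_fut|exists X; exact: futX|move=> s x; exact: futZ].
Qed.

Lemma fut_absorb (e z : 'rV[int]_d.+1) : fut (intv e) -> exists K : nat, fut (intv (z + e *+ K.+1)).
Proof.
move=> fe.
have c : (intv e : E) + k.+1%:R^-1 *: (intv z : E) @[k --> \oo] --> (intv e : E) + (0 : R) *: (intv z : E).
  by apply: cvgD; [exact: cvg_cst|apply: cvgZr_tmp; exact: cvg_harmonic].
have /c[K _ hK] : nbhs (intv e + 0 *: intv z : E) fut.
  by rewrite scale0r addr0; apply: open_nbhs_nbhs; split => //; exact: open_fut.
exists K; rewrite intvD intvMn; apply: (@futZV K.+1%:R^-1); first by rewrite invr_gt0.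
by rewrite scalerDr scalerA mulVf// scale1r addrC; exact: (hK K (leqnn K)).
Qed.

Lemma pairing_inj (A B : E) :
  (forall z, fut (intv z) -> pairing A (intv z) = pairing B (intv z)) -> A = B.
Proof.
move=> AB; have [e fe] := fut_intv_exists; apply/rowP => j.
have [K fK] := fut_absorb (delta_mx 0 j) fe.
have := AB _ fK; rewrite intvD intvMn !pairingD !pairingZ (AB _ fe) => /addIr.
rewrite /pairing !mxE (bigD1 j)//= [RHS](bigD1 j)//= !mxE !eqxx/= !mul1r.
rewrite !big1 ?addr0// => i ij; rewrite !mxE (negbTE ij) andbF mul0r//.
Qed.

(** The quantity [N(a)]. Restricting to integral vectors makes it a countable infimum; by density
    and homogeneity it still bounds the quotients over the whole future cone, see
    [cone_inf_real]. *)
Definition cone_inf (A : E) : R :=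
  inf [set pairing A (intv z) / Num.sqrt (- g (intv z) (intv z)) | z in [set z | fut (intv z)]].

Lemma lorentz_unitmx : G \in unitmx.
Proof.
have [P uP PG] := Gsig.
have : minkowski_mx R d \in unitmx.
  rewrite unitmxE unitfE /minkowski_mx det_diag; apply/prodf_neq0 => i _; rewrite mxE.
  by case: ifP; rewrite ?oppr_eq0 oner_eq0.
by rewrite -PG !unitmx_mul => /andP[/andP[]].
Qed.

Section cone_inf.
Variable A : E.
Hypothesis A0 : forall z, fut (intv z) -> 0 <= pairing A (intv z).
Let V : set R :=
  [set pairing A (intv z) / Num.sqrt (- g (intv z) (intv z)) | z in [set z | fut (intv z)]].

Let V0 : lbound V 0.
Proof. by move=> _ [z fz <-]; rewrite divr_ge0 ?sqrtr_ge0// A0. Qed.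

Let Vn : V !=set0.
Proof. by have [e fe] := fut_intv_exists; eexists; exists e. Qed.

Lemma cone_inf_ge0 : 0 <= cone_inf A.
Proof. exact: lb_le_inf. Qed.

Lemma cone_inf_le z : fut (intv z) ->
  cone_inf A <= pairing A (intv z) / Num.sqrt (- g (intv z) (intv z)).
Proof. by move=> fz; apply: ge_inf; [exists 0|exists z]. Qed.

(** The vector representing the covector [A], with the sign for which [pairing A v] is [- g v a],
    the form used in the duality lemmas. *)
Let a := - (A *m invmx G).

Let aE v : g v a = - pairing A v.
Proof.
rewrite /qf /a linearN/= trmx_mul trmx_inv Gsym mulmxN mxE -mulmxA mulmxA.
by rewrite -[_ *m G *m _]mulmxA [G *m _]mulmxA mulmxV ?lorentz_unitmx// mul1mx.
Qed.

(** A violation at [b] would persist on an open cone, which contains an integral vector. *)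
Let cone_inf_real b : fut b -> cone_inf A * Num.sqrt (- g b b) <= - g b a.
Proof.
move=> fb; rewrite aE opprK leNgt; apply/negP => H.
pose f (v : E) : R := pairing A v - cone_inf A * Num.sqrt (- g v v).
have cf : continuous f.
  move=> v; apply: (@continuousB _ R^o E (pairing A)); first exact: continuous_pairing.
  apply: (@continuousM R E (fun=> cone_inf A) (fun v => Num.sqrt (- g v v)) v); first exact: cst_continuous.
  apply: (@continuous_comp _ _ _ (fun v : E => - g v v) Num.sqrt v); last exact: sqrt_continuous.
  apply: (@continuousN _ R^o); exact: continuous_qfd.
have [z [fz fz0]] : exists z, ((fut : set E) `&` [set v | f v < 0]) (intv z).
  apply: dense_intv.
  - apply: openI; first exact: open_fut.
    by apply: (@open_comp _ _ f [set x : R | x < 0]); [move=> v _; exact: cf|exact: open_lt].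
  - by exists b; split => //=; rewrite /f subr_lt0.
  - move=> s v s0 [fv /= fv0]; split; first exact: futZ.
    rewrite /f /= pairingZ qfZl qfZr (_ : - (s * (s * g v v)) = s ^+ 2 * - g v v); last by rewrite mulrA -expr2 mulrN.
    by rewrite sqrtrM ?sqr_ge0// sqrtr_sqr gtr0_norm// mulrCA -mulrBr pmulr_rlt0.
have n0 : 0 < Num.sqrt (- g (intv z) (intv z)) by rewrite sqrtr_gt0 oppr_gt0; case: fz.
have := cone_inf_le fz; rewrite ler_pdivlMr// -subr_ge0 => /le_lt_trans /(_ fz0).
by rewrite ltxx.
Qed.

(** A positive infimum makes [a] future timelike of at least that length by duality, and the
    reversed Cauchy-Schwarz inequality gives the converse bound. If the infimum is 0, [a] is causal,
    and it cannot be timelike: the future case contradicts the converse bound, the past case the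
    sign of the pairing with [- a]. *)
Lemma cone_inf_sqr : cone_inf A ^+ 2 = - (A *m invmx G *m A^T) 0 0.
Proof.
have -> : - (A *m invmx G *m A^T) 0 0 = - g a a.
  by rewrite aE /pairing /a mulNmx [in RHS]mxE opprK.
have fa_le : fut a -> Num.sqrt (- g a a) <= cone_inf A.
  move=> fa; apply: lb_le_inf => // _ [z fz <-].
  rewrite ler_pdivlMr; last by rewrite sqrtr_gt0 oppr_gt0; case: fz.
  have := fut_le Gsym Gsig XX fa fz; rewrite mulrC => /le_trans; apply.
  by rewrite (qfC _ _ Gsym) aE opprK.
have := cone_inf_ge0; rewrite le_eqVlt => /predU1P[m0|m0].
  have aa : g a a <= 0.
    by apply: (dual_causal Gsym Gsig XX) => b fb; have := cone_inf_real fb; rewrite -m0 mul0r.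
  rewrite -m0 expr0n /=; apply/eqP; rewrite eq_sym oppr_eq0 eq_le aa leNgt; apply/negP => aa0.
  have a0 : a != 0 by apply: contraTneq aa0 => ->; rewrite qf0l ltxx.
  have [aX|aX] := leP (g a X) 0.
    have aX' := causal_dot_lt0 Gsym Gsig XX a0 (ltW aa0) aX.
    have := fa_le (conj aa0 aX'); rewrite -m0 leNgt => /negP; apply.
    by rewrite sqrtr_gt0 oppr_gt0.
  have fN : fut (- a) by split; [rewrite qfNl qfNr opprK|rewrite qfNl oppr_lt0].
  by have := cone_inf_real fN; rewrite -m0 mul0r qfNl opprK leNgt aa0.
have [fa ma] := dual_fut Gsym XX m0 cone_inf_real.
have -> : cone_inf A = Num.sqrt (- g a a) by apply/eqP; rewrite eq_le ma fa_le.
by rewrite sqr_sqrtr// oppr_ge0 ltW//; case: fa.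
Qed.

End cone_inf.

End cone_linear_forms.

(** * Causal curves *)

Section derive_line.
Context {R : realType} {V W : normedModType R}.

Let derive_line_quotient (f : V -> W) (y w : V) (t : R) :
  (fun h : R => h^-1 *: (((fun s : R => f (y + s *: w)) \o shift t) (h *: (1 : R)) - f (y + t *: w))) =
  (fun h : R => h^-1 *: ((f \o shift (y + t *: w)) (h *: w) - f (y + t *: w))).
Proof.
apply/funext => h; congr (_ *: (f _ - _)); rewrite /shift /= scalerDl addrCA.
by rewrite [h *: 1]mulr1.
Qed.

Lemma derivable_line (f : V -> W) (y w : V) (t : R) :
  derivable (fun s : R => f (y + s *: w)) t 1 <-> derivable f (y + t *: w) w.
Proof. by rewrite /derivable derive_line_quotient. Qed.

Lemma derive_line (f : V -> W) (y w : V) (t : R) :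
  'D_1 (fun s : R => f (y + s *: w)) t = 'D_w f (y + t *: w).
Proof. by rewrite /derive derive_line_quotient. Qed.

End derive_line.

Section vector_curves.
Context {R : realType} {m : nat}.

Lemma is_derive_coord (V : normedModType R) (f : V -> 'rV[R]_m) x v df j :
  is_derive x v f df -> is_derive x v (fun y => f y 0 j) (df 0 j).
Proof.
move=> [df1 <-]; have h := (derivable_mxP f x v).1 df1 0 j.
by split => //; rewrite derive_mx// mxE.
Qed.

Lemma curve_mvt (f : R -> 'rV[R]_m) (df : R -> 'rV[R]_m) (a b : R) j : a <= b ->
  (forall t, a <= t <= b -> is_derive t (1 : R) f (df t)) ->
  exists2 c, a <= c <= b & f b 0 j - f a 0 j = df c 0 j * (b - a).
Proof.
move=> ab fd.
have fdj t : a <= t <= b -> is_derive t (1 : R) (fun t => f t 0 j) (df t 0 j).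
  by move=> /fd; exact: is_derive_coord.
have [||c cab] := @MVT_segment R (fun t => f t 0 j) (fun t => df t 0 j) a b ab.
- by move=> t; rewrite in_itv/= => /andP[t1 t2]; apply: fdj; rewrite !ltW.
- apply: derivable_within_continuous => t; rewrite in_itv/= => /fdj tab.
  exact: ex_derive.
by move=> h; exists c => //; move: cab; rewrite in_itv.
Qed.

Lemma curve_mvt_sym (f : R -> 'rV[R]_m) (df : R -> 'rV[R]_m) (a : R) j :
  (forall t, `|t| <= `|a| -> is_derive t (1 : R) f (df t)) ->
  exists2 c, `|c| <= `|a| & f a 0 j - f 0 0 j = df c 0 j * a.
Proof.
move=> fd; have [a0|a0] := leP 0 a.
  have [|c /andP[c0 ca] ce] := @curve_mvt f df 0 a j a0.
    by move=> t /andP[t0 ta]; apply: fd; rewrite !ger0_norm.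
  by exists c; rewrite ?ger0_norm// ce subr0.
have [|c /andP[c0 ca] ce] := @curve_mvt f df a 0 j (ltW a0).
  by move=> t /andP[t0 ta]; apply: fd; rewrite !ler0_norm ?lerN2// ltW.
exists c; first by rewrite !ler0_norm ?lerN2// ltW.
by rewrite -opprB ce sub0r mulrN opprK.
Qed.

End vector_curves.

Lemma curve_bound (R : realType) (m : nat) (f df : R -> 'rV[R]_m.+1) (a b K : R) : 0 <= K ->
  (forall t, a <= t <= b -> is_derive t (1 : R) f (df t)) ->
  (forall t, a <= t <= b -> `|df t| <= K) ->
  forall s t, a <= s <= b -> a <= t <= b -> `|f t - f s| <= K * `|t - s|.
Proof.
move=> K0 fd dfK.
have H s t : a <= s -> s <= t -> t <= b -> `|f t - f s| <= K * `|t - s|.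
  move=> sa st tb; apply/ler_rV_norm => [|j]; first by rewrite mulr_ge0.
  have [|c /andP[c1 c2] ce] := @curve_mvt R m.+1 f df s t j st.
    by move=> u /andP[u1 u2]; apply: fd; rewrite (le_trans sa)//= (le_trans u2).
  have := ce; rewrite !mxE => ->; rewrite normrM ler_wpM2r//.
  have : `|df c| <= K by apply: dfK; rewrite (le_trans sa)//= (le_trans c2).
  by move=> /(ler_rV_norm _ K0).
move=> s t /andP[s1 s2] /andP[t1 t2]; have [st|ts] := leP s t; first exact: H.
by rewrite distrC [`|t - s|]distrC; apply: H => //; exact: ltW.
Qed.

Lemma continuous_mulmxr (R : realType) (n m : nat) (J : 'M[R]_(n.+1, m.+1)) :
  continuous (mulmxr J : 'rV[R]_n.+1 -> 'rV[R]_m.+1).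
Proof.
suff H : forall y : 'rV[R]_n.+1, z *m J @[z --> y] --> y *m J by exact: H.
move=> y; apply/(@cvgrPdist_lt _ _ _ _ (nbhs_filter y)) => e e0.
have : \forall z \near y, forall j : 'I_m.+1, `|(y *m J - z *m J) 0 j| < e.
  apply: (@filter_forall _ _ (fun j z => `|(y *m J - z *m J) 0 j| < e) _ (nbhs_filter y)) => j.
  have E z : (z *m J) 0 j = pairing (col j J)^T z.
    by rewrite /pairing trmxK !mxE; apply: eq_bigr => i _; rewrite mxE.
  have /cvgrPdist_lt /(_ e e0) := @continuous_pairing _ _ (col j J)^T y.
  apply: (@filterS _ _ (nbhs_filter y)) => z.
  have EB (a b : 'rV[R]_m.+1) : (a - b) 0 j = a 0 j - b 0 j by rewrite !mxE.
  by rewrite EB !E.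
by apply: (@filterS _ _ (nbhs_filter y)) => z hz; apply/ltr_rV_norm.
Qed.

Section class_C1.
Context {R : realType} {n m : nat}.
Variables (U : set 'rV[R]_n.+1) (f : 'rV[R]_n.+1 -> 'rV[R]_m.+1).
Hypothesis (oU : open U) (fC1 : class_C 1 U f).

Let fder x v : U x -> derivable f x v.
Proof. by move=> Ux; have [_ /(_ v)[+ _]] := fC1; apply. Qed.

Let fdc x v : U x -> {for x, continuous ('D_v f)}.
Proof. by move=> Ux; have [_ /(_ v)[_ +]] := fC1; apply. Qed.

(** [class_C] only speaks of directional derivatives. The increment is split into moves along the
    coordinate axes, each estimated by the mean value theorem and the continuity of one partial
    derivative. *)
Lemma class_C1_differentiable x : U x -> differentiable f x.
Proof.
move=> Ux.
pose J : 'M[R]_(n.+1, m.+1) := \matrix_(i, j) 'D_(delta_mx 0 i) f x 0 j.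
have Jrow i j : J i j = 'D_(delta_mx 0 i) f x 0 j by rewrite mxE.
have key (e : R) : 0 < e -> \forall h \near (0 : 'rV[R]_n.+1),
    `|f (h + x) - f x - h *m J| <= n.+1%:R * e * `|h|.
  move=> e0.
  have nearD i : \forall y \near x, `|'D_(delta_mx 0 i) f x - 'D_(delta_mx 0 i) f y| < e.
    by have /cvgrPdist_lt := @fdc x (delta_mx 0 i) Ux; apply.
  have allD : \forall y \near x, U y /\ forall i : 'I_n.+1,
      `|'D_(delta_mx 0 i) f x - 'D_(delta_mx 0 i) f y| < e.
    apply: filterI; first exact: open_nbhs_nbhs.
    apply: (@filter_forall _ _ _ _ _ nearD).
  have /nbhs_ballP[r /= r0 xr] := allD.
  near=> h.
  have hr : `|h| < r.
    near: h; apply/nbhs_ballP; exists r => // y; rewrite -ball_normE /= sub0r normrN.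
    by [].
  apply/ler_rV_norm => [|j]; first by rewrite !mulr_ge0// ltW.
  (* The corner after [k] moves; every intermediate point still has norm at most that of [h]. *)
  pose s (k : nat) : 'rV[R]_n.+1 := \row_i (if (i < k)%N then h 0 i else 0).
  have sh : s n.+1 = h by apply/rowP => i; rewrite mxE ltn_ord.
  suff : forall k, (k <= n.+1)%N ->
      `|(f (s k + x) - f x - s k *m J) 0 j| <= k%:R * e * `|h|.
    by move=> /(_ n.+1 (leqnn _)); rewrite sh.
  elim=> [_|k IH kn].
    have -> : s 0%N = 0 by apply/rowP => i; rewrite !mxE.
    by rewrite add0r subrr mul0mx subr0 mxE normr0 !mul0r.
  pose i0 : 'I_n.+1 := Ordinal kn.
  have sS : s k.+1 = s k + h 0 i0 *: delta_mx 0 i0.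
    apply/rowP => i; rewrite !mxE eqxx/= ltnS leq_eqVlt.
    have [ik|ik] := eqVneq i i0.
      by rewrite ik /= eqxx ltnn/= mulr1 add0r.
    have /negbTE -> : (i != k :> nat) by apply: contra ik => /eqP ik; apply/eqP/val_inj.
    by rewrite /= mulr0 addr0.
  have hi i : `|h 0 i| <= `|h| by exact: ((ler_rV_norm h (normr_ge0 h)).1 (lexx _)).
  have le_s (t : R) : `|t| <= `|h 0 i0| -> `|s k + t *: delta_mx 0 i0| <= `|h|.
    move=> t1; apply/ler_rV_norm => // i; rewrite !mxE eqxx/=.
    have [->|ik] := eqVneq i i0.
      by rewrite /= ltnn add0r mulr1; exact: le_trans t1 (hi i0).
    by rewrite mulr0 addr0; case: ifP; rewrite ?normr0.
  have nearx (t : R) : `|t| <= `|h 0 i0| -> U (s k + x + t *: delta_mx 0 i0) /\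
      `|'D_(delta_mx 0 i0) f x - 'D_(delta_mx 0 i0) f (s k + x + t *: delta_mx 0 i0)| < e.
    move=> ht; have [|h1 h2] := xr (s k + x + t *: delta_mx 0 i0); last by split.
    rewrite -ball_normE /= addrAC addrC opprD addNKr normrN.
    by apply: le_lt_trans hr; exact: le_s.
  have [|c c1 ce] := @curve_mvt_sym R m.+1 (fun t : R => f ((s k + x) + t *: delta_mx 0 i0))
     (fun t : R => 'D_(delta_mx 0 i0) f ((s k + x) + t *: delta_mx 0 i0)) (h 0 i0) j.
    move=> t ht; rewrite -derive_line; apply: derivableP; apply/derivable_line.
    by apply: fder; exact: (nearx t ht).1.
  have -> : (f (s k.+1 + x) - f x - s k.+1 *m J) 0 j = (f (s k + x) - f x - s k *m J) 0 j +
      ('D_(delta_mx 0 i0) f ((s k + x) + c *: delta_mx 0 i0) 0 j - 'D_(delta_mx 0 i0) f x 0 j) * h 0 i0.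
    rewrite mulrBl -ce scale0r addr0 sS mulmxDl -scalemxAl -rowE addrAC.
    rewrite [s k + _ + x]addrAC.
    have JE : row i0 J 0 j = 'D_(delta_mx 0 i0) f x 0 j by rewrite !mxE.
    by move: (row i0 J) JE (s k *m J) => r1 JE q; rewrite !mxE JE; ring.
  rewrite -natr1 [(_ + 1) * e]mulrDl mul1r [(_ + e) * _]mulrDl (le_trans (ler_normD _ _))// lerD//; first exact/IH/ltnW.
  rewrite normrM ler_pM ?hi//.
  have [_ /ltW] := nearx c c1; rewrite distrC => /(ler_rV_norm _ (ltW e0)) /(_ j).
  by rewrite !mxE.
have cJ : continuous (mulmxr J : 'rV[R]_n.+1 -> 'rV[R]_m.+1) by exact: continuous_mulmxr.
have dE : 'd f x = mulmxr J :> ('rV[R]_n.+1 -> 'rV[R]_m.+1).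
  apply: diff_unique => //; apply/eqaddoP => _ /posnumP[e].
  have e1 : 0 < e%:num / n.+1%:R by rewrite divr_gt0.
  apply: filterS (key _ e1) => h; rewrite [n.+1%:R * _]mulrC divfK//= /shift.
  rewrite (_ : (_ - _) h = f (h + x) - f x - h *m J)//.
  by rewrite !fctE /= opprD addrA.
apply/diff_locallyP; rewrite dE; split => //.
apply/eqaddoP => _ /posnumP[e].
have e1 : 0 < e%:num / n.+1%:R by rewrite divr_gt0.
apply: filterS (key _ e1) => h; rewrite [n.+1%:R * _]mulrC divfK//= /shift.
rewrite (_ : (_ - _) h = f (h + x) - f x - h *m J)//.
by rewrite !fctE /= opprD addrA.
Unshelve. all: by end_near. Qed.

End class_C1.


Section affine.
Context {R : realType}.
Local Notation mu := (@lebesgue_measure R).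
Variables (a b : R) (a0 : 0 < a).

Let aff : measurableTypeR R -> measurableTypeR R := fun s => a * s + b.

Lemma measurable_affine : measurable_fun setT aff.
Proof. by apply: measurable_funD => //; apply: measurable_funM. Qed.

Lemma lebesgue_measure_affine (A : set R) : measurable A ->
  (a%:E * mu (aff @^-1` A) = mu A)%E.
Proof.
move=> mA.
have a1 : 0 <= a by exact: ltW.
have mf : measurable_fun setT aff := measurable_affine.
suff H : mscale (NngNum a1) (pushforward mu aff) A = mu A by exact: (H mf).
move=> ?; apply/esym/lebesgue_measure_unique => //=.
move=> X /ocitvP[->|[[x y] /= xy ->]]; first by rewrite !measure0.
rewrite /mscale /= /pushforward (_ : _ @^-1` _ = `](x - b) / a, (y - b) / a]%classic).
  rewrite !lebesgue_measure_itv/= !lte_fin ltr_pM2r ?invr_gt0// ltrD2r xy -!EFinB -EFinM.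
  by congr (_%:E); rewrite -mulrBl mulrCA divff ?gt_eqF// mulr1 opprB addrA subrK.
by apply/seteqP; split=> z /=; rewrite !in_itv/= /aff ltr_pdivrMr// ler_pdivlMr// ltrBlDr lerBrDr mulrC.
Qed.

Lemma ae_affine (P : R -> Prop) : {ae mu, forall t, P t} ->
  {ae mu, forall s, P (a * s + b)}.
Proof.
move=> [N [mN N0 PN]]; exists (aff @^-1` N); split.
- by rewrite -[X in measurable X]setTI; exact: measurable_affine.
- have := lebesgue_measure_affine mN; rewrite N0 => /eqP; rewrite mule_eq0 => /orP[|/eqP//].
  by rewrite eqe gt_eqF.
- by move=> s /= ns; apply: PN.
Qed.

Lemma ge0_integral_affine (D : set R) (f : R -> \bar R) : measurable D ->
  measurable_fun D f -> (forall t, D t -> (0 <= f t)%E) ->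
  (a%:E * \int[mu]_(s in aff @^-1` D) f (a * s + b)%R = \int[mu]_(t in D) f t)%E.
Proof.
move=> mD mf f0.
have a1 : 0 <= a by exact: ltW.
have := ge0_integral_pushforward measurable_affine (@lebesgue_measure R) mD mf.
move=> E1; rewrite -[X in (_ * X)%E](E1 _); last by move=> y /set_mem; exact: f0.
have ma : measurable_fun setT aff := measurable_affine.
apply: etrans (esym (@ge0_integral_mscale _ _ R (pushforward mu aff) D mD (NngNum a1) f mf f0)) _.
by apply: eq_measure_integral => B mB _; exact: lebesgue_measure_affine.
Qed.

End affine.

Section vector_lipschitz.
Context {R : realType} {m : nat}.
Implicit Types f : R -> 'rV[R]_m.+1.

Lemma lipschitz_itvP f (a b : R) : [lipschitz f t | t in `[a, b]] <->
  exists2 K : R, 0 <= K & forall s t, a <= s <= b -> a <= t <= b -> `|f t - f s| <= K * `|t - s|.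
Proof.
split=> [[M [_ hM]]|[K K0 hK]].
  exists (Num.max M 0 + 1); first by rewrite addr_ge0// le_max lexx orbT.
  move=> s t sab tab; apply: (hM (Num.max M 0 + 1) _ (t, s)).
    by rewrite /= ltr_pwDr// le_max lexx.
  by split; rewrite /= in_itv/=.
exists K; split; first exact: num_real.
move=> M KM [t s] [/=]; rewrite !in_itv/= => tab sab.
by apply: le_trans (hK _ _ sab tab) _; rewrite ler_wpM2r// ltW.
Qed.

Lemma derive_affine f (a b s : R) : derivable f (a * s + b) 1 ->
  derivable (fun t => f (a * t + b)) s 1 /\
  derive1 (fun t => f (a * t + b)) s = a *: derive1 f (a * s + b).
Proof.
move=> df.
have dphi : is_derive s (1 : R) (fun t : R => a * t + b) a.
  apply/is_derive1P; apply/cvgrPdist_lt => e e0.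
  near=> h; rewrite (_ : a * (s + h) + b - (a * s + b) = h * a); last by ring.
  by rewrite mulKf ?subrr ?normr0//; near: h; exact: nbhs_dnbhs_neq.
have d1 : differentiable (fun t : R => a * t + b) s by apply/derivable1_diffP; exact: ex_derive.
have d2 : differentiable f (a * s + b) by apply/derivable1_diffP.
have d3 : differentiable (f \o (fun t : R => a * t + b)) s by exact: differentiable_comp.
split; first by apply/derivable1_diffP.
rewrite !derive1E (deriveE _ d3) (diff_comp d1 d2) /= -(deriveE _ d1).
by rewrite (derive_val (is_derive := dphi)) (deriveE _ d2) -linearZ/= [_ *: 1]mulr1.
Unshelve. all: by end_near. Qed.

End vector_lipschitz.

(** * Change of chart, reparametrization and concatenation of causal curves *)

Section curves.
Context {R : realType} {d : nat} {M : topologicalType}.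
Context {A : smooth_structure R d.+1 M} (g : lorentz_metric A) (X : vector_field A).
Implicit Types (c : chart R d.+1 M) (x : M) (v w : 'rV[R]_d.+1) (gamma : R -> M).

Lemma cimgK c y : (cmap c @` cdom c) y -> cdom c (cinv c y) /\ cmap c (cinv c y) = y.
Proof. by move=> [x dx <-]; rewrite cmapK. Qed.

Lemma gform_qf c x v w : gform g c x v w = qf (gmx g c x) v w.
Proof. by []. Qed.

Lemma gform_change c c' x v w : atlas A c -> atlas A c' -> cdom c x -> cdom c' x ->
  gform g c' x (v *m jac c c' x) (w *m jac c c' x) = gform g c x v w.
Proof.
move=> ac ac' dx dx'; rewrite /gform (gmx_change g ac ac' dx dx') trmx_mul.
by rewrite !mulmxA.
Qed.

Lemma open_transition c c' : open (cmap c @` (cdom c `&` cdom c')).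
Proof.
rewrite openE => _ [x [dx dx'] <-].
have ic : (cmap c @` cdom c) (cmap c x) by exists x.
have n1 : nbhs (cmap c x) (cmap c @` cdom c) by apply: open_nbhs_nbhs; split => //; exact: cimg_open.
have n2 : nbhs (cmap c x) (cinv c @^-1` cdom c').
  apply: (cinv_continuous ic); rewrite cmapK//; apply: open_nbhs_nbhs; split => //; exact: cdom_open.
apply: filterS (filterI n1 n2) => _ [[y dy <-] /=]; rewrite cmapK// => dy'.
by exists y.
Qed.

Lemma transition_differentiable c c' x : atlas A c -> atlas A c' -> cdom c x -> cdom c' x ->
  differentiable (transition c c') (cmap c x).
Proof.
move=> ac ac' dx dx'.
have Ux : (cmap c @` (cdom c `&` cdom c')) (cmap c x) by exists x.
exact (class_C1_differentiable (@open_transition c c') (atlas_smooth ac ac' 1%N) Ux).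
Qed.

Lemma velocity_change c c' gamma t : atlas A c -> atlas A c' ->
  cdom c (gamma t) -> cdom c' (gamma t) -> {for t, continuous gamma} ->
  derivable (cmap c \o gamma) t 1 ->
  derivable (cmap c' \o gamma) t 1 /\
  velocity c' gamma t = velocity c gamma t *m jac c c' (gamma t).
Proof.
move=> ac ac' dt dt' cg dc.
have near_eq : \forall s \near t, (transition c c' \o (cmap c \o gamma)) s = (cmap c' \o gamma) s.
  have : \forall s \near t, cdom c (gamma s).
    by apply: cg; apply: open_nbhs_nbhs; split => //; exact: cdom_open.
  by apply: filterS => s ds; rewrite /transition /= cmapK.
have d1 : differentiable (cmap c \o gamma) t by apply/derivable1_diffP.
have d2 : differentiable (transition c c') (cmap c (gamma t)) by exact: transition_differentiable.
have d3 : differentiable (transition c c' \o (cmap c \o gamma)) t by exact: differentiable_comp.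
split.
  by apply: (near_eq_derivable near_eq); apply/derivable1_diffP.
rewrite /velocity !derive1E -(near_eq_derive _ near_eq) (deriveE _ d3) (diff_comp d1 d2) /=.
by rewrite -(deriveE _ d1) /jac -(deriveEjacobian _ d2) (deriveE _ d2).
Qed.

Lemma continuous_itv_interior gamma t : {within `[0, 1], continuous gamma} -> 0 < t < 1 ->
  {for t, continuous gamma}.
Proof.
move=> cg t01.
have nI : nbhs (t : R) (`[0, 1]%classic : set R).
  have t01' : (t : R) \in `]0, 1[ by rewrite in_itv.
  by apply: filterS (near_in_itvoo t01') => s; apply: subset_itv_oo_cc.
have E : nbhs (t : subspace `[0, 1]%classic) = nbhs (t : R).
  have tI : (`[0, 1]%classic : set R) t by exact: nbhs_singleton nI.
  exact: (etrans (esym (nbhs_subspace_in tI)) (within_interior nI)).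
have cgt : gamma @ nbhs (t : subspace `[0, 1]%classic) --> gamma t := cg t.
by rewrite E in cgt.
Qed.

Lemma lipschitz_abs_continuous_on (f : R -> 'rV[R]_d.+1) (a b : R) :
  [lipschitz f t | t in `[a, b]] -> abs_continuous_on a b f.
Proof.
move=> /lipschitz_itvP[K K0 hK] e e0.
have K1 : 0 < K + 1 by rewrite ltr_wpDl.
exists (e / (K + 1)); first by rewrite divr_gt0.
move=> n s t st _ sum.
apply: (@le_lt_trans _ _ ((K + 1) * \sum_i (t i - s i))); last first.
  by rewrite mulrC -ltr_pdivlMr.
rewrite mulr_sumr; apply: ler_sum => i _; have [a1 a2 a3] := st i.
have -> : t i - s i = `|t i - s i| by rewrite ger0_norm// subr_ge0.
apply: le_trans (hK _ _ _ _) _; rewrite ?a1 ?a3 ?(le_trans a2)//= ?(le_trans a1)//.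
by rewrite ler_wpM2r// lerDl.
Qed.

Definition lcurve gamma := @lipschitz_curve R d M A gamma /\ fd_causal_curve g X gamma.

Definition fd_at gamma (t : R) := forall c, atlas A c -> cdom c (gamma t) ->
  let v := velocity c gamma t in
  [/\ derivable (cmap c \o gamma) t 1, gform g c (gamma t) v v <= 0
    & future_directed g X c (gamma t) v \/ v = 0].

Lemma lcurveI gamma : @lipschitz_curve R d M A gamma ->
  {ae lebesgue_measure, forall t : R, 0 < t < 1 -> fd_at gamma t} -> lcurve gamma.
Proof.
move=> lg aeg; split => //; split.
  have [cg lip] := lg; split => // c a b ac a0 ab b1 dc.
  by apply: lipschitz_abs_continuous_on; exact: lip.
apply: ae_imp (ae_and aeg (ae_and (ae_neq 0) (ae_neq 1))) => t [ft [t0 t1]].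
rewrite in_itv/= => /andP[t2 t3]; apply: ft.
by rewrite !lt_neqAle t2 t3 t1 eq_sym t0.
Qed.

Lemma lcurve_fd gamma : lcurve gamma ->
  {ae lebesgue_measure, forall t : R, 0 < t < 1 -> fd_at gamma t}.
Proof.
move=> [_ [_ aeg]]; apply: ae_imp aeg => t ft /andP[t0 t1]; apply: ft.
by rewrite in_itv/= !ltW.
Qed.

Lemma time_sep_ge (gamma : R -> M) : lcurve gamma ->
  (length g gamma <= time_sep g X (gamma 0%R) (gamma 1%R))%E.
Proof. by move=> [l f]; apply: ereal_sup_ubound; exists gamma. Qed.

Lemma length_ge0 gamma : (0 <= length g gamma)%E.
Proof. by apply: integral_ge0 => t _; rewrite lee_fin sqrtr_ge0. Qed.

(** The supremum of the empty set is [-oo], so a nonnegative value forces some curve to exist. *)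
Lemma time_sep_curve x y : (0 <= time_sep g X x y)%E ->
  exists gamma, [/\ lcurve gamma, gamma 0 = x & gamma 1 = y].
Proof.
move=> xy; apply: contrapT => nc; move: xy.
rewrite /time_sep (_ : [set length g gamma | gamma in _] = set0) ?ereal_sup0//.
by apply/seteqP; split=> // z [gamma [l f g0 g1] _]; apply: nc; exists gamma.
Qed.

End curves.

Lemma within_comp_affine {R : realType} {M : topologicalType} (gamma : R -> M) (a b : R) (B C : set R) :
  {within C, continuous gamma} -> (forall s, B s -> C (a * s + b)) ->
  {within B, continuous (fun s => gamma (a * s + b))}.
Proof.
move=> /subspace_continuousP cg BC; apply/subspace_continuousP => s Bs P nP.
have h := cg _ (BC _ Bs) P nP.
have caff : (a * t + b) @[t --> s] --> a * s + b.
  by apply: cvgD; [apply: cvgM; [exact: cvg_cst|exact: cvg_id]|exact: cvg_cst].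
have K : nbhs s [set t | C (a * t + b) -> P (gamma (a * t + b))] := caff _ h.
change (nbhs s [set t | B t -> P (gamma (a * t + b))]).
by apply: filterS K => t ht Bt; exact/ht/BC.
Qed.

Section curve_operations.
Context {R : realType} {d : nat} {M : topologicalType}.
Context {A : smooth_structure R d.+1 M} (g : lorentz_metric A) (X : vector_field A).
Implicit Types (c : chart R d.+1 M) (x : M) (v w : 'rV[R]_d.+1) (gamma : R -> M).

Lemma future_directedZ c x (a : R) v : 0 < a -> future_directed g X c x v ->
  future_directed g X c x (a *: v).
Proof.
move=> a0; rewrite /future_directed /causal /timelike /null !gform_qf !qfZl !qfZr.
move=> [h vX]; split; last by rewrite pmulr_rlt0.
case: h => [tv|[nv v0]]; [left|right]; first by rewrite !pmulr_rlt0.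
by rewrite nv !mulr0; split=> // /eqP; rewrite scaler_eq0 gt_eqF//= => /eqP.
Qed.

Lemma fd_at_affine gamma (a b s : R) : 0 < a -> fd_at g X gamma (a * s + b) ->
  fd_at g X (fun t => gamma (a * t + b)) s.
Proof.
move=> a0 h c ac dc; have [dg vv fv] := h c ac dc.
have [d1 d2] := derive_affine dg.
rewrite /= /velocity /comp d2; split => //.
- rewrite gform_qf qfZl qfZr pmulr_rle0// pmulr_rle0//.
- case: fv => [fv|fv0]; first by left; exact: future_directedZ.
  by right; rewrite [derive1 _ _]fv0 scaler0.
Qed.

Lemma near_fd_at gamma gamma' (t : R) : (\forall s \near t, gamma s = gamma' s) ->
  fd_at g X gamma t -> fd_at g X gamma' t.
Proof.
move=> gg h c ac; have gt := nbhs_singleton gg; rewrite -gt => dc.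
have ng : \forall s \near t, (cmap c \o gamma) s = (cmap c \o gamma') s.
  by apply: filterS gg => s /= ->.
have [dg vv fv] := h c ac dc.
have E : velocity c gamma' t = velocity c gamma t.
  by rewrite /velocity !derive1E; apply/esym/near_eq_derive.
cbv zeta; rewrite E; split; [exact: (near_eq_derivable ng)|exact: vv|exact: fv].
Qed.

Lemma sub_lcurve gamma (a b : R) : 0 <= a -> a < b -> b <= 1 -> lcurve g X gamma ->
  lcurve g X (fun s => gamma ((b - a) * s + a)).
Proof.
move=> a0 ab b1 lg; have [[cg lip] _] := lg.
have ba0 : 0 < b - a by rewrite subr_gt0.
have I01 (s : R) : 0 <= s <= 1 -> 0 <= (b - a) * s + a <= 1.
  by move=> /andP[s0 s1]; apply/andP; split; nra.
apply: lcurveI; first split.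
- apply: (@within_comp_affine _ _ gamma (b - a) a _ `[0, 1]%classic) => //.
- move=> c a' b' ac a'0 ab' b'1 sub.
  have /lipschitz_itvP[K K0 hK] : [lipschitz (cmap c \o gamma) t | t in `[(b - a) * a' + a, (b - a) * b' + a]].
    apply: lip => //.
    - nra.
    - by rewrite lerD2r ler_pM2l.
    - nra.
    - move=> _ [t /= + <-]; rewrite in_itv/= => /andP[t1 t2]; apply: sub.
      exists ((t - a) / (b - a)); last by rewrite mulrC divfK ?gt_eqF// subrK.
      by rewrite /= in_itv/= ler_pdivlMr// ler_pdivrMr// lerBrDr lerBlDr ![_ * (b - a)]mulrC t1.
  apply/lipschitz_itvP; exists (K * (b - a)); first by rewrite mulr_ge0// ltW.
  move=> s t /andP[s1 s2] /andP[t1 t2] /=.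
  apply: le_trans (hK _ _ _ _) _; rewrite ?lerD2r ?ler_pM2l ?s1 ?s2 ?t1 ?t2//.
  by rewrite opprD addrACA subrr addr0 -mulrBr normrM (gtr0_norm ba0) mulrA.
- apply: ae_imp (ae_affine a ba0 (lcurve_fd lg)) => s h /andP[s0 s1].
  apply: (fd_at_affine ba0); apply: h; apply/andP; split; nra.
Qed.

Lemma lcurve_time_sep gamma (s t : R) : lcurve g X gamma -> 0 <= s -> s <= t -> t <= 1 ->
  (0 <= time_sep g X (gamma s) (gamma t))%E.
Proof.
move=> lg s0 st t1; have [->|ne] := eqVneq s t; first exact: time_sep_refl.
have {}st : s < t by rewrite lt_neqAle ne.
have := time_sep_ge (sub_lcurve s0 st t1 lg).
by rewrite mulr0 add0r mulr1 subrK; apply: le_trans; exact: length_ge0.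
Qed.

Lemma lipschitz_glue (f : R -> 'rV[R]_d.+1) (a m b : R) : a <= m <= b ->
  [lipschitz f t | t in `[a, m]] -> [lipschitz f t | t in `[m, b]] ->
  [lipschitz f t | t in `[a, b]].
Proof.
move=> /andP[am mb] /lipschitz_itvP[K K0 hK] /lipschitz_itvP[K' K'0 hK'].
have KK : 0 <= K + K' by exact: addr_ge0.
have H s t : a <= s -> s <= t -> t <= b -> `|f t - f s| <= (K + K') * `|t - s|.
  move=> sa st tb; have [tm|mt] := leP t m.
    by apply: le_trans (hK _ _ _ _) _; rewrite ?sa ?(le_trans st)//= ?(le_trans sa)// ler_wpM2r// lerDl.
  have [ms|sm] := leP m s.
    by apply: le_trans (hK' _ _ _ _) _; rewrite ?ms ?(le_trans st)//= ?(le_trans ms)// ler_wpM2r// lerDr.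
  rewrite -(subrKA (f m)); apply: le_trans (ler_normD _ _) _.
  rewrite [(K + K') * _]mulrDl [leRHS]addrC; apply: lerD.
    apply: le_trans (hK' _ _ _ _) _; rewrite ?lexx ?mb ?(ltW mt)//.
    by rewrite ler_wpM2l// !ger0_norm ?subr_ge0 ?(ltW mt)// lerD2l lerN2 ltW.
  apply: le_trans (hK _ _ _ _) _; rewrite ?lexx ?sa ?am ?(ltW sm)//.
  by rewrite ler_wpM2l// !ger0_norm ?subr_ge0 ?(ltW sm)// lerD2r ltW.
apply/lipschitz_itvP; exists (K + K') => // s t /andP[s1 s2] /andP[t1 t2].
have [st|ts] := leP s t; first exact: H.
by rewrite distrC [`|t - s|]distrC; apply: H => //; exact: ltW.
Qed.

(** The terms [+ 0] and [+ (- 1)] keep both halves in the form [a * t + b] of the affine lemmas. *)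
Lemma concat_lcurve gamma1 gamma2 : lcurve g X gamma1 -> lcurve g X gamma2 ->
  gamma1 1 = gamma2 0 ->
  lcurve g X (fun t => if t <= 2^-1 then gamma1 (2 * t + 0) else gamma2 (2 * t + (- 1))).
Proof.
move=> l1 l2 g12; set gam := fun t : R => _.
have [[c1 lip1] _] := l1; have [[c2 lip2] _] := l2.
have E1 t : t <= 2^-1 -> gam t = gamma1 (2 * t + 0) by move=> t2; rewrite /gam t2.
have E2 t : 2^-1 <= t -> gam t = gamma2 (2 * t + -1).
  rewrite le_eqVlt => /predU1P[<-|t2]; last by rewrite /gam leNgt t2.
  by rewrite E1// divff// addr0 subrr.
have h0 : 0 < (2 : R) by [].
have h12 : (2^-1 : R) = 1 / 2 by rewrite mul1r.
apply: lcurveI; first split.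
- have -> : `[0, 1]%classic = `[0, 2^-1]%classic `|` `[2^-1, 1]%classic :> set R.
    apply/seteqP; split=> t /=; rewrite !in_itv/=.
      move=> /andP[t0 t1]; have [?|/ltW ?] := leP t 2^-1; [left|right]; lra.
    by case=> /andP[? ?]; lra.
  apply: withinU_continuous; [exact: itv_closed|exact: itv_closed| |].
    apply: (@subspace_eq_continuous R _ M (fun t => gamma1 (2 * t + 0))).
      by move=> t /set_mem /=; rewrite in_itv/= => /andP[_ t2]; exact: (esym (E1 _ t2)).
    apply: (@within_comp_affine _ _ gamma1 2 0 _ `[0, 1]%classic) => // s.
    by rewrite /= !in_itv/= => /andP[? ?]; lra.
  apply: (@subspace_eq_continuous R _ M (fun t => gamma2 (2 * t + -1))).
    by move=> t /set_mem /=; rewrite in_itv/= => /andP[t2 _]; exact: (esym (E2 _ t2)).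
  apply: (@within_comp_affine _ _ gamma2 2 (-1) _ `[0, 1]%classic) => // s.
  by rewrite /= !in_itv/= => /andP[? ?]; lra.
- move=> c a b ac a0 ab b1 sub.
  have L1 (a' b' : R) : a <= a' -> a' <= b' -> b' <= b -> b' <= 2^-1 ->
      [lipschitz (cmap c \o gam) t | t in `[a', b']].
    move=> aa ab' bb b2.
    have /lipschitz_itvP[K K0 hK] : [lipschitz (cmap c \o gamma1) t | t in `[2 * a', 2 * b']].
      apply: lip1 => //; [lra|lra|lra|move=> _ [t /= + <-]; rewrite in_itv/= => /andP[t1 t2]].
      apply: sub; exists (t / 2); first by rewrite /= in_itv/=; lra.
      by rewrite E1; [congr gamma1; field|lra].
    apply/lipschitz_itvP; exists (K * 2) => [|s t /andP[s1 s2] /andP[t1 t2] /=]; first lra.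
    rewrite !E1 ?addr0; [|lra|lra]; apply: le_trans (hK _ _ _ _) _; [lra|lra|].
    by rewrite -mulrBr normrM gtr0_norm// mulrA.
  have L2 (a' b' : R) : a <= a' -> a' <= b' -> b' <= b -> 2^-1 <= a' ->
      [lipschitz (cmap c \o gam) t | t in `[a', b']].
    move=> aa ab' bb b2.
    have /lipschitz_itvP[K K0 hK] : [lipschitz (cmap c \o gamma2) t | t in `[2 * a' - 1, 2 * b' - 1]].
      apply: lip2 => //; [lra|lra|lra|move=> _ [t /= + <-]; rewrite in_itv/= => /andP[t1 t2]].
      apply: sub; exists ((t + 1) / 2); first by rewrite /= in_itv/=; lra.
      by rewrite E2; [congr gamma2; field|lra].
    apply/lipschitz_itvP; exists (K * 2) => [|s t /andP[s1 s2] /andP[t1 t2] /=]; first lra.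
    rewrite !E2; [|lra|lra]; apply: le_trans (hK _ _ _ _) _; [lra|lra|].
    by rewrite opprD addrACA subrr addr0 -mulrBr normrM gtr0_norm// mulrA.
  have [b2|b2] := leP b 2^-1; first exact: L1.
  have [a2|a2] := leP 2^-1 a; first exact: L2.
  by apply: (@lipschitz_glue _ _ 2^-1 _); [lra|apply: L1; lra|apply: L2; lra].
- have f1 := ae_affine 0 h0 (lcurve_fd l1); have f2 := ae_affine (-1) h0 (lcurve_fd l2).
  apply: ae_imp (ae_and (ae_neq 2^-1) (ae_and f1 f2)) => t [t2 [h1 h2]] /andP[t0 t1].
  have [lt|gt] := ltP t 2^-1.
    apply: (@near_fd_at (fun t => gamma1 (2 * t + 0))).
      by apply: filterS (lt_nbhsl lt) => s s2; rewrite E1// ltW.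
    apply: (fd_at_affine h0); apply: h1; lra.
  have {}gt : 2^-1 < t by rewrite lt_neqAle eq_sym t2.
  apply: (@near_fd_at (fun t => gamma2 (2 * t + -1))).
    by apply: filterS (lt_nbhsr gt) => s s2; rewrite E2// ltW.
  apply: (fd_at_affine h0); apply: h2; lra.
Qed.

(** Concatenating curves in both directions gives a closed causal curve, which must be constant; [y]
    is its value at the middle. *)
Lemma time_sep_antisym x y : causally_simple g X ->
  (0 <= time_sep g X x y)%E -> (0 <= time_sep g X y x)%E -> x = y.
Proof.
move=> [cs _] /time_sep_curve[g1 [l1 g10 g11]] /time_sep_curve[g2 [l2 g20 g21]].
have lc := concat_lcurve l1 l2 (etrans g11 (esym g20)).
have [_ fl] := lc.
have := cs _ fl; rewrite /= invr_ge0 ler0n mulr0 addr0 g10 => cl.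
have h1 : (1 <= 2^-1 :> R) = false by apply/negbTE; lra.
move: cl; rewrite h1 mulr1 (_ : 2 + -1 = 1 :> R); last by ring.
rewrite g21 => /(_ erefl 2^-1); rewrite lexx divff// addr0 g11 => -> //.
by rewrite in_itv/= invr_ge0 ler0n/=; lra.
Qed.

Definition futc c x v := fut (gmx g c x) (vcomp X c x) v.

Section segment.
Variables (c : chart R d.+1 M) (y v : 'rV[R]_d.+1).
Hypothesis ac : atlas A c.
Hypothesis img : forall t : R, 0 <= t <= 1 -> (cmap c @` cdom c) (y + t *: v).

Let gam (t : R) := cinv c (y + t *: v).

Let cline (t : R) : {for t, continuous (fun t : R => y + t *: v)}.
Proof. by apply: cvgD; [exact: cvg_cst|apply: cvgZr_tmp; exact: cvg_id]. Qed.

Lemma segment_continuous (t : R) : 0 <= t <= 1 -> {for t, continuous gam}.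
Proof.
move=> t01; apply: (@continuous_comp _ _ _ (fun t : R => y + t *: v) (cinv c)); first exact: cline.
by apply: cinv_continuous; exact: img.
Qed.

Lemma segment_velocity (t : R) : 0 <= t <= 1 ->
  derivable (cmap c \o gam) t 1 /\ velocity c gam t = v.
Proof.
move=> t01.
have nE : \forall s \near t, y + s *: v = (cmap c \o gam) s.
  have : \forall s \near t, (cmap c @` cdom c) (y + s *: v).
    by apply: cline; apply: open_nbhs_nbhs; split; [exact: cimg_open|exact: img].
  by apply: filterS => s /cimgK[_ /esym].
have dl : is_derive t (1 : R) (fun s : R => y + s *: v) v.
  split; first by apply/(@derivable_line R _ _ id); exact: derivable_id.
  by rewrite (@derive_line R _ _ id) derive_id.
split; first by apply: (near_eq_derivable nE); exact: ex_derive.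
by rewrite /velocity derive1E -(near_eq_derive _ nE); exact: derive_val.
Qed.

(** A segment is straight in [c] only; in another chart its velocity is a directional derivative of
    the transition map, bounded on the compact parameter interval. *)
Lemma segment_lipschitz : @lipschitz_curve R d M A gam.
Proof.
split.
  by apply: continuous_in_subspaceT => t /set_mem; rewrite /= in_itv/=; exact: segment_continuous.
move=> c' a b ac' a0 ab b1 sub.
pose f := transition c c'.
have tU t : a <= t <= b -> (cmap c @` (cdom c `&` cdom c')) (y + t *: v).
  move=> /andP[t1 t2]; have [] := @cimgK R d M c (y + t *: v).
    by apply: img; rewrite (le_trans a0)//= (le_trans t2).
  by move=> h1 h2; exists (gam t) => //; split => //; apply: sub; exists t => //=; rewrite in_itv/= t1.
have [_ fC1] := atlas_smooth ac ac' 1%N.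
have [fd fc] := fC1 v.
have der t : a <= t <= b -> is_derive t (1 : R) (cmap c' \o gam) ('D_v f (y + t *: v)).
  move=> /tU tab; split; first by apply: (derivable_line f y v t).2; exact: fd.
  exact: (derive_line f).
have [t0 _ t0max] : exists2 t0 : R, t0 \in `[a, b] & forall t, t \in `[a, b] ->
    `|'D_v f (y + t *: v)| <= `|'D_v f (y + t0 *: v)|.
  apply: EVT_max => //; apply: continuous_in_subspaceT => t /set_mem; rewrite /= in_itv/= => tab.
  apply: (@continuous_comp _ _ _ (fun t : R => 'D_v f (y + t *: v)) Num.norm); last exact: norm_continuous.
  apply: (@continuous_comp _ _ _ (fun t : R => y + t *: v) ('D_v f)); first exact: cline.
  exact/fc/tU.
apply/lipschitz_itvP; exists `|'D_v f (y + t0 *: v)| => //.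
apply: (curve_bound (normr_ge0 _) der) => t tab; apply: t0max; rewrite in_itv/=; exact: tab.
Qed.

Hypothesis fv : forall t : R, 0 <= t <= 1 -> futc c (gam t) v.

Lemma segment_lcurve : lcurve g X gam.
Proof.
apply: lcurveI; first exact: segment_lipschitz.
apply: aeW => t /andP[/ltW t0 /ltW t1] c' ac' dc'.
have t01 : 0 <= t <= 1 by rewrite t0.
have [dct _] := cimgK (img t01).
have [dv ve] := segment_velocity t01.
have [dv' ve'] := velocity_change ac ac' dct dc' (segment_continuous t01) dv.
rewrite /= ve' ve; have [vv vX] := fv t01.
have E1 : gform g c' (gam t) (v *m jac c c' (gam t)) (v *m jac c c' (gam t)) < 0.
  by rewrite gform_change.
split=> //; first exact: ltW.
left; split; first by left.
by rewrite (vcomp_change X ac ac' dct dc') gform_change.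
Qed.

End segment.

(** [length] is written with the auxiliary charts [chart_at A (gamma t)]; this brings its integrand
    to the working chart. *)
Lemma speed_chart c gamma t : atlas A c -> cdom c (gamma t) -> {for t, continuous gamma} ->
  derivable (cmap c \o gamma) t 1 ->
  let c' := chart_at A (gamma t) in
  gform g c' (gamma t) (velocity c' gamma t) (velocity c' gamma t) =
  gform g c (gamma t) (velocity c gamma t) (velocity c gamma t).
Proof.
move=> ac dc cg dg c'.
have ac' : atlas A c' by exact: chart_at_atlas.
have dc' : cdom c' (gamma t) by exact: chart_at_dom.
have [_ ->] := velocity_change ac ac' dc dc' cg dg.
exact: gform_change.
Qed.

End curve_operations.

Lemma qf_pairing (R : realType) (n : nat) (G : 'M[R]_n.+1) (u w : 'rV[R]_n.+1) :
  qf G u w = pairing (w *m G^T) u.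
Proof. by rewrite /pairing trmx_mul trmxK mulmxA. Qed.

Lemma is_derive_pairing (R : realType) (n : nat) (B : 'rV[R]_n.+1) (f : R -> 'rV[R]_n.+1) (t : R) :
  derivable f t 1 -> is_derive t (1 : R) (fun s => pairing B (f s)) (pairing B (derive1 f t)).
Proof.
move=> df.
have c1 : (fun h : R => h^-1 *: ((f \o shift t) (h *: (1 : R)) - f t)) @ 0^' --> derive1 f t.
  by rewrite derive1E; exact: df.
have c2 := cvg_comp _ _ c1 (@continuous_pairing _ _ B (derive1 f t)).
have pB u v : pairing B (u - v) = pairing B u - pairing B v.
  by rewrite pairingD -scaleN1r pairingZ mulN1r.
have c3 : (fun h : R => h^-1 *: (((fun s => pairing B (f s)) \o shift t) (h *: (1 : R)) - pairing B (f t)))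
    @ 0^' --> pairing B (derive1 f t).
  apply: cvg_trans c2; apply: near_eq_cvg; apply: nearW => h /=.
  by rewrite pairingZ pB.
by split; [exact: cvgP c3|exact: cvg_lim c3].
Qed.

(** * Local causality *)

Section local_causality.
Context {R : realType} {d : nat} {M : topologicalType}.
Context {A : smooth_structure R d.+1 M} (g : lorentz_metric A) (X : vector_field A).
Hypothesis hX : timelike_field g X.
Hypothesis hM : causally_simple g X.
Implicit Types (x y z : M) (v w u : 'rV[R]_d.+1) (gamma : R -> M).
Variables (c : chart R d.+1 M) (p : M).
Hypotheses (ac : atlas A c) (dp : cdom c p).

Local Notation E := 'rV[R]_d.+1.
Local Notation cle x y := (0 <= time_sep g X x y)%E.

Lemma near_chart (N : set M) : nbhs p N -> exists2 r : R, 0 < r &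
  forall y : E, `|y - cmap c p| <= r -> [/\ (cmap c @` cdom c) y, cdom c (cinv c y) & N (cinv c y)].
Proof.
move=> nN.
have ip : (cmap c @` cdom c) (cmap c p) by exists p.
have n1 : nbhs (cmap c p) (cmap c @` cdom c) by apply: open_nbhs_nbhs; split => //; exact: cimg_open.
have n2 : nbhs (cmap c p) (cinv c @^-1` N).
  by apply: (cinv_continuous ip); rewrite cmapK.
have n12 := filterI n1 n2; have /nbhs_ballP[r /= r0 hr] : nbhs (cmap c p) ((cmap c @` cdom c) `&` (cinv c @^-1` N)) := n12 (nbhs_filter _).
exists (r / 2) => [|y yr]; first by rewrite divr_gt0.
have [|h1 h2] := hr y.
  by rewrite -ball_normE /= distrC; apply: le_lt_trans yr _; rewrite ltr_pdivrMr// ltr_pMr// ltr1n.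
by split => //; exact: (cimgK h1).1.
Qed.

Section chart_norm.
Variable r : R.
Hypothesis r0 : 0 < r.
Hypothesis cr : forall y : E, `|y - cmap c p| <= r -> (cmap c @` cdom c) y.

(** Chart distance to [p], cut off at [r] so that it extends continuously by [r] outside the chart:
    the closed chart ball is compact, hence closed in the Hausdorff space [M]. *)
Let cdist x : R := if pselect (cdom c x) then Num.min `|cmap c x - cmap c p| r else r.

Let cdist_in x : cdom c x -> cdist x = Num.min `|cmap c x - cmap c p| r.
Proof. by move=> dx; rewrite /cdist; case: (pselect (cdom c x)). Qed.

Let cdist_out x : ~ cdom c x -> cdist x = r.
Proof. by move=> dx; rewrite /cdist; case: (pselect (cdom c x)). Qed.

Let ball_closed : closed [set x | cdom c x /\ `|cmap c x - cmap c p| <= r].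
Proof.
apply: compact_closed; first exact: M_hausdorff A.
rewrite (_ : [set x | _] = cinv c @` [set y | `|y - cmap c p| <= r]); last first.
  apply/seteqP; split=> [x [dx xr]|_ [y /= yr <-]]; first by exists (cmap c x); rewrite ?cmapK.
  by have [h1 h2] := cimgK (cr yr); rewrite h2.
apply: continuous_compact.
  by apply: continuous_in_subspaceT => y /set_mem /= yr; apply: cinv_continuous; exact: cr.
apply: bounded_closed_compact.
  exists (`|cmap c p| + r); split; first exact: num_real.
  move=> m hm y /= yr; apply: le_trans (ltW hm).
  by rewrite -lerBlDl (le_trans _ yr)// lerB_dist.
rewrite (_ : [set y | _] = (fun y : E => `|y - cmap c p|) @^-1` [set t : R | t <= r])//.
apply: closed_comp; last exact: closed_le.
move=> y _; apply: (@continuous_comp _ _ _ (fun y : E => y - cmap c p) Num.norm); last exact: norm_continuous.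
exact: continuous_subr.
Qed.

Let cdist_continuous : continuous cdist.
Proof.
move=> x; have [dx|ndx] := pselect (cdom c x).
  have nx : \forall z \near x, cdom c z by apply: open_nbhs_nbhs; split => //; exact: cdom_open.
  have cm : {for x, continuous (fun z => Num.min `|cmap c z - cmap c p| r)}.
    apply: (@continuous_min _ _ (fun z => `|cmap c z - cmap c p|) (cst r)); last exact: cst_continuous.
    apply: (@continuous_comp _ _ _ (fun z => cmap c z - cmap c p) Num.norm); last exact: norm_continuous.
    apply: (@continuous_comp _ _ _ (cmap c) (fun y : E => y - cmap c p)); last exact: continuous_subr.
    exact: cmap_continuous.
  rewrite /continuous_at cdist_in//.
  apply: cvg_trans cm; apply: near_eq_cvg; apply: filterS nx => z dz.
  by rewrite cdist_in.
have nx : \forall z \near x, cdist z = r.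
  have : nbhs x (~` [set x | cdom c x /\ `|cmap c x - cmap c p| <= r]).
    by apply: open_nbhs_nbhs; split; [exact: closed_openC|case].
  apply: filterS => z /= nz; have [dz|dz] := pselect (cdom c z); last exact: cdist_out.
  rewrite cdist_in//; apply/min_r; rewrite leNgt; apply/negP => /ltW zr; exact: nz.
by rewrite /continuous_at (cdist_out ndx); exact: cvg_near_cst.
Qed.

Lemma path_crosses_sphere gamma (e t : R) : {within `[0, 1], continuous gamma} -> 0 < e < r ->
  cdom c (gamma 0) -> `|cmap c (gamma 0) - cmap c p| < e -> 0 <= t <= 1 ->
  ~ (cdom c (gamma t) /\ `|cmap c (gamma t) - cmap c p| < e) ->
  exists2 s, 0 <= s <= 1 & cdom c (gamma s) /\ `|cmap c (gamma s) - cmap c p| = e.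
Proof.
move=> cg /andP[e0 er] d0 h0 /andP[t0 t1] nt.
have c0 : cdist (gamma 0) < e.
  by rewrite cdist_in// gt_min h0.
have ct : e <= cdist (gamma t).
  have [dt|dt] := pselect (cdom c (gamma t)); last by rewrite cdist_out// ltW.
  by rewrite cdist_in// le_min (ltW er) andbT leNgt; apply/negP => ht; apply: nt.
have [||s st hs] := @IVT R (cdist \o gamma) 0 t e t0.
- apply/subspace_continuousP => s /= + P nP; rewrite in_itv/= => /andP[s0 st].
  have s1 : `[0, 1]%classic s by rewrite /= in_itv/= s0 (le_trans st).
  have K : nbhs s [set q | `[0, 1]%classic q -> P (cdist (gamma q))].
    by have /subspace_continuousP/(_ _ s1) h := cg; exact: (h _ (cdist_continuous nP)).
  change (nbhs s [set q | `[0, t]%classic q -> P (cdist (gamma q))]).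
  apply: filterS K => q hq; rewrite /= in_itv/= => /andP[q0 qt]; apply: hq.
  by rewrite /= in_itv/= q0 (le_trans qt).
- by rewrite /= ge_min (ltW c0)/= le_max ct orbT.
move: st; rewrite in_itv/= => /andP[s0 st]; exists s; first by rewrite s0 (le_trans st).
have [ds|ds] := pselect (cdom c (gamma s)); last first.
  by move: er; rewrite -hs /= cdist_out// ltxx.
move: hs; rewrite /= cdist_in// minEle; case: ifP => [_ ->//|_ re].
by rewrite re ltxx in er.
Qed.

End chart_norm.

(** A curve leaving [N] meets a small coordinate sphere [K] around [p] at some [z] causally between
    its endpoints. Closedness of the relation and antisymmetry exclude this for endpoints close to
    [p], uniformly on the compact [K]. *)
Lemma strong_causality (N : set M) : nbhs p N ->
  \forall x \near p & y \near p, forall gamma, lcurve g X gamma -> gamma 0 = x -> gamma 1 = y ->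
    forall t, 0 <= t <= 1 -> N (gamma t).
Proof.
move=> nN; have [r r0 hr] := near_chart nN.
have cr (y : E) : `|y - cmap c p| <= r -> (cmap c @` cdom c) y by move=> /hr[].
have [r20 r2r] : 0 < r / 2 /\ r / 2 < r by rewrite divr_gt0// ltr_pdivrMr// ltr_pMr// ltr1n.
pose K := cinv c @` [set y : E | `|y - cmap c p| = r / 2].
have Kle (y : E) : `|y - cmap c p| = r / 2 -> `|y - cmap c p| <= r by move=> ->; exact: ltW.
have cK : compact K.
  apply: continuous_compact.
    by apply: continuous_in_subspaceT => y /set_mem /= /Kle yr; apply: cinv_continuous; exact: cr.
  apply: bounded_closed_compact.
    exists (`|cmap c p| + r); split; first exact: num_real.
    move=> m hm y /= /Kle yr; apply: le_trans (ltW hm).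
    by rewrite -lerBlDl (le_trans _ yr)// lerB_dist.
  rewrite (_ : [set y | _] = (fun y : E => `|y - cmap c p|) @^-1` [set t : R | t = r / 2])//.
  apply: closed_comp; last exact: closed_eq.
  move=> y _; apply: (@continuous_comp _ _ _ (fun y : E => y - cmap c p) Num.norm); last exact: norm_continuous.
  exact: continuous_subr.
have cle_closed a b : ~ cle a b -> exists U V, [/\ nbhs a U, nbhs b V &
    forall a' b', U a' -> V b' -> ~ cle a' b'].
  move=> nab; have [_ cl] := hM.
  have : nbhs (a, b) (~` [set q : M * M | cle q.1 q.2]).
    by apply: open_nbhs_nbhs; split; [exact: closed_openC|].
  move=> [[U V] /= [nU nV] UV]; exists U, V; split => // a' b' Ua Vb ab.
  exact: (UV (a', b')).
pose F := filter_prod (nbhs p) (nbhs p).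
have FF : Filter F by exact: filter_prod_filter.
(* For [z] on the sphere one of [p <= z] and [z <= p] fails; by closedness it keeps failing near [z]
   and [p]. *)
have cov : \forall i \near F, K `<=` [set z | ~ (cle i.1 z /\ cle z i.2)].
  apply: ((compact_near_coveringP K).1 cK) => z Kz.
  have zp : z <> p.
    move: Kz => [y /= yr <-] cp; have [_ h] := cimgK (cr _ (Kle _ yr)).
    by move: yr; rewrite -h cp subrr normr0 => /eqP; rewrite lt_eqF.
  have [nc|nc] : ~ cle p z \/ ~ cle z p.
    by apply/not_andP => -[h1 h2]; apply: zp; exact: (time_sep_antisym hM).
  - have [U [V [nU nV UV]]] := cle_closed _ _ nc.
    exists (V, [set i | U i.1]) => /=; first split => //.
      by exists (U, setT) => //=; [split => //; exact: filterT|move=> i []].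
    by move=> [z' i] /= [Vz Ui] [h _]; exact: (UV i.1 z').
  - have [U [V [nU nV UV]]] := cle_closed _ _ nc.
    exists (U, [set i | V i.2]) => /=; first split => //.
      by exists (setT, V) => //=; [split => //; exact: filterT|move=> i []].
    by move=> [z' i] /= [Uz Vi] [_ h]; exact: (UV z' i.2).
have nB : nbhs p [set x | cdom c x /\ `|cmap c x - cmap c p| < r / 2].
  apply: filterI; first by apply: open_nbhs_nbhs; split => //; exact: cdom_open.
  have /cvgrPdist_lt/(_ _ r20) := cmap_continuous dp.
  by apply: filterS => x; rewrite distrC.
move: cov => [[U V] /= [nU nV] UV].
exists (U `&` [set x | cdom c x /\ `|cmap c x - cmap c p| < r / 2], V) => /=.
  by split => //; exact: filterI.
move=> [x y] /= [[Ux [dx xr]] Vy] gamma lg g0 g1 t t01.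
have [tin|nt] := pselect (cdom c (gamma t) /\ `|cmap c (gamma t) - cmap c p| < r / 2).
  case: tin => dt ht; have [|_ _] := hr (cmap c (gamma t)); last by rewrite cmapK.
  by rewrite ltW// (lt_trans ht).
have [[cg _] _] := lg.
have r2 : 0 < r / 2 < r by rewrite r20.
rewrite -g0 in dx xr.
have [s s01 [ds hs]] := path_crosses_sphere cr cg r2 dx xr t01 nt.
have Ks : K (gamma s) by exists (cmap c (gamma s)); rewrite ?cmapK.
exfalso; apply: (UV (x, y) _ _ Ks) => //=; move: s01 => /andP[s0 s1].
by rewrite -g0 -g1; split; apply: lcurve_time_sep.
Qed.

Let Gp := gmx g c p.
Let Xp := vcomp X c p.
Let Gsym : Gp^T = Gp. Proof. exact: gmx_sym. Qed.
Let Gsig : exists2 P, P \in unitmx & P *m Gp *m P^T = minkowski_mx R d.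
Proof. exact: gmx_signature. Qed.
Let XX : qf Gp Xp Xp < 0. Proof. exact: hX. Qed.

Let cG : {for p, continuous (gmx g c)}. Proof. exact: gmx_continuous. Qed.
Let cX : {for p, continuous (vcomp X c)}. Proof. exact: vcomp_continuous. Qed.

Lemma pairing_bound (B : E) : exists2 K : R, 0 < K & forall u, `|pairing B u| <= K * `|u|.
Proof.
exists (1 + \sum_j `|B 0 j|) => [|u]; first by rewrite ltr_pwDl// sumr_ge0.
have hi i : `|u 0 i| <= `|u| by exact: ((ler_rV_norm u (normr_ge0 u)).1 (lexx _)).
rewrite mulrDl mul1r /pairing mxE; apply: le_trans (ler_norm_sum _ _ _) _.
rewrite ler_wpDl// mulr_suml; apply: ler_sum => j _.
by rewrite mxE normrM mulrC ler_wpM2l.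
Qed.

Section curve_pairing.
Variables (N : set M) (B : E) (k : R) (gamma : R -> M).
Hypotheses (Ndom : forall x, N x -> cdom c x) (k0 : 0 <= k).
Hypothesis hB : forall x v, N x -> gform g c x v v <= 0 -> gform g c x v (vcomp X c x) <= 0 ->
  k * Num.sqrt (- gform g c x v v) <= pairing B v.
Hypotheses (lg : lcurve g X gamma) (gN : forall t, 0 <= t <= 1 -> N (gamma t)).

Let pB u v : pairing B (u - v) = pairing B u - pairing B v.
Proof. by rewrite pairingD -scaleN1r pairingZ mulN1r. Qed.

(** Integrates a pointwise bound of the length by a constant covector [B]. With [k = 0] it says that
    a covector nonnegative on causal vectors is nonnegative on displacements. *)
Lemma integral_speed_le :
  (\int[lebesgue_measure]_(t in `[0%R, 1%R])
     (k * (let c' := chart_at A (gamma t) in let v := velocity c' gamma t in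
     Num.sqrt (- gform g c' (gamma t) v v)))%:E <=
   (pairing B (cmap c (gamma 1) - cmap c (gamma 0)))%:E)%E.
Proof.
have [[cg lip] _] := lg; rewrite pB.
have /lipschitz_itvP[L L0 hL] : [lipschitz (cmap c \o gamma) t | t in `[0, 1]].
  by apply: lip => // _ [t /= + <-]; rewrite in_itv/= => t01; exact/Ndom/gN.
have [K K0 hK] := pairing_bound B.
apply: (@lipschitz_integral_le _ (fun t => pairing B (cmap c (gamma t))) (K * L)).
- move=> s t s01 t01; rewrite -pB; apply: le_trans (hK _) _.
  by rewrite -mulrA ler_pM2l//; exact: hL.
- by move=> t; rewrite lee_fin mulr_ge0 ?sqrtr_ge0.
- apply: ae_imp (lcurve_fd lg) => t ft t01.
  have t01' : 0 <= t <= 1 by move: t01 => /andP[? ?]; rewrite !ltW.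
  have dc := Ndom (gN t01').
  have [dg vv fv] := ft t01 c ac dc.
  have dpair := is_derive_pairing B dg.
  split; first exact: ex_derive.
  rewrite derive1E (derive_val (is_derive := dpair)) lee_fin.
  have := speed_chart g ac dc (continuous_itv_interior cg t01) dg.
  cbv zeta => ->; apply: hB => //; first exact: gN.
  by case: fv => [[_ /ltW]//|->]; rewrite gform_qf qf0l.
Qed.

End curve_pairing.

Let tau (v : E) := - qf Gp v Xp.

Let tauE v : tau v = pairing (- (Xp *m Gp^T)) v.
Proof. by rewrite /tau qf_pairing /pairing linearN/= mulmxN [RHS]mxE. Qed.

Let pairingl (B1 B2 v : E) : pairing (B1 + B2) v = pairing B1 v + pairing B2 v.
Proof. by rewrite /pairing linearD/= mulmxDr mxE. Qed.

Let pairingZl (a : R) (B1 v : E) : pairing (a *: B1) v = a * pairing B1 v.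
Proof. by rewrite /pairing linearZ/= -scalemxAr mxE. Qed.

Let pairing_delta i (v : E) : pairing (delta_mx 0 i) v = v 0 i.
Proof. by rewrite /pairing trmx_delta -colE mxE. Qed.

Let nbhs_cdom : nbhs p (cdom c).
Proof. by apply: open_nbhs_nbhs; split => //; exact: cdom_open. Qed.

Let FF : Filter (filter_prod (nbhs p) (nbhs p)).
Proof. exact: filter_prod_filter. Qed.

(** The norm is not linear and cannot be integrated directly, but for each coordinate the covectors
    [C * tau] plus or minus that coordinate are nonnegative on causal vectors near [p], hence on the
    displacement. *)
Lemma norm_le_time : exists2 C : R, 0 < C & \forall x \near p & y \near p, cle x y ->
  `|cmap c y - cmap c x| <= C * - qf Gp (cmap c y - cmap c x) Xp.
Proof.
have [C C0 hC] := causal_norm_near cG cX Gsym Gsig XX.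
exists C => //.
pose N : set M := cdom c `&` [set z | forall w : E, qf (gmx g c z) w w <= 0 ->
  qf (gmx g c z) w (vcomp X c z) <= 0 -> `|w| <= C * - qf Gp w Xp].
have K := @strong_causality N (@filterI _ _ (nbhs_filter p) _ _ nbhs_cdom hC).
have K' : filter_prod (nbhs p) (nbhs p) (fun q => cle q.1 q.2 ->
  `|cmap c q.2 - cmap c q.1| <= C * - qf Gp (cmap c q.2 - cmap c q.1) Xp).
  apply: (@filterS _ _ FF _ _ _ K) => -[x y] hxy /= /time_sep_curve[gamma [lg g0 g1]].
  have gN := hxy gamma lg g0 g1.
  have nb (v : E) i : `|v 0 i| <= `|v| by exact: ((ler_rV_norm v (normr_ge0 v)).1 (lexx _)).
  have B0 (B : E) : (forall v, `|v| <= C * tau v -> 0 <= pairing B v) ->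
      0 <= pairing B (cmap c y - cmap c x).
    move=> hB; rewrite -lee_fin -g0 -g1.
    apply: le_trans (integral_speed_le (N := N) (k := 0) _ _ _ lg gN) => //.
    - by apply: integral_ge0 => t _; rewrite mul0r.
    - by move=> z [].
    - by move=> z v [_ hz] h1 h2; rewrite mul0r; apply: hB; exact: hz.
  have tauC : 0 <= C * tau (cmap c y - cmap c x).
    rewrite tauE -pairingZl; apply: B0 => v hv; rewrite pairingZl -tauE.
    exact: le_trans (normr_ge0 _) hv.
  apply/ler_rV_norm => [|i]; first exact: tauC.
  rewrite ler_norml; apply/andP; split.
    rewrite lerNl -subr_ge0 opprK -/(tau _) -pairing_delta tauE -pairingZl -pairingl.
    apply: B0 => v hv; rewrite pairingl pairing_delta pairingZl -tauE.
    by have := le_trans (nb v i) hv; rewrite ler_norml => /andP[+ _]; lra.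
  rewrite -subr_ge0 -/(tau _) -pairing_delta tauE -pairingZl -mulN1r -pairingZl -pairingl.
  apply: B0 => v hv; rewrite pairingl !pairingZl pairing_delta -tauE.
  by have := le_trans (nb v i) hv; rewrite ler_norml => /andP[_ +]; lra.
exact: K'.
Qed.

(** The perturbed reversed Cauchy-Schwarz inequality is integrated along the curves from [x] to [y].
    Its error involves the norm of the velocity, which is first replaced by a multiple of the linear
    form [tau]. *)
Lemma time_sep_le (th : R) : 0 < th -> \forall x \near p & y \near p, forall b, fut Gp Xp b ->
  ((Num.sqrt (- qf Gp b b))%:E * time_sep g X x y <=
   (- qf Gp b (cmap c y - cmap c x) + th * (- qf Gp b Xp * `|cmap c y - cmap c x|))%:E)%E.
Proof.
move=> th0.
have [C C0 hC] := causal_norm_near cG cX Gsym Gsig XX.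
have [K K0 hK] := pairing_bound (- (Xp *m Gp^T)).
(* [C] is lost in passing from the norm of the velocity to [tau], and [K] in returning from [tau] to
   the norm of the displacement. *)
pose th' := th / (C * K).
have th'0 : 0 < th' by rewrite divr_gt0// mulr_gt0.
have hth := causal_perturbation_near cG cX Gsym Gsig XX th'0.
pose N : set M := cdom c `&` ([set z | forall w : E, qf (gmx g c z) w w <= 0 ->
    qf (gmx g c z) w (vcomp X c z) <= 0 -> `|w| <= C * - qf Gp w Xp] `&`
  [set z | forall w b : E, qf (gmx g c z) w w <= 0 ->
    qf (gmx g c z) w (vcomp X c z) <= 0 -> fut Gp Xp b ->
    Num.sqrt (- qf Gp b b) * Num.sqrt (- qf (gmx g c z) w w) <=
    - qf Gp b w + th' * `|w| * - qf Gp b Xp]).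
have SC := @strong_causality N (@filterI _ _ (nbhs_filter p) _ _ nbhs_cdom
  (@filterI _ _ (nbhs_filter p) _ _ hC hth)).
have K' : filter_prod (nbhs p) (nbhs p) (fun q => forall b, fut Gp Xp b ->
  ((Num.sqrt (- qf Gp b b))%:E * time_sep g X q.1 q.2 <=
   (- qf Gp b (cmap c q.2 - cmap c q.1) + th * (- qf Gp b Xp * `|cmap c q.2 - cmap c q.1|))%:E)%E).
  apply: (@filterS _ _ FF _ _ _ SC) => -[x y] hxy b fb /=.
  set u := cmap c y - cmap c x; set be := - qf Gp b Xp.
  have be0 : 0 < be by rewrite oppr_gt0; case: fb.
  set nb := Num.sqrt (- qf Gp b b).
  have nb0 : 0 < nb by rewrite sqrtr_gt0 oppr_gt0; case: fb.
  rewrite muleC -lee_pdivlMr//; apply: ge_ereal_sup => _ [gamma [l f g0 g1] <-].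
  have lg : lcurve g X gamma by split.
  have gN := hxy gamma lg g0 g1.
  pose B : E := nb^-1 *: (- (b *m Gp^T) + (th' * be * C) *: - (Xp *m Gp^T)).
  have BE v : pairing B v = nb^-1 * (- qf Gp b v + th' * be * C * tau v).
    rewrite pairingZl pairingl pairingZl -tauE; congr (_ * (_ + _)).
    by rewrite (qfC b v Gsym) qf_pairing /pairing linearN/= mulmxN [LHS]mxE.
  apply: (@le_trans _ _ (pairing B u)%:E).
    rewrite /u -g0 -g1.
    apply: le_trans (integral_speed_le (N := N) (k := 1) _ _ _ lg gN) => //.
    - rewrite le_eqVlt; apply/orP; left; apply/eqP; apply: eq_integral => t _.
      by rewrite mul1r.
    - by move=> z [].
    - move=> z v [_ [hz1 hz2]] h1 h2; rewrite mul1r BE -ler_pdivrMl ?invr_gt0// invrK.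
      apply: le_trans (hz2 v b h1 h2 fb) _; rewrite lerD2l -/be mulrAC -[th' * be * C * _]mulrA.
      by apply: ler_wpM2l; [exact: ltW (mulr_gt0 th'0 be0)|exact: (hz1 v h1 h2)].
  rewrite lee_fin BE mulrC ler_pM2r ?invr_gt0// lerD2l.
  apply: (@le_trans _ _ (th' * be * C * (K * `|u|))).
    apply: ler_wpM2l; first exact: ltW (mulr_gt0 (mulr_gt0 th'0 be0) C0).
    by rewrite tauE; exact: le_trans (ler_norm _) (hK _).
  rewrite le_eqVlt; apply/orP; left; apply/eqP; rewrite /th'; field.
  by rewrite !gt_eqF.
exact: K'.
Qed.

End local_causality.

Lemma ae_forall_countable d (T : measurableType d) (R : realType) (mu : {measure set T -> \bar R})
    (I : countType) (P : I -> T -> Prop) :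
  (forall i, {ae mu, forall x, P i x}) -> {ae mu, forall x, forall i, P i x}.
Proof.
move=> h; have := @ae_foralln _ _ _ mu
  (fun k x => if unpickle k is Some i then P i x else True).
have hk k : \forall x \ae mu, (if @unpickle I k is Some i then P i x else True).
  by case: unpickle => [i|]; [exact: h|apply: aeW].
by move=> /(_ hk); apply: ae_imp => x hx i; have := hx (pickle i); rewrite pickleK.
Qed.

(** * Backward differentials of bounded causal functions in a chart *)

Section causal_directions.
Context {R : realType} {d : nat} {M : topologicalType}.
Context {A : smooth_structure R d.+1 M} (g : lorentz_metric A) (X : vector_field A).
Implicit Types (v w u : 'rV[R]_d.+1).
Variable (c : chart R d.+1 M).
Hypothesis ac : atlas A c.

Local Notation E := 'rV[R]_d.+1.
Local Notation cle x y := (0 <= time_sep g X x y)%E.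
Local Notation cimg := (cmap c @` cdom c).

(** One radius serves for points and for directions, so that [dircone v r] consists of future
    directions all over the ball, and countably many rational balls suffice. *)
Definition timelike_ball (q v : E) (r : R) := forall y : E, `|y - q| < r ->
  cimg y /\ forall w : E, `|w - v| < r -> futc g X c (cinv c y) w.

Lemma timelike_ball_near (y v : E) : cimg y -> futc g X c (cinv c y) v ->
  exists2 r : R, 0 < r & timelike_ball y v r.
Proof.
move=> iy fv; have [dy _] := cimgK iy.
have ny : nbhs y cimg by apply: open_nbhs_nbhs; split => //; exact: cimg_open.
have FFw : Filter (filter_prod (nbhs v) (nbhs y)) by exact: filter_prod_filter.
have c1 : (fun q : E * E => q.1) @ filter_prod (nbhs v) (nbhs y) --> v by exact: cvg_fst.
have c0 : (fun q : E * E => q.2) @ filter_prod (nbhs v) (nbhs y) --> y by exact: cvg_snd.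
have ccy : {for y, continuous (cinv c)} by exact: cinv_continuous.
have c2 : (fun q : E * E => gmx g c (cinv c q.2)) @ filter_prod (nbhs v) (nbhs y) --> gmx g c (cinv c y).
  have cgy : (gmx g c \o cinv c) @ (nbhs y) --> gmx g c (cinv c y) by apply: (@continuous_comp _ _ _ (cinv c) (gmx g c) y); [exact: ccy|exact: gmx_continuous].
  exact: (@cvg_comp _ _ _ (fun q : E * E => q.2) (gmx g c \o cinv c) _ _ _ c0 cgy).
have c3 : (fun q : E * E => vcomp X c (cinv c q.2)) @ filter_prod (nbhs v) (nbhs y) --> vcomp X c (cinv c y).
  have cgy : (vcomp X c \o cinv c) @ (nbhs y) --> vcomp X c (cinv c y) by apply: (@continuous_comp _ _ _ (cinv c) (vcomp X c) y); [exact: ccy|exact: vcomp_continuous].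
  exact: (@cvg_comp _ _ _ (fun q : E * E => q.2) (vcomp X c \o cinv c) _ _ _ c0 cgy).
have [vv vX] := fv.
have k1 := cvgr_lt _ (cvg_qf FFw c2 c1 c1) _ vv.
have k2 := cvgr_lt _ (cvg_qf FFw c2 c1 c3) _ vX.
have [[U V] /= [nU nV] UV] := @filterI _ _ FFw _ _ (k1 FFw) (k2 FFw).
have /nbhs_ballP[r1 /= r10 h1] := nU.
have nV' : nbhs y (V `&` cimg) := @filterI _ _ (nbhs_filter y) _ _ nV ny.
have /nbhs_ballP[r2 /= r20 h2] := nV'.
exists (Num.min r1 r2); first by rewrite lt_min r10.
move=> z zr; have [|Vz iz] := h2 z.
  by rewrite -ball_normE /= distrC; apply: lt_le_trans zr _; rewrite ge_min lexx orbT.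
split => // w wr; have Uw : U w.
  by apply: h1; rewrite -ball_normE /= distrC; apply: lt_le_trans wr _; rewrite ge_min lexx.
by have [q1 q2] := UV (w, z) (conj Uw Vz); split.
Qed.

Lemma timelike_ball_sub (q v q' : E) (r r' : R) : timelike_ball q v r -> `|q' - q| + r' <= r ->
  timelike_ball q' v r'.
Proof.
move=> h qr y yr; have [|iy hy] := h y.
  apply: lt_le_trans qr; apply: le_lt_trans (_ : `|q' - q| + `|y - q'| < _); last by rewrite ltrD2l.
  by rewrite [leRHS]addrC (_ : y - q = (y - q') + (q' - q)) ?ler_normD// addrA subrK.
split => // w wr; apply: hy; apply: lt_le_trans wr _; apply: le_trans qr.
by rewrite lerDr.
Qed.

(** The coordinate segment from [y] to [z] stays in the ball by convexity and has constant velocity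
    in the cone, so it is a causal curve. *)
Lemma timelike_ball_cle (q v y z : E) (r : R) : timelike_ball q v r ->
  `|y - q| < r -> `|z - q| < r -> dircone v r (z - y) -> cle (cinv c y) (cinv c z).
Proof.
move=> h yr zr [s s0 zy].
have seg (t : R) : 0 <= t <= 1 -> `|y + t *: (z - y) - q| < r.
  move=> /andP[t0 t1]; have -> : y + t *: (z - y) - q = (1 - t) *: (y - q) + t *: (z - q).
    by rewrite !scalerBl !scalerBr !scale1r; apply/rowP => i; rewrite !mxE; ring.
  apply: le_lt_trans (ler_normD _ _) _; rewrite !normrZ !ger0_norm ?subr_ge0//.
  have [->|tn0] := eqVneq t 0; first by rewrite subr0 mul0r addr0 mul1r.
  have t0' : 0 < t by rewrite lt_neqAle eq_sym tn0.
  have : t * `|z - q| < t * r by rewrite ltr_pM2l.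
  have : (1 - t) * `|y - q| <= (1 - t) * r by rewrite ler_wpM2l ?subr_ge0// ltW.
  by lra.
have l := @segment_lcurve R d M A g X c y (z - y) ac (fun t ht => (h _ (seg t ht)).1).
have fl t : 0 <= t <= 1 -> futc g X c (cinv c (y + t *: (z - y))) (z - y).
  move=> ht; have [_ hf] := h _ (seg t ht).
  have := futZ s0 (hf (s^-1 *: (z - y)) _); rewrite scalerA divff ?gt_eqF// scale1r; apply.
  have -> : s^-1 *: (z - y) - v = s^-1 *: (z - y - s *: v).
    by rewrite [RHS]scalerBr [in RHS]scalerA mulVf ?gt_eqF// scale1r.
  by rewrite normrZ gtr0_norm ?invr_gt0// mulrC ltr_pdivrMr// mulrC.
have := time_sep_ge (l fl); rewrite /= scale0r addr0 scale1r (addrC y) subrK.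
by apply: le_trans; exact: length_ge0.
Qed.

Section limits.
Variables (phi : M -> R) (m : R).
Hypotheses (phim : forall x : M, `|phi x| <= m) (phi_causal : forall x y : M, cle x y -> phi x <= phi y).
Let phic : E -> R := phi \o cinv c.

Let phic_mono (q v : E) r : timelike_ball q v r -> forall x y, ball q r x -> ball q r y ->
  dircone v r (y - x) -> phic x <= phic y.
Proof.
move=> h x y; rewrite -!ball_normE /= ![`|q - _|]distrC => xq yq hxy.
exact/phi_causal/(timelike_ball_cle h).
Qed.

Lemma leb_ballT (q : E) r : (leb (ball q r : set (borel E)) < +oo)%E.
Proof.
have r0 : 0 < `|q| + `|r| + 1 by rewrite ltr_wpDl// addr_ge0.
apply: (@le_lt_trans _ _ (leb (ball (0 : E) (`|q| + `|r| + 1) : set (borel E)))); last exact: leb_ball_lty.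
apply: le_measure.
- by rewrite inE; apply: sub_sigma_algebra; exact: ball_open.
- by rewrite inE; apply: sub_sigma_algebra; exact: ball_open.
move=> x; rewrite -!ball_normE /= sub0r normrN => qx.
have : `|x| <= `|q| + `|q - x|.
  by have := ler_normD q (x - q); rewrite addrC subrK [`|x - q|]distrC.
by have := ler_norm r; lra.
Qed.

Lemma ball_regularization (q v : E) r : 0 < r -> timelike_ball q v r ->
  exists F : E -> R, [/\ measurable_fun setT (F : borel E -> R), (forall x, `|F x| <= m),
    {ae (@leb R d), forall y, ball q r y -> phic y = F y} &
    {ae (@leb R d), forall y, F (y + k.+1%:R^-1 *: v) @[k --> \oo] --> F y}].
Proof.
move=> r0 h.
have [F [mF Fm hF cF _]] := monotone_regularization r0 (@ball_open R E q r)
  (fun x => phim (cinv c x)) (phic_mono h).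
by exists F.
Qed.

Lemma ball_pq_cvg (q v : E) r : 0 < r -> timelike_ball q v r ->
  {ae (@leb R d), forall y, ball q r y -> cvgn (pq phic v ^~ y)}.
Proof.
move=> r0 h; exact: (monotone_cvg_pq r0 (@ball_open R E q r)
  (fun x => phim (cinv c x)) (phic_mono h)).
Qed.

Lemma rational_ball (x : E) (r : R) : 0 < r -> exists (q : 'rV[rat]_d.+1) (k : nat),
  `|x - ratv q| < k.+1%:R^-1 /\ `|ratv q - x| + k.+1%:R^-1 <= r.
Proof.
move=> r0; have r20 : 0 < r / 2 by rewrite divr_gt0.
have [k kr] : exists k : nat, k.+1%:R^-1 < r / 2.
  exists (Num.truncn (r / 2)^-1); rewrite invf_plt ?posrE//; exact: truncnS_gt.
have k0 : (0 : R) < k.+1%:R^-1 by rewrite invr_gt0.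
have [q qx] : exists q, ball x k.+1%:R^-1 (ratv q).
  apply: dense_ratv; first exact: ball_open.
  by exists x; exact: ballxx.
rewrite -ball_normE /= in qx; exists q, k; split => //.
by rewrite distrC [r]splitr lerD// ltW// (lt_trans qx).
Qed.

(** The regularization works in one ball for one direction; the exceptional sets are collected over
    the countably many triples of rational centre, radius and integral vector. *)
Lemma pq_cvg_ae : {ae (@leb R d), forall x, cimg x ->
  forall z, futc g X c (cinv c x) (intv z) -> cvgn (pq phic (intv z) ^~ x)}.
Proof.
have H : {ae (@leb R d), forall x, forall i : 'rV[rat]_d.+1 * nat * 'rV[int]_d.+1,
    timelike_ball (ratv i.1.1) (intv i.2) i.1.2.+1%:R^-1 -> ball (ratv i.1.1) i.1.2.+1%:R^-1 x ->
    cvgn (pq phic (intv i.2) ^~ x)}.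
  apply: ae_forall_countable => -[[q k] z] /=.
  have [h|h] := pselect (timelike_ball (ratv q) (intv z) k.+1%:R^-1); last by apply: aeW.
  have k0 : (0 : R) < k.+1%:R^-1 by rewrite invr_gt0.
  by apply: ae_imp (ball_pq_cvg k0 h) => x hx _; exact: hx.
apply: ae_imp H => x hx ix z fz.
have [r r0 hr] := timelike_ball_near ix fz.
have [q [k [xq qr]]] := rational_ball x r0.
apply: (hx ((q, k), z)) => /=; first exact: timelike_ball_sub hr qr.
by rewrite -ball_normE /= distrC.
Qed.

Lemma pq_additive_ae : {ae (@leb R d), forall x, cimg x ->
  forall z1 z2, futc g X c (cinv c x) (intv z1) -> futc g X c (cinv c x) (intv z2) ->
    futc g X c (cinv c x) (intv (z1 + z2)) ->
    limn (pq phic (intv (z1 + z2)) ^~ x) = limn (pq phic (intv z1) ^~ x) + limn (pq phic (intv z2) ^~ x)}.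
Proof.
have H : {ae (@leb R d), forall x, forall i : 'rV[rat]_d.+1 * nat * ('rV[int]_d.+1 * 'rV[int]_d.+1),
    timelike_ball (ratv i.1.1) (intv i.2.1) i.1.2.+1%:R^-1 ->
    timelike_ball (ratv i.1.1) (intv i.2.2) i.1.2.+1%:R^-1 ->
    timelike_ball (ratv i.1.1) (intv (i.2.1 + i.2.2)) i.1.2.+1%:R^-1 ->
    ball (ratv i.1.1) i.1.2.+1%:R^-1 x ->
    limn (pq phic (intv (i.2.1 + i.2.2)) ^~ x) =
    limn (pq phic (intv i.2.1) ^~ x) + limn (pq phic (intv i.2.2) ^~ x)}.
  apply: ae_forall_countable => -[[q k] [z1 z2]] /=.
  have [h1|h1] := pselect (timelike_ball (ratv q) (intv z1) k.+1%:R^-1); last by apply: aeW.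
  have [h2|h2] := pselect (timelike_ball (ratv q) (intv z2) k.+1%:R^-1); last by apply: aeW.
  have [h3|h3] := pselect (timelike_ball (ratv q) (intv (z1 + z2)) k.+1%:R^-1); last by apply: aeW.
  have k0 : (0 : R) < k.+1%:R^-1 by rewrite invr_gt0.
  have [F [mF Fm hF _]] := ball_regularization k0 h1.
  have h3' := ball_pq_cvg k0 h3; rewrite intvD in h3'.
  have := limn_pq_additive (@ball_open R E (ratv q) k.+1%:R^-1) (leb_ballT _ _) mF hF
    (ball_pq_cvg k0 h1) (ball_pq_cvg k0 h2) h3'.
  by apply: ae_imp => x hx _ _ _; rewrite intvD; exact: hx.
apply: ae_imp H => x hx ix z1 z2 f1 f2 f3.
have [r1 r10 hr1] := timelike_ball_near ix f1.
have [r2 r20 hr2] := timelike_ball_near ix f2.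
have [r3 r30 hr3] := timelike_ball_near ix f3.
have r0 : 0 < Num.min r1 (Num.min r2 r3) by rewrite !lt_min r10 r20.
have [q [k [xq]]] := rational_ball x r0; rewrite !le_min => /and3P[q1 q2 q3].
apply: (hx ((q, k), (z1, z2))) => /=.
- exact: timelike_ball_sub hr1 q1.
- exact: timelike_ball_sub hr2 q2.
- exact: timelike_ball_sub hr3 q3.
- by rewrite -ball_normE /= distrC.
Qed.

Hypothesis hX : timelike_field g X.

(** The future integral vectors form a semigroup absorbing each of its elements [e] in the sense of
    [additive_linear], which turns additivity of the limits into a covector. *)
Lemma pq_linear_ae : {ae (@leb R d), forall x, cimg x ->
  exists a : E, forall z, futc g X c (cinv c x) (intv z) ->
    0 <= pairing a (intv z) /\ pq phic (intv z) k x @[k --> \oo] --> pairing a (intv z)}.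
Proof.
apply: ae_imp (ae_and pq_cvg_ae pq_additive_ae) => x [hc ha] ix.
have [dx _] := cimgK ix.
pose G := gmx g c (cinv c x); pose Y := vcomp X c (cinv c x).
have Gsym : G^T = G by exact: gmx_sym.
have Gsig : exists2 P, P \in unitmx & P *m G *m P^T = minkowski_mx R d by exact: gmx_signature.
have XX : qf G Y Y < 0 by exact: hX.
have [e fe] := fut_intv_exists XX.
have SD z1 z2 : futc g X c (cinv c x) (intv z1) -> futc g X c (cinv c x) (intv z2) ->
    futc g X c (cinv c x) (intv (z1 + z2)).
  by move=> f1 f2; rewrite intvD; exact: (futD Gsym Gsig XX).
have [|a hae] := @additive_linear R d [set z | futc g X c (cinv c x) (intv z)]
   (fun z => limn (pq phic (intv z) ^~ x)) e fe SD (fun z => fut_absorb z fe).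
  by move=> z1 z2 f1 f2; apply: ha => //; exact: SD.
exists a => z fz; rewrite /pairing -hae//; split; last exact: hc.
have [r r0 hr] := timelike_ball_near ix fz.
apply: limr_ge; first exact: hc.
have := near_step (intv z) (@ball_open R E x r) (ballxx x r0).
apply: filterS => k; rewrite -ball_normE /= distrC => kr.
rewrite /pq mulr_ge0// subr_ge0; apply/phi_causal/(timelike_ball_cle hr) => //.
  by rewrite subrr normr0.
by rewrite opprB addrC subrK; apply: dircone_dir; rewrite ?invr_gt0.
Qed.

End limits.

End causal_directions.


Lemma dense_intv_scaled (R : realType) (d : nat) (O : set 'rV[R]_d.+1) : open O -> O !=set0 ->
  exists (z : 'rV[int]_d.+1) (s : R), 0 < s /\ O (s *: intv z).
Proof.
move=> oO [w Ow].
have [z [s s0 hz]] : exists z, (\bigcup_(s in [set s : R | 0 < s]) ((fun w => s *: w) @^-1` O)) (intv z).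
  apply: dense_intv.
  - apply: bigcup_open => s _; apply: open_comp => // v _; exact: scaler_continuous.
  - by exists w; exists 1 => //=; rewrite scale1r.
  - move=> s v s0 [t t0 /= hv]; exists (t / s) => /=; first exact: divr_gt0.
    by rewrite scalerA divfK ?gt_eqF.
by exists z, s.
Qed.

Lemma lee_scaled (R : realType) (nb q C B : R) (l : \bar R) : 0 < nb -> 0 <= q ->
  (nb%:E * l <= C%:E)%E -> q * C <= nb * B -> (q%:E * l <= B%:E)%E.
Proof.
move=> nb0 q0 hl qC; have hl' : (l <= (C / nb)%:E)%E.
  by rewrite EFinM lee_pdivlMr// muleC.
apply: (@le_trans _ _ (q%:E * (C / nb)%:E)%E); first by rewrite lee_wpmul2l// lee_fin.
by rewrite -EFinM lee_fin mulrA ler_pdivrMr// mulrC [B * _]mulrC mulrC.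
Qed.

Lemma step_index (R : realType) (r s N : R) : 0 < r -> 0 < s -> 0 < N -> N^-1 < r * s ->
  r < (s * (N + 1) + 1)^-1 -> False.
Proof.
move=> r0 s0 N0 h rlt.
have p0 : 0 < s * (N + 1) + 1 by rewrite addr_gt0// mulr_gt0// addr_gt0.
have h1 : r * (s * (N + 1) + 1) < 1 by rewrite -ltr_pdivlMr// div1r.
have h2 : 1 < r * s * N by rewrite -ltr_pdivrMr// div1r.
have h3 : 0 < r * s by rewrite mulr_gt0.
by lra.
Qed.

Lemma cubic_le (R : realType) (W : R) : 0 < W -> W * (1 - W) * (1 + W) <= W.
Proof.
move=> W0; have : 0 < W * (W * W) by rewrite !mulr_gt0.
by rewrite (_ : W * (1 - W) * (1 + W) = W - W * (W * W)); [lra|ring].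
Qed.

(** The error budget of [timelike_case]: [ep / 4] for rounding the step to [1 / (k + 1)], [ep / 4]
    for the difference quotient and [ep / 2] for the choice of direction. *)
Lemma step_estimate (R : realType) (r s t D e ep De P T : R) :
  t * (D - e) <= De -> r * s * (1 - r * s) * D <= t * D -> t * e <= r * s * e ->
  r * (r * (s * (s * D))) <= r * (ep / 4) -> r * (s * e) <= r * (ep / 4) ->
  r * T <= r * (ep / 2) -> r * P <= r * (s * D) -> r * (P + T) <= De + r * ep.
Proof. by move=> *; lra. Qed.

(** * First-order lower bound for increments towards a point *)

Section lower_bound.
Context {R : realType} {d : nat} {M : topologicalType}.
Context {A : smooth_structure R d.+1 M} (g : lorentz_metric A) (X : vector_field A).
Hypothesis hX : timelike_field g X.
Hypothesis hM : causally_simple g X.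
Variables (c : chart R d.+1 M) (x : M).
Hypotheses (ac : atlas A c) (dx : cdom c x).
Local Notation E := 'rV[R]_d.+1.
Local Notation cle x y := (0 <= time_sep g X x y)%E.
Let G := gmx g c x.
Let Y := vcomp X c x.
Let cx := cmap c x.
Let nrm (v : E) := Num.sqrt (- qf G v v).
Let Gsym : G^T = G. Proof. exact: gmx_sym. Qed.
Let XX : qf G Y Y < 0. Proof. exact: hX. Qed.

Variable phi : M -> R.
Hypothesis phi_causal : forall y z : M, cle y z -> phi y <= phi z.
Let phic : E -> R := phi \o cinv c.
Variable q : R.
Hypothesis q0 : 0 <= q.
Hypothesis hq : forall z, futc g X c x (intv z) -> exists2 D : R,
  pq phic (intv z) k cx @[k --> \oo] --> D & q * nrm (intv z) <= D.

Let nrmZ (a : R) v : 0 < a -> nrm (a *: v) = a * nrm v.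
Proof.
move=> a0; rewrite /nrm qfZl qfZr (_ : - (a * (a * qf G v v)) = a ^+ 2 * - qf G v v).
  by rewrite sqrtrM ?sqr_ge0// sqrtr_sqr gtr0_norm.
by rewrite mulrA -expr2 mulrN.
Qed.

Let icx : (cmap c @` cdom c) cx. Proof. by exists x. Qed.

Let time_sep_u (th : R) : 0 < th -> \forall u \near (0 : E), forall b, fut G Y b ->
  ((nrm b)%:E * time_sep g X (cinv c (cx - u)) x <= (- qf G b u + th * (- qf G b Y * `|u|))%:E)%E.
Proof.
move=> th0; have [[U V] /= [nU nV] UV] := time_sep_le hX hM ac dx th0.
have n1 : \forall u \near (0 : E), U (cinv c (cx - u)).
  have cu : (fun u : E => cx - u) @ (0 : E) --> cx - 0 by exact: continuous_rsubr.
  rewrite subr0 in cu; apply: (cvg_comp _ _ cu (cinv_continuous icx)).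
  by rewrite cmapK.
have n2 : \forall u \near (0 : E), (cmap c @` cdom c) (cx - u).
  have cu : (fun u : E => cx - u) @ (0 : E) --> cx - 0 by exact: continuous_rsubr.
  by rewrite subr0 in cu; apply: cu; apply: open_nbhs_nbhs; split; [exact: cimg_open|].
apply: filterS (filterI n1 n2) => u [Uu iu] b fb.
have := UV (cinv c (cx - u), x) (conj Uu (nbhs_singleton nV)) b fb.
by rewrite /= (cimgK iu).2 (_ : cmap c x - (cx - u) = u)// opprB addrC subrK.
Qed.

Let concl (ep : R) (u : E) := cle (cinv c (cx - u)) x ->
  (q%:E * time_sep g X (cinv c (cx - u)) x <= (phi x - phi (cinv c (cx - u)) + ep * `|u|)%:E)%E.

Let near_scaled (P : E -> Prop) : (\forall u \near (0 : E), P u) ->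
  \forall r \near 0^'+, forall w : E, `|w| = 1 -> P (r *: w).
Proof.
move=> /nbhs_ballP[e /= e0 he].
apply: filterS (filterI (nbhs_right_gt 0) (nbhs_right_lt e0)) => r [r0 re] w w1; apply: he.
by rewrite -ball_normE /= sub0r normrN normrZ w1 mulr1 gtr0_norm.
Qed.

(** By duality some future [b] pairs with [u0] to less than [eta] times the length of [b], so the
    time separation in directions near [u0] is itself of the order of the error, while the increment
    of [phi] is nonnegative. *)
Let spacelike_case (ep : R) (u0 : E) : 0 < ep -> ~ fut G Y u0 ->
  \forall u \near u0 & r \near 0^'+, `|u| = 1 -> concl ep (r *: u).
Proof.
move=> ep0 nf.
(* Two contributions of size [eta] occur below; [q + 1] in place of [q] covers [q = 0]. *)
pose eta := ep / (2 * (q + 1)).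
have q10 : 0 < 2 * (q + 1) by rewrite mulr_gt0// ltr_wpDl.
have eta0 : 0 < eta by rewrite divr_gt0.
have [b [fb hb]] : exists b, fut G Y b /\ - qf G b u0 < eta * nrm b.
  apply: contrapT => nb; apply: nf; apply: (dual_fut Gsym XX eta0 _).1 => b fb.
  by rewrite leNgt; apply/negP => hb; apply: nb; exists b.
have nb0 : 0 < nrm b by rewrite sqrtr_gt0 oppr_gt0; case: fb.
have be0 : 0 < - qf G b Y by rewrite oppr_gt0; case: fb.
pose th := eta * nrm b / - qf G b Y.
have th0 : 0 < th by rewrite divr_gt0// mulr_gt0.
have nu : \forall u \near u0, - qf G b u < eta * nrm b.
  have cb : (fun u : E => - qf G b u) @ u0 --> - qf G b u0.
    apply: (@continuousN _ R^o).
    have Eb : qf G b = qf G ^~ b by apply/funext => u; exact: qfC.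
    by rewrite Eb; exact: continuous_qfl.
  exact: (cvgr_lt _ cb).
exists ([set u | - qf G b u < eta * nrm b], [set r : R | 0 < r /\ forall w : E, `|w| = 1 ->
   forall b, fut G Y b -> ((nrm b)%:E * time_sep g X (cinv c (cx - r *: w)) x <=
     (- qf G b (r *: w) + th * (- qf G b Y * `|r *: w|))%:E)%E]) => /=.
  split => //; apply: filterI; first exact: nbhs_right_gt.
  exact: (near_scaled (time_sep_u th0)).
move=> [u r] /= [hu [r0 hr]] u1 hcle.
have := hr u u1 b fb; rewrite normrZ u1 mulr1 gtr0_norm// => hl.
apply: (lee_scaled nb0 q0 hl).
have thE : th * (- qf G b Y * r) = eta * nrm b * r.
  by rewrite /th mulrA divfK// gt_eqF.
rewrite thE qfZr; have : 0 <= phi x - phi (cinv c (cx - r *: u)) by rewrite subr_ge0 phi_causal.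
set De := _ - _ => De0.
have h1 : - (r * qf G b u) <= r * (eta * nrm b) by rewrite -mulrN ler_pM2l// ltW.
apply: (@le_trans _ _ (nrm b * (ep * r))); last by rewrite ler_pM2l// lerDr.
apply: (@le_trans _ _ (q * (2 * (eta * nrm b * r)))).
  by rewrite ler_wpM2l//; lra.
have -> : q * (2 * (eta * nrm b * r)) = (q / (q + 1)) * (nrm b * (ep * r)).
  by rewrite /eta; field; rewrite gt_eqF// ltr_wpDl.
rewrite ler_piMl// ?mulr_ge0 ?ltW//.
by rewrite ltr_pdivrMr ?ltr_wpDl// mul1r ltrDl.
Qed.

(** The hypothesis only concerns integral directions. A multiple [s *: v] of an integral vector is
    chosen in the past of [u0] and almost as long; monotonicity compares [x - r *: u] with
    [x - (r * s) *: v] and then with the nearest later point [x - t *: v] of the sequence of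
    steps. *)
Let timelike_case (ep : R) (u0 : E) : 0 < ep -> fut G Y u0 ->
  \forall u \near u0 & r \near 0^'+, `|u| = 1 -> concl ep (r *: u).
Proof.
move=> ep0 fu0; have n0 : 0 < nrm u0 by rewrite sqrtr_gt0 oppr_gt0; case: fu0.
pose eta := ep / (6 * (q + 1)).
have q10 : 0 < 6 * (q + 1) by rewrite mulr_gt0// ltr_wpDl.
have eta0 : 0 < eta by rewrite divr_gt0.
have cnrm : continuous nrm.
  move=> v; apply: (@continuous_comp _ _ _ (fun v : E => - qf G v v) Num.sqrt v); last exact: sqrt_continuous.
  by apply: (@continuousN _ R^o); exact: continuous_qfd.
pose O : set E := fut G Y `&` ((fun w => u0 - w) @^-1` fut G Y) `&` [set w | nrm u0 - eta < nrm w].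
have oO : open O.
  apply: openI; first apply: openI; first exact: open_fut.
    by apply: open_comp; [move=> w _; exact: continuous_rsubr|exact: open_fut].
  by apply: (@open_comp _ _ nrm [set t : R | nrm u0 - eta < t]); [move=> w _; exact: cnrm|exact: open_gt].
have nO : O !=set0.
  (* A slightly shortened [u0] lies in [O]: the bound [1/2] keeps [1 - a] positive, the other one
     limits the loss of length. *)
  pose a := Num.min (2^-1) (eta / (2 * nrm u0)).
  have a0 : 0 < a by rewrite lt_min invr_gt0 ltr0n/= divr_gt0// mulr_gt0.
  have a2 : a <= 2^-1 by rewrite ge_min lexx.
  have aE : a * nrm u0 < eta.
    apply: (@le_lt_trans _ _ (eta / (2 * nrm u0) * nrm u0)).
      by rewrite ler_pM2r// ge_min lexx orbT.
    rewrite (_ : _ * _ = eta / 2); last by field; rewrite gt_eqF.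
    by rewrite ltr_pdivrMr// ltr_pMr// ltr1n.
  have a1 : 0 < 1 - a by lra.
  exists ((1 - a) *: u0); split; first split.
  - exact: futZ.
  - by rewrite /= -[X in X - _]scale1r -scalerBl opprB addrC subrK; exact: futZ.
  - by rewrite /= nrmZ// mulrBl mul1r ltrD2l ltrN2.
have [z [s [s0 [[fsz fuz] nz]]]] := dense_intv_scaled oO nO.
have fz : futc g X c x (intv z) by exact: futZV s0 fsz.
have [D Dcv qD] := hq fz.
have icx' : futc g X c (cinv c cx) (intv z) by rewrite /cx cmapK.
have [r1 r10 hr1] := timelike_ball_near ac icx icx'.
have icx2 : futc g X c (cinv c cx) (u0 - s *: intv z) by rewrite /cx cmapK.
have [r2 r20 hr2] := timelike_ball_near ac icx icx2.
pose v : E := intv z.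
have D0 : 0 <= D by apply: le_trans qD; rewrite mulr_ge0// sqrtr_ge0.
pose eta' := ep / (4 * (s + 1)).
have s10 : 0 < 4 * (s + 1) by rewrite mulr_gt0// ltr_wpDl// ltW.
have eta'0 : 0 < eta' by rewrite divr_gt0.
have [K _ hK] : \forall k \near \oo, D - eta' < pq phic v k cx.
  by apply: (cvgr_gt _ Dcv); rewrite ltrBlDr ltrDl.
have be0 : 0 < - qf G u0 Y by rewrite oppr_gt0; case: fu0.
pose th := eta * nrm u0 / - qf G u0 Y.
have th0 : 0 < th by rewrite divr_gt0// mulr_gt0.
have nu : \forall u \near u0, - qf G u0 u < nrm u0 * (nrm u0 + eta).
  have cb : (fun u : E => - qf G u0 u) @ u0 --> - qf G u0 u0.
    apply: (@continuousN _ R^o).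
    have Eb : qf G u0 = qf G ^~ u0 by apply/funext => u; exact: qfC.
    by rewrite Eb; exact: continuous_qfl.
  apply: (cvgr_lt _ cb); rewrite -[X in X < _]sqr_sqrtr; last by rewrite oppr_ge0 ltW//; case: fu0.
  by rewrite -/(nrm u0) expr2 ltr_pM2l// ltrDl.
have nu2 : \forall u \near u0, `|u - u0| < r2.
  by apply/nbhs_ballP; exists r2 => // u; rewrite -ball_normE /= distrC.
have nv0 : 0 < s * (K.+1%:R + 1) + 1 by rewrite ltr_wpDl// mulr_ge0 ?ltW// addr_ge0.
have nD0 : 0 < 4 * (s * (s * D) + 1).
  by rewrite mulr_gt0// ltr_wpDl// !mulr_ge0// ltW.
have nV0 : 0 < s * `|v| + 2 by rewrite ltr_wpDl// mulr_ge0// ltW.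
(* The last three conditions on [r] ensure that the index of the step is at least [K], that the
   rounding loss of second order [r * s ^+ 2 * D] is small, and that all points stay in the timelike
   balls. *)
exists ([set u | - qf G u0 u < nrm u0 * (nrm u0 + eta) /\ `|u - u0| < r2],
  [set r : R | [/\ 0 < r, (forall w : E, `|w| = 1 -> forall b, fut G Y b ->
     ((nrm b)%:E * time_sep g X (cinv c (cx - r *: w)) x <=
     (- qf G b (r *: w) + th * (- qf G b Y * `|r *: w|))%:E)%E),
     r < (s * (K.+1%:R + 1) + 1)^-1, r < ep / (4 * (s * (s * D) + 1)) &
     r < Num.min r1 r2 / (s * `|v| + 2)]]) => /=.
  split; first exact: filterI.
  have f1 := nbhs_right_gt (0 : R).
  have f2 := near_scaled (time_sep_u th0).
  have f3 := nbhs_right_lt (_ : 0 < (s * (K.+1%:R + 1) + 1)^-1).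
  have f4 := nbhs_right_lt (_ : 0 < ep / (4 * (s * (s * D) + 1))).
  have f5 := nbhs_right_lt (_ : 0 < Num.min r1 r2 / (s * `|v| + 2)).
  apply: filterS (filterI f1 (filterI f2 (filterI (f3 _) (filterI (f4 _) (f5 _))))).
  - by move=> r [? [? [? [? ?]]]].
  - by rewrite invr_gt0.
  - by rewrite divr_gt0.
  - by rewrite divr_gt0// lt_min r10.
move=> [u r] /= [[hu ur2] [r0 hr rK rD rv]] u1 hcle.
have := hr u u1 u0 fu0; rewrite normrZ u1 mulr1 gtr0_norm// => hl.
apply: (lee_scaled n0 q0 hl).
have thE : th * (- qf G u0 Y * r) = eta * nrm u0 * r.
  by rewrite /th mulrA divfK// gt_eqF.
rewrite thE qfZr.
(* The first index whose step [1 / (k + 1)] is below [r * s]; the step is then at least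
   [r * s * (1 - r * s)]. *)
pose k := Num.truncn (r * s)^-1.
have rs0 : 0 < r * s by rewrite mulr_gt0.
have k1 : (r * s)^-1 < k.+1%:R by exact: truncnS_gt.
have k2 : k%:R <= (r * s)^-1 by rewrite truncn_le// ltW ?invr_gt0.
pose t : R := k.+1%:R^-1.
have t0 : 0 < t by rewrite invr_gt0.
have trs : t < r * s by rewrite /t invf_plt ?posrE.
have Kk : (K <= k)%N.
  rewrite -(ler_nat R) leNgt; apply/negP => kK.
  have : (r * s)^-1 < K.+1%:R.
    apply: lt_le_trans k1 _; rewrite ler_nat ltnS.
    by move: kK; rewrite ltr_nat => /ltnW.
  rewrite invf_plt ?posrE// => h1.
  exact: (step_index r0 s0 (ltr0Sn _ K) h1 rK).
have hpq : t * (D - eta') < phi x - phi (cinv c (cx - t *: v)).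
  have := hK k Kk; rewrite /pq /phic /= /cx cmapK// -/t -/cx -/v => hh.
  by rewrite mulrC -ltr_pdivlMr// /t invrK mulrC.
have rmin : r * (s * `|v| + 2) < Num.min r1 r2 by rewrite -ltr_pdivlMr.
have rv2 : r * s * `|v| + r < Num.min r1 r2.
  by move: rmin; rewrite mulrDr mulrA; lra.
have [b1 b2] : r * s * `|v| + r < r1 /\ r * s * `|v| + r < r2.
  by move: rv2; rewrite lt_min => /andP[].
have cx_sub w : cx - w - cx = - w by rewrite addrAC subrr add0r.
have m1 : phi (cinv c (cx - r *: u)) <= phi (cinv c (cx - (r * s) *: v)).
  apply/phi_causal/(timelike_ball_cle ac hr2).
  - rewrite cx_sub normrN normrZ u1 mulr1 gtr0_norm//; apply: le_lt_trans b2.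
    by rewrite lerDr mulr_ge0// ltW.
  - rewrite cx_sub normrN normrZ gtr0_norm//; apply: le_lt_trans b2.
    by rewrite lerDl ltW.
  exists r => //.
  have -> : cx - (r * s) *: v - (cx - r *: u) - r *: (u0 - s *: intv z) = r *: (u - u0).
    by rewrite -scalerA !scalerBr /v; apply/rowP => i; rewrite !mxE; ring.
  by rewrite normrZ gtr0_norm// ltr_pM2l.
have m2 : phi (cinv c (cx - (r * s) *: v)) <= phi (cinv c (cx - t *: v)).
  apply/phi_causal/(timelike_ball_cle ac hr1).
  - rewrite cx_sub normrN normrZ gtr0_norm//; apply: le_lt_trans b1.
    by rewrite lerDl ltW.
  - rewrite cx_sub normrN normrZ gtr0_norm//; apply: le_lt_trans b1.
    apply: (@le_trans _ _ (r * s * `|v|)); last by rewrite lerDl ltW.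
    by rewrite ler_wpM2r// ltW.
  have -> : cx - t *: v - (cx - (r * s) *: v) = (r * s - t) *: v.
    by rewrite scalerBl; apply/rowP => i; rewrite !mxE; ring.
  by apply: dircone_dir => //; rewrite subr_gt0.
set De := phi x - phi (cinv c (cx - r *: u)).
have hDe : t * (D - eta') <= De by apply: le_trans (ltW hpq) _; rewrite lerD2l lerN2 (le_trans m1).
have tlow : r * s * (1 - r * s) <= t.
  have h1 : k.+1%:R <= (1 + r * s) / (r * s) :> R.
    by rewrite -natr1 mulrDl divff ?gt_eqF// mul1r addrC [leRHS]addrC lerD2l.
  have h2 : r * s / (1 + r * s) <= t.
    rewrite /t -[leLHS]invrK invf_div lef_pV2 ?posrE// divr_gt0//; lra.
  apply: le_trans h2; rewrite ler_pdivlMr; last by lra.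
  exact: cubic_le.
have hD1 : r * s * (1 - r * s) * D <= t * D by rewrite ler_wpM2r.
have hE1 : t * eta' <= r * s * eta' by rewrite ler_pM2r// ltW.
have qD' : q * (s * nrm v) <= s * D by rewrite mulrCA ler_pM2l.
have nsv : nrm (s *: v) = s * nrm v by exact: nrmZ.
have nz' : nrm u0 - eta < s * nrm v by rewrite -nsv.
have qn : q * (nrm u0 - eta) <= s * D by apply: le_trans qD'; rewrite ler_wpM2l// ltW.
have h1 : q * (r * (nrm u0 * (nrm u0 + eta)) + eta * nrm u0 * r) <= nrm u0 * (De + ep * r).
  have -> : q * (r * (nrm u0 * (nrm u0 + eta)) + eta * nrm u0 * r) = nrm u0 * (r * (q * (nrm u0 - eta) + 3 * (q * eta))).
    by ring.
  rewrite ler_pM2l//.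
  have e1 : 3 * (q * eta) <= ep / 2.
    have -> : 3 * (q * eta) = (q / (q + 1)) * (ep / 2).
      by rewrite /eta; field; rewrite gt_eqF// ltr_wpDl.
    by rewrite ler_piMl ?divr_ge0 ?ltW// ltr_pdivrMr ?ltr_wpDl// mul1r ltrDl.
  have e2 : s * eta' <= ep / 4.
    have -> : s * eta' = (s / (s + 1)) * (ep / 4).
      by rewrite /eta'; field; rewrite gt_eqF// ltr_wpDl// ltW.
    rewrite ler_piMl ?divr_ge0 ?(ltW ep0)// ler_pdivrMr ?ltr_wpDl ?(ltW s0)// mul1r lerDl//.
  have e3 : r * (s * (s * D)) <= ep / 4.
    have := rD; rewrite ltr_pdivlMr// => hh.
    by have : 0 < r by []; nra.
  have -> : De + ep * r = De + r * ep by rewrite (mulrC ep).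
  have : r * (q * (nrm u0 - eta)) <= r * (s * D) by rewrite ler_pM2l.
  have : r * (3 * (q * eta)) <= r * (ep / 2) by rewrite ler_pM2l.
  have : r * (s * eta') <= r * (ep / 4) by rewrite ler_pM2l.
  have : r * (r * (s * (s * D))) <= r * (ep / 4) by rewrite ler_pM2l.
  exact: (step_estimate hDe hD1 hE1).
apply: le_trans h1; rewrite ler_wpM2l// lerD2r -mulrN ler_pM2l// ltW//.
Qed.

(** Both cases hold near every unit direction, and compactness of the sphere makes the distance
    uniform over directions. *)
Lemma causal_lower_bound (ep : R) : 0 < ep -> \forall y \near x, cle y x ->
  (q%:E * time_sep g X y x <= (phi x - phi y + ep * `|cx - cmap c y|)%:E)%E.
Proof.
move=> ep0.
have cov : \forall r \near 0^'+, [set w : E | `|w| = 1] `<=` (fun u => `|u| = 1 -> concl ep (r *: u)).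
  apply: ((compact_near_coveringP _).1 (@sphere_compact R d)) => u0 _.
  by have [f|f] := pselect (fut G Y u0); [exact: timelike_case|exact: spacelike_case].
have [e /= e0 he] := cov.
have n1 : \forall y \near x, cdom c y by apply: open_nbhs_nbhs; split => //; exact: cdom_open.
have n2 : \forall y \near x, `|cx - cmap c y| < e.
  by have /cvgrPdist_lt/(_ _ e0) := cmap_continuous dx.
apply: filterS (filterI n1 n2) => y [dy ye] hcle.
have [yx|yx] := eqVneq (cmap c y) cx.
  have {}yx : y = x by rewrite -(cmapK dy) yx /cx cmapK.
  (* The local bound on [time_sep] with zero displacement. *)
  have l0 : (time_sep g X x x <= 0)%E.
    have [[U V] /= [nU nV] UV] := time_sep_le hX hM ac dx ltr01.
    have := UV (x, x) (conj (nbhs_singleton nU) (nbhs_singleton nV)) Y (conj XX XX).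
    rewrite /= subrr qf0r normr0 !mulr0 oppr0 addr0 -[X in (_ <= X%:E)%E](mulr0 (nrm Y)) EFinM.
    by rewrite lee_pmul2l// lte_fin sqrtr_gt0 oppr_gt0.
  by rewrite yx -/cx !subrr normr0 mulr0 addr0; apply: mule_ge0_le0.
have r0 : 0 < `|cx - cmap c y| by rewrite normr_gt0 subr_eq0 eq_sym.
have := he `|cx - cmap c y|; rewrite /= sub0r normrN normr_id => /(_ ye r0).
move=> /(_ (`|cx - cmap c y|^-1 *: (cx - cmap c y))).
have n1' : `| `|cx - cmap c y|^-1 *: (cx - cmap c y)| = 1.
  by rewrite normrZ normfV normr_id mulVf// gt_eqF.
move=> /(_ n1' n1'); rewrite /concl scalerA divff ?gt_eqF// scale1r opprB addrC subrK cmapK//.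
by apply.
Qed.

End lower_bound.

(** * Lower bound on the maximal weak subslope *)

Section lebesgue_density.
Context {R : realType}.
Local Notation mu := (@lebesgue_measure R).

Lemma left_average_cvg (f : R -> R) : measurable_fun setT f ->
  mu.-integrable setT (EFin \o f) ->
  {ae mu, forall t : R,
    k.+1%:R * fine (\int[mu]_(s in `](t - k.+1%:R^-1)%R, t]) (f s)%:E)%E @[k --> \oo] --> f t}.
Proof.
move=> mf intf.
have kinty (y : R) : mu.-integrable [set` `]-oo, y]] (EFin \o f) by apply: integrableS intf.
have lk : locally_integrable [set: R] f by exact: (open_integrable_locally openT).
apply: ae_imp (FTC1Ny kinty lk) => t [df dE].
pose F (x : R) : R := (\int[mu]_(s in [set` `]-oo, x]]) f s)%R.
have /is_derive1P/cvgr_dnbhsP dF : is_derive t (1 : R) F (f t) by split; [exact: df|rewrite -derive1E; exact: dE].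
have /dF : (forall k : nat, - (k.+1%:R^-1 : R) != 0) /\ (fun k : nat => - (k.+1%:R^-1 : R)) @ \oo --> (0 : R).
  split; first by move=> k; rewrite oppr_eq0 invr_neq0.
  by rewrite -[X in _ --> X]oppr0; apply: (@cvgN _ R^o); exact: cvg_harmonic.
apply: cvg_trans; apply: near_eq_cvg; apply: nearW => k /=.
have st : t - k.+1%:R^-1 <= t by rewrite gerBl.
have -> : F t = F (t - k.+1%:R^-1) + (\int[mu]_(s in `](t - k.+1%:R^-1)%R, t]) f s)%R.
  rewrite /F; have U : [set` `]-oo, t]] = [set` `]-oo, (t - k.+1%:R^-1)%R]] `|` [set` `](t - k.+1%:R^-1)%R, t]] :> set R.
    apply/seteqP; split=> z /=; rewrite !in_itv/=.
      by move=> zt; have [h|h] := leP z (t - k.+1%:R^-1); [left|right; rewrite zt].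
    by case=> [h|/andP[]//]; exact: le_trans st.
  rewrite U Rintegral_setU//.
  - by rewrite -U.
  - apply/disj_setPS => z []; rewrite /= !in_itv/= => h1 /andP[h2 _].
    by move: h2; rewrite ltNge h1.
by rewrite invrN invrK mulNr -mulrN opprB addrC addKr.
Qed.

(** [rho] may be infinite or not integrable, so Lebesgue differentiation is applied to its
    truncations at height [m] on []-m, m[]. The null set is chosen before [q] and [D], which may
    thus depend on [t]. *)
Lemma density_le_left_bound (rho : R -> \bar R) : measurable_fun setT rho ->
  (forall t, (0 <= rho t)%E) ->
  {ae mu, forall t q D : R, 0 <= q -> 0 <= D ->
    (forall ep, 0 < ep -> \forall k \near \oo,
      (q%:E * \int[mu]_(s in `[(t - k.+1%:R^-1)%R, t]) rho s <= ((D + ep) / k.+1%:R)%:E)%E) ->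
    (q%:E * rho t <= D%:E)%E}.
Proof.
move=> mrho rho0.
pose I (m : nat) : set R := `](- m%:R)%R, m%:R[%classic.
pose f (m : nat) : R -> R := fun t => fine (mine (rho t) m%:R%:E) * \1_(I m) t.
have f0 m t : 0 <= fine (mine (rho t) m%:R%:E).
  by rewrite fine_ge0// le_min rho0 lee_fin ler0n.
have fm m t : (mine (rho t) m%:R%:E)%E = (fine (mine (rho t) m%:R%:E))%:E.
  rewrite fineK// ge0_fin_numE; last by rewrite le_min rho0 lee_fin ler0n.
  by rewrite gt_min ltry orbT.
have mf m : measurable_fun setT (f m).
  apply: measurable_funM; last by apply: measurable_indic; exact: measurable_itv.
  apply: measurableT_comp => //; exact: measurable_mine.
have intf m : mu.-integrable setT (EFin \o f m).
  have mI : measurable (I m : set (measurableTypeR R)) by exact: measurable_itv.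
  have Ifin : (mu (I m) < +oo)%E by rewrite /I lebesgue_measure_itv/=; case: ifP => _; rewrite ?ltry.
  have h : mu.-integrable (I m) (fun t => (fine (mine (rho t) m%:R%:E))%:E).
    have mz : measurable_fun setT (fun t => fine (mine (rho t) m%:R%:E)).
      by apply: measurableT_comp => //; exact: measurable_mine.
    have bz t : 0 <= fine (mine (rho t) m%:R%:E) <= m%:R by rewrite f0/= -lee_fin -fm ge_min lexx orbT.
    exact: (@bounded_integrable _ _ R mu (I m) mI Ifin _ (ler0n _ m) _ mz bz).
  have h' := (@integrable_mkcond _ _ R mu (I m) _ mI).1 h.
  apply: eq_integrable h' => // t _; rewrite patchE /f /= indicE.
  by case: ifPn => ?; rewrite ?mulr1// mulr0.
have := @ae_forall_countable _ _ R mu nat _ (fun m => left_average_cvg (mf m) (intf m)).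
apply: ae_imp => t ht q D q0 D0 hq.
have key (m : nat) : I m t -> q * fine (mine (rho t) m%:R%:E) <= D.
  move=> It; apply/ler_addgt0Pr => ep ep0.
  have c1 : q * (k.+1%:R * fine (\int[mu]_(s in `](t - k.+1%:R^-1)%R, t]) (f m s)%:E)%E) @[k --> \oo] --> q * f m t.
    by apply: (@cvgM R); [exact: cvg_cst|exact: ht].
  have -> : fine (mine (rho t) m%:R%:E) = f m t by rewrite /f indicE mem_set// mulr1.
  rewrite -(cvg_lim (@Rhausdorff R) c1); apply: limr_le; first by apply: cvgP c1.
  apply: filterS (hq ep ep0) => k hk.
  have iN : (\int[mu]_(s in `](t - k.+1%:R^-1)%R, t]) (f m s)%:E)%E \is a fin_num.
    by apply: integrable_fin_num => //; apply: integrableS (intf m).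
  have le1 : (\int[mu]_(s in `](t - k.+1%:R^-1)%R, t]) (f m s)%:E <= \int[mu]_(s in `[(t - k.+1%:R^-1)%R, t]) rho s)%E.
    apply: (@le_trans _ _ (\int[mu]_(s in `](t - k.+1%:R^-1)%R, t]) rho s)%E).
      apply: le_lower_integral => //.
        by move=> s _; rewrite lee_fin mulr_ge0// f0.
      move=> s _; rewrite EFinM -fm indicE; case: (_ \in _) => /=.
        by rewrite mule1 ge_min lexx.
      by rewrite mule0.
    apply: ge0_subset_integral => //; first exact: measurable_funTS.
    by move=> s; rewrite /= !in_itv/= => /andP[/ltW -> ->].
  rewrite mulrCA mulrC -ler_pdivlMr ?ltr0n// -lee_fin EFinM fineK//.
  by apply: le_trans hk; rewrite lee_wpmul2l// lee_fin.
pose m0 := Num.truncn `|t|.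
have Im (m : nat) : I (m + m0).+1 t.
  have : `|t| < (m + m0).+1%:R.
    by apply: lt_le_trans (truncnS_gt _) _; rewrite ler_nat ltnS leq_addl.
  by rewrite /I/= in_itv/= ltr_norml.
case E : (rho t) => [r||].
- have := key _ (Im (Num.truncn r)); rewrite E -EFin_min /= min_l ?lee_fin//.
  by apply: ltW; apply: lt_le_trans (truncnS_gt _) _; rewrite ler_nat ltnS leq_addr.
- have [->|qn] := eqVneq q 0; first by rewrite mul0e lee_fin.
  have qp : 0 < q by rewrite lt_neqAle eq_sym qn.
  have := key _ (Im (Num.truncn (D / q))); rewrite E min_r ?leey//= leNgt => /negP[].
  rewrite mulrC -ltr_pdivrMr//; apply: lt_le_trans (truncnS_gt _) _.
  by rewrite ler_nat ltnS leq_addr.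
- by have := rho0 t; rewrite E.
Qed.

End lebesgue_density.

Lemma derivable_left_quotient (R : realType) (f : R -> R) (t : R) : derivable f t 1 ->
  k.+1%:R * (f t - f (t - k.+1%:R^-1)) @[k --> \oo] --> derive1 f t.
Proof.
move=> df; have /is_derive1P/cvgr_dnbhsP dF : is_derive t (1 : R) f (derive1 f t).
  by split => //; rewrite derive1E.
have /dF : (forall k : nat, - (k.+1%:R^-1 : R) != 0) /\ (fun k : nat => - (k.+1%:R^-1 : R)) @ \oo --> (0 : R).
  split; first by move=> k; rewrite oppr_eq0 invr_neq0.
  by rewrite -[X in _ --> X]oppr0; apply: (@cvgN _ R^o); exact: cvg_harmonic.
apply: cvg_trans; apply: near_eq_cvg; apply: nearW => k /=.
by rewrite invrN invrK mulNr -mulrN opprB.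
Qed.

Section causal_speed_bound.
Context {R : realType} {d : nat} {M : ptopologicalType}.
Context {A : smooth_structure R d.+1 M} (g : lorentz_metric A) (X : vector_field A).
Hypothesis hX : timelike_field g X.
Hypothesis hM : causally_simple g X.
Local Notation E := 'rV[R]_d.+1.
Local Notation l := (lorentz_tsep g X).
Local Notation mu := (@lebesgue_measure R).
Variable c : chart R d.+1 M.
Hypothesis ac : atlas A c.

Lemma lcc_cle (gamma : lcc l) (s t : R) : s <= t -> (0 <= time_sep g X (gamma s) (gamma t))%E.
Proof.
move=> st; rewrite (lcc_clamp gamma s) (lcc_clamp gamma t).
apply: (lcc_causal gamma).
- by rewrite le_max lexx.
- rewrite ge_max !le_max lexx/= orbC; apply/orP; left.
  by rewrite le_min ge_min st/= ge_min lexx !orbT.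
- by rewrite ge_max ler01/= ge_min lexx orbT.
Qed.

Lemma lcc_ge1 (gamma : lcc l) (t : R) : 1 <= t -> gamma t = gamma 1.
Proof. by move=> t1; rewrite (lcc_clamp gamma t) min_r// max_r. Qed.

(** In the default case of the choice the speed is zero, so the upper bounds on its integral remain
    true. *)
Lemma causal_speed_cases (gamma : lcc l) : causal_speed l gamma = cst 0%E \/
  exists nu, maximal_speed_measure l gamma nu /\ ac_density nu (causal_speed l gamma).
Proof.
rewrite /causal_speed; case: xgetP => [rho -> [nu h1 h2]|_]; last by left.
by right; exists nu.
Qed.

Lemma causal_speed_ge0 (gamma : lcc l) t : (0 <= causal_speed l gamma t)%E.
Proof. by case: (causal_speed_cases gamma) => [->//|[nu [_ []]]]. Qed.

(* [K] and [C] bound the coordinates on [U] and compare displacements there with a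
   time function; the latter makes the path a.e. Lipschitz at points of [U]. *)
Lemma speed_integral_le (p : M) (U : set M) (C K : R) (B : set M) (q : R) (phi : M -> R)
    (gamma : lcc l) :
  open U -> U `<=` cdom c -> 0 < C -> 0 <= K ->
  (forall x, U x -> `|qf (gmx g c p) (cmap c x) (vcomp X c p)| <= K) ->
  (forall x y, U x -> U y -> (0 <= time_sep g X x y)%E ->
    `|cmap c y - cmap c x| <= C * - qf (gmx g c p) (cmap c y - cmap c x) (vcomp X c p)) ->
  B `<=` U -> 0 <= q ->
  (forall y z : M, (0 <= time_sep g X y z)%E -> phi y <= phi z) ->
  (forall x, B x -> forall z, futc g X c x (intv z) -> exists2 D : R,
    pq (phi \o cinv c) (intv z) k (cmap c x) @[k --> \oo] --> D &
    q * Num.sqrt (- qf (gmx g c x) (intv z) (intv z)) <= D) ->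
  (\int[mu]_(t in `[0%R, 1%R]) ((q * \1_B (gamma t))%:E * causal_speed l gamma t)
     <= (phi (gamma 1) - phi (gamma 0))%:E)%E.
Proof.
move=> oU Uc C0 K0 UK UC BU q0 phi_causal hB.
have ndpsi : {homo (phi \o gamma) : s t / s <= t}.
  by move=> s t st; apply/phi_causal/lcc_cle.
case: (causal_speed_cases gamma) => [->|[nu [[adm _] [mrho rho0 [nus [_ nuE]]]]]].
  rewrite integral0_eq ?lee_fin ?subr_ge0 ?phi_causal//; first by apply: lcc_cle.
  by move=> t _; rewrite mule0.
set rho := causal_speed l gamma in mrho rho0 nuE *.
pose tau (x : M) := - qf (gmx g c p) (cmap c x) (vcomp X c p).
have tauB x y : tau y - tau x = - qf (gmx g c p) (cmap c y - cmap c x) (vcomp X c p).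
  by rewrite /tau qfDl qfNl opprD.
have tauK x : U x -> - K <= tau x <= K by move=> /UK; rewrite -ler_norml /tau normrN.
(* [theta a] is the time function along the path as long as it has stayed in [U] since time [a], and
   [- K] before, [K] after. This makes it monotone on the whole line, hence derivable a.e. *)
pose T (a : R) : set R := [set s | a <= s /\ forall r, a <= r <= s -> U (gamma r)].
pose theta (a s : R) : R := if s < a then - K else if pselect (T a s) then tau (gamma s) else K.
have ndtheta a : {homo theta a : s t / s <= t}.
  move=> s t st; rewrite /theta.
  have KK : - K <= K by lra.
  case: ltP => [sa|sa].
    case: ltP => ta //; case: (pselect (T a t)) => //= -[_ h].
    have Ut : U (gamma t) by apply: h; rewrite ta lexx.
    by have /andP[] := tauK _ Ut.
  rewrite ltNge (le_trans sa st) /=.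
  case: (pselect (T a t)) => [[h1 h2]|h].
    have Us : U (gamma s) by apply: h2; rewrite sa st.
    have Ut : U (gamma t) by apply: h2; rewrite h1 lexx.
    case: (pselect (T a s)) => [_|[]] /=; last first.
      by split => // r /andP[h3 h4]; apply: h2; rewrite h3 (le_trans h4).
    rewrite -subr_ge0 tauB; have := UC _ _ Us Ut (lcc_cle gamma st).
    by move=> /(le_trans (normr_ge0 _)); rewrite pmulr_rge0.
  case: (pselect (T a s)) => //= -[h1 h2]; have Us : U (gamma s) by apply: h2; rewrite h1 lexx.
  by have /andP[] := tauK _ Us.
apply: (nondecreasing_integral_le ndpsi).
- by move=> t t1 /=; rewrite lcc_ge1.
- by move=> t; rewrite mule_ge0// lee_fin mulr_ge0.
have dth := @ae_forall_countable _ _ R mu rat _ (fun a => nondecreasing_ae_derivable (ndtheta (ratr a))).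
apply: ae_imp (ae_and (density_le_left_bound mrho rho0) dth) => t [hrho hth] t01 dpsi.
have cvpsi := derivable_left_quotient dpsi.
have dpsi0 : 0 <= derive1 (phi \o gamma) t.
  rewrite -(cvg_lim (@Rhausdorff R) cvpsi); apply: limr_ge; first exact: cvgP cvpsi.
  by apply: nearW => k; rewrite mulr_ge0// subr_ge0 ndpsi// gerBl.
rewrite indicE; have [xB|xB] := boolP (gamma t \in B); last by rewrite mulr0 mul0e lee_fin.
rewrite mulr1; move/set_mem : xB => Bt; have Ut := BU _ Bt.
have [t0 t1] := andP t01.
apply: hrho => // ep ep0.
have lc := @lcc_left_continuous _ _ _ gamma t t0 (ltW t1).
have nU : \forall s \near t^'-, U (gamma s) by apply: lc; apply: open_nbhs_nbhs.
have [del /= del0 hdel] := nU.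
pose lo := Num.max 0 (t - del).
have lot : lo < t by rewrite gt_max t0 ltrBlDr ltrDl.
(* By left continuity the path stays in [U] just before [t], so some rational starting time is
   adapted to [t]; countably many functions [theta] are enough. *)
have [a] := rat_in_itvoo lot; rewrite in_itv/= => /andP[la at_].
have Tt : T (ratr a) t.
  split; first exact: ltW.
  move=> r /andP[ar]; rewrite le_eqVlt => /orP[/eqP->//|rt]; apply: hdel => //=.
  rewrite gtr0_norm ?subr_gt0//; move: la ar; rewrite gt_max => /andP[_ h1] h2; lra.
have cvth := derivable_left_quotient (hth a).
set th' := derive1 _ _ in cvth.
(* Bounds the rate of the coordinate displacement just before [t], which makes the first-order error
   linear in the time step. *)
pose L := C * (`|th'| + 1).
have L0 : 0 < L by rewrite mulr_gt0// ltr_wpDl.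
have ep'0 : 0 < ep / 2 / L by rewrite !divr_gt0.
have lb := causal_lower_bound hX hM ac (Uc _ Ut) phi_causal q0 (hB _ Bt) ep'0.
have tk : t - k.+1%:R^-1 @[k --> \oo] --> t^'-.
  have : (fun k : nat => t - k.+1%:R^-1) @ \oo --> t - 0.
    by apply: (@cvgB _ R^o); [exact: cvg_cst|exact: cvg_harmonic].
  rewrite subr0 => ct P [e /= e0 he].
  have : \forall k \near \oo, ball t e (t - k.+1%:R^-1) by apply: ct; exact: nbhsx_ballx.
  by apply: filterS => k hk; apply: he => //; rewrite ltrBlDr ltrDl invr_gt0.
have n1 : \forall k \near \oo, (0 <= time_sep g X (gamma (t - k.+1%:R^-1)%R) (gamma t))%E ->
   (q%:E * time_sep g X (gamma (t - k.+1%:R^-1)%R) (gamma t) <= (phi (gamma t) - phi (gamma (t - k.+1%:R^-1)%R) +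
     ep / 2 / L * `|cmap c (gamma t) - cmap c (gamma (t - k.+1%:R^-1)%R)|)%:E)%E.
  exact: (tk _ (lc _ lb)).
have n2 : \forall k \near \oo, k.+1%:R * ((phi \o gamma) t - (phi \o gamma) (t - k.+1%:R^-1)) < derive1 (phi \o gamma) t + ep / 2.
  by apply: (cvgr_lt _ cvpsi); rewrite ltrDl divr_gt0.
have n3 : \forall k \near \oo, k.+1%:R * (theta (ratr a) t - theta (ratr a) (t - k.+1%:R^-1)) < `|th'| + 1.
  by apply: (cvgr_lt _ cvth); rewrite (le_lt_trans (ler_norm _))// ltrDl.
have n4 : \forall k \near \oo, ratr a < t - k.+1%:R^-1.
  exact: (tk _ (nbhs_left_gt at_)).
apply: filterS (filterI (filterI n1 n2) (filterI n3 n4)) => k [[h1 h2] [h3 h4]].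
set s := t - k.+1%:R^-1 in h1 h2 h3 h4 *.
have st : s <= t by rewrite gerBl.
have s0 : 0 <= s by move: la; rewrite gt_max => /andP[h5 _]; lra.
have Ts : T (ratr a) s.
  by split; [exact: ltW|move=> r /andP[r1 r2]; apply: Tt.2; rewrite r1 (le_trans r2)].
have Us : U (gamma s) by apply: Ts.2; rewrite lexx ltW.
have thE r : T (ratr a) r -> theta (ratr a) r = tau (gamma r).
  by move=> Tr; rewrite /theta ltNge Tr.1 /=; case: (pselect (T (ratr a) r)).
have h3' : k.+1%:R * (tau (gamma t) - tau (gamma s)) < `|th'| + 1.
  by move: h3; rewrite !thE.
have cl := lcc_cle gamma st.
have rint : (\int[mu]_(r in `[s, t]) rho r <= time_sep g X (gamma s) (gamma t))%E.
  apply: le_trans (adm.2 s t s0 st (ltW t1)); rewrite nuE; last exact: measurable_itv.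
  by rewrite leeDl.
apply: (@le_trans _ _ (q%:E * time_sep g X (gamma s) (gamma t))%E); first by rewrite lee_wpmul2l// lee_fin.
apply: (le_trans (h1 cl)); rewrite lee_fin ler_pdivlMr ?ltr0n// mulrC mulrDr.
have -> : derive1 (phi \o gamma) t + ep = (derive1 (phi \o gamma) t + ep / 2) + ep / 2 by lra.
rewrite lerD//; first exact: ltW.
rewrite mulrCA -[leRHS](@divfK _ L) ?gt_eqF// ler_pM2l// /L.
apply: (@le_trans _ _ (k.+1%:R * (C * (tau (gamma t) - tau (gamma s))))).
  by rewrite ler_pM2l ?ltr0n// tauB; apply: UC.
by rewrite mulrCA ler_pM2l// ltW.
Qed.

End causal_speed_bound.

(** * Borel maps, volume in charts and truncation *)

Section borel_measurability.
Context {R : realType} {T T' : ptopologicalType}.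

Lemma open_continuous_borel (D : set (borel T)) (f : T -> T') : open (D : set T) ->
  (forall x, D x -> {for x, continuous f}) ->
  measurable_fun D (f : borel T -> borel T').
Proof.
move=> oD cf; suff h : preimage_set_system D f (@open T') `<=` (measurable : set (set (borel T))).
  by refine (@measurability _ _ (borel T) (borel T') D f (@open T' : set (set (borel T'))) _ h).
move=> _ [U oU <-]; apply: sub_sigma_algebra; rewrite openE => x [Dx Ux].
apply: filterI; first exact: open_nbhs_nbhs.
by apply: cf => //; exact: open_nbhs_nbhs.
Qed.

Lemma open_continuous_measurable (D : set (borel T)) (f : T -> R) : open (D : set T) ->
  (forall x, D x -> {for x, continuous f}) ->
  measurable_fun D (f : borel T -> R).
Proof.
move=> oD cf; apply: (measurability (@RGenOInfty.G R)); first exact: RGenOInfty.measurableE.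
move=> _ [_ [a ->] <-]; apply: sub_sigma_algebra; rewrite openE => x [Dx Ux].
apply: filterI; first exact: open_nbhs_nbhs.
by apply: cf => //; apply: open_nbhs_nbhs; split => //; exact: interval_open.
Qed.

Lemma borel_open (U : set T) : open U -> measurable (U : set (borel T)).
Proof. exact: sub_sigma_algebra. Qed.

End borel_measurability.

Lemma cvg_bigprod (R : realType) (T I : Type) (F : set_system T) (FF : Filter F)
    (r : seq I) (f : I -> T -> R) (l : I -> R) :
  (forall i, f i t @[t --> F] --> l i) ->
  \prod_(i <- r) f i t @[t --> F] --> \prod_(i <- r) l i.
Proof.
move=> fl; elim: r => [|i r IH].
  by rewrite big_nil; under eq_fun do rewrite big_nil; exact: cvg_cst.
by rewrite big_cons; under eq_fun do rewrite big_cons; apply: cvgM.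
Qed.

Lemma continuous_det (R : realType) (n : nat) : continuous (fun A : 'M[R]_n.+1 => \det A).
Proof.
move=> A; apply: (cvg_bigsum (nbhs_filter A)) => s; apply: (@cvgM R _ _ (nbhs_filter A)); first exact: cvg_cst.
by apply: (cvg_bigprod (nbhs_filter A)) => i; exact: coord_continuous.
Qed.

Lemma lorentz_det_lt0 (R : realType) (d : nat) (G : 'M[R]_d.+1) :
  (exists2 P, P \in unitmx & P *m G *m P^T = minkowski_mx R d) -> \det G < 0.
Proof.
move=> [P uP PG]; have : \det P ^+ 2 * \det G = -1.
  have := congr1 determinant PG; rewrite !det_mulmx det_tr mulrAC -expr2 => ->.
  rewrite /minkowski_mx det_diag big_ord_recl mxE eqxx big1 ?mulr1// => i _.
  by rewrite mxE.
have P0 : 0 < \det P ^+ 2 by rewrite exprn_even_gt0//= -unitfE -unitmxE.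
by move=> h; rewrite -(pmulr_rlt0 _ P0) h ltrN10.
Qed.

Section volume.
Context {R : realType} {d : nat} {M : ptopologicalType}.
Context {A : smooth_structure R d.+1 M} (g : lorentz_metric A).
Variable vol : {measure set (borel M) -> \bar R}.
Hypothesis hvol : is_volume g vol.
Variable c : chart R d.+1 M.
Hypothesis ac : atlas A c.
Local Notation E := 'rV[R]_d.+1.
Local Notation cimg := (cmap c @` cdom c).

Lemma measurable_chart_preimage (B : set E) : measurable (B : set (borel E)) ->
  measurable (cdom c `&` cmap c @^-1` B : set (borel M)).
Proof.
move=> mB; apply: (open_continuous_borel (cdom_open c)) => //.
- by move=> x dx; exact: cmap_continuous.
- by apply: borel_open; exact: cdom_open.
Qed.

Let image_preimage (B : set E) : cmap c @` (cdom c `&` cmap c @^-1` B) = B `&` cimg.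
Proof.
apply/seteqP; split=> [_ [x [dx Bx] <-]|y [By [x dx xy]]]; first by split => //; exists x.
by exists x => //; split => //=; rewrite xy.
Qed.

Let mcimg (B : set E) : measurable (B : set (borel E)) -> measurable (B `&` cimg : set (borel E)).
Proof. by move=> mB; apply: measurableI => //; apply: borel_open; exact: cimg_open. Qed.

Lemma vol_null (N : set E) : measurable (N : set (borel E)) -> leb (N : set (borel E)) = 0%E ->
  vol (cdom c `&` cmap c @^-1` N) = 0%E.
Proof.
move=> mN N0; rewrite (hvol ac (measurable_chart_preimage mN)) ?image_preimage; last exact: subIsetl.
apply/eqP; rewrite eq_le; apply/andP; split; last first.
  by apply: integral_ge0 => y _; rewrite lee_fin sqrtr_ge0.
rewrite -[leRHS](@integral0 _ _ _ (@lebesgue_rV R d) (N `&` cimg)).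
apply: ae_le_lower_integral => //.
  by apply: borel_caratheodory; exact: mcimg.
exists N; split => //; first exact: borel_caratheodory.
by move=> y /= h; apply: contrapT => Ny; apply: h => -[].
Qed.

Lemma ae_vol (P : E -> Prop) : {ae (@leb R d), forall y, P y} ->
  {ae vol, forall x, cdom c x -> P (cmap c x)}.
Proof.
move=> [N [mN N0 PN]]; exists (cdom c `&` cmap c @^-1` N); split.
- exact: measurable_chart_preimage.
- exact: vol_null.
by move=> x /= /not_implyP[dx nP]; split => //; apply: PN.
Qed.

(** The density is continuous and positive, hence at least half of its value at [y] nearby; test
    plans need their coordinate laws bounded by the volume. *)
Lemma leb_le_vol (y : E) : cimg y -> exists C r : R, [/\ 0 < C, 0 < r, ball y r `<=` cimg &
  forall B : set E, measurable (B : set (borel E)) -> B `<=` ball y r ->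
    (leb (B : set (borel E)) <= C%:E * vol (cdom c `&` cmap c @^-1` B))%E].
Proof.
move=> iy; pose D (z : E) := Num.sqrt (- \det (gmx g c (cinv c z))).
have [dy _] := cimgK iy.
have D0 : 0 < D y.
  by rewrite sqrtr_gt0 oppr_gt0; apply: lorentz_det_lt0; exact: gmx_signature.
have cD : {for y, continuous D}.
  apply: (@continuous_comp _ _ _ (fun z => - \det (gmx g c (cinv c z))) Num.sqrt y); last exact: sqrt_continuous.
  apply: (@continuousN _ R^o).
  apply: (@continuous_comp _ _ _ (fun z => gmx g c (cinv c z)) (fun G : 'M[R]_d.+1 => \det G) y); last exact: continuous_det.
  by apply: (@continuous_comp _ _ _ (cinv c) (gmx g c) y); [exact: cinv_continuous|exact: gmx_continuous].
have D2 : D y / 2 < D y by rewrite ltr_pdivrMr// ltr_pMr// ltr1n.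
have n1 : nbhs y [set z | D y / 2 < D z] by exact: (cvgr_gt _ cD).
have n2 : nbhs y cimg by apply: open_nbhs_nbhs; split => //; exact: cimg_open.
have /nbhs_ballP[r /= r0 hr] := @filterI _ _ (nbhs_filter y) _ _ n1 n2.
exists (D y / 2)^-1, r; split => //.
- by rewrite invr_gt0 divr_gt0.
- by move=> z /hr[].
move=> B mB Br; have Bi : B `&` cimg = B by apply/setIidPl => z /Br/hr[].
rewrite (hvol ac (measurable_chart_preimage mB)) ?image_preimage ?Bi; last exact: subIsetl.
rewrite muleC lee_pdivlMr ?divr_gt0//.
apply: (@le_trans _ _ (\int[lebesgue_rV]_(z in B) (D y / 2)%:E)%E).
  have mB' : measurable (B : set (caratheodory_type (@lebesgue_outer R d))) by exact: borel_caratheodory.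
  rewrite (@integral_cst _ _ _ (@lebesgue_rV R d) _ mB') [leRHS]muleC; exact: lexx.
apply: le_lower_integral; first exact: borel_caratheodory.
- by move=> z _; rewrite lee_fin ltW ?divr_gt0.
- by move=> z /Br/hr[/ltW].
Qed.

End volume.

Section truncation.
Context {R : realType}.
Implicit Types a b : \bar R.

Definition trunc (n : nat) a : R := fine (maxe (- n%:R)%:E (mine a n%:R%:E)).

Let truncE n a : (trunc n a)%:E = (maxe (- n%:R)%:E (mine a n%:R%:E))%E.
Proof.
rewrite fineK// fin_real// lt_max ltNyr/= gt_max ltry/= gt_min ltry orbT//.
Qed.

Lemma trunc_norm n a : `|trunc n a| <= n%:R.
Proof.
rewrite ler_norml -!lee_fin truncE le_max lexx/= ge_max ge_min lexx orbT andbT.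
by rewrite lee_fin -subr_ge0 opprK addr_ge0.
Qed.

Lemma le_trunc n a b : (a <= b)%E -> trunc n a <= trunc n b.
Proof.
move=> ab; rewrite -lee_fin !truncE ge_max le_max lexx/= le_max.
by apply/orP; right; rewrite le_min !ge_min ab lexx orbT.
Qed.

Lemma trunc_fin n (r : R) : - n%:R <= r <= n%:R -> trunc n r%:E = r.
Proof. by move=> /andP[h1 h2]; rewrite /trunc min_l ?lee_fin// max_r ?lee_fin. Qed.

(** If [a] or [b] is infinite the difference is [+oo] by convention; for finite values truncation is
    1-Lipschitz. *)
Lemma trunc_sub_le n a b : (a <= b)%E ->
  ((trunc n b - trunc n a)%:E <= (b - a)%dE)%E.
Proof.
move: a b => [a||] [b||] //= ab; rewrite ?leey//.
rewrite lee_fin in ab; rewrite (_ : (b%:E - a%:E)%dE = (b - a)%:E)// lee_fin /trunc -!EFin_min -!EFin_max /=.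
move: (ler0n R n); move: (n%:R) => N N0.
case: (leP b N) => ?; case: (leP a N) => ?; case: (leP (- N) b) => ?;
  case: (leP (- N) a) => ?; case: (leP (- N) N) => ?; lra.
Qed.

Lemma truncK n a : - n%:R < trunc n a < n%:R -> a = (trunc n a)%:E.
Proof.
have -> : trunc n a = fine (maxe (- n%:R)%:E (mine a n%:R%:E)) by [].
case: a => [r||].
- rewrite -EFin_min -EFin_max /=.
  case: (leP r n%:R) => h1.
    by case: (leP (- n%:R) r) => h2 /andP[h3 h4] //; move: h3; rewrite ltxx.
  by case: (leP (- n%:R) n%:R) => h2 /andP[h3 h4]; [move: h4|move: h3]; rewrite ltxx.
- rewrite min_r ?leey// -EFin_max /=.
  by case: (leP (- n%:R) n%:R) => h2 /andP[h3 h4]; [move: h4|move: h3]; rewrite ltxx.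
- by rewrite min_l ?leNye// max_l ?leNye//= ltxx.
Qed.

End truncation.

Section lower_bound_ae.
Context {R : realType} {d : nat} {M : ptopologicalType}.
Context {A : smooth_structure R d.+1 M} (g : lorentz_metric A) (X : vector_field A).
Hypothesis hX : timelike_field g X.
Hypothesis hM : causally_simple g X.
Variable vol : {measure set (borel M) -> \bar R}.
Hypothesis hvol : is_volume g vol.
Variable c : chart R d.+1 M.
Hypothesis ac : atlas A c.
Local Notation E := 'rV[R]_d.+1.
Local Notation l := (lorentz_tsep g X).
Local Notation mu := (@lebesgue_measure R).
Local Notation cimg := (cmap c @` cdom c).
Local Notation nrm x v := (Num.sqrt (- qf (gmx g c x) v v)).

(* [a] is the backward differential at [x] of [phi], read in the chart [c],
   along the future integral directions. *)
Definition left_differential (phi : M -> R) (x : M) (a : E) :=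
  forall z, futc g X c x (intv z) -> 0 <= pairing a (intv z) /\
    pq (phi \o cinv c) (intv z) k (cmap c x) @[k --> \oo] --> pairing a (intv z).

Lemma left_differential_ae (phi : M -> R) (m : R) : (forall x, `|phi x| <= m) ->
  (forall x y, (0 <= time_sep g X x y)%E -> phi x <= phi y) ->
  {ae vol, forall x, cdom c x -> exists a, left_differential phi x a}.
Proof.
move=> phim phi_causal; have := ae_vol hvol ac (pq_linear_ae ac phim phi_causal hX).
apply: ae_imp => x h dx; have [|a ha] := h dx; first by exists x.
by exists a => z; have := ha z; rewrite cmapK.
Qed.

Lemma regularization_at (phi : M -> R) (m : R) (p : M) : (forall x, `|phi x| <= m) ->
  (forall x y, (0 <= time_sep g X x y)%E -> phi x <= phi y) -> cdom c p ->
  exists (r : R) (F : E -> R), [/\ 0 < r, ball (cmap c p) r `<=` cimg,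
    measurable_fun setT (F : borel E -> R), (forall x, `|F x| <= m) &
    {ae (@leb R d), forall y, ball (cmap c p) r y -> (phi \o cinv c) y = F y}].
Proof.
move=> phim phi_causal dp; have [e fe] := fut_intv_exists (hX ac dp).
have icp : cimg (cmap c p) by exists p.
have fe' : futc g X c (cinv c (cmap c p)) (intv e) by rewrite cmapK.
have [r r0 hr] := timelike_ball_near ac icp fe'.
have [F [mF Fm hF _]] := ball_regularization ac phim phi_causal r0 hr.
exists r, F; split => // y; rewrite -ball_normE/= distrC => yr.
by have [] := hr y yr.
Qed.

Lemma open_futc (z : E) : open [set y | cimg y /\ futc g X c (cinv c y) z].
Proof.
rewrite openE => y [iy fy]; have [r r0 hr] := timelike_ball_near ac iy fy.
apply/nbhs_ballP; exists r => // w; rewrite -ball_normE/= distrC => wr.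
by have [iw] := hr w wr; move=> /(_ z); rewrite subrr normr0 => /(_ r0).
Qed.

Lemma continuous_norm (z y : E) : cimg y -> {for y, continuous (fun y => nrm (cinv c y) z)}.
Proof.
move=> iy; have [dy _] := cimgK iy.
apply: (@continuous_comp _ _ _ (fun y => - qf (gmx g c (cinv c y)) z z) Num.sqrt y); last exact: sqrt_continuous.
apply: (@continuousN _ R^o).
have cg : (gmx g c \o cinv c) @ (nbhs y) --> gmx g c (cinv c y).
  by apply: (@continuous_comp _ _ _ (cinv c) (gmx g c) y); [exact: cinv_continuous|exact: gmx_continuous].
exact: (cvg_qf (nbhs_filter y) cg (cvg_cst _) (cvg_cst _)).
Qed.

Lemma causal_speed_integral_ge0 (G : M -> \bar R) (gamma : lcc l) : (forall x, (0 <= G x)%E) ->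
  (0 <= \int[mu]_(t in `[0%R, 1%R]) (G (gamma t) * causal_speed l gamma t))%E.
Proof.
by move=> G0; apply: integral_ge0 => t _; rewrite mule_ge0//; exact: causal_speed_ge0.
Qed.

Variables (f : M -> \bar R) (G : borel M -> \bar R).
Hypothesis f_causal : causal_function l f.
Hypothesis Gmax : maximal_weak_subslope l vol f G.
Variable n : nat.
Let phi x := trunc n (f x).

Let phi_causal x y : (0 <= time_sep g X x y)%E -> phi x <= phi y.
Proof. by move=> xy; apply: le_trunc; exact: f_causal. Qed.

(** The candidates [q 1_B] need a Borel set [B], whereas [f] and its differential are not known to
    be measurable; the conditions are therefore expressed with the regularization [F], outside a
    Borel null set [N]. *)
Lemma cone_inf_le_maximal (p : M) : cdom c p -> exists O, nbhs p O /\
  {ae vol, forall x, O x -> forall a, left_differential phi x a ->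
    ((cone_inf (gmx g c x) (vcomp X c x) a)%:E <= G x)%E}.
Proof.
move=> dp.
have [r [F [r0 Qi mF _ hF]]] := regularization_at (fun x => trunc_norm n (f x)) phi_causal dp.
set Q := ball (cmap c p) r in Qi hF.
have oQ : open Q by exact: ball_open.
have mQ : measurable (Q : set (borel E)) by exact: borel_open.
have [C C0 [[U1 V1] /= [nU nV] UV]] := norm_le_time hX hM ac dp.
have nS : nbhs p (U1 `&` V1 `&` (cdom c `&` cmap c @^-1` Q)).
  apply: filterI; first exact: filterI.
  apply: filterI; first by apply: open_nbhs_nbhs; split => //; exact: cdom_open.
  by apply: cmap_continuous => //; exact: nbhsx_ballx.
move: nS; rewrite nbhsE => -[U [oU Up] US].
have Uc : U `<=` cdom c by move=> x /US[_ []].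
have UQ x : U x -> Q (cmap c x) by move=> /US[_ []].
have [K0 K00 hK0] := pairing_bound (vcomp X c p *m (gmx g c p)^T).
have K1 : 0 <= K0 * (`|cmap c p| + r) by rewrite mulr_ge0 ?(ltW K00)// addr_ge0// ltW.
have UK x : U x -> `|qf (gmx g c p) (cmap c x) (vcomp X c p)| <= K0 * (`|cmap c p| + r).
  move=> Ux; rewrite qf_pairing; apply: le_trans (hK0 _) _; rewrite ler_pM2l//.
  have := UQ _ Ux; rewrite /Q -ball_normE/= distrC => /ltW h.
  rewrite (_ : cmap c x = cmap c p + (cmap c x - cmap c p)); last by rewrite addrC subrK.
  by apply: le_trans (ler_normD _ _) _; rewrite lerD2l.
have UC x y : U x -> U y -> (0 <= time_sep g X x y)%E ->
    `|cmap c y - cmap c x| <= C * - qf (gmx g c p) (cmap c y - cmap c x) (vcomp X c p).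
  by move=> /US[[Ux _] _] /US[[_ Vy] _]; exact: (UV (x, y)).
have hz := ae_forall_countable (fun z : 'rV[int]_d.+1 => ae_eq_pq (intv z) oQ hF).
have [N [mN N0 HN]] := ae_and (pq_linear_ae ac (fun x => trunc_norm n (f x)) phi_causal hX) hz.
(* A Borel function that agrees with the directional derivative of [phi] off [N]. *)
pose D z (y : borel E) : \bar R := limn_esup (fun k => (pq F (intv z) k y)%:E).
pose bad q (z : 'rV[int]_d.+1) : set (borel E) := [set y | cimg y /\ futc g X c (cinv c y) (intv z)] `&`
  (Q `&` [set y | (D z y < (ratr q * nrm (cinv c y) (intv z))%:E)%E]).
have mbad q z : measurable (bad q z).
  apply: measurableI; first by apply: borel_open; exact: open_futc.
  apply: measurable_lte => //.
    apply: measurable_funTS; apply: measurable_fun_limn_esup => k.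
    by apply/measurable_EFinP; exact: measurable_pq.
  apply/measurable_EFinP; apply: measurable_funM => //.
  by apply: open_continuous_measurable => // y /Qi iy; exact: continuous_norm.
(* The points where the derivative along every future integral vector is at least [q] times its
   length. *)
pose Bq q : set (borel E) := (Q `&` ~` N) `&` ~` (\bigcup_(z in [set: 'rV[int]_d.+1]) bad q z).
have mBq q : measurable (Bq q).
  apply: measurableI; first by apply: measurableI => //; exact: measurableC.
  apply: measurableC; apply: countable_bigcupT_measurable => //; exact: countableP.
pose B q : set (borel M) := U `&` (cdom c `&` cmap c @^-1` (Bq q)).
have mB q : measurable (B q).
  by apply: measurableI; [exact: borel_open|exact: measurable_chart_preimage].
have Dlim y z (a : E) : Q y -> ~ N y -> pq (phi \o cinv c) (intv z) k y @[k --> \oo] --> pairing a (intv z) ->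
    D z y = (pairing a (intv z))%:E.
  move=> Qy Ny ca; have [_ /(_ z Qy) eqk] : (cimg y -> exists a : E, forall z, futc g X c (cinv c y) (intv z) ->
      0 <= pairing a (intv z) /\ pq (phi \o cinv c) (intv z) k y @[k --> \oo] --> pairing a (intv z)) /\
      (forall z : 'rV[int]_d.+1, Q y -> \forall k \near \oo, pq (phi \o cinv c) (intv z) k y = pq F (intv z) k y).
    by apply: contrapT => h; apply: Ny; apply: HN.
  apply: (cvg_limn_einf_sup _).2; apply: cvg_EFin; first exact: nearW.
  by apply: cvg_trans ca; apply: near_eq_cvg; apply: filterS eqk => k ->.
have wB (q : rat) : 0 <= ratr q :> R -> weak_subslope l vol f (fun x => (ratr q * \1_(B q) x)%:E).
  move=> q0; split.
  - by apply/measurable_EFinP; apply: measurable_funM => //; exact: measurable_indic.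
  - by move=> x; rewrite lee_fin mulr_ge0.
  move=> pi _; apply: le_lower_integral => // gamma _.
    by apply: (@causal_speed_integral_ge0 (fun x => (ratr q * \1_(B q) x)%:E)) => x; rewrite lee_fin mulr_ge0.
  apply: le_trans (trunc_sub_le n _); last first.
    by apply: f_causal; apply: lcc_cle; exact: ler01.
  apply: (@speed_integral_le _ _ _ _ g X hX hM c ac p U C _ (B q) (ratr q) phi gamma oU Uc C0 K1 UK UC) => //.
    by move=> x [].
  move=> x [Ux [dx [[Qx Nx] nbad]]] z fz.
  have [hlin _] : (cimg (cmap c x) -> exists a : E, forall z, futc g X c (cinv c (cmap c x)) (intv z) ->
      0 <= pairing a (intv z) /\ pq (phi \o cinv c) (intv z) k (cmap c x) @[k --> \oo] --> pairing a (intv z)) /\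
      (forall z : 'rV[int]_d.+1, Q (cmap c x) -> \forall k \near \oo, pq (phi \o cinv c) (intv z) k (cmap c x) = pq F (intv z) k (cmap c x)).
    by apply: contrapT => h; apply: Nx; apply: HN.
  have [|a ha] := hlin; first by exists x.
  have fz' : futc g X c (cinv c (cmap c x)) (intv z) by rewrite cmapK.
  have [_ ca] := ha z fz'; exists (pairing a (intv z)) => //.
  rewrite leNgt; apply/negP => qlt; apply: nbad; exists z => //; split.
    by split => //; exists x.
  by split => //=; rewrite (Dlim _ _ _ Qx Nx ca) lte_fin cmapK.
exists U; split; first by exists U.
have aeq : {ae vol, forall x, forall q : rat, 0 <= ratr q :> R -> ((ratr q * \1_(B q) x)%:E <= G x)%E}.
  apply: ae_forall_countable => q.
  have [q0|q0] := boolP (0 <= ratr q :> R); last by apply: aeW.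
  by apply: ae_imp (Gmax.2 _ (wB q q0)) => x h _.
have aN : {ae (@leb R d), forall y, ~ N y}.
  by exists N; split => // y /= /contrapT.
apply: ae_imp (ae_and aeq (ae_vol hvol ac aN)) => x [hq hN] Ux a ha.
have dx := Uc _ Ux; have Qx := UQ _ Ux; have Nx := hN dx.
have G0 : (0 <= G x)%E by have [[]] := Gmax.
apply/lee_addgt0Pr => e e0.
set s := cone_inf _ _ _.
have s0 : 0 <= s by apply: (cone_inf_ge0 (hX ac dx)) => z fz; exact: (ha z fz).1.
have [se|es] := leP s e.
  by apply: (@le_trans _ _ e%:E); [rewrite lee_fin|rewrite leeDr].
(* Rational constants suffice, so only countably many candidates are compared with [G]. *)
have [q] := @rat_in_itvoo R (s - e) s (ltac:(by rewrite ltrBlDr ltrDl)).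
rewrite in_itv/= => /andP[q1 q2].
have q0 : 0 <= ratr q :> R by lra.
apply: (@le_trans _ _ ((ratr q)%:E + e%:E)%E); first by rewrite -EFinD lee_fin; lra.
rewrite leeD2r//; have := hq q q0; rewrite indicE mem_set ?mulr1//.
split => //; split => //; split; first by split.
move=> [z _ [[_ fz] [_ /= Dz]]]; rewrite cmapK// in fz Dz.
have [_ ca] := ha z fz; move: Dz; rewrite (Dlim _ _ _ Qx Nx ca) lte_fin.
apply/negP; rewrite -leNgt.
have nz : 0 < nrm x (intv z) by rewrite sqrtr_gt0 oppr_gt0; case: fz.
rewrite -ler_pdivlMr//; apply: le_trans (ltW q2) _.
by apply: cone_inf_le fz => z' fz'; exact: (ha z' fz').1.
Qed.

End lower_bound_ae.

(** * Upper bound on the maximal weak subslope *)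

Section absolutely_continuous_measures.
Context {R : realType}.
Local Notation mu := (@lebesgue_measure R).
Implicit Types nu : {measure set (measurableTypeR R) -> \bar R}.
Local Notation I01 := (`[0%R, 1%R]%classic : set (measurableTypeR R)).

(** The Lipschitz bound gives [nu] a density, and the bound on short left intervals compares it with
    [f] a.e. This serves to prove maximality of a speed measure. *)
Lemma measure_le_density (f : R -> \bar R) (C : R) nu : 0 < C ->
  measurable_fun setT f -> (forall t, (0 <= f t)%E) -> nu (~` I01) = 0%E ->
  (forall s t : R, 0 <= s -> s <= t -> t <= 1 -> (nu `[s, t]%classic <= (C * (t - s))%:E)%E) ->
  (forall t, 0 < t < 1 -> exists2 k, f t = k%:E & forall ep, 0 < ep -> \forall n \near \oo,
     (nu `[(t - n.+1%:R^-1)%R, t]%classic <= ((k + ep) / n.+1%:R)%:E)%E) ->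
  forall B : set (measurableTypeR R), measurable B -> (nu B <= \int[mu]_(t in B) f t)%E.
Proof.
move=> C0 mf f0 nuC nuL nuf B mB.
have mI : measurable I01 by exact: measurable_itv.
have nuI (D : set (measurableTypeR R)) : measurable D -> nu D = nu (D `&` I01).
  move=> mD; apply/eqP; rewrite eq_le; apply/andP; split; last first.
    by apply: le_measure; rewrite ?inE//; exact: measurableI.
  rewrite -[X in nu X](setUIDK D I01); apply: le_trans (measureU2 _ _ _) _ => //.
  - exact: measurableI.
  - exact: measurableD.
  rewrite -[leRHS]adde0 leeD2l// -nuC.
  by apply: le_measure => [||x []//]; rewrite inE; [exact: measurableD|exact: measurableC].
have nuab (a b : R) : a <= b -> (nu `]a, b]%classic <= (C * (b - a))%:E)%E.
  move=> ab; rewrite nuI; last exact: measurable_itv.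
  pose a' := Num.max 0 a; pose b' := Num.min b 1.
  have [ab'|ba'] := leP a' b'; last first.
    rewrite (_ : _ `&` _ = set0) ?measure0 ?lee_fin ?mulr_ge0 ?subr_ge0// ?(ltW C0)//.
    apply/seteqP; split=> x //= []; rewrite !in_itv/= => /andP[h1 h2] /andP[h3 h4].
    move: ba'; rewrite lt_max !gt_min => /orP[/orP[]|/orP[]] h; lra.
  apply: (@le_trans _ _ (nu `[a', b']%classic)).
    apply: le_measure; rewrite ?inE.
    - by apply: measurableI => //; exact: measurable_itv.
    - exact: measurable_itv.
    move=> x []; rewrite /= !in_itv/= => /andP[h1 h2] /andP[h3 h4].
    by rewrite /a' /b' ge_max le_min h2 h3 h4 (ltW h1).
  apply: le_trans (nuL _ _ _ ab' _) _; [by rewrite /a' le_max lexx|by rewrite /b' ge_min lexx orbT|].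
  by rewrite lee_fin ler_pM2l// lerB// /a' /b' ?le_max ?ge_min lexx ?orbT.
have nuT : (nu setT < +oo)%E.
  rewrite nuI// setTI; apply: (@le_lt_trans _ _ (C * (1 - 0))%:E); last exact: ltry.
  exact: nuL.
have [k [mk k0 ik nuE _]] := lipschitz_measure_density C0 nuab nuT.
have mek : measurable_fun setT (EFin \o k) by apply/measurable_EFinP.
have ke0 t : (0 <= (EFin \o k) t)%E by rewrite lee_fin.
have kf : {ae mu, forall t : R, 0 < t < 1 -> ((k t)%:E <= f t)%E}.
  apply: ae_imp (density_le_left_bound mek ke0) => t ht t01.
  have [q fq hq] := nuf t t01.
  have q0 : 0 <= q by rewrite -lee_fin -fq.
  have := ht 1 q ler01 q0; rewrite mul1e fq; apply => ep ep0.
  apply: filterS (hq ep ep0) => n; rewrite mul1e => hn; apply: le_trans hn.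
  by rewrite nuE//; exact: measurable_itv.
rewrite nuI//.
apply: (@le_trans _ _ (\int[mu]_(t in B `&` I01) f t)%E); last first.
  apply: ge0_subset_integral => //; [exact: measurableI|exact: measurable_funTS].
rewrite nuE; last exact: measurableI.
apply: ae_le_lower_integral => [|t _|//|]; [exact: measurableI|by rewrite lee_fin|].
apply: ae_imp (ae_and (ae_and (ae_neq 0%R) (ae_neq 1%R)) kf) => t [[t0 t1] kft] [_].
rewrite /= in_itv/= => h; apply: kft.
by rewrite !lt_neqAle eq_sym t0 t1.
Qed.

(** Uniqueness of the density: off a null set [Z] carrying the singular part, both functions have
    the same integrals. *)
Lemma ac_density_ae (f rho : R -> \bar R) nu : mu.-integrable setT f -> (forall t, (0 <= f t)%E) ->
  (forall B : set (measurableTypeR R), measurable B -> nu B = \int[mu]_(t in B) f t)%E ->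
  ac_density nu rho -> {ae mu, forall t, f t = rho t}.
Proof.
move=> fint f0 nuf [mrho rho0 [nus [[Z mZ [Z0 nusZ]] nuE]]].
have mf : measurable_fun setT f by case/integrableP: fint.
suff : ae_eq mu setT f rho by apply: ae_imp => t; exact.
apply: integral_ae_eq => // B _ mB.
have mBZ : measurable (B `\` Z) by exact: measurableD.
rewrite (@ge0_negligible_integral _ _ _ mu B Z)//; last exact: measurable_funTS.
rewrite [RHS](@ge0_negligible_integral _ _ _ mu B Z)//; last exact: measurable_funTS.
rewrite -nuf// nuE// (_ : nus (B `\` Z) = 0%E) ?adde0//.
apply/eqP; rewrite eq_le measure_ge0 andbT -nusZ.
by apply: le_measure => [||x []//]; rewrite inE//; exact: measurableC.
Qed.

End absolutely_continuous_measures.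

(** * Causal speed of coordinate segments *)

Section segment_speed.
Context {R : realType} {d : nat} {M : ptopologicalType}.
Context {A : smooth_structure R d.+1 M} (g : lorentz_metric A) (X : vector_field A).
Hypothesis hX : timelike_field g X.
Hypothesis hM : causally_simple g X.
Local Notation E := 'rV[R]_d.+1.
Local Notation l := (lorentz_tsep g X).
Local Notation mu := (@lebesgue_measure R).
Local Notation I01 := (`[0%R, 1%R]%classic : set (measurableTypeR R)).
Variable c : chart R d.+1 M.
Hypothesis ac : atlas A c.
Local Notation cimg := (cmap c @` cdom c).
Local Notation nrm x v := (Num.sqrt (- qf (gmx g c x) v v)).

Definition clamp (t : R) : R := Num.max 0 (Num.min t 1).

Lemma clamp01 t : 0 <= clamp t <= 1.
Proof. by rewrite /clamp le_max lexx/= ge_max ler01/= ge_min lexx orbT. Qed.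

Lemma clamp_id t : 0 <= t <= 1 -> clamp t = t.
Proof. by move=> /andP[t0 t1]; rewrite /clamp min_l// max_r. Qed.

Lemma continuous_clamp : continuous clamp.
Proof.
move=> t.
have c1 : {for t, continuous ((fun x : R => x : R^o) \min (cst 1))}.
  by apply: continuous_min; [exact: cvg_id|exact: cst_continuous].
have : {for t, continuous ((cst 0 : R -> R^o) \max ((fun x : R => x : R^o) \min (cst 1)))}.
  by apply: continuous_max => //; exact: cst_continuous.
exact.
Qed.

Variables (y v : E) (C : R).
Hypothesis img : forall t : R, 0 <= t <= 1 -> cimg (y + t *: v).
Hypothesis fv : forall t : R, 0 <= t <= 1 -> futc g X c (cinv c (y + t *: v)) v.
Hypothesis C0 : 0 < C.
Hypothesis timeC : forall s t : R, 0 <= s -> s <= t -> t <= 1 ->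
  (time_sep g X (cinv c (y + s *: v)) (cinv c (y + t *: v)) <= (C * (t - s))%:E)%E.

Let gam0 (t : R) := cinv c (y + t *: v).
Let gam (t : R) := gam0 (clamp t).

Let imgc t : cimg (y + clamp t *: v). Proof. exact/img/clamp01. Qed.

Let gam_continuous : continuous gam.
Proof.
move=> t; apply: (@continuous_comp _ _ _ clamp gam0 t); first exact: continuous_clamp.
exact: (segment_continuous img (clamp01 t)).
Qed.

Let lgam0 : lcurve g X gam0. Proof. exact: segment_lcurve ac img fv. Qed.

Let gam_causal : causal_path l gam.
Proof.
move=> s t s0 st t1; rewrite /cle /gam !clamp_id ?s0 ?t1 ?(le_trans s0 st) ?(le_trans st t1)//.
exact: lcurve_time_sep lgam0 s0 st t1.
Qed.

Let gam_clamp t : gam t = gam (Num.max 0 (Num.min t 1)).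
Proof. by rewrite /gam -/(clamp t) (clamp_id (clamp01 t)). Qed.

Definition segment_path : lcc l := Lcc gam_causal
  (fun t _ _ => cvg_at_left_filter (@gam_continuous t)) gam_clamp.

Let k0 (t : R) := nrm (gam t) v.
Let f (t : R) : \bar R := (k0 t * \1_I01 t)%:E.

Let k0_continuous : continuous k0.
Proof.
move=> t; apply: (@continuous_comp _ _ _ (fun t => - qf (gmx g c (gam t)) v v) Num.sqrt t); last exact: sqrt_continuous.
apply: (@continuousN _ R^o).
have [dt _] := cimgK (imgc t).
have cg : (gmx g c \o gam) @ t --> gmx g c (gam t).
  by apply: (@continuous_comp _ _ _ gam (gmx g c) t); [exact: gam_continuous|exact: gmx_continuous].
exact: (cvg_qf (nbhs_filter t) cg (cvg_cst _) (cvg_cst _)).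
Qed.

Let mk0 : measurable_fun setT k0. Proof. exact: continuous_measurable_fun. Qed.
Let mf : measurable_fun setT f.
Proof.
apply/measurable_EFinP; apply: measurable_funM => //; exact: measurable_indic.
Qed.
Let f0 t : (0 <= f t)%E. Proof. by rewrite lee_fin mulr_ge0// sqrtr_ge0. Qed.

Let nu : {measure set (measurableTypeR R) -> \bar R} := density_measure mu mf f0.

(** The reparametrized piece of the segment is a causal curve, and its length is [nu] of the
    interval by an affine change of variables. *)
Let nu_itv (s t : R) : 0 <= s -> s < t -> t <= 1 -> (nu `[s, t]%classic <= time_sep g X (gam s) (gam t))%E.
Proof.
move=> s0 st t1; have ts0 : 0 < t - s by rewrite subr_gt0.
have s01 : 0 <= s <= 1 by rewrite s0 (le_trans (ltW st)).
have t01 : 0 <= t <= 1 by rewrite t1 (le_trans s0 (ltW st)).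
have aff01 r : 0 <= r <= 1 -> 0 <= (t - s) * r + s <= 1.
  by move=> /andP[r0 r1]; apply/andP; split; [rewrite addr_ge0// mulr_ge0// ltW|nra].
have := time_sep_ge (sub_lcurve s0 st t1 lgam0).
rewrite mulr0 add0r mulr1 subrK /gam !clamp_id//; apply: le_trans.
have E1 := @ge0_integral_affine R (t - s) s ts0 `[s, t]%classic f (measurable_itv _)
  (measurable_funTS mf) (fun t _ => f0 t).
rewrite /nu /= /density_measure /length -E1.
rewrite -ge0_integralZl; last 4 first.
- rewrite -[X in measurable X]setTI; apply: measurable_affine => //; exact: measurable_itv.
- apply: measurable_funTS; exact: (measurableT_comp mf (measurable_affine _ _)).
- by [].
- by rewrite lee_fin ltW.
rewrite (_ : _ @^-1` _ = `[0%R, 1%R]%classic); last first.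
  apply/seteqP; split=> r /=; rewrite !in_itv/=.
    by move=> /andP[r0 r1]; apply/andP; split; nra.
  by move=> /andP[r0 r1]; apply/andP; split; nra.
apply: le_lower_integral => //.
  by move=> r _; rewrite mule_ge0// lee_fin ltW.
move=> r; rewrite /= in_itv/= => r01; have h01 := aff01 r r01.
rewrite /f -EFinM lee_fin indicE mem_set/=; last by rewrite in_itv.
have [dx _] := cimgK (img h01).
have [dg vg] := segment_velocity img h01.
have cg0 := segment_continuous img h01.
have [dg' vg'] := derive_affine dg.
have cgr : {for r, continuous (fun r => gam0 ((t - s) * r + s))}.
  apply: (@continuous_comp _ _ _ (fun r => (t - s) * r + s) gam0 r); last exact: cg0.
  by apply: (@continuousD _ R^o); [apply: (@continuousM R); [exact: cst_continuous|exact: cvg_id]|exact: cst_continuous].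
have := @speed_chart R d M A g c (fun r => gam0 ((t - s) * r + s)) r ac dx cgr dg'.
rewrite /= => ->; rewrite /velocity /comp vg' -/(velocity c gam0 _) vg gform_qf qfZl qfZr.
rewrite mulr1 /k0 /gam clamp_id//.
rewrite -[leLHS]/((t - s) * nrm (gam0 ((t - s) * r + s)) v).
rewrite (_ : - ((t - s) * _) = (t - s) ^+ 2 * - qf (gmx g c (gam0 ((t - s) * r + s))) v v); last by ring.
by rewrite sqrtrM ?sqr_ge0// sqrtr_sqr gtr0_norm.
Qed.

Let nu_adm : speed_admissible l segment_path nu.
Proof.
split.
  rewrite /nu /= /density_measure; apply: integral0_eq => t /= tI.
  by rewrite /f indicE memNset// mulr0.
move=> s t s0 st t1; have [->|ne] := eqVneq s t; last by apply: nu_itv => //; rewrite lt_neqAle ne.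
rewrite set_itv1 (_ : nu _ = 0%E); first exact: time_sep_refl.
exact: (integral_set1 f t).
Qed.

(** The time separation of nearby points of the segment exceeds its length by a small relative error
    only, by the local bound at [gam0 t] tested with [b = v]. *)
Let nu_max : maximal_speed_measure l segment_path nu.
Proof.
split; first exact: nu_adm.
move=> nu' [nu'C nu'l] B mB.
have gamE t : 0 <= t <= 1 -> gam t = gam0 t by move=> t01; rewrite /gam clamp_id.
apply: (@measure_le_density _ f C nu' C0 mf f0 nu'C) => //.
  move=> s t s0 st t1; apply: le_trans (nu'l s t s0 st t1) _.
  rewrite /= !gamE ?s0 ?t1 ?(le_trans s0 st) ?(le_trans st t1)//; exact: timeC.
move=> t t01; have [t0 t1] := andP t01.
have t01' : 0 <= t <= 1 by rewrite !ltW.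
have tI : I01 t by rewrite /= in_itv.
exists (k0 t); first by rewrite /f indicE mem_set// mulr1.
move=> ep ep0.
have [dx cx] := cimgK (img t01').
have fvt := fv t01'.
have Pf : 0 < - qf (gmx g c (gam0 t)) v (vcomp X c (gam0 t)) by rewrite oppr_gt0; case: fvt.
have nv0 : 0 < nrm (gam0 t) v by rewrite sqrtr_gt0 oppr_gt0; case: fvt.
pose P := - qf (gmx g c (gam0 t)) v (vcomp X c (gam0 t)) * `|v| + 1.
have P0 : 0 < P by rewrite ltr_wpDl// mulr_ge0// ltW.
(* Makes the relative error at most [ep] after division by the length of [v]; the summand 1 in [P]
   makes it positive. *)
pose th := ep * nrm (gam0 t) v / P.
have th0 : 0 < th by rewrite divr_gt0// mulr_gt0.
have [[U V] /= [nU nV] UV] := time_sep_le hX hM ac dx th0.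
have tk : t - k.+1%:R^-1 @[k --> \oo] --> t.
  have : (fun k : nat => t - k.+1%:R^-1) @ \oo --> t - 0.
    by apply: (@cvgB _ R^o); [exact: cvg_cst|exact: cvg_harmonic].
  by rewrite subr0.
have n1 : \forall k \near \oo, U (gam (t - k.+1%:R^-1)).
  by apply: (tk (gam @^-1` U)); apply: gam_continuous; rewrite gamE.
have n2 : \forall k \near \oo, 0 < t - k.+1%:R^-1 by apply: (cvgr_gt _ tk).
apply: filterS (filterI n1 n2) => k [Uk sk].
set s := t - k.+1%:R^-1 in Uk sk *.
have st : s <= t by rewrite gerBl.
have s01 : 0 <= s <= 1 by rewrite (ltW sk) (le_trans st (ltW t1)).
apply: le_trans (nu'l s t (ltW sk) st (ltW t1)) _ => /=.
have := UV (gam s, gam t) (conj Uk _) v fvt; rewrite /= !gamE//.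
move=> /(_ (nbhs_singleton nV)); have [_ cs] := cimgK (img s01).
rewrite cs cx (_ : y + t *: v - (y + s *: v) = k.+1%:R^-1 *: v); last first.
  by rewrite /s scalerBl opprD addrACA subrr add0r opprB addrC subrK.
move=> h; have := lee_scaled nv0 ler01 h; rewrite mul1e; apply.
rewrite mul1r qfZr normrZ gtr0_norm ?invr_gt0// /k0 gamE//.
have nv2 : nrm (gam0 t) v * nrm (gam0 t) v = - qf (gmx g c (gam0 t)) v v.
  by rewrite -expr2 sqr_sqrtr// oppr_ge0 ltW//; case: fvt.
have thP : nrm (gam0 t) v * ep = th * P by rewrite /th divfK ?gt_eqF// mulrC.
rewrite mulrA mulrDr nv2 thP -subr_ge0 /P; set Q := qf _ _ (vcomp _ _ _).
rewrite (_ : _ - _ = th / k.+1%:R); last by rewrite /Q /gam0; ring.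
by rewrite divr_ge0// ltW.
Qed.

(** [causal_speed] is the density of some maximal measure, which coincides with [nu] since each
    dominates the other; densities are unique a.e. *)
Lemma segment_causal_speed : {ae mu, forall t, 0 <= t <= 1 ->
  causal_speed l segment_path t = (nrm (cinv c (y + t *: v)) v)%:E}.
Proof.
have fint : mu.-integrable setT f.
  apply/integrableP; split; first exact: mf.
  have -> : (\int[mu]_x `|f x| = \int[mu]_x f x)%E by apply: eq_integral => t _; rewrite gee0_abs.
  rewrite -[X in (X < _)%E]/(nu setT).
  apply: (@le_lt_trans _ _ (nu I01 + nu (~` I01))%E).
    rewrite -measureU//; last by rewrite setICr.
    - by rewrite setUCr.
    - by apply: measurableC.
  rewrite nu_adm.1 adde0; apply: (@le_lt_trans _ _ (C * (1 - 0))%:E); last exact: ltry.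
  apply: le_trans (nu_adm.2 0 1 (lexx _) ler01 (lexx _)) _.
  by rewrite /= /gam !clamp_id ?lexx ?ler01//; exact: timeC.
have acf : ac_density nu f.
  split => //; exists mzero; split; first by exists set0 => //; rewrite measure0.
  by move=> B mB; rewrite adde0.
have : exists2 nu', maximal_speed_measure l segment_path nu' & ac_density nu' (causal_speed l segment_path).
  rewrite /causal_speed; case: xgetP => [rho _ //|h].
  by exfalso; apply: (h f); exists nu.
move=> [nu' [adm' max'] ac'].
have nuE (B : set (measurableTypeR R)) : measurable B -> (nu' B = \int[mu]_(t in B) f t)%E.
  move=> mB; apply/eqP; rewrite eq_le; apply/andP; split.
    exact: nu_max.2.
  exact: max' nu_adm _ mB.
apply: ae_imp (ac_density_ae fint f0 nuE ac') => t <- t01.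
by rewrite /f indicE mem_set ?mulr1 /k0 /gam ?clamp_id//= in_itv.
Qed.

End segment_speed.

(** The law of [Phi x] for [x] uniform in [B]. The factor [mu B] stays on the left so that no
    division of extended reals occurs. *)
Section uniform_law.
Context d (T : measurableType d) (R : realType) (mu : {measure set T -> \bar R}).
Context d' (T' : measurableType d') (P : probability T' R).
Variables (B : set T) (mB : measurable B) (Phi : T -> T') (mPhi : measurable_fun setT Phi).
Local Open Scope ereal_scope.

Lemma integral_mrestr (D : set T) (mD : measurable D) (h : T -> \bar R) : measurable_fun setT h ->
  (forall x, 0 <= h x) -> \int[mrestr mu mD]_x h x = \int[mu]_(x in D) h x.
Proof.
move=> mh h0; rewrite (@ge0_negligible_integral _ _ _ (mrestr mu mD) setT (~` D))//.
- rewrite setTD setCK; apply: eq_measure_integral => A mA AD.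
  by rewrite [LHS](_ : _ = mu (A `&` D))//; congr (mu _); apply/setIidPl.
- exact: measurableC.
- by rewrite [LHS](_ : _ = mu (~` D `&` D))// setICl measure0.
Qed.

Lemma uniform_law : 0 < mu B -> mu B < +oo -> exists pi : probability T' R,
  (forall A, measurable A -> mu B * pi A = mu (B `&` Phi @^-1` A)) /\
  (forall h : T' -> \bar R, measurable_fun setT h -> (forall y, 0 <= h y) ->
     mu B * \int[pi]_y h y = \int[mu]_(x in B) h (Phi x)).
Proof.
move=> B0 Boo.
pose nu : {measure set T' -> \bar R} :=
  measure_function_pushforward__canonical__measure_function_Measure (mrestr mu mB) mPhi.
have nuE A : nu A = mu (B `&` Phi @^-1` A) by rewrite [LHS](_ : _ = mu (Phi @^-1` A `&` B))// setIC.
have nuT : nu setT = mu B by rewrite nuE preimage_setT setIT.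
have Bfin : mu B \is a fin_num by rewrite ge0_fin_numE.
pose r : R := fine (mu B).
have r0 : (0 < r)%R by rewrite fine_gt0// B0.
pose pi : probability T' R := mnormalize nu P.
have piE A : pi A = nu A * (r^-1)%:E.
  rewrite [LHS](_ : _ = mnormalize nu P A)// /mnormalize nuT.
  by rewrite gt_eqF//= lt_eqF.
have muB : mu B = r%:E by rewrite fineK.
exists pi; split=> [A mA|h mh h0].
  by rewrite piE nuE muB muleCA -EFinM divff ?gt_eqF// mule1.
have rV0 : (0 <= r^-1)%R by rewrite invr_ge0 ltW.
rewrite (eq_measure_integral (mscale (NngNum rV0) nu)); last first.
  by move=> A mA _; rewrite [LHS](piE A) muleC.
rewrite ge0_integral_mscale//= muleA muB -EFinM divff ?gt_eqF// mul1e.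
rewrite [LHS](ge0_integral_pushforward mPhi (mrestr mu mB) measurableT mh); last first.
  by move=> y _; exact: h0.
rewrite preimage_setT integral_mrestr//.
- exact: measurableT_comp.
- by move=> x /=; exact: h0.
Qed.

End uniform_law.

(** Tested on the sets where [a] exceeds [b] by [1 / (j + 1)]. Only [b] must be integrable, since
    [a] may be infinite. *)
Lemma ae_le_of_integral_le d (T : measurableType d) (R : realType) (mu : {measure set T -> \bar R})
    (D : set T) (a : T -> \bar R) (b : T -> R) (C : R) : measurable D -> (mu D < +oo)%E -> 0 <= C ->
  measurable_fun setT a -> measurable_fun setT b -> (forall x, (0 <= a x)%E) ->
  (forall x, 0 <= b x <= C) ->
  (forall B, measurable B -> B `<=` D -> (0 < mu B)%E ->
     (\int[mu]_(x in B) a x <= \int[mu]_(x in B) (b x)%:E)%E) ->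
  {ae mu, forall x, D x -> (a x <= (b x)%:E)%E}.
Proof.
move=> mD Doo C0 ma mb a0 bC hB.
pose B j := D `&` [set x | ((b x + j.+1%:R^-1)%:E <= a x)%E].
have mbj j : measurable_fun D (fun x => (b x + j.+1%:R^-1)%:E).
  by apply/measurable_EFinP; apply: measurable_funD => //; exact: measurable_funTS.
have mB j : measurable (B j).
  by apply: measurable_lee => //; exact: measurable_funTS.
have B0 j : mu (B j) = 0%E.
  apply/eqP; rewrite eq_le measure_ge0 andbT leNgt; apply/negP => Bp.
  have Bfin : mu (B j) \is a fin_num.
    rewrite ge0_fin_numE//; apply: le_lt_trans Doo.
    by apply: le_measure; rewrite ?inE//; exact: subIsetl.
  have e0 : 0 < j.+1%:R^-1 :> R by rewrite invr_gt0.
  have h1 := hB _ (mB j) (@subIsetl _ _ _) Bp.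
  have bfin : (\int[mu]_(x in B j) (b x)%:E)%E \is a fin_num.
    apply: integrable_fin_num => //.
    apply: (@bounded_integrable _ _ _ mu _ (mB j) _ C) => //.
    by rewrite -ge0_fin_numE.
  have h2 : (\int[mu]_(x in B j) (b x)%:E + j.+1%:R^-1%:E * mu (B j) <= \int[mu]_(x in B j) (b x)%:E)%E.
    apply: le_trans h1; rewrite -integral_cst// -ge0_integralD//.
    - apply: le_lower_integral => //.
        by move=> x _; have /andP[bx _] := bC x; rewrite /= -EFinD lee_fin addr_ge0// ltW.
      by move=> x [_].
    - by move=> x _; rewrite lee_fin; have /andP[] := bC x.
    - by apply/measurable_EFinP; exact: measurable_funTS.
    - by move=> x _; rewrite lee_fin ltW.
  move: h2; rewrite -[leRHS]adde0 leeD2lE//; apply/negP; rewrite -ltNge.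
  by rewrite mule_gt0 ?lte_fin.
exists (\bigcup_j B j); split.
- exact: bigcup_measurable.
- apply/eqP; rewrite eq_le measure_ge0 andbT.
  apply: le_trans (measure_sigma_subadditive _ _ _ (@subset_refl _ _)) _ => //.
    exact: bigcup_measurable.
  by rewrite eseries0// => j _ _.
move=> x /= /not_implyP[Dx nab].
have [j hj] : exists j : nat, ((b x + j.+1%:R^-1)%:E <= a x)%E; last by exists j.
apply: contrapT => nj; apply: nab; apply/lee_addgt0Pr => e e0.
rewrite leNgt; apply/negP => h; apply: nj; exists (Num.truncn e^-1).
apply: le_trans (ltW h); rewrite -EFinD lee_fin lerD2l ltW//.
by rewrite invf_plt ?posrE// truncnS_gt.
Qed.

Section lebesgue_on_lines.
Context {R : realType} {n : nat}.
Local Notation E := 'rV[R]_n.+1.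
Local Notation mu := (@lebesgue_measure R).
Variables (h : E -> \bar R) (v : E).
Hypotheses (mh : measurable_fun setT (h : borel E -> \bar R)) (h0 : forall y, (0 <= h y)%E).

(** The mean over the segment that ends at [y], so as to match left intervals and backward
    increments. *)
Definition line_average (w y : E) : \bar R :=
  (\int[mu]_(t in `[0%R, 1%R]) h (y - w + t *: w)%R)%E.

Lemma line_average_ge0 w y : (0 <= line_average w y)%E.
Proof. exact: integral_ge0. Qed.

Lemma measurable_line_average w : measurable_fun setT (line_average w : borel E -> \bar R).
Proof.
pose H (p : borel E * measurableTypeR R) : \bar R := (h ((p.1 : E) - w + p.2 *: w)%R * (\1_(`[0%R, 1%R]%classic : set R) p.2)%:E)%E.
have mH : measurable_fun setT H.
  apply: emeasurable_funM.
    have m1 : measurable_fun setT (fun p : borel E * R => (((p.1 : E) - w : borel E), p.2)).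
      apply: measurable_fun_pair; last exact: measurable_snd.
      by apply: (measurableT_comp (measurable_translate (- w))); exact: measurable_fst.
    exact: (measurableT_comp mh (measurableT_comp (measurable_line w) m1)).
  have mI : measurable_fun setT (\1_(`[0%R, 1%R]%classic : set R) : R -> R).
    by apply: measurable_indic; exact: measurable_itv.
  by apply/measurable_EFinP; exact: (measurableT_comp mI measurable_snd).
have H0 p : (0 <= H p)%E by rewrite mule_ge0.
have := measurable_fun_fubini_tonelli_F (m2 := mu) H mH H0.
congr (measurable_fun _ _); apply/funext => y; rewrite /line_average integral_mkcond.
apply: eq_integral => t _; rewrite /H patchE indicE /=; case: ifPn => _; by rewrite ?mule1 ?mule0.
Qed.

(** [h] is not assumed locally integrable, so only an inequality with the upper limit is claimed; it
    holds a.e. on every line by [density_le_left_bound], hence a.e. *)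
Lemma ae_le_line_average : {ae (@leb R n), forall y,
  (h y <= limn_esup (fun k => line_average (k.+1%:R^-1 *: v) y))%E}.
Proof.
pose L (y : borel E) := limn_esup (fun k => line_average (k.+1%:R^-1 *: v) y).
pose N : set (borel E) := setT `&` [set y | (L y < h y)%E].
have mL : measurable_fun setT L.
  by apply: measurable_fun_limn_esup => k; exact: measurable_line_average.
have mN : measurable N by exact: measurable_lte.
exists N; split => //; last by move=> y /= /negP; rewrite -ltNge => hy; split.
apply: (null_on_lines (v := v)) => // x.
pose rho (s : R) : \bar R := h (x + s *: v).
have mrho : measurable_fun setT rho.
  have m1 : measurable_fun setT (fun s : R => ((x : borel E), s)) by exact: measurable_pair1.
  exact: (measurableT_comp mh (measurableT_comp (measurable_line v) m1)).
apply: ae_imp (density_le_left_bound mrho (fun s => h0 _)) => s hs [_ /= Lh].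
have L0 : (0 <= L (x + s *: v)%R)%E.
  rewrite /L limn_esup_lim; apply: lime_ge; first exact: is_cvg_esups.
  apply: nearW => k; apply: ereal_sup_ge; exists (line_average (k.+1%:R^-1 *: v) (x + s *: v)%R) => //.
    by exists k => /=.
  exact: line_average_ge0.
move: Lh L0; rewrite -/(rho s); case E1 : (L (x + s *: v)%R) => [r||] //; last first.
  by rewrite ltNge leey.
move=> Lh r0; move: Lh; apply/negP; rewrite -leNgt.
have := hs 1 r ler01; rewrite mul1e; apply => // ep ep0.
have : \forall k \near \oo, (line_average (k.+1%:R^-1 *: v) (x + s *: v)%R < (r + ep)%:E)%E.
  have cv : esups (fun k => line_average (k.+1%:R^-1 *: v) (x + s *: v)%R) @ \oo --> r%:E.
    by rewrite -E1 /L limn_esup_lim; exact: is_cvg_esups.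
  have : nbhs r%:E [set z : \bar R | (z < (r + ep)%:E)%E].
    by apply: open_nbhs_nbhs; split; [exact: open_ereal_lt_ereal|rewrite /= lte_fin ltrDl].
  move=> hn; have nk : \forall k \near \oo, (esups (fun k => line_average (k.+1%:R^-1 *: v) (x + s *: v)%R) k < (r + ep)%:E)%E by exact: cv _ hn.
  apply: filterS nk => k; apply: le_lt_trans.
  by apply: ereal_sup_ubound; exists k => /=.
apply: filterS => k; rewrite mul1e => hk.
have k0 : 0 < k.+1%:R^-1 :> R by rewrite invr_gt0.
have E2 := @ge0_integral_affine R k.+1%:R^-1 (s - k.+1%:R^-1) k0
  `[(s - k.+1%:R^-1), s]%classic rho (measurable_itv _) (measurable_funTS mrho) (fun t _ => h0 _).
rewrite -E2 (_ : _ @^-1` _ = `[0%R, 1%R]%classic); last first.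
  apply/seteqP; split=> t /=; rewrite !in_itv/= lerDr -lerBrDr opprB addrC subrK.
    by rewrite pmulr_rge0// ger_pMr.
  by rewrite pmulr_rge0// ger_pMr.
rewrite [X in (_ <= X)%E](_ : _ = k.+1%:R^-1%:E * (r + ep)%:E)%E; last by rewrite -EFinM mulrC.
apply: lee_wpmul2l; first by rewrite lee_fin ltW.
apply: le_trans (ltW hk); rewrite le_eqVlt; apply/orP; left; apply/eqP.
apply: eq_integral => t _; rewrite /rho; congr (h _).
by rewrite scalerDl scalerBl scalerA mulrC !addrA; apply/rowP => i; rewrite !mxE; ring.
Qed.

End lebesgue_on_lines.

Section path_space.
Context {R : realType} {M : ptopologicalType} (l : time_separation R M).
Implicit Types gamma : lcc l.

Lemma lcc_clampE gamma t : gamma t = gamma (clamp t).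
Proof. exact: lcc_clamp. Qed.

Lemma measurable_evaluation (t : R) :
  measurable_fun setT (fun gamma : g_sigma_algebraType (evaluations l) => gamma t : borel M).
Proof.
move=> _ B mB; rewrite setTI; apply: sub_sigma_algebra; exists (clamp t); split.
  exact: clamp01.
exists B; first exact: mB.
by apply/funext => gamma; apply/propext; rewrite /preimage/= -lcc_clampE.
Qed.

(** Positive times are approached by rationals from the left, where [gamma] is continuous; time 0 is
    itself rational. *)
Lemma lcc_eq_dense gamma (eta : R -> M) : hausdorff_space M -> continuous eta ->
  (forall r : rat, gamma (ratr r) = eta (clamp (ratr r))) ->
  forall t, gamma t = eta (clamp t).
Proof.
move=> hausM ceta h t; rewrite lcc_clampE; have := clamp01 t; move: (clamp t) => {}t /andP[t0 t1].
have [->|tn0] := eqVneq t 0.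
  by have := h 0; rewrite rmorph0 clamp_id// lexx ler01.
have {}t0 : 0 < t by rewrite lt_neqAle eq_sym tn0.
apply: hausM => U V nU nV.
have n1 : \forall s \near t^'-, U (gamma s) by exact: (lcc_left_continuous t0 t1).
have n2 : \forall s \near t^'-, V (eta s) by apply: (cvg_at_left_filter (@ceta t)).
have [e /= e0 he] := filterI n1 n2.
have lo : Num.max 0 (t - e) < t by rewrite gt_max t0 ltrBlDr ltrDl.
have [r] := rat_in_itvoo lo; rewrite in_itv/= gt_max => /andP[/andP[r0 rt'] rt].
have [Ur Vr] : U (gamma (ratr r)) /\ V (eta (ratr r)).
  by apply: he => //=; rewrite gtr0_norm ?subr_gt0//; lra.
exists (gamma (ratr r)); split => //.
by rewrite h clamp_id ?(ltW r0) ?(ltW (lt_le_trans rt t1)).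
Qed.

End path_space.

Lemma ball_segment (R : realType) (n : nat) (q y y' : 'rV[R]_n.+1) (rad t : R) :
  ball q rad y -> ball q rad y' -> 0 <= t <= 1 -> ball q rad (y + t *: (y' - y)).
Proof.
rewrite -!ball_normE/= => qy qy' /andP[t0 t1].
have -> : q - (y + t *: (y' - y)) = t *: (q - y') + (1 - t) *: (q - y).
  by rewrite !scalerBl !scale1r; apply/rowP => i; rewrite !mxE; ring.
apply: le_lt_trans (ler_normD _ _) _; rewrite !normrZ !ger0_norm ?subr_ge0//.
have [->|tn] := eqVneq t 0; first by rewrite mul0r add0r subr0 mul1r.
have {}t0 : 0 < t by rewrite lt_neqAle eq_sym tn.
have : t * `|q - y'| < t * rad by rewrite ltr_pM2l.
have : (1 - t) * `|q - y| <= (1 - t) * rad by rewrite ler_wpM2l ?subr_ge0// ltW.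
lra.
Qed.

(** * Test plans on parallel coordinate segments *)

Section segment_plan.
Context {R : realType} {d : nat} {M : ptopologicalType}.
Context {A : smooth_structure R d.+1 M} (g : lorentz_metric A) (X : vector_field A).
Hypothesis hX : timelike_field g X.
Hypothesis hM : causally_simple g X.
Variable vol : {measure set (borel M) -> \bar R}.
Variable c : chart R d.+1 M.
Hypothesis ac : atlas A c.
Local Notation E := 'rV[R]_d.+1.
Local Notation l := (lorentz_tsep g X).
Local Notation mu := (@lebesgue_measure R).
Local Notation leb := (@leb R d).
Local Notation cimg := (cmap c @` cdom c).
Local Notation nrm x v := (Num.sqrt (- qf (gmx g c x) v v)).
Local Notation paths := (g_sigma_algebraType (evaluations l)).
Variables (q : E) (rad : R) (w : E) (C Cv : R).
Let Q := ball q rad.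
Hypothesis hQ : forall y, Q y -> cimg y /\ futc g X c (cinv c y) w.
Hypothesis C0 : 0 < C.
Hypothesis timeQ : forall y, Q y -> Q (y + w) -> forall s t : R, 0 <= s -> s <= t -> t <= 1 ->
  (time_sep g X (cinv c (y + s *: w)) (cinv c (y + t *: w)) <= (C * (t - s))%:E)%E.
Hypothesis Cv0 : 0 < Cv.
Hypothesis volQ : forall B : set E, measurable (B : set (borel E)) -> B `<=` Q ->
  (leb (B : set (borel E)) <= Cv%:E * vol (cdom c `&` cmap c @^-1` B))%E.

Let D : set E := [set y | Q y /\ Q (y - w)].

Let segQ y t : D y -> 0 <= t <= 1 -> Q (y - w + t *: w).
Proof.
move=> [Qy Qw] t01; have := ball_segment Qw Qy t01.
by rewrite (_ : y - (y - w) = w)// opprB addrC subrK.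
Qed.

Let img y (Dy : D y) t : 0 <= t <= 1 -> cimg (y - w + t *: w).
Proof. by move=> t01; have [] := hQ (segQ Dy t01). Qed.

Let fv y (Dy : D y) t : 0 <= t <= 1 -> futc g X c (cinv c (y - w + t *: w)) w.
Proof. by move=> t01; have [] := hQ (segQ Dy t01). Qed.

(** A segment is indexed by its final point [y], from which it is recovered as the value at time 1;
    outside [D] the default path keeps the map total. *)
Let Phi (y : borel E) : paths :=
  match pselect (D y) with
  | left Dy => segment_path ac (img Dy) (fv Dy)
  | right _ => point
  end.

Let PhiE y t : D y -> Phi y t = cinv c (y - w + clamp t *: w).
Proof. by move=> Dy; rewrite /Phi; case: pselect. Qed.

Let oD : open D.
Proof.
apply: openI; first exact: ball_open.
by apply: (@open_comp _ _ (fun y : E => y - w)); [move=> y _; exact: continuous_subr|exact: ball_open].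
Qed.

Let line_continuous (t : R) : continuous (fun y : E => y - w + t *: w).
Proof.
move=> y; have c1 : (fun y : E => y - w) @ y --> y - w by exact: continuous_subr.
exact: (@cvgD _ E E (nbhs y) _ (fun y : E => y - w) (cst (t *: w)) (y - w) (t *: w) c1 (cvg_cst _)).
Qed.

Let mPhi : measurable_fun setT Phi.
Proof.
suff h : preimage_set_system setT Phi (evaluations l) `<=` (measurable : set (set (borel E))).
  by refine (@measurability _ _ (borel E) paths setT Phi (evaluations l) _ h).
move=> _ [_ [t [t01 [B mB ->]]] <-]; rewrite setTI.
have -> : Phi @^-1` [set gamma : lcc l | B (gamma t)] =
    (D `&` (fun y => cinv c (y - w + t *: w)) @^-1` B) `|`
    (~` D `&` [set _ | B ((point : lcc l) t)]).
  apply/seteqP; split=> y /=.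
    have [Dy|nD] := pselect (D y); first by rewrite PhiE// clamp_id//; left.
    by rewrite /Phi; case: pselect => // _ h; right.
  move=> [[Dy]|[nD]]; first by rewrite PhiE// clamp_id.
  by rewrite /Phi; case: pselect.
apply: measurableU.
  apply: (@open_continuous_borel E M D (fun y => cinv c (y - w + t *: w))) => //; last exact: borel_open.
  move=> y Dy; apply: (@continuous_comp _ _ _ (fun y : E => y - w + t *: w) (cinv c) y).
    exact: line_continuous.
  by apply: cinv_continuous; exact: img.
apply: measurableI; first by apply: measurableC; exact: borel_open.
have [h|h] := pselect (B ((point : lcc l) t)).
  by rewrite (_ : [set _ | _] = setT)//; apply/seteqP; split.
by rewrite (_ : [set _ | _] = set0)//; apply/seteqP; split.
Qed.

Let chartp : borel M -> borel E := (cmap c : borel M -> borel E) \_ (cdom c).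

Let mchartp : measurable_fun setT chartp.
Proof.
apply/(measurable_restrict (cmap c : borel M -> borel E)) => //; first by apply: borel_open; exact: cdom_open.
rewrite setTI; apply: open_continuous_borel; first exact: cdom_open.
by move=> x dx; exact: cmap_continuous.
Qed.

Let chartpE x : cdom c x -> chartp x = cmap c x.
Proof. by move=> dx; rewrite /chartp patchE mem_set. Qed.

Variables (B : set E).
Hypotheses (mB : measurable (B : set (borel E))) (BD : B `<=` D).

Let mev t : measurable_fun setT (fun gamma : paths => chartp (gamma t)).
Proof. exact: (measurableT_comp mchartp (@measurable_evaluation R M l t)). Qed.

(** The set of segments ending in [B]. The sigma-algebra on paths is generated by evaluations, and
    testing rational times only makes this set measurable. *)
Let S : set paths := [set gamma | [/\ cdom c (gamma 1), B (chartp (gamma 1)) &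
  forall r : rat, cdom c (gamma (ratr r)) /\
    forall i, (chartp (gamma (ratr r)) : E) 0 i =
     ((chartp (gamma 1) : E) - w + clamp (ratr r) *: w) 0 i]].

Let mS : measurable S.
Proof.
pose T1 : set paths := [set gamma | cdom c (gamma 1)].
pose T2 : set paths := [set gamma | B (chartp (gamma 1))].
pose T3 (r : rat) : set paths := [set gamma | cdom c (gamma (ratr r))].
pose T4 (p : rat * 'I_d.+1) : set paths := setT `&` [set gamma : paths |
  ((chartp (gamma (ratr p.1)) : E) 0 p.2)%:E =
     (((chartp (gamma 1) : E) - w + clamp (ratr p.1) *: w) 0 p.2)%:E].
have mdom t : measurable [set gamma : paths | cdom c (gamma t)].
  rewrite -[X in measurable X]setTI; apply: measurable_evaluation => //.
  by apply: borel_open; exact: cdom_open.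
have mT2 : measurable T2 by rewrite -[X in measurable X]setTI; exact: mev.
have mT4 p : measurable (T4 p).
  apply: measurable_eqe => //; apply/measurable_EFinP.
    exact: (measurableT_comp (measurable_coord _) (mev _)).
  apply: (eq_measurable_fun (fun gamma : paths => (chartp (gamma 1) : E) 0 p.2 + (- w + clamp (ratr p.1) *: w) 0 p.2)).
    by move=> gamma _; rewrite !mxE; ring.
  by apply: measurable_funD => //; exact: (measurableT_comp (measurable_coord _) (mev _)).
rewrite (_ : S = (T1 `&` T2) `&` ~` (\bigcup_(r in [set: rat]) ~` T3 r) `&`
    ~` (\bigcup_(p in [set: rat * 'I_d.+1]) ~` T4 p)).
  apply: measurableI; first apply: measurableI; first by apply: measurableI => //; exact: mdom.
    apply: measurableC; apply: countable_bigcupT_measurable; first exact: countableP.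
    by move=> r; apply: measurableC; exact: mdom.
  apply: measurableC; apply: countable_bigcupT_measurable; first exact: countableP.
  by move=> r; apply: measurableC.
apply/seteqP; split=> gamma.
  move=> [h1 h2 h3]; split; first split => //.
    by move=> [r _]; apply; have [] := h3 r.
  by move=> [[r i] _]; apply; split => //=; have [_ ->] := h3 r.
move=> [[[h1 h2] h3] h4]; split => // r; split.
  by apply: contrapT => h; apply: h3; exists r.
move=> i; apply: contrapT => h; apply: h4; exists (r, i) => //.
by move=> [_ /= [/h]].
Qed.

Let Phi_S y : B y -> S (Phi y).
Proof.
move=> By; have Dy := BD By.
have clE t : cdom c (Phi y t) /\ chartp (Phi y t) = y - w + clamp t *: w.
  by rewrite PhiE//; have [dx cx] := cimgK (img Dy (clamp01 t)); rewrite chartpE.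
have y1 : chartp (Phi y 1) = y.
  by rewrite (clE 1).2 clamp_id ?ler01 ?lexx// scale1r subrK.
split; [exact: (clE 1).1|by rewrite y1|].
by move=> r; split; [exact: (clE _).1|move=> i; rewrite (clE _).2 y1].
Qed.

Let chartp_Phi1 y : D y -> chartp (Phi y 1) = y.
Proof.
move=> Dy; rewrite PhiE//; have [dx cx] := cimgK (img Dy (clamp01 1)).
by rewrite chartpE// cx clamp_id ?ler01 ?lexx// scale1r subrK.
Qed.

Let S_Phi gamma : S gamma -> (gamma : R -> M) = Phi (chartp (gamma 1)) :> (R -> M).
Proof.
move=> [h1 h2 h3]; have Dy := BD h2; set y : E := chartp (gamma 1) in h2 h3 Dy *.
pose eta (t : R) := cinv c (y - w + clamp t *: w).
have ceta : continuous eta.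
  move=> t; apply: (@continuous_comp _ _ _ clamp (fun t : R => cinv c (y - w + t *: w)) t).
    exact: continuous_clamp.
  exact: (segment_continuous (img Dy) (clamp01 t)).
have heq := lcc_eq_dense (M_hausdorff A) ceta.
apply/funext => t; rewrite PhiE//.
have -> : cinv c (y - w + clamp t *: w) = eta (clamp t) by rewrite /eta (clamp_id (clamp01 t)).
apply: heq => r; have [dr hr] := h3 r.
rewrite /eta (clamp_id (clamp01 _)) -[LHS](cmapK dr); congr (cinv c _).
by rewrite -(chartpE dr); apply/rowP => i; rewrite hr.
Qed.

Hypothesis B0 : (0 < leb (B : set (borel E)))%E.

Let Boo : (leb (B : set (borel E)) < +oo)%E.
Proof.
apply: (@le_lt_trans _ _ (leb (Q : set (borel E)))); last exact: leb_ballT.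
apply: le_measure; rewrite ?inE//; first by apply: borel_open; exact: ball_open.
by move=> y /BD[].
Qed.

(** At a fixed time the segments are translated by a fixed vector, so the coordinate law is bounded
    by Lebesgue measure divided by [leb B], and that by a multiple of the volume. *)
Let plan (pi : probability paths R) :
  (forall T, measurable T -> (leb (B : set (borel E)) * pi T = leb ((B : set (borel E)) `&` Phi @^-1` T))%E) ->
  test_plan vol pi.
Proof.
move=> piE; pose L := fine (leb (B : set (borel E))).
have LE : leb (B : set (borel E)) = L%:E by rewrite fineK// ge0_fin_numE.
have L0 : 0 < L by rewrite -lte_fin -LE.
exists (Cv / L); first exact: divr_gt0.
move=> t t01 T mT.
have mT' : measurable [set gamma : paths | T (gamma t)].
  by rewrite -[X in measurable X]setTI; apply: measurable_evaluation.
have := piE _ mT'; rewrite LE => pE.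
have -> : pi [set gamma : paths | T (gamma t)] = (L^-1%:E * (L%:E * pi [set gamma : paths | T (gamma t)]))%E.
  by rewrite muleA -EFinM mulVf ?gt_eqF// mul1e.
rewrite pE mulrC EFinM -muleA; apply: lee_wpmul2l; first by rewrite lee_fin invr_ge0 ltW.
pose T0 : set E := Q `&` cinv c @^-1` T.
have mT0 : measurable (T0 : set (borel E)).
  apply: (@open_continuous_borel E M Q (cinv c)) => //; [exact: ball_open| |by apply: borel_open; exact: ball_open].
  by move=> y /hQ[iy _]; exact: cinv_continuous.
apply: (@le_trans _ _ (leb ((fun y : E => y + (- w + t *: w)) @^-1` T0 : set (borel E)))).
  apply: le_measure.
  - by rewrite inE; apply: measurableI => //; rewrite -[X in measurable X]setTI; exact: mPhi.
  - by rewrite inE -[X in measurable X]setTI; apply: measurable_translate.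
  move=> y [By]; have Dy := BD By; rewrite /preimage/= PhiE// clamp_id// => Ty.
  by split; rewrite /= addrA; [exact: segQ|].
rewrite leb_translate; apply: le_trans (volQ mT0 (@subIsetl _ _ _)) _.
apply: lee_wpmul2l; first by rewrite lee_fin ltW.
apply: le_measure; rewrite ?inE//.
- exact: measurable_chart_preimage.
- by move=> x [dx [_ /=]]; rewrite cmapK.
Qed.

Variables (f : M -> \bar R) (G : borel M -> \bar R) (n : nat) (F : E -> R).
Hypothesis f_causal : causal_function l f.
Hypothesis Gsub : weak_subslope l vol f G.
Hypothesis mF : measurable_fun setT (F : borel E -> R).
Hypothesis hF : {ae leb, forall y, Q y -> trunc n (f (cinv c y)) = F y}.
Hypothesis BF : forall y, B y -> - n%:R < F y < n%:R /\ - n%:R < F (y - w) < n%:R.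

Let h : E -> \bar R := (fun y => (G (cinv c y) * (nrm (cinv c y) w)%:E)%E) \_ Q.

Let h0 y : (0 <= h y)%E.
Proof.
have [_ G0 _] := Gsub; rewrite /h patchE; case: ifP => _ //.
by rewrite mule_ge0// lee_fin sqrtr_ge0.
Qed.

(** The subslope inequality for the uniform plan. Its two sides need not have measurable integrands,
    so they are squeezed by the measurable functions [a] and [b] of the endpoint. *)
Lemma integral_line_average_le : measurable_fun setT (h : borel E -> \bar R) ->
  (\int[leb]_(y in B) line_average h w y <= \int[leb]_(y in B) (Num.max 0 (F y - F (y - w))%R)%:E)%E.
Proof.
move=> mh; have [pi [piE piI]] := uniform_law (\d_(point : paths) : probability paths R) mB mPhi B0 Boo.
have [mG G0 Gpi] := Gsub.
have main := Gpi _ (plan piE).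
pose a (gamma : paths) : \bar R := ((fun gamma : paths => line_average h w (chartp (gamma 1))) \_ S) gamma.
pose b (gamma : paths) : \bar R := ((fun gamma : paths =>
  (Num.max 0 (F (chartp (gamma 1)) - F ((chartp (gamma 1) : E) - w)%R))%:E) \_ S) gamma.
have a0 gamma : (0 <= a gamma)%E by rewrite /a patchE; case: ifP => // _; exact: line_average_ge0.
have b0 gamma : (0 <= b gamma)%E.
  by rewrite /b patchE; case: ifP => // _; rewrite lee_fin le_max lexx.
have ma : measurable_fun setT a.
  apply/measurable_restrict => //; rewrite setTI; apply: measurable_funTS.
  exact: (measurableT_comp (measurable_line_average mh h0 w) (mev 1)).
have mFw : measurable_fun setT (fun y : borel E => Num.max 0 (F y - F ((y : E) - w)%R)).
  apply: measurable_maxr => //; apply: measurable_funB => //.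
  exact: measurable_fun_translate.
have mb : measurable_fun setT b.
  apply/measurable_restrict => //; rewrite setTI; apply: measurable_funTS.
  by apply/measurable_EFinP; exact: (measurableT_comp mFw (mev 1)).
have inner gamma : (a gamma <= \int[mu]_(t in `[0%R, 1%R]) (G (gamma t) * causal_speed l gamma t))%E.
  rewrite /a patchE; case: ifPn => [/set_mem Sg|_]; last exact: causal_speed_integral_ge0.
  have Dy : D (chartp (gamma 1)) by apply: BD; case: Sg.
  have := S_Phi Sg; set y : E := chartp (gamma 1) in Dy * => ->.
  have yw : Q (y - w + w) by rewrite subrK; case: Dy.
  have := segment_causal_speed hX hM ac (img Dy) (fv Dy) C0 (timeQ Dy.2 yw).
  have -> : segment_path ac (img Dy) (fv Dy) = Phi y.
    by rewrite /Phi; case: pselect => // Dy'; rewrite (Prop_irrelevance Dy Dy').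
  move=> cs; apply: ae_le_lower_integral => //.
    by move=> t _; rewrite mule_ge0//; exact: causal_speed_ge0.
  apply: ae_imp cs => t ct; rewrite /= in_itv/= => t01; rewrite ct// PhiE// clamp_id//.
  by rewrite /h patchE mem_set//; exact: segQ.
(* At both endpoints the truncation is strictly between [- n] and [n], so there [f] is finite and
   equal to [F], off a null set of endpoints. *)
have outer : {ae pi, forall gamma : paths, ((f (gamma 1%R) - f (gamma 0%R))%dE <= b gamma)%E}.
  have [N [mN N0 HN]] := ae_and hF (ae_translate (- w) hF).
  pose T : set paths := ~` S `|` [set gamma | N (chartp (gamma 1))].
  have mT : measurable T.
    apply: measurableU; first exact: measurableC.
    by rewrite -[X in measurable X]setTI; exact: mev.
  exists T; split => //.
    suff z : leb ((B : set (borel E)) `&` Phi @^-1` T) = 0%E.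
      by have /eqP := etrans (piE _ mT) z; rewrite mule_eq0 gt_eqF//= => /eqP.
    apply/eqP; rewrite eq_le measure_ge0 andbT -N0; apply: le_measure; rewrite ?inE//.
      by apply: measurableI => //; rewrite -[X in measurable X]setTI; exact: mPhi.
    move=> y [By [|]]; first by move=> /(_ (Phi_S By)).
    by rewrite /= chartp_Phi1//; exact: BD.
  move=> gamma /= nb; apply: contrapT => /not_orP[/contrapT Sg nN]; apply: nb.
  rewrite /b patchE mem_set//.
  have Bg : B (chartp (gamma 1)) by case: Sg.
  have Dy := BD Bg; have gE t : gamma t = Phi (chartp (gamma 1)) t by rewrite {1}(S_Phi Sg).
  set y : E := chartp (gamma 1) in nN Bg Dy gE *; rewrite (gE 1) (gE 0).
  have [hy hyw] : (Q y -> trunc n (f (cinv c y)) = F y) /\ (Q (y - w) -> trunc n (f (cinv c (y - w))) = F (y - w)).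
    by apply: contrapT => hn; apply: nN; exact: HN.
  rewrite !PhiE// !clamp_id ?lexx ?ler01// scale1r scale0r subrK addr0.
  have [Fy Fyw] := BF Bg.
  rewrite (truncK (n := n) (a := f (cinv c y))) ?(hy Dy.1)//.
  rewrite (truncK (n := n) (a := f (cinv c (y - w)))) ?(hyw Dy.2)//.
  by rewrite (_ : ((F y)%:E - (F (y - w))%:E)%dE = (F y - F (y - w))%:E)// lee_fin le_max lexx orbT.
have Bfin : leb (B : set (borel E)) \is a fin_num by rewrite ge0_fin_numE.
have : (leb (B : set (borel E)) * \int[pi]_gamma a gamma <= leb (B : set (borel E)) * \int[pi]_gamma b gamma)%E.
  apply: lee_wpmul2l; first exact: measure_ge0.
  apply: (@le_trans _ _ (\int[pi]_gamma (\int[mu]_(t in `[0%R, 1%R]) (G (gamma t) * causal_speed l gamma t)))%E).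
    by apply: le_lower_integral.
  apply: (le_trans main); apply: ae_le_lower_integral => //.
    (* Truncation at height 0 yields the nonnegativity of the increment, infinite values
       included. *)
    move=> gamma _; have : (f (gamma 0%R) <= f (gamma 1%R))%E by apply: f_causal; apply: lcc_cle; exact: ler01.
    move=> h01; apply: le_trans (trunc_sub_le 0 h01).
    by rewrite lee_fin subr_ge0; exact: le_trunc.
  by apply: ae_imp outer => gamma + _.
rewrite !piI// => hle.
apply: le_trans (le_trans _ hle) _.
  rewrite le_eqVlt; apply/orP; left; apply/eqP; apply: eq_integral => y /set_mem By.
  by rewrite /a patchE mem_set ?chartp_Phi1//; [exact: BD|exact: Phi_S].
rewrite le_eqVlt; apply/orP; left; apply/eqP; apply: eq_integral => y /set_mem By.
by rewrite /b patchE mem_set ?chartp_Phi1//; [exact: BD|exact: Phi_S].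
Qed.

End segment_plan.

(** Localization: a countable basis reduces the neighbourhoods to countably many. *)
Lemma ae_patch (R : realType) (M : ptopologicalType) (vol : {measure set (borel M) -> \bar R})
    (W : set M) (P : M -> Prop) : @second_countable M ->
  (forall p, W p -> exists O, nbhs p O /\ {ae vol, forall x, O x -> P x}) ->
  {ae vol, forall x, W x -> P x}.
Proof.
move=> [B cB [oB bB]] h; have /countable_injP[e einj] := cB.
pose good (b : set M) := {ae vol, forall x : borel M, b x -> P x}.
have H : {ae vol, forall x : borel M, forall k : nat, forall b, B b -> e b = k -> good b -> b x -> P x}.
  apply: ae_forall_countable => k.
  have [[b [Bb eb gb]]|nb] := pselect (exists b, [/\ B b, e b = k & good b]); last first.
    by apply: aeW => x b Bb eb gb; exfalso; apply: nb; exists b.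
  apply: ae_imp gb => x gx b' Bb' eb' _ bx; apply: gx.
  by rewrite (einj b b') ?inE// eb'.
apply: ae_imp H => x hx Wx; have [V [nV aeV]] := h x Wx.
have [b [Bb bx] bV] := bB x V nV.
apply: (hx (e b) b Bb erefl _ bx).
by apply: ae_imp aeV => y hy /bV; exact: hy.
Qed.

Lemma limn_esup_le_near (R : realType) (u : nat -> \bar R) (b : \bar R) :
  (\forall k \near \oo, u k <= b)%E -> (limn_esup u <= b)%E.
Proof.
move=> [K _ hK]; rewrite limn_esup_lim; apply: lime_le; first exact: is_cvg_esups.
exists K => // k /= Kk; apply: ge_ereal_sup => _ [j /= kj <-].
by apply: hK => /=; exact: leq_trans kj.
Qed.

Section upper_bound_ae.
Context {R : realType} {d : nat} {M : ptopologicalType}.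
Context {A : smooth_structure R d.+1 M} (g : lorentz_metric A) (X : vector_field A).
Hypothesis hX : timelike_field g X.
Hypothesis hM : causally_simple g X.
Variable vol : {measure set (borel M) -> \bar R}.
Hypothesis hvol : is_volume g vol.
Variable c : chart R d.+1 M.
Hypothesis ac : atlas A c.
Local Notation E := 'rV[R]_d.+1.
Local Notation l := (lorentz_tsep g X).
Local Notation leb := (@leb R d).
Local Notation cimg := (cmap c @` cdom c).
Local Notation nrm x v := (Num.sqrt (- qf (gmx g c x) v v)).

Variables (f : M -> \bar R) (G : borel M -> \bar R) (n : nat).
Hypothesis f_causal : causal_function l f.
Hypothesis Gsub : weak_subslope l vol f G.
Let phi x := trunc n (f x).

Let phi_causal x y : (0 <= time_sep g X x y)%E -> phi x <= phi y.
Proof. by move=> xy; apply: le_trunc; exact: f_causal. Qed.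

Lemma nrmZ x (a : R) v : 0 < a -> nrm x (a *: v) = a * nrm x v.
Proof.
move=> a0; rewrite qfZl qfZr (_ : - (a * (a * qf _ v v)) = a ^+ 2 * - qf (gmx g c x) v v).
  by rewrite sqrtrM ?sqr_ge0// sqrtr_sqr gtr0_norm.
by rewrite mulrA -expr2 mulrN.
Qed.

Let plan_ball p v : cdom c p -> futc g X c p v -> exists (rad C Cv : R) (F : E -> R),
  [/\ 0 < rad, forall y, ball (cmap c p) rad y -> cimg y /\ futc g X c (cinv c y) v,
    0 < C /\ (forall (a : R) y, 0 < a -> a <= 1 -> ball (cmap c p) rad y -> ball (cmap c p) rad (y + a *: v) ->
      forall s t : R, 0 <= s -> s <= t -> t <= 1 ->
      (time_sep g X (cinv c (y + s *: (a *: v))) (cinv c (y + t *: (a *: v))) <= (C * (t - s))%:E)%E),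
    0 < Cv /\ (forall B : set E, measurable (B : set (borel E)) -> B `<=` ball (cmap c p) rad ->
      (leb (B : set (borel E)) <= Cv%:E * vol (cdom c `&` cmap c @^-1` B))%E) &
    [/\ measurable_fun setT (F : borel E -> R), (forall x, `|F x| <= n%:R) &
      {ae leb, forall y, ball (cmap c p) rad y -> phi (cinv c y) = F y}]].
Proof.
move=> dp fv; set q := cmap c p.
have iq : cimg q by exists p.
have fq : futc g X c (cinv c q) v by rewrite /q cmapK.
have [r r0 hr] := timelike_ball_near ac iq fq.
have [F [mF Fn hF _]] := ball_regularization ac (fun x => trunc_norm n (f x)) phi_causal r0 hr.
have [Cv [r1 [Cv0 r10 _ hv]]] := leb_le_vol hvol ac iq.
have [[U V] /= [nU nV] UV] := time_sep_le hX hM ac dp ltr01.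
have [r2 /= r20 hr2] : \forall rad \near 0^'+, forall y, ball q rad y -> U (cinv c y) /\ V (cinv c y).
  have : nbhs q [set y | U (cinv c y) /\ V (cinv c y)].
    have nUV : nbhs (cinv c q) (U `&` V) by rewrite /q cmapK//; exact: filterI.
    exact: (cinv_continuous iq nUV).
  move=> /nbhs_ballP[e /= e0 he]; near=> rad => y; move=> qy; apply: he.
  by apply: le_ball qy; near: rad; exact: nbhs_right_le.
pose rad := Num.min (Num.min r r1) (r2 / 2).
have rad0 : 0 < rad by rewrite !lt_min r0 r10 divr_gt0.
have radr : rad <= r by rewrite !ge_min lexx.
have radr1 : rad <= r1 by rewrite !ge_min lexx orbT.
have radr2 y : ball q rad y -> U (cinv c y) /\ V (cinv c y).
  apply: hr2 => //=; rewrite sub0r normrN gtr0_norm//.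
  by rewrite /rad gt_min; apply/orP; right; rewrite ltr_pdivrMr// ltr_pMr// ltr1n.
have hball y : ball q rad y -> cimg y /\ futc g X c (cinv c y) v.
  move=> /(le_ball radr); rewrite -ball_normE/= distrC => qy.
  by have [iy h] := hr y qy; split => //; apply: h; rewrite subrr normr0.
have nv0 : 0 < nrm p v by rewrite sqrtr_gt0 oppr_gt0; case: fv.
(* The right-hand side of [time_sep_le] at [p] for [th = 1], [b = v] and the displacement [v]. *)
pose K := - qf (gmx g c p) v v + - qf (gmx g c p) v (vcomp X c p) * `|v|.
have K0 : 0 < K.
  by case: fv => h1 h2; rewrite ltr_pwDl ?oppr_gt0// mulr_ge0// oppr_ge0 ltW.
exists rad, (K / nrm p v), Cv, F; split => //.
- split; first exact: divr_gt0.
  move=> a y a0 a1 Qy Qav s t s0 st t1.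
  have Qs r' : 0 <= r' <= 1 -> ball q rad (y + r' *: (a *: v)).
    by move=> /(ball_segment Qy Qav); rewrite [y + a *: v]addrC addrK.
  have s01 : 0 <= s <= 1 by rewrite s0 (le_trans st).
  have t01 : 0 <= t <= 1 by rewrite t1 (le_trans s0).
  have [is_ _] := hball _ (Qs _ s01); have [it _] := hball _ (Qs _ t01).
  have := UV (cinv c (y + s *: (a *: v)), cinv c (y + t *: (a *: v)))
    (conj (radr2 _ (Qs _ s01)).1 (radr2 _ (Qs _ t01)).2) v fv.
  rewrite /= (cimgK is_).2 (cimgK it).2.
  have -> : y + t *: (a *: v) - (y + s *: (a *: v)) = ((t - s) * a) *: v.
    by rewrite opprD addrACA subrr add0r -scalerBl scalerA.
  move=> hl; have := lee_scaled nv0 ler01 hl; rewrite mul1e; apply.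
  have ts0 : 0 <= (t - s) * a by rewrite mulr_ge0 ?subr_ge0// ltW.
  rewrite mul1r qfZr normrZ ger0_norm// mul1r.
  have -> : nrm p v * (K / nrm p v * (t - s)) = (t - s) * K by field; rewrite gt_eqF.
  have -> : - ((t - s) * a * qf (gmx g c p) v v) + - qf (gmx g c p) v (vcomp X c p) * ((t - s) * a * `|v|) =
    (t - s) * a * K by rewrite /K; ring.
  by rewrite ler_pM2r// ler_piMr// subr_ge0.
- split => // B mB Br; apply: hv => // y /Br; exact: le_ball.
- split => //; apply: ae_imp hF => y hy Qy; apply: hy; exact: le_ball Qy.
Unshelve. all: by end_near. Qed.

(** Segments of displacement [v / (k + 1)] bound the line average of [G |v|] by the quotient
    [pq F v k], which tends to [D]. The line averages recover [G |v|] a.e. as [k] grows. *)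
Lemma maximal_mul_norm_le (p : M) v : cdom c p -> futc g X c p v -> exists O, nbhs p O /\
  {ae vol, forall x, O x -> - n%:R < phi x < n%:R -> forall D : R, 0 <= D ->
    pq (phi \o cinv c) v k (cmap c x) @[k --> \oo] --> D -> (G x * (nrm x v)%:E <= D%:E)%E}.
Proof.
move=> dp fv; have [rad [C [Cv [F [rad0 hball [C0 hC] [Cv0 hCv] [mF Fn hF]]]]]] := plan_ball dp fv.
set q := cmap c p in hball hC hCv hF; pose Q := ball q rad.
have [mG G0 _] := Gsub.
have mQ : measurable (Q : set (borel E)) by apply: borel_open; exact: ball_open.
exists (cdom c `&` cmap c @^-1` Q); split.
  apply: filterI; first by apply: open_nbhs_nbhs; split => //; exact: cdom_open.
  by apply: cmap_continuous => //; exact: nbhsx_ballx.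
pose h (u : E) : E -> \bar R := (fun y => (G (cinv c y) * (nrm (cinv c y) u)%:E)%E) \_ Q.
have h0 u y : (0 <= h u y)%E.
  by rewrite /h patchE; case: ifP => _ //; rewrite mule_ge0// lee_fin sqrtr_ge0.
have mh u : measurable_fun setT (h u : borel E -> \bar R).
  apply/(measurable_restrict (fun y : borel E => (G (cinv c y) * (nrm (cinv c y) u)%:E)%E)) => //.
  rewrite setTI; apply: emeasurable_funM.
    apply: (measurable_comp (F := setT) _ _ mG) => //.
    apply: (@open_continuous_borel E M Q (cinv c)); first exact: ball_open.
    by move=> y /hball[iy _]; exact: cinv_continuous.
  apply/measurable_EFinP; apply: open_continuous_measurable; first exact: ball_open.
  by move=> y /hball[iy _]; exact: continuous_norm.
have step (k : nat) : {ae leb, forall y : borel E,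
    [/\ Q y, Q ((y : E) - k.+1%:R^-1 *: v), - n%:R < F y < n%:R & - n%:R < F ((y : E) - k.+1%:R^-1 *: v) < n%:R] ->
    (line_average (h (k.+1%:R^-1 *: v)) (k.+1%:R^-1 *: v) y <=
      (Num.max 0 (F y - F ((y : E) - k.+1%:R^-1 *: v)))%:E)%E}.
  set w := k.+1%:R^-1 *: v.
  have k0 : 0 < k.+1%:R^-1 :> R by rewrite invr_gt0.
  have k1 : k.+1%:R^-1 <= 1 :> R by rewrite invf_le1// ler1n.
  pose T : set (borel E) := (Q `&` (fun y : E => y + - w) @^-1` Q) `&`
    ((F @^-1` `](- n%:R), n%:R[%classic) `&` (fun y : E => F (y - w)) @^-1` `](- n%:R), n%:R[%classic).
  have mFw : measurable_fun setT ((fun y : E => F (y - w)) : borel E -> R) by exact: measurable_fun_translate.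
  have mT : measurable T.
    apply: measurableI; first apply: measurableI => //.
      by rewrite -[X in measurable X]setTI; apply: measurable_translate.
    by apply: measurableI; rewrite -[X in measurable X]setTI; [apply: mF|apply: mFw].
  have Too : (leb T < +oo)%E.
    apply: (@le_lt_trans _ _ (leb (Q : set (borel E)))); last exact: leb_ballT.
    by apply: le_measure; rewrite ?inE// => y [[]].
  have mb : measurable_fun setT ((fun y : E => Num.max 0 (F y - F (y - w))) : borel E -> R).
    by apply: measurable_maxr => //; exact: measurable_funB.
  have bC y : 0 <= Num.max 0 (F y - F (y - w)) <= n%:R + n%:R.
    rewrite le_max lexx/= ge_max addr_ge0//=.
    have := Fn y; have := Fn (y - w); rewrite !ler_norml => /andP[h1 h2] /andP[h3 h4]; lra.
  have hQ y : Q y -> cimg y /\ futc g X c (cinv c y) w.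
    by move=> /hball[iy fy]; split => //; exact: futZ.
  have := @ae_le_of_integral_le _ _ _ leb T (line_average (h w) w)
    (fun y : E => Num.max 0 (F y - F (y - w))) (n%:R + n%:R) mT Too (addr_ge0 (ler0n _ _) (ler0n _ _))
    (measurable_line_average (mh w) (h0 w) w) mb (fun y => line_average_ge0 (h0 w) w y) bC.
  move=> /(_ _)/ae_imp; apply; last first.
    move=> B mB BT B0.
    have BD : B `<=` [set y | ball q rad y /\ ball q rad (y - w)] by move=> y /BT[[]].
    have BF y : B y -> - n%:R < F y < n%:R /\ - n%:R < F (y - w) < n%:R.
      by move=> /BT[_ []]; rewrite /= !in_itv.
    exact: (integral_line_average_le hX hM ac hQ C0 (fun y Qy Qw => hC _ y k0 k1 Qy Qw) Cv0 hCv mB BD B0 f_causal Gsub mF hF BF (mh w)).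
  move=> y hy [y1 y2 y3 y4]; apply: hy; split; first by split.
  by split; rewrite /= in_itv.
have oQ : open Q by exact: ball_open.
have hv := ae_and (ae_le_line_average v (mh v) (h0 v)) (ae_and (ae_foralln step)
  (ae_and hF (ae_eq_pq v oQ hF))).
apply: ae_imp (ae_vol hvol ac hv) => x hx [dx Qx] phix D D0 cD.
have [h1 [h2 [h3 h4]]] := hx dx; set y := cmap c x in Qx cD h1 h2 h3 h4 *.
have hy : h v y = (G x * (nrm x v)%:E)%E by rewrite /h patchE mem_set// /y cmapK.
rewrite -hy; apply: (le_trans h1); apply/lee_addgt0Pr => e e0; apply: limn_esup_le_near.
have Fy : F y = phi x by rewrite -h3// /y cmapK.
have cF : pq F v k y @[k --> \oo] --> D.
  by apply: cvg_trans cD; apply: near_eq_cvg; apply: filterS (h4 Qx) => k ->.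
have cFk : F (y - k.+1%:R^-1 *: v) @[k --> \oo] --> F y.
  have c1 : F y - k.+1%:R^-1 * pq F v k y @[k --> \oo] --> F y - 0 * D.
    by apply: (@cvgB _ R^o); [exact: cvg_cst|apply: (@cvgM R); [exact: cvg_harmonic|exact: cF]].
  rewrite mul0r subr0 in c1; apply: cvg_trans c1; apply: near_eq_cvg; apply: nearW => k.
  by rewrite /pq mulrA mulVf// mul1r opprB addrC subrK.
have [p1 p2] := andP phix; rewrite -Fy in p1 p2.
have n1 : \forall k \near \oo, - n%:R < F (y - k.+1%:R^-1 *: v) by exact: (cvgr_gt _ cFk).
have n2 : \forall k \near \oo, F (y - k.+1%:R^-1 *: v) < n%:R by exact: (cvgr_lt _ cFk).
have n3 : \forall k \near \oo, Q (y - k.+1%:R^-1 *: v) by exact: near_step.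
have n4 : \forall k \near \oo, pq F v k y < D + e by apply: (cvgr_lt _ cF); rewrite ltrDl.
apply: filterS (filterI (filterI n1 n2) (filterI n3 n4)) => k [[k1 k2] [k3 k4]].
have k0 : 0 < k.+1%:R^-1 :> R by rewrite invr_gt0.
have := h2 k; rewrite p1 p2 k1 k2 => /(_ (And4 Qx k3 isT isT)).
(* Homogeneity of the length supplies the factor [1 / (k + 1)] that turns the increment of [F] into
   a difference quotient. *)
have -> : line_average (h (k.+1%:R^-1 *: v)) (k.+1%:R^-1 *: v) y =
    (k.+1%:R^-1%:E * line_average (h v) (k.+1%:R^-1 *: v) y)%E.
  have ml : measurable_fun setT (fun s : R => h v (y - k.+1%:R^-1 *: v + s *: (k.+1%:R^-1 *: v))).
    have m1 : measurable_fun setT (fun s : R => ((y - k.+1%:R^-1 *: v : borel E), s)) by exact: measurable_pair1.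
    exact: (measurableT_comp (mh v) (measurableT_comp (measurable_line _) m1)).
  have kE : (0 <= k.+1%:R^-1%:E :> \bar R)%E by rewrite lee_fin ltW.
  rewrite /line_average -ge0_integralZl//; last exact: measurable_funTS.
  apply: eq_integral => t _; rewrite /h !patchE; case: ifP => _; last by rewrite mule0.
  by rewrite nrmZ// EFinM muleCA.
rewrite -lee_pdivlMl ?invr_gt0// invrK => hle; apply: (le_trans hle).
rewrite -EFinM -EFinD lee_fin maxr_pMr ?ler0n// mulr0 ge_max addr_ge0 ?(ltW e0)//=.
exact: ltW.
Qed.

End upper_bound_ae.

(** * The differential almost everywhere *)

Section differential_ae.
Context {R : realType} {d : nat} {M : ptopologicalType}.
Context {A : smooth_structure R d.+1 M} (g : lorentz_metric A) (X : vector_field A).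
Hypothesis hX : timelike_field g X.
Hypothesis hM : causally_simple g X.
Variable vol : {measure set (borel M) -> \bar R}.
Hypothesis hvol : is_volume g vol.
Variable c : chart R d.+1 M.
Hypothesis ac : atlas A c.
Local Notation E := 'rV[R]_d.+1.
Local Notation l := (lorentz_tsep g X).
Local Notation cimg := (cmap c @` cdom c).
Local Notation nrm x v := (Num.sqrt (- qf (gmx g c x) v v)).
Local Notation cle x y := (0 <= time_sep g X x y)%E.
Variables (f : M -> \bar R) (G : borel M -> \bar R).
Hypothesis f_causal : causal_function l f.
Hypothesis Gmax : maximal_weak_subslope l vol f G.

Lemma near_cle (x : M) (v : E) : cdom c x -> futc g X c x v ->
  \forall k \near \oo, \forall x' \near x,
    cle (cinv c (cmap c x - k.+1%:R^-1 *: v)) x' /\ cle x' (cinv c (cmap c x + k.+1%:R^-1 *: v)).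
Proof.
move=> dx fv; set y := cmap c x.
have iy : cimg y by exists x.
have fy : futc g X c (cinv c y) v by rewrite /y cmapK.
have [r r0 hr] := timelike_ball_near ac iy fy.
have n1 : \forall k \near \oo, ball y r (y - k.+1%:R^-1 *: v).
  by apply: near_step; [exact: ball_open|exact: ballxx].
apply: filterS n1 => k hk.
have kv : `|k.+1%:R^-1 *: v| < r.
  by move: hk; rewrite -ball_normE/= opprB addrC subrK.
have dk : dircone v r (k.+1%:R^-1 *: v) by apply: dircone_dir => //; rewrite invr_gt0.
have n2 : \forall z \near y, dircone v r (k.+1%:R^-1 *: v + (z - y)) /\ dircone v r (k.+1%:R^-1 *: v - (z - y)).
  have nd := open_nbhs_nbhs (conj (@open_dircone _ _ v r) dk).
  have cz : (fun z : E => z - y) @ y --> y - y by exact: continuous_subr.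
  rewrite subrr in cz.
  have c1 : (fun z : E => k.+1%:R^-1 *: v + (z - y)) @ y --> k.+1%:R^-1 *: v + 0.
    exact: (@cvgD _ E E (nbhs y) _ (cst (k.+1%:R^-1 *: v)) (fun z : E => z - y) _ _ (cvg_cst _) cz).
  have c2 : (fun z : E => k.+1%:R^-1 *: v - (z - y)) @ y --> k.+1%:R^-1 *: v - 0.
    exact: (@cvgB _ E E (nbhs y) _ (cst (k.+1%:R^-1 *: v)) (fun z : E => z - y) _ _ (cvg_cst _) cz).
  rewrite addr0 in c1; rewrite subr0 in c2.
  by apply: (@filterI _ _ (nbhs_filter y)); [exact: (c1 _ nd)|exact: (c2 _ nd)].
have n3 : \forall z \near y, `|z - y| < r.
  by apply/nbhs_ballP; exists r => // z; rewrite -ball_normE/= distrC.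
have n4 : \forall x' \near x, cdom c x' by apply: open_nbhs_nbhs; split => //; exact: cdom_open.
have cc := cmap_continuous dx.
apply: filterS (filterI n4 (filterI (cc _ n2) (cc _ n3))) => x' /= [dx' [[h1 h2] h3]].
split.
  rewrite -[X in cle _ X](cmapK dx'); apply: (timelike_ball_cle ac hr) => //.
    by rewrite addrAC subrr add0r normrN.
  by rewrite opprB addrCA.
rewrite -[X in cle X _](cmapK dx'); apply: (timelike_ball_cle ac hr) => //.
  by rewrite addrAC subrr add0r.
have -> : y + k.+1%:R^-1 *: v - cmap c x' = k.+1%:R^-1 *: v - (cmap c x' - y).
  by rewrite opprB [y + _]addrC addrA.
exact: h2.
Qed.

(** The indicator of [f = +oo] is causal, so a.e. it is continuous along past steps. Hence [f] is
    already infinite at some point of the past, whose future contains a neighbourhood of [x]. *)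
Lemma pinfty_interior_ae : {ae vol, forall x, cdom c x -> f x = +oo%E -> \forall x' \near x, f x' = +oo%E}.
Proof.
pose phi x : R := if f x == +oo%E then 1 else 0.
have phim x : `|phi x| <= 1 by rewrite /phi; case: ifP; rewrite ?normr1 ?normr0.
have phi_causal x y : cle x y -> phi x <= phi y.
  move=> /f_causal; rewrite /phi; case: eqP => [->|_]; last by case: ifP.
  by rewrite leye_eq => /eqP ->; rewrite eqxx.
apply: ae_imp (left_differential_ae hX hvol ac phim phi_causal) => x hx dx fx.
have [a ha] := hx dx; have [e fe] := fut_intv_exists (hX ac dx).
have [_ ca] := ha e fe.
have ck : phi (cinv c (cmap c x - k.+1%:R^-1 *: intv e)) @[k --> \oo] --> phi x.
  have c1 : phi x - k.+1%:R^-1 * pq (phi \o cinv c) (intv e) k (cmap c x) @[k --> \oo] --> phi x - 0 * pairing a (intv e).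
    by apply: (@cvgB _ R^o); [exact: cvg_cst|apply: (@cvgM R); [exact: cvg_harmonic|exact: ca]].
  rewrite mul0r subr0 in c1; apply: cvg_trans c1; apply: near_eq_cvg; apply: nearW => k.
  by rewrite /pq /= cmapK// mulrA mulVf// mul1r opprB addrC subrK.
have n1 : \forall k \near \oo, 0 < phi (cinv c (cmap c x - k.+1%:R^-1 *: intv e)).
  by apply: (cvgr_gt _ ck); rewrite /phi fx eqxx.
have [k [k1 k2]] := filter_ex (filterI n1 (near_cle dx fe)).
apply: filterS k2 => x' [/f_causal + _].
have -> : f (cinv c (cmap c x - k.+1%:R^-1 *: intv e)) = +oo%E.
  by move: k1; rewrite /phi; case: eqP => //; rewrite ltxx.
by rewrite leye_eq => /eqP.
Qed.

(** Here a point of the future with value [-oo] is required, and backward quotients say nothing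
    about it; the forward continuity of the regularization is used instead. *)
Lemma ninfty_interior_ae : {ae vol, forall x, cdom c x -> f x = -oo%E -> \forall x' \near x, f x' = -oo%E}.
Proof.
pose phi x : R := if f x == -oo%E then 0 else 1.
have phim x : `|phi x| <= 1 by rewrite /phi; case: ifP; rewrite ?normr1 ?normr0.
have phi_causal x y : cle x y -> phi x <= phi y.
  move=> /f_causal; rewrite /phi; case: (f y =P -oo%E) => [->|_]; last by case: ifP.
  by rewrite leeNy_eq => ->.
apply: (ae_patch (M_second_countable A)) => p dp.
have [e fe] := fut_intv_exists (hX ac dp).
have ip : cimg (cmap c p) by exists p.
have fe' : futc g X c (cinv c (cmap c p)) (intv e) by rewrite cmapK.
have [r r0 hr] := timelike_ball_near ac ip fe'.
have [F [_ _ hF cF]] := ball_regularization ac phim phi_causal r0 hr.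
exists (cdom c `&` cmap c @^-1` ball (cmap c p) r); split.
  apply: filterI; first by apply: open_nbhs_nbhs; split => //; exact: cdom_open.
  by apply: cmap_continuous => //; exact: nbhsx_ballx.
have hFk := ae_foralln (fun k => ae_translate (k.+1%:R^-1 *: intv e) hF).
have hv := ae_and hF (ae_and hFk cF).
apply: ae_imp (ae_vol hvol ac hv) => x hx [dx Qx] fx.
have [h1 [h2 h3]] := hx dx; set y := cmap c x in Qx h1 h2 h3.
have Fy : F y = 0 by rewrite -h1// /= /y cmapK// /phi fx eqxx.
have fx' : futc g X c x (intv e).
  have xr : `|y - cmap c p| < r by move: Qx; rewrite -ball_normE/= distrC.
  by have [_] := hr y xr; rewrite /y cmapK//; apply; rewrite subrr normr0.
have n1 : \forall k \near \oo, F (y + k.+1%:R^-1 *: intv e) < 1.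
  by apply: (cvgr_lt _ h3); rewrite Fy.
have n2 : \forall k \near \oo, ball (cmap c p) r (y + k.+1%:R^-1 *: intv e).
  have := near_step (- intv e) (@ball_open R E (cmap c p) r) Qx.
  by apply: filterS => k; rewrite scalerN opprK.
have [k [[k1 k2] k3]] := filter_ex (filterI (filterI n1 n2) (near_cle dx fx')).
apply: filterS k3 => x' [_ /f_causal].
have -> : f (cinv c (cmap c x + k.+1%:R^-1 *: intv e)) = -oo%E.
  by move: k1; rewrite -(h2 k k2) /= /phi; case: eqP => //; rewrite ltxx.
by rewrite leeNy_eq => /eqP.
Qed.

Lemma maximal_infinite_ae : {ae vol, forall x, cdom c x -> f x \isn't a fin_num -> G x = +oo%E}.
Proof.
pose U : set (borel M) := [set x | f x = +oo%E]^° `|` [set x | f x = -oo%E]^°.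
have mU : measurable U by apply: borel_open; apply: openU; exact: open_interior.
have fU x : U x -> f x \isn't a fin_num.
  by move=> [/interior_subset|/interior_subset] /= ->.
have h0 x : (0 <= (if x \in U then +oo else 0) :> \bar R)%E by case: ifP.
have sub : weak_subslope l vol f (fun x => if x \in U then +oo else 0)%E.
  split=> //.
    rewrite (_ : (fun _ => _) = (cst +oo%E : borel M -> \bar R) \_ U).
      by apply/measurable_restrict.
    by apply/funext => x; rewrite patchE.
  move=> pi _; apply: le_lower_integral => // gamma _.
    exact: (@causal_speed_integral_ge0 _ _ _ _ g X (fun x : M => if (x : borel M) \in U then +oo else 0)%E).
  have mono s t : s <= t -> (f (gamma s) <= f (gamma t))%E by move=> st; apply/f_causal/lcc_cle.
  have f01 := mono _ _ (@ler01 R).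
  (* If [f] is [+oo] at the end or [-oo] at the start, the increment is [+oo]. Otherwise
     monotonicity keeps [f] finite along the path, which then avoids [U]. *)
  have [E1|E1] := eqVneq (f (gamma 1)) +oo%E; first by rewrite E1; case: (f (gamma 0)) => *; exact: leey.
  have [E0|E0] := eqVneq (f (gamma 0)) -oo%E.
    by rewrite E0; case: (f (gamma 1)) E1 => // *; exact: leey.
  rewrite integral0_eq.
    apply: le_trans (trunc_sub_le 0 f01).
    by rewrite lee_fin subr_ge0; exact: le_trunc.
  move=> t; rewrite /= in_itv/= => /andP[t0 t1].
  case: ifPn => [/set_mem/fU|_]; last by rewrite mul0e.
  rewrite fin_numE negb_and !negbK => /orP[] /eqP ft.
    by have := mono _ _ t0; rewrite ft leeNy_eq (negbTE E0).
  by have := mono _ _ t1; rewrite ft leye_eq (negbTE E1).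
apply: ae_imp (ae_and (ae_and pinfty_interior_ae ninfty_interior_ae) (Gmax.2 _ sub)).
move=> x [[h1 h2] h3] dx fx; apply/eqP; rewrite -leye_eq; apply: le_trans h3.
rewrite mem_set//; move: fx; rewrite fin_numE negb_and !negbK => /orP[] /eqP fx.
  by right; exact: h2.
by left; exact: h1.
Qed.

(** The upper bound holds for each integral vector outside a null set of its own; countability
    allows the infimum to be taken at a single point. *)
Lemma maximal_eq_cone_inf (n : nat) : {ae vol, forall x, cdom c x ->
  - n%:R < trunc n (f x) < n%:R -> forall a, left_differential g X c (fun x => trunc n (f x)) x a ->
  G x = (cone_inf (gmx g c x) (vcomp X c x) a)%:E}.
Proof.
have lower : {ae vol, forall x, cdom c x -> forall a, left_differential g X c (fun x => trunc n (f x)) x a ->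
    ((cone_inf (gmx g c x) (vcomp X c x) a)%:E <= G x)%E}.
  apply: (ae_patch (M_second_countable A)) => p dp.
  exact: (cone_inf_le_maximal hX hM hvol ac f_causal Gmax n dp).
have upper : {ae vol, forall x, forall z : 'rV[int]_d.+1, (cdom c x /\ futc g X c x (intv z)) ->
    - n%:R < trunc n (f x) < n%:R -> forall D : R, 0 <= D ->
    pq ((fun x => trunc n (f x)) \o cinv c) (intv z) k (cmap c x) @[k --> \oo] --> D ->
    (G x * (nrm x (intv z))%:E <= D%:E)%E}.
  apply: ae_forall_countable => z.
  apply: (ae_patch (W := [set x | cdom c x /\ futc g X c x (intv z)]) (M_second_countable A)) => p [dp fp].
  exact: (maximal_mul_norm_le hX hM hvol ac n f_causal Gmax.1 dp fp).
apply: ae_imp (ae_and lower upper) => x [lo up] dx fx a ha.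
apply/eqP; rewrite eq_le lo// andbT.
have G0 : (0 <= G x)%E by have [[]] := Gmax.
have key z : futc g X c x (intv z) -> (G x <= (pairing a (intv z) / nrm x (intv z))%:E)%E.
  move=> fz; have [h1 h2] := ha z fz.
  have nz : 0 < nrm x (intv z) by rewrite sqrtr_gt0 oppr_gt0; case: fz.
  by rewrite EFinM lee_pdivlMr//; exact: up.
have [e fe] := fut_intv_exists (hX ac dx).
have Gfin : G x \is a fin_num by rewrite ge0_fin_numE// (le_lt_trans (key e fe))// ltry.
rewrite -(fineK Gfin) lee_fin; apply: lb_le_inf; first by eexists; exists e.
by move=> _ [z fz <-]; rewrite -lee_fin fineK//; exact: key.
Qed.

End differential_ae.

(** * The identity at a point and the conclusion *)

Section parallelogram.
Context {R : realType}.
Implicit Types a b : \bar R.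

Lemma le_ladde a a' b b' : (a <= a')%E -> (b <= b')%E -> (ladde a b <= ladde a' b')%E.
Proof.
case: a a' => [r||] [r'||] //= rr' bb'; rewrite ?leey ?leNye//.
exact: leeD.
Qed.

Lemma cone_inf_parallelogram (d : nat) (G : 'M[R]_d.+1) (Y a1 a2 : 'rV[R]_d.+1) :
  G^T = G -> (exists2 P, P \in unitmx & P *m G *m P^T = minkowski_mx R d) -> qf G Y Y < 0 ->
  (forall z, fut G Y (intv z) -> 0 <= pairing a1 (intv z)) ->
  (forall z, fut G Y (intv z) -> 0 <= pairing a2 (intv z)) ->
  2 * cone_inf G Y (a1 + a2) ^+ 2 + 2 * cone_inf G Y a1 ^+ 2 =
  cone_inf G Y a2 ^+ 2 + cone_inf G Y (2 *: a1 + a2) ^+ 2.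
Proof.
move=> Gsym Gsig YY h1 h2.
have pD u v z : pairing (u + v) (intv z) = pairing u (intv z) + pairing v (intv z).
  by rewrite !pairing_qf qfDr.
have pZ s u z : pairing (s *: u) (intv z) = s * pairing u (intv z).
  by rewrite !pairing_qf qfZr.
rewrite !(cone_inf_sqr Gsym Gsig YY)//; last 2 first.
- by move=> z fz; rewrite pD pZ addr_ge0 ?mulr_ge0 ?h1 ?h2.
- by move=> z fz; rewrite pD addr_ge0 ?h1 ?h2.
rewrite -!/(qf (invmx G) _ _) !qfDl !qfDr !qfZl !qfZr; ring.
Qed.

End parallelogram.

Section parallelogram_ae.
Context {R : realType} {d : nat} {M : ptopologicalType}.
Context {A : smooth_structure R d.+1 M} (g : lorentz_metric A) (X : vector_field A).
Hypothesis hX : timelike_field g X.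
Local Notation E := 'rV[R]_d.+1.
Local Notation l := (lorentz_tsep g X).
Variable c : chart R d.+1 M.
Hypothesis ac : atlas A c.
Variables (x : M) (n : nat).
Hypothesis dx : cdom c x.

Lemma left_differential_cvg (phi : M -> R) a z : left_differential g X c phi x a ->
  futc g X c x (intv z) -> phi (cinv c (cmap c x - k.+1%:R^-1 *: intv z)) @[k --> \oo] --> phi x.
Proof.
move=> ha fz; have [_ ca] := ha z fz.
have c1 : phi x - k.+1%:R^-1 * pq (phi \o cinv c) (intv z) k (cmap c x) @[k --> \oo] --> phi x - 0 * pairing a (intv z).
  by apply: (@cvgB _ R^o); [exact: cvg_cst|apply: (@cvgM R); [exact: cvg_harmonic|exact: ca]].
rewrite mul0r subr0 in c1; apply: cvg_trans c1; apply: near_eq_cvg; apply: nearW => k.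
by rewrite /pq /= cmapK// mulrA mulVf// mul1r opprB addrC subrK.
Qed.

(** Along the backward steps the truncated functions converge to their values at [x], which are
    strictly inside the bounds; so truncation is eventually inactive and the linear relation passes
    to the quotients. *)
Lemma left_differential_combination (s : R) (f1 f2 f3 : M -> \bar R) (a1 a2 a3 : E) :
  (forall y (r1 r2 : R), f1 y = r1%:E -> f2 y = r2%:E -> f3 y = (s * r1 + r2)%:E) ->
  left_differential g X c (fun x => trunc n (f1 x)) x a1 ->
  left_differential g X c (fun x => trunc n (f2 x)) x a2 ->
  left_differential g X c (fun x => trunc n (f3 x)) x a3 ->
  - n%:R < trunc n (f1 x) < n%:R -> - n%:R < trunc n (f2 x) < n%:R ->
  - n%:R < trunc n (f3 x) < n%:R -> a3 = s *: a1 + a2.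
Proof.
move=> hf h1 h2 h3 t1 t2 t3; apply: (pairing_inj (hX ac dx)) => z fz.
rewrite [in RHS]pairing_qf qfDr qfZr -!pairing_qf.
have near_n f a : left_differential g X c (fun x => trunc n (f x)) x a -> - n%:R < trunc n (f x) < n%:R ->
    \forall k \near \oo, - n%:R < trunc n (f (cinv c (cmap c x - k.+1%:R^-1 *: intv z))) < n%:R.
  move=> ha /andP[p1 p2]; have cv := left_differential_cvg ha fz.
  have m1 : \forall k \near \oo, - n%:R < trunc n (f (cinv c (cmap c x - k.+1%:R^-1 *: intv z))) by exact: (cvgr_gt _ cv).
  have m2 : \forall k \near \oo, trunc n (f (cinv c (cmap c x - k.+1%:R^-1 *: intv z))) < n%:R by exact: (cvgr_lt _ cv).
  by apply: filterS (filterI m1 m2) => k [-> ->].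
have lim : s * pq ((fun x => trunc n (f1 x)) \o cinv c) (intv z) k (cmap c x) +
    pq ((fun x => trunc n (f2 x)) \o cinv c) (intv z) k (cmap c x) @[k --> \oo] -->
    s * pairing a1 (intv z) + pairing a2 (intv z).
  apply: (@cvgD _ R^o); last exact: (h2 z fz).2.
  by apply: (@cvgM R); [exact: cvg_cst|exact: (h1 z fz).2].
apply: (@cvg_unique _ (@Rhausdorff R) _ _ _ _ (h3 z fz).2).
apply: cvg_trans lim; apply: near_eq_cvg.
have n1 := near_n _ _ h1 t1; have n2 := near_n _ _ h2 t2; have n3 := near_n _ _ h3 t3.
apply: filterS (filterI n1 (filterI n2 n3)) => k [m1 [m2 m3]]; rewrite /pq /= cmapK//.
set y := cinv c _ in m1 m2 m3 *.
have E3 w : - n%:R < trunc n (f1 w) < n%:R -> - n%:R < trunc n (f2 w) < n%:R ->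
    - n%:R < trunc n (f3 w) < n%:R -> trunc n (f3 w) = s * trunc n (f1 w) + trunc n (f2 w).
  move=> w1 w2 w3; have := truncK w3; rewrite (hf _ _ _ (truncK w1) (truncK w2)).
  by move=> h; exact: (esym (congr1 fine h)).
rewrite (E3 x)// (E3 y)//.
move: (trunc n (f1 x)) (trunc n (f1 y)) (trunc n (f2 x)) (trunc n (f2 y)) k.+1%:R => u1 u2 u3 u4 u5.
by ring.
Qed.

End parallelogram_ae.

Theorem theorem1 (R : realType) (d : nat) (hd : (1 <= d)%N)
    (M : ptopologicalType) (A : smooth_structure R d.+1 M)
    (g : lorentz_metric A) (X : vector_field A) (hX : timelike_field g X)
    (hM : causally_simple g X)
    (vol : {measure set (borel M) -> \bar R}) (hvol : is_volume g vol) :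
  infinitesimally_Minkowskian (lorentz_tsep g X) vol.
Proof.
move=> f1 f2 c1 c2 G1 G2 G12 G112 m1 m2 m12 m112.
have c12 : causal_function (lorentz_tsep g X) (fun x => ladde (f1 x) (f2 x)).
  by move=> x y xy; apply: le_ladde; [exact: c1|exact: c2].
have c112 : causal_function (lorentz_tsep g X) (fun x => ladde (2%:E * f1 x) (f2 x)).
  move=> x y xy; apply: le_ladde; last exact: c2.
  by apply: lee_wpmul2l; [rewrite lee_fin|exact: c1].
have pos f G x : maximal_weak_subslope (lorentz_tsep g X) vol f G -> (0 <= G x)%E by move=> [[]].
have neNy (a : \bar R) : (0 <= a -> a != -oo)%E by case: a.
have sqr0 (a : \bar R) : (0 <= a -> 0 <= a ^+ 2)%E by move=> a0; rewrite expe2 mule_ge0.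
suff : {ae vol, forall x : borel M, setT x -> (2%:E * G12 x ^+ 2 + 2%:E * G1 x ^+ 2 = G2 x ^+ 2 + G112 x ^+ 2)%E}.
  by apply: ae_imp => x; exact.
apply: (ae_patch (W := setT) (M_second_countable A)) => p _.
pose c := chart_at A p; have ac : atlas A c by exact: chart_at_atlas.
exists (cdom c); split.
  by apply: open_nbhs_nbhs; split; [exact: cdom_open|exact: chart_at_dom].
have D f G : causal_function (lorentz_tsep g X) f -> maximal_weak_subslope (lorentz_tsep g X) vol f G ->
  {ae vol, forall x, cdom c x -> (f x \isn't a fin_num -> G x = +oo%E) /\ forall n : nat,
    (exists a, left_differential g X c (fun x => trunc n (f x)) x a) /\
    (- n%:R < trunc n (f x) < n%:R -> forall a, left_differential g X c (fun x => trunc n (f x)) x a ->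
       G x = (cone_inf (gmx g c x) (vcomp X c x) a)%:E)}.
  move=> cf mG.
  have h1 := ae_forall_countable (fun n => left_differential_ae hX hvol ac
    (fun x => trunc_norm n (f x)) (fun x y xy => le_trunc n (cf x y xy))).
  have h2 := ae_forall_countable (maximal_eq_cone_inf hX hM hvol ac cf mG).
  have h3 := maximal_infinite_ae hX hvol ac cf mG.
  apply: ae_imp (ae_and h3 (ae_and h1 h2)) => x [k3 [k1 k2]] dx; split; first exact: k3.
  by move=> n; split; [exact: k1|exact: k2].
apply: ae_imp (ae_and (ae_and (D _ _ c1 m1) (D _ _ c2 m2)) (ae_and (D _ _ c12 m12) (D _ _ c112 m112))).
move=> x [[k1 k2] [k12 k112]] dx.
have {}k1 := k1 dx; have {}k2 := k2 dx; have {}k12 := k12 dx; have {}k112 := k112 dx.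
have oo2 : (+oo ^+ 2 = +oo :> \bar R)%E by rewrite expe2 mulyy.
have two_oo : (2%:E * +oo = +oo :> \bar R)%E by rewrite gt0_muley ?lte_fin.
(* An infinite [f1 x] dominates [2 f1 + f2], so [G1] and [G112] are infinite, one on each side of
   the identity. Below, with [f1 x] finite and [f2 x] infinite, the same happens with [G2] and
   [G12]. *)
have [fin1|inf1] := boolP (f1 x \is a fin_num); last first.
  have i112 : ladde (2%:E * f1 x) (f2 x) \isn't a fin_num.
    case: (f1 x) inf1 => [r||]//= _; first by rewrite two_oo.
    by rewrite mulrNy gtr0_sg// mul1e.
  rewrite (k1.1 inf1) (k112.1 i112) oo2 two_oo addey ?addey//.
    by apply/neNy/sqr0; exact: pos m2.
  by apply/neNy; rewrite mule_ge0// sqr0//; exact: pos m12.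
have [fin2|inf2] := boolP (f2 x \is a fin_num); last first.
  have i12 : ladde (f1 x) (f2 x) \isn't a fin_num.
    by rewrite -(fineK fin1) /=; case: (f2 x) inf2.
  rewrite (k2.1 inf2) (k12.1 i12) oo2 two_oo !addye//.
    by apply/neNy/sqr0; exact: pos m112.
  by apply/neNy; rewrite mule_ge0// sqr0//; exact: pos m1.
pose r1 := fine (f1 x); pose r2 := fine (f2 x).
have e1 : f1 x = r1%:E by rewrite fineK.
have e2 : f2 x = r2%:E by rewrite fineK.
(* A height strictly above the absolute values of all four functions at [x]. *)
pose n := (Num.truncn (2 * `|r1| + `|r2|)).+1.
have hn : 2 * `|r1| + `|r2| < n%:R by exact: truncnS_gt.
have tr (r : R) : `|r| <= 2 * `|r1| + `|r2| -> - n%:R < trunc n r%:E < n%:R.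
  move=> hr; have : `|r| < n%:R by exact: le_lt_trans hn.
  by rewrite ltr_norml => /andP[h1 h2]; rewrite trunc_fin ?h1// !ltW.
have a1 := normr_ge0 r1; have a2 := normr_ge0 r2.
have t1 : - n%:R < trunc n (f1 x) < n%:R by rewrite e1; apply: tr; lra.
have t2 : - n%:R < trunc n (f2 x) < n%:R by rewrite e2; apply: tr; lra.
have t12 : - n%:R < trunc n (ladde (f1 x) (f2 x)) < n%:R.
  by rewrite e1 e2 /= -EFinD; apply: tr; have := ler_normD r1 r2; lra.
have t112 : - n%:R < trunc n (ladde (2%:E * f1 x) (f2 x)) < n%:R.
  rewrite e1 e2 -EFinM /= -EFinD; apply: tr; apply: le_trans (ler_normD _ _) _.
  by rewrite normrM ger0_norm.
have [[b1 d1] v1] := k1.2 n; have [[b2 d2] v2] := k2.2 n.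
have [[b12 d12] v12] := k12.2 n; have [[b112 d112] v112] := k112.2 n.
rewrite (v1 t1 _ d1) (v2 t2 _ d2) (v12 t12 _ d12) (v112 t112 _ d112).
have E12 : b12 = b1 + b2.
  rewrite -[b1]scale1r; apply: (left_differential_combination hX ac dx _ d1 d2 d12 t1 t2 t12).
  by move=> y s1 s2 -> ->; rewrite mul1r.
have E112 : b112 = 2 *: b1 + b2.
  apply: (left_differential_combination hX ac dx _ d1 d2 d112 t1 t2 t112).
  by move=> y s1 s2 -> ->.
have Gsym : (gmx g c x)^T = gmx g c x by exact: gmx_sym.
have Gsig : exists2 P, P \in unitmx & P *m gmx g c x *m P^T = minkowski_mx R d by exact: gmx_signature.
have := cone_inf_parallelogram Gsym Gsig (hX _ _ ac dx)
  (fun z fz => (d1 z fz).1) (fun z fz => (d2 z fz).1).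
by rewrite E12 E112 !expe2 -!EFinM -!EFinD !expr2 => ->.
Qed.
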